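(* For all $a\in(a_{\mathrm{crit}},a_{\max})$ there exists $\epsilon>0$ such that for all $G\in(-\epsilon,\epsilon)$ and all sufficiently large $H$ there exists a solution (for some constant $Q\in\mathbb R$) of the finite-depth water wave problem $$\Delta\psi=-\Omega \ \text{ in } D,\qquad \psi=0\ \text{ on } S,\qquad \tfrac12|\nabla\psi|^2+Gy=B\ \text{ on } S,\qquad \psi=Q\ \text{ on } \{y=-H\},$$ with $$\Omega=\Omega(a):=\frac{1-a}{1-3a},\qquad B=B(a):=\frac12\left(\frac{1+a}{1-3a}\right)^2,$$ whose profile $S$ is overhanging.
   Context: Here $G,\Omega,B,Q$ are real constants (dimensionless gravity, constant vorticity, Bernoulli constant, and an a priori unknown constant value of $\psi$ on the bottom), and $H>0$. Parameters. For $a\in(0,\tfrac14)$ let $w(a)(\zeta)=-\dfrac{4i\sqrt a\,\zeta}{1+\sqrt a\,\zeta}$ for $|\zeta|=1$ and consider the explicit curve $\alpha\mapsto z(\alpha;a)=\alpha+w(a)(e^{-i\alpha})$, $\alpha\in\mathbb R$. The number $a_{\mathrm{crit}}=(\sqrt2-1)^2$ is the value of $a$ at which $\operatorname{Re}z_\alpha(\cdot\,;a)$ first has a zero. The number $a_{\max}\in(a_{\mathrm{crit}},\tfrac14)$ is the smallest value of $a$ at which the curve $z(\cdot\,;a)$ is not injective (it then touches itself); $a_{\max}\approx(0.454670016452010)^2$. Solutions. For $0<d<\infty$ let $\mathbb S_d=\{\alpha+i\beta\in\mathbb C:-d<\beta<0\}$ and identify $\mathbb R^2$ with $\mathbb C$.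 A solution consists of a domain $D\subset\mathbb R^2$ which is $2\pi$-periodic in $x$, bounded below by the line $\{y=-H\}$ and bounded above by a free surface $S$, and a stream function $\psi$ on $\overline D$, such that the displayed equations hold. $D$ and $\psi$ are $2\pi$-periodic in $x$ and symmetric under reflection in the vertical lines beneath the crest and the trough. The domain is described by a unique $d\in(0,\infty)$ and a conformal bijection $z=x+iy:\mathbb S_d\to D$ that extends continuously to $\{\beta=-d\}$, mapping it onto $\{y=-H\}$, and extends in a $C^1$ and injective fashion to $\{\beta=0\}$ with $z_\alpha\ne0$ there, such that $x-\alpha$ and $y$ are $2\pi$-periodic in $\alpha$ and $S$ is the curve $\alpha\mapsto z(\alpha+i0)$. The profile is overhanging if $x_\alpha(\alpha+i0)<0$ for some $\alpha$ (so that $S$ is not a graph over the $x$-axis). *)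

(* Defs.v *)
(* Stdlib reals with Coquelicot.  The plane is Coquelicot's C, which is R * R:
   the point (x, y) is x + i y. *)
From Stdlib Require Import Reals.
From Coquelicot Require Import Coquelicot.
Open Scope R_scope.

(** ** The explicit curves and the parameters *)

Definition w (a : R) (zeta : C) : C :=
  (- (RtoC 4 * Ci * RtoC (sqrt a) * zeta / (1 + RtoC (sqrt a) * zeta)))%C.

(* (cos alpha, - sin alpha) is e^{-i alpha}. *)
Definition explicit_curve (a alpha : R) : C :=
  (RtoC alpha + w a (cos alpha, - sin alpha)%R)%C.

(* Since [Re z - alpha] is periodic, injectivity is meant on all of R: contact
   between neighbouring periods counts as non-injectivity. *)
Definition explicit_curve_injective (a : R) : Prop :=
  forall alpha1 alpha2 : R,
    explicit_curve a alpha1 = explicit_curve a alpha2 -> alpha1 = alpha2.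

Definition a_crit : R := (sqrt 2 - 1) ^ 2.

(* The smallest value of a in (0, 1/4) for which the curve is not injective,
   given as the (attained) greatest lower bound of the set of such values. *)
Definition a_max : R :=
  real (Glb_Rbar (fun a => 0 < a < 1 / 4 /\ ~ explicit_curve_injective a)).

Definition Omega_of (a : R) : R := (1 - a) / (1 - 3 * a).

Definition B_of (a : R) : R := 1 / 2 * ((1 + a) / (1 - 3 * a)) ^ 2.

(** ** Plane topology *)

Definition closure (A : C -> Prop) (p : C) : Prop :=
  forall U : C -> Prop, locally p U -> exists q, U q /\ A q.

Definition frontier (A : C -> Prop) (p : C) : Prop :=
  closure A p /\ closure (fun q => ~ A q) p.

Definition connected (A : C -> Prop) : Prop :=
  forall U V : C -> Prop, open U -> open V ->
    (forall p, A p -> U p \/ V p) ->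
    (exists p, A p /\ U p) -> (exists p, A p /\ V p) ->
    exists p, A p /\ U p /\ V p.

Definition plane_domain (A : C -> Prop) : Prop :=
  open A /\ connected A /\ exists p, A p.

(** ** Conformal parametrization by a strip *)

Definition strip (d : R) (p : C) : Prop := - d < Im p < 0.
Definition strip_top (d : R) (p : C) : Prop := - d < Im p <= 0.
Definition strip_closed (d : R) (p : C) : Prop := - d <= Im p <= 0.

Definition free_surface (z : C -> C) (p : C) : Prop :=
  exists alpha : R, p = z (alpha, 0)%R.

(* C^1 up to [beta = 0] means that the complex derivative of z in the strip
   extends continuously to [beta = 0]; its boundary values are then the
   tangent vectors z_alpha of the curve [alpha |-> z (alpha, 0)%R]. *)
Record conformal_parametrization
    (D : C -> Prop) (H d : R) (z : C -> C) : Prop := {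
  cp_depth : 0 < d;
  cp_image : forall p, D p <-> exists q, strip d q /\ z q = p;
  cp_continuous : continuous_on (strip_closed d) z;
  cp_bottom : forall p, Im p = - H <-> exists alpha : R, z (alpha, - d)%R = p;
  cp_injective : forall p q,
    strip_top d p -> strip_top d q -> z p = z q -> p = q;
  cp_C1 : exists dz : C -> C,
    (forall p, strip d p -> is_derive (K := C_AbsRing) (V := C_NormedModule) z p (dz p)) /\
    continuous_on (strip_top d) dz /\
    (forall alpha : R, dz (alpha, 0)%R <> RtoC 0);
  cp_periodic : forall p, strip_closed d p ->
    z (p + RtoC (2 * PI))%C = (z p + RtoC (2 * PI))%C
}.

(** ** Solutions *)

(* Invariance of D and psi under reflection in the vertical line [x = c]. *)
Definition reflection_symmetric
    (D : C -> Prop) (psi : R -> R -> R) (c : R) : Prop :=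
  (forall x y, D (x, y) -> D (2 * c - x, y)) /\
  (forall x y, closure D (x, y) -> psi (2 * c - x) y = psi x y).

Definition laplacian (f : R -> R -> R) (x y : R) : R :=
  partial_derive 2 0 f x y + partial_derive 0 2 f x y.

(* psi is of class C^2 in D and C^1 up to the boundary: it is continuous on the
   closure of D, and [gx, gy] extend its gradient continuously to that closure.
   The values of psi outside the closure of D are irrelevant. *)
Record water_wave_solution (G Omega B Q H : R)
    (D : C -> Prop) (psi : R -> R -> R) (d : R) (z : C -> C) : Prop := {
  ww_domain : plane_domain D;
  ww_conformal : conformal_parametrization D H d z;
  ww_frontier : forall p, frontier D p <-> (Im p = - H \/ free_surface z p);
  ww_above : forall p, D p \/ free_surface z p -> - H < Im p;
  ww_D_periodic : forall x y, D (x + 2 * PI, y) <-> D (x, y);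
  ww_psi_periodic : forall x y,
    closure D (x, y) -> psi (x + 2 * PI) y = psi x y;
  ww_crest : exists alpha0 : R,
    (forall alpha : R, Im (z (alpha, 0)%R) <= Im (z (alpha0, 0))) /\
    reflection_symmetric D psi (Re (z (alpha0, 0)));
  ww_trough : exists alpha0 : R,
    (forall alpha : R, Im (z (alpha0, 0)) <= Im (z (alpha, 0)%R)) /\
    reflection_symmetric D psi (Re (z (alpha0, 0)));
  ww_continuous : continuous_on (closure D) (fun p : C => psi (Re p) (Im p));
  ww_C2 : forall x y, D (x, y) -> ex_diff_n psi 2 x y;
  ww_poisson : forall x y, D (x, y) -> laplacian psi x y = - Omega;
  ww_kinematic : forall p, free_surface z p -> psi (Re p) (Im p) = 0;
  ww_bernoulli : exists gx gy : C -> R,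
    continuous_on (closure D) gx /\
    continuous_on (closure D) gy /\
    (forall x y, D (x, y) ->
       gx (x, y) = partial_derive 1 0 psi x y /\
       gy (x, y) = partial_derive 0 1 psi x y) /\
    (forall p, free_surface z p ->
       1 / 2 * (gx p ^ 2 + gy p ^ 2) + G * Im p = B);
  ww_bottom : forall x : R, psi x (- H) = Q
}.

Definition overhanging (z : C -> C) : Prop :=
  exists alpha : R, Derive (fun t => Re (z (t, 0))) alpha < 0.

(* Main.v *)
(* For G = 0 and infinite depth the curve z(.; a) is the profile of an explicit solution, and it is
   overhanging for a > a_crit.  We perturb it.  Parametrizing the flow by the strip, Bernoulli's law
   on the surface becomes an equation E(x; G, d) = 0 in the Wiener algebra of Laurent series with
   weight 2^|k|; the depth enters only through the multiplier coth (k d), which tends to sgn k.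
   A modified Newton method needs only a bounded right inverse of the linearization at the explicit
   solution.  That linearization is a Riemann-Hilbert problem, which reduces to a first-order linear
   ODE in the unit disc with an explicit homogeneous solution and singular points at +-b
   (b = sqrt a); three free parameters make the right-hand side vanish to third order at -b.

   For univalence, level curves of the explicit parametrization are, up to a vertical shift, the
   curves z(.; a') with a' <= a, so they are injective for a < a_max.  A deepest double point of the
   half-plane map could be lowered by local surjectivity, so there is none; with compactness the map
   is bi-Lipschitz, and this is stable under the C^1-small perturbation. *)
Require Import Defs.
From Stdlib Require Import Reals Lra Lia ZArith Classical ClassicalEpsilon FunctionalExtensionality ProofIrrelevance.
From Coquelicot Require Import Coquelicot.
Open Scope R_scope.

(** The weight is matched to the parameter range: [1 / (1 + b zeta)] lies in the algebra exactly
    when [b < 1/2], that is [a < 1/4], and it makes all moments of the coefficients finite. The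
    unknown is essentially [|D| y] instead of the elevation [y], so every operator in the equation
    is bounded and no derivative is lost. Since [y] has mean zero in the conformal variable,
    conformal and geometric depth coincide, and [H] is prescribed by taking [d = H].

    In the linearized problem a function U, holomorphic in the disc, is coupled with its conjugate.
    The conjugate is multiplied by v, whose only pole is simple and lies at -1/b, so only one number
    chi, proportional to the value of U at -b, survives the projection onto positive frequencies.
    The pole of 1 / conj v at b adds a constant c. The homogeneous solution vanishes to second order
    at -b and the leading coefficient to first order; hence the third-order condition. It is met by
    c and by adding q1 zeta + q2 zeta^2 to the primitive of U, which also fixes chi. What remains is
    division of the k-th coefficient by [k + kap], harmless because [kap > 0]. *)

(** * Interchange of summation for double real series *)

Lemma ex_series_plus_R (a b : nat -> R) :
  ex_series a -> ex_series b -> ex_series (fun n => a n + b n).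
Proof. exact (ex_series_plus (K := R_AbsRing) (V := R_NormedModule) a b). Qed.

Lemma ex_series_scal_R (c : R) (a : nat -> R) :
  ex_series a -> ex_series (fun n => c * a n).
Proof. exact (ex_series_scal_l (K := R_AbsRing) c a). Qed.

Lemma ex_series_le_R (a b : nat -> R) :
  (forall n, Rabs (a n) <= b n) -> ex_series b -> ex_series a.
Proof.
  intros H Hb.
  exact (ex_series_le (K := R_AbsRing) (V := R_CompleteNormedModule) a b H Hb).
Qed.

Lemma ex_series_bounded (a : nat -> R) (M : R) :
  (forall n, 0 <= a n) -> (forall n, sum_n a n <= M) -> ex_series a /\ Series a <= M.
Proof.
  intros Ha HM.
  assert (Hex : ex_series a).
  { assert (Hl : ex_finite_lim_seq (sum_n a)).
    { apply ex_finite_lim_seq_incr with M; [|exact HM].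
      intros n. rewrite sum_Sn. unfold plus; simpl. specialize (Ha (S n)). lra. }
    destruct Hl as [l Hl]. exists l. exact Hl. }
  split; [exact Hex|].
  destruct Hex as [l Hl]. rewrite (is_series_unique _ _ Hl).
  assert (Hl' : is_lim_seq (sum_n a) l) by exact Hl.
  apply (is_lim_seq_le (sum_n a) (fun _ => M) l M); auto. apply is_lim_seq_const.
Qed.

Lemma sum_n_le_Series (a : nat -> R) (n : nat) :
  (forall n, 0 <= a n) -> ex_series a -> sum_n a n <= Series a.
Proof.
  intros Ha Hex.
  assert (Hl : is_lim_seq (sum_n a) (Series a)) by exact (Series_correct _ Hex).
  apply (is_lim_seq_incr_compare _ _ Hl).
  intros k. rewrite sum_Sn. unfold plus; simpl. specialize (Ha (S k)). lra.
Qed.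

Lemma Series_pos (a : nat -> R) : (forall n, 0 <= a n) -> ex_series a -> 0 <= Series a.
Proof.
  intros Ha Hex. apply Rle_trans with (sum_n a 0).
  - rewrite sum_O. apply Ha.
  - apply sum_n_le_Series; auto.
Qed.

Lemma term_le_Series (a : nat -> R) (n : nat) :
  (forall n, 0 <= a n) -> ex_series a -> a n <= Series a.
Proof.
  intros Ha Hex. apply Rle_trans with (sum_n a n); [|apply sum_n_le_Series; auto].
  destruct n; [rewrite sum_O; lra|].
  rewrite sum_Sn. unfold plus; simpl.
  assert (0 <= sum_n a n); [|lra].
  clear -Ha. induction n; [rewrite sum_O; auto|].
  rewrite sum_Sn. unfold plus; simpl. specialize (Ha (S n)). lra.
Qed.

Lemma Series_sum_n (a : nat -> nat -> R) (M : nat) :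
  (forall m, ex_series (fun n => a n m)) ->
  ex_series (fun n => sum_n (a n) M) /\
  Series (fun n => sum_n (a n) M) = sum_n (fun m => Series (fun n => a n m)) M.
Proof.
  intros Hm. induction M as [|M [IH1 IH2]].
  - split.
    + apply ex_series_ext with (fun n => a n 0%nat); [|apply Hm].
      intros n. now rewrite sum_O.
    + rewrite sum_O. apply Series_ext. intros n. now rewrite sum_O.
  - split.
    + apply ex_series_ext with (fun n => sum_n (a n) M + a n (S M)).
      * intros n. now rewrite sum_Sn.
      * apply ex_series_plus_R; auto.
    + rewrite sum_Sn, <- IH2. unfold plus; simpl. rewrite <- Series_plus; auto.
      apply Series_ext. intros n. now rewrite sum_Sn.
Qed.

(** A finite sum over m commutes with the series over n and is dominated row by row, so the partial
    sums are bounded. Applied once more to the transposed array, the inequality becomes an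
    equality. *)
Lemma Tonelli_le (a : nat -> nat -> R) :
  (forall n m, 0 <= a n m) -> (forall n, ex_series (a n)) ->
  ex_series (fun n => Series (a n)) ->
  (forall m, ex_series (fun n => a n m)) /\
  ex_series (fun m => Series (fun n => a n m)) /\
  Series (fun m => Series (fun n => a n m)) <= Series (fun n => Series (a n)).
Proof.
  intros Hp Hr Ht.
  assert (Hc : forall m, ex_series (fun n => a n m)).
  { intros m. apply ex_series_le_R with (fun n => Series (a n)); auto.
    intros n. rewrite Rabs_pos_eq by auto.
    now apply term_le_Series. }
  split; [exact Hc|].
  apply ex_series_bounded.
  - intros m. apply Series_pos; auto.
  - intros M. destruct (Series_sum_n a M Hc) as [H1 H2]. rewrite <- H2.
    apply Series_le; auto. intros n. split.
    + clear -Hp. induction M; [rewrite sum_O; auto|].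
      rewrite sum_Sn. unfold plus; simpl. specialize (Hp n (S M)). lra.
    + apply sum_n_le_Series; auto.
Qed.

Lemma Tonelli (a : nat -> nat -> R) :
  (forall n m, 0 <= a n m) -> (forall n, ex_series (a n)) ->
  ex_series (fun n => Series (a n)) ->
  Series (fun m => Series (fun n => a n m)) = Series (fun n => Series (a n)).
Proof.
  intros Hp Hr Ht.
  destruct (Tonelli_le a Hp Hr Ht) as (H1 & H2 & H3).
  apply Rle_antisym; [exact H3|].
  destruct (Tonelli_le (fun m n => a n m)) as (H4 & H5 & H6); auto.
Qed.

(** Tonelli applies to [|a|] and to [|a| + a]; subtract. *)
Lemma Fubini_series (a : nat -> nat -> R) :
  (forall n, ex_series (fun m => Rabs (a n m))) ->
  ex_series (fun n => Series (fun m => Rabs (a n m))) ->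
  Series (fun m => Series (fun n => a n m)) = Series (fun n => Series (a n)).
Proof.
  intros Hr Ht.
  destruct (Tonelli_le (fun n m => Rabs (a n m))) as (H1 & H2 & H3); auto.
  { intros; apply Rabs_pos. }
  assert (HT1 := Tonelli (fun n m => Rabs (a n m)) (fun _ _ => Rabs_pos _) Hr Ht).
  set (c := fun n m => Rabs (a n m) + a n m).
  assert (Hc0 : forall n m, 0 <= c n m).
  { intros n m. unfold c. generalize (Rle_abs (- a n m)). rewrite Rabs_Ropp. lra. }
  assert (Hc1 : forall n, ex_series (c n)).
  { intros n. apply ex_series_plus_R; auto. now apply ex_series_Rabs. }
  assert (Hcs : forall n, Series (c n) = Series (fun m => Rabs (a n m)) + Series (a n)).
  { intros n. apply Series_plus; auto. now apply ex_series_Rabs. }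
  assert (Hsa : ex_series (fun n => Series (a n))).
  { apply ex_series_le_R with (2 := Ht). intros n. now apply Series_Rabs. }
  assert (Hc2 : ex_series (fun n => Series (c n))).
  { apply ex_series_ext with (fun n => Series (fun m => Rabs (a n m)) + Series (a n)).
    - intros n. now rewrite Hcs.
    - now apply ex_series_plus_R. }
  assert (HT2 := Tonelli c Hc0 Hc1 Hc2).
  assert (Hcol : forall m, Series (fun n => c n m) =
     Series (fun n => Rabs (a n m)) + Series (fun n => a n m)).
  { intros m. apply Series_plus; auto. now apply ex_series_Rabs. }
  assert (Hsc : ex_series (fun m => Series (fun n => a n m))).
  { apply ex_series_le_R with (2 := H2). intros n. now apply Series_Rabs. }
  rewrite (Series_ext _ _ Hcs), (Series_ext _ _ Hcol) in HT2.
  rewrite !Series_plus in HT2; auto. lra.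
Qed.

(** * Summation over Z *)

(** Two-sided sums become ordinary series along this enumeration; for absolutely convergent sums the
    choice does not matter, by [SumZ_bij]. *)
Definition zn (n : nat) : Z :=
  if Nat.even n then Z.of_nat (Nat.div2 n) else (- Z.of_nat (Nat.div2 n) - 1)%Z.
Definition nz (k : Z) : nat :=
  if (0 <=? k)%Z then (2 * Z.to_nat k)%nat else (2 * Z.to_nat (- k - 1) + 1)%nat.

Lemma zn_nz (k : Z) : zn (nz k) = k.
Proof.
  unfold zn, nz. destruct (Z.leb_spec 0 k).
  - replace (Nat.even (2 * Z.to_nat k)) with true.
    + rewrite Nat.div2_double. lia.
    + symmetry. apply Nat.even_spec. now exists (Z.to_nat k).
  - replace (Nat.even (2 * Z.to_nat (- k - 1) + 1)) with false.
    + rewrite Nat.add_1_r, Nat.div2_succ_double. lia.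
    + symmetry. rewrite <- Bool.not_true_iff_false, Nat.even_spec. intros [j Hj]. lia.
Qed.

Lemma nz_zn (n : nat) : nz (zn n) = n.
Proof.
  unfold zn, nz. destruct (Nat.even n) eqn:E.
  - apply Nat.even_spec in E. destruct E as [j ->].
    rewrite Nat.div2_double. destruct (Z.leb_spec 0 (Z.of_nat j)); lia.
  - assert (E' : Nat.odd n = true) by (rewrite <- Nat.negb_even, E; reflexivity).
    apply Nat.odd_spec in E'. destruct E' as [j ->].
    rewrite Nat.add_1_r, Nat.div2_succ_double.
    destruct (Z.leb_spec 0 (- Z.of_nat j - 1)); lia.
Qed.

Definition sumable (f : Z -> R) : Prop := ex_series (fun n => Rabs (f (zn n))).
Definition SumZ (f : Z -> R) : R := Series (fun n => f (zn n)).

Lemma sumable_le (f g : Z -> R) :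
  (forall k, Rabs (f k) <= g k) -> sumable g -> sumable f.
Proof.
  intros H Hg. apply ex_series_le_R with (2 := Hg). intros n.
  rewrite Rabs_Rabsolu. apply Rle_trans with (1 := H _), Rle_abs.
Qed.

Lemma sumable_ext (f g : Z -> R) : (forall k, f k = g k) -> sumable f -> sumable g.
Proof.
  intros H. apply ex_series_ext. intros n. now rewrite H.
Qed.

Lemma sumable_Rabs (f : Z -> R) : sumable f -> sumable (fun k => Rabs (f k)).
Proof. apply ex_series_ext. intros n. now rewrite Rabs_Rabsolu. Qed.

Lemma sumable_ex (f : Z -> R) : sumable f -> ex_series (fun n => f (zn n)).
Proof. apply ex_series_Rabs. Qed.

Lemma sumable_plus (f g : Z -> R) : sumable f -> sumable g -> sumable (fun k => f k + g k).
Proof.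
  intros Hf Hg. apply ex_series_le_R with (fun n => Rabs (f (zn n)) + Rabs (g (zn n))).
  - intros n. rewrite Rabs_Rabsolu. apply Rabs_triang.
  - exact (ex_series_plus_R _ _ Hf Hg).
Qed.

Lemma sumable_scal (c : R) (f : Z -> R) : sumable f -> sumable (fun k => c * f k).
Proof.
  intros Hf. apply ex_series_ext with (fun n => Rabs c * Rabs (f (zn n))).
  - intros n. now rewrite Rabs_mult.
  - apply ex_series_scal_R; exact Hf.
Qed.

Lemma SumZ_ext (f g : Z -> R) : (forall k, f k = g k) -> SumZ f = SumZ g.
Proof. intros H. apply Series_ext. intros; apply H. Qed.

Lemma SumZ_plus (f g : Z -> R) : sumable f -> sumable g ->
  SumZ (fun k => f k + g k) = SumZ f + SumZ g.
Proof. intros Hf Hg. apply Series_plus; now apply sumable_ex. Qed.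

Lemma SumZ_scal (c : R) (f : Z -> R) : SumZ (fun k => c * f k) = c * SumZ f.
Proof. apply Series_scal_l. Qed.

Lemma SumZ_opp (f : Z -> R) : SumZ (fun k => - f k) = - SumZ f.
Proof.
  rewrite (SumZ_ext _ (fun k => (-1) * f k)) by (intros; ring).
  rewrite SumZ_scal. ring.
Qed.

Lemma SumZ_minus (f g : Z -> R) : sumable f -> sumable g ->
  SumZ (fun k => f k - g k) = SumZ f - SumZ g.
Proof. intros Hf Hg. apply Series_minus; now apply sumable_ex. Qed.

Lemma SumZ_le (f g : Z -> R) : (forall k, f k <= g k) -> sumable f -> sumable g ->
  SumZ f <= SumZ g.
Proof.
  intros H Hf Hg.
  assert (0 <= SumZ (fun k => g k - f k)); [|rewrite SumZ_minus in H0; auto; lra].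
  apply Series_pos; [intros; specialize (H (zn n)); lra|].
  apply (ex_series_plus_R (fun n => g (zn n)) (fun n => - f (zn n))); [now apply sumable_ex|].
  apply ex_series_ext with (fun n => (-1) * f (zn n)); [intros n; assert (E : forall x : R, -1 * x = - x) by (intros; ring); apply E|].
  apply ex_series_scal_R. now apply sumable_ex.
Qed.

Lemma SumZ_Rabs (f : Z -> R) : sumable f -> Rabs (SumZ f) <= SumZ (fun k => Rabs (f k)).
Proof. intros Hf. now apply Series_Rabs. Qed.

Lemma SumZ_bound (f g : Z -> R) : (forall k, Rabs (f k) <= g k) -> sumable g ->
  Rabs (SumZ f) <= SumZ g.
Proof.
  intros H Hg. assert (Hf := sumable_le f g H Hg).
  apply Rle_trans with (1 := SumZ_Rabs f Hf).
  apply SumZ_le; auto. now apply sumable_Rabs.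
Qed.

Lemma SumZ_pos (f : Z -> R) : (forall k, 0 <= f k) -> sumable f -> 0 <= SumZ f.
Proof. intros H Hf. apply Series_pos; auto. now apply sumable_ex. Qed.

Lemma term_le_SumZ (f : Z -> R) (k : Z) : (forall k, 0 <= f k) -> sumable f -> f k <= SumZ f.
Proof.
  intros H Hf. rewrite <- (zn_nz k) at 1.
  apply (term_le_Series (fun n => f (zn n))); auto. now apply sumable_ex.
Qed.

Lemma SumZ_Fubini (a : Z -> Z -> R) :
  (forall i, sumable (a i)) -> sumable (fun i => SumZ (fun j => Rabs (a i j))) ->
  (forall j, sumable (fun i => a i j)) /\
  sumable (fun j => SumZ (fun i => Rabs (a i j))) /\
  sumable (fun j => SumZ (fun i => a i j)) /\
  SumZ (fun j => SumZ (fun i => a i j)) = SumZ (fun i => SumZ (a i)).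
Proof.
  intros H1 H2. apply sumable_ex in H2.
  assert (HT := Tonelli_le (fun n m => Rabs (a (zn n) (zn m)))).
  destruct HT as (H3 & H4 & H5); auto.
  { intros; apply Rabs_pos. }
  { intros n; apply H1. }
  assert (H6 : forall j, sumable (fun i => a i j)).
  { intros j. specialize (H3 (nz j)). rewrite zn_nz in H3. exact H3. }
  assert (H7 : sumable (fun j => SumZ (fun i => Rabs (a i j)))).
  { apply ex_series_ext with (2 := H4). intros n. symmetry.
    apply Rabs_pos_eq, (SumZ_pos (fun i => Rabs (a i (zn n)))); [intros; apply Rabs_pos|]. apply sumable_Rabs, H6. }
  repeat split; auto.
  - apply sumable_le with (2 := H7). intros j. apply SumZ_Rabs, H6.
  - apply (Fubini_series (fun n m => a (zn n) (zn m))); auto. intros n; apply H1.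
Qed.

Lemma sumable_finite (f : Z -> R) (N : nat) :
  (forall k, (Z.of_nat N < Z.abs k)%Z -> f k = 0) -> sumable f.
Proof.
  intros H. unfold sumable.
  (* From index [2 * N + 2] on, the enumeration meets only integers of modulus larger than N. *)
  assert (Hz : is_series (fun n => Rabs (f (zn (2 * N + 2 + n)%nat))) 0).
  { apply is_series_ext with (fun _ => 0).
    - intros n. rewrite H; [now rewrite Rabs_R0|].
      assert (Hn := nz_zn (2 * N + 2 + n)). revert Hn. unfold nz.
      destruct (Z.leb_spec 0 (zn (2 * N + 2 + n))); lia.
    - assert (Hc := is_lim_seq_const 0).
      assert (He : forall n, sum_n (fun _ : nat => 0) n = 0).
      { intros n. induction n; [now rewrite sum_O|]. rewrite sum_Sn, IHn.
        unfold plus; simpl; ring. }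
      exact (is_lim_seq_ext (fun _ => 0) _ _ (fun n => eq_sym (He n)) Hc). }
  apply (ex_series_incr_n (fun n => Rabs (f (zn n))) (2 * N + 2)). now exists 0.
Qed.

Lemma SumZ_single (f : Z -> R) (k0 : Z) :
  (forall k, k <> k0 -> f k = 0) -> sumable f /\ SumZ f = f k0.
Proof.
  intros H.
  assert (Hs : is_series (fun n => f (zn n)) (f k0)).
  { assert (HN : forall n, (nz k0 <= n)%nat -> sum_n (fun n => f (zn n)) n = f k0).
    { assert (H0 : forall n, (n < nz k0)%nat -> sum_n (fun n => f (zn n)) n = 0).
      { induction n; intros Hn.
        - rewrite sum_O. apply H. intros E. rewrite <- E, nz_zn in Hn. lia.
        - rewrite sum_Sn, IHn by lia. rewrite H; [unfold plus; simpl; ring|].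
          intros E. rewrite <- E, nz_zn in Hn. lia. }
      induction n; intros Hn.
      - assert (nz k0 = 0)%nat by lia. rewrite sum_O, <- H1, zn_nz. reflexivity.
      - destruct (Nat.eq_dec (nz k0) (S n)) as [E|E].
        + rewrite sum_Sn, H0, <- E, zn_nz by lia. unfold plus; simpl; ring.
        + rewrite sum_Sn, IHn, (H (zn (S n))) by (try lia; intros E'; apply E; rewrite <- E', nz_zn; auto).
          unfold plus; simpl; ring. }
    change (is_lim_seq (sum_n (fun n => f (zn n))) (f k0)).
    apply (is_lim_seq_ext_loc (fun _ => f k0)); [|apply is_lim_seq_const].
    exists (nz k0). intros n Hn. now rewrite HN. }
  split; [|now apply is_series_unique].
  apply sumable_finite with (Z.abs_nat k0). intros k Hk. apply H. intros ->. lia.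
Qed.

(* Rearrangement follows from Fubini applied to [(i, j) |-> if sigma j = i then f i else 0]. *)
Lemma SumZ_bij (f : Z -> R) (s t : Z -> Z) :
  (forall k, s (t k) = k) -> (forall k, t (s k) = k) -> sumable f ->
  sumable (fun k => f (s k)) /\ SumZ (fun k => f (s k)) = SumZ f.
Proof.
  intros Hst Hts Hf.
  set (a := fun i j : Z => if Z.eq_dec (s j) i then f i else 0).
  assert (Ha1 : forall i j, j <> t i -> a i j = 0).
  { intros i j Hj. unfold a. destruct (Z.eq_dec (s j) i); auto. subst. now rewrite Hts in Hj. }
  assert (Ha2 : forall i, a i (t i) = f i).
  { intros i. unfold a. destruct (Z.eq_dec (s (t i)) i); auto. now rewrite Hst in n. }
  assert (Hb1 : forall i j, i <> s j -> a i j = 0).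
  { intros i j Hj. unfold a. destruct (Z.eq_dec (s j) i); auto. now subst. }
  assert (Hb2 : forall j, a (s j) j = f (s j)).
  { intros i. unfold a. destruct (Z.eq_dec (s i) (s i)); auto. tauto. }
  assert (HA : forall i, SumZ (fun j => Rabs (a i j)) = Rabs (f i)).
  { intros i. rewrite <- Ha2. apply (SumZ_single (fun j => Rabs (a i j))).
    intros k Hk. rewrite Ha1; auto. apply Rabs_R0. }
  destruct (SumZ_Fubini a) as (H1 & H2 & H3 & H4).
  - intros i. apply (SumZ_single (a i) (t i)); auto.
  - apply sumable_ext with (fun i => Rabs (f i)); [|now apply sumable_Rabs].
    intros; now rewrite HA.
  - assert (E1 : forall j, SumZ (fun i => a i j) = f (s j)).
    { intros j. rewrite <- Hb2. apply (SumZ_single (fun i => a i j)); auto. }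
    assert (E2 : forall i, SumZ (a i) = f i).
    { intros i. rewrite <- Ha2. apply (SumZ_single (a i)); auto. }
    split.
    + apply sumable_ext with (2 := H3); auto.
    + rewrite <- (SumZ_ext _ _ E1), H4. now apply SumZ_ext.
Qed.

(** * The weighted Wiener algebra as a commutative ring *)

Definition wt (k : Z) : R := 2 ^ Z.abs_nat k.

Lemma wt_ge1 (k : Z) : 1 <= wt k.
Proof. apply pow_R1_Rle. lra. Qed.

Lemma wt_pos (k : Z) : 0 < wt k.
Proof. generalize (wt_ge1 k); lra. Qed.

Lemma wt_add (j k : Z) : wt (j + k) <= wt j * wt k.
Proof.
  unfold wt. rewrite <- pow_add. apply Rle_pow; [lra|lia].
Qed.

Lemma wt_opp (k : Z) : wt (- k) = wt k.
Proof. unfold wt. f_equal. lia. Qed.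

Definition sumw (f : Z -> R) : Prop := sumable (fun k => Rabs (f k) * wt k).

(** Real coefficients encode the reflection symmetry of the wave: on the circle, the value at
    [- alpha] is the conjugate of the value at [alpha]. *)
Record W := mkW { cf :> Z -> R; cf_sumw : sumw cf }.

Lemma W_ext (f g : W) : (forall k, f k = g k) -> f = g.
Proof.
  destruct f as [f Hf], g as [g Hg]. simpl. intros H.
  assert (f = g) by (now apply functional_extensionality). subst.
  f_equal. apply proof_irrelevance.
Qed.

Lemma sumw_zero : sumw (fun _ => 0).
Proof.
  apply sumable_le with (fun _ => 0).
  - intros k. rewrite Rabs_R0, Rmult_0_l, Rabs_R0. lra.
  - apply (SumZ_single (fun _ => 0) 0%Z). auto.
Qed.

(* [toW f] is the junk value 0 when [f] is not summable. *)
Definition toW (f : Z -> R) : W :=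
  match excluded_middle_informative (sumw f) with
  | left H => mkW f H
  | right _ => mkW _ sumw_zero
  end.

Lemma cf_toW (f : Z -> R) (k : Z) : sumw f -> toW f k = f k.
Proof. intros H. unfold toW. destruct (excluded_middle_informative (sumw f)); tauto. Qed.

Lemma sumw_le (f g : Z -> R) : (forall k, Rabs (f k) <= Rabs (g k)) -> sumw g -> sumw f.
Proof.
  intros H. apply sumable_le. intros k. rewrite Rabs_mult, Rabs_Rabsolu.
  rewrite (Rabs_pos_eq (wt k)) by (apply Rlt_le, wt_pos).
  apply Rmult_le_compat_r; auto. apply Rlt_le, wt_pos.
Qed.

Lemma sumw_ext (f g : Z -> R) : (forall k, f k = g k) -> sumw f -> sumw g.
Proof. intros H. apply sumw_le. intros k. rewrite H. lra. Qed.

Lemma sumw_plus (f g : Z -> R) : sumw f -> sumw g -> sumw (fun k => f k + g k).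
Proof.
  intros Hf Hg. apply sumable_le with (2 := sumable_plus _ _ Hf Hg).
  intros k. rewrite Rabs_mult, Rabs_Rabsolu, (Rabs_pos_eq (wt k)) by (apply Rlt_le, wt_pos).
  rewrite <- Rmult_plus_distr_r. apply Rmult_le_compat_r; [apply Rlt_le, wt_pos|].
  apply Rabs_triang.
Qed.

Lemma sumw_bound (m f : Z -> R) (c : R) :
  (forall k, Rabs (m k) <= c) -> sumw f -> sumw (fun k => m k * f k).
Proof.
  intros Hm Hf. apply sumable_le with (2 := sumable_scal c _ Hf).
  intros k. rewrite !Rabs_mult, !Rabs_Rabsolu, (Rabs_pos_eq (wt k)) by (apply Rlt_le, wt_pos).
  rewrite Rmult_assoc. apply Rmult_le_compat_r; auto.
  apply Rmult_le_pos; [apply Rabs_pos|apply Rlt_le, wt_pos].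
Qed.

Lemma sumw_refl (f : Z -> R) : sumw f -> sumw (fun k => f (- k)%Z).
Proof.
  intros Hf. destruct (SumZ_bij _ Z.opp Z.opp Z.opp_involutive Z.opp_involutive Hf) as [H _].
  apply sumable_ext with (2 := H). intros k. now rewrite wt_opp.
Qed.

Lemma sumw_sumable (f phi : Z -> R) (c : R) :
  (forall k, Rabs (phi k) <= c * wt k) -> sumw f -> sumable (fun k => f k * phi k).
Proof.
  intros Hp Hf. apply sumable_le with (2 := sumable_scal c _ Hf).
  intros k. rewrite Rabs_mult.
  replace (c * (Rabs (f k) * wt k)) with (Rabs (f k) * (c * wt k)) by ring.
  apply Rmult_le_compat_l; auto. apply Rabs_pos.
Qed.

Definition convo (f g : Z -> R) (n : Z) : R := SumZ (fun k => f k * g (n - k)%Z).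

Lemma shift_sum (f : Z -> R) (n : Z) : sumable f ->
  sumable (fun k => f (k + n)%Z) /\ SumZ (fun k => f (k + n)%Z) = SumZ f.
Proof.
  apply (SumZ_bij f (fun k => k + n)%Z (fun k => k - n)%Z); intros; ring.
Qed.

Lemma weight_shift (g phi : Z -> R) (c : R) (k : Z) :
  (forall n, Rabs (phi n) <= c * wt n) -> sumw g ->
  sumable (fun j => g j * phi (k + j)%Z) /\
  SumZ (fun j => Rabs (g j * phi (k + j)%Z)) <= c * wt k * SumZ (fun j => Rabs (g j) * wt j).
Proof.
  intros Hp Hg.
  assert (Hb : forall j, Rabs (g j * phi (k + j)%Z) <= c * wt k * (Rabs (g j) * wt j)).
  { intros j. rewrite Rabs_mult.
    assert (0 <= c).
    { apply Rmult_le_reg_r with (wt 0); [apply wt_pos|]. rewrite Rmult_0_l.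
      apply Rle_trans with (2 := Hp 0%Z), Rabs_pos. }
    apply Rle_trans with (Rabs (g j) * (c * (wt k * wt j))).
    - apply Rmult_le_compat_l; [apply Rabs_pos|]. apply Rle_trans with (1 := Hp _).
      apply Rmult_le_compat_l; auto. apply wt_add.
    - right; ring. }
  split.
  - apply sumable_le with (1 := Hb). now apply sumable_scal.
  - rewrite <- SumZ_scal. apply SumZ_le; auto.
    + apply sumable_Rabs, sumable_le with (1 := Hb). now apply sumable_scal.
    + now apply sumable_scal.
Qed.

(** A convolution is paired with a test sequence dominated by the weight. The norm bound of a
    product, associativity and multiplicativity of the evaluation on the circle are all this one
    interchange of sums, for different [phi]. *)
Lemma convo_test (f g phi : Z -> R) (c : R) :
  (forall n, Rabs (phi n) <= c * wt n) -> sumw f -> sumw g ->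
  (forall n, 0 < Rabs (phi n) -> sumable (fun k => f k * g (n - k)%Z)) /\
  sumable (fun n => convo f g n * phi n) /\
  SumZ (fun n => convo f g n * phi n) =
    SumZ (fun k => f k * SumZ (fun j => g j * phi (k + j)%Z)).
Proof.
  intros Hp Hf Hg.
  set (a := fun k n => f k * (g (n - k)%Z * phi n)).
  assert (Hr : forall k, sumable (fun n => g (n - k)%Z * phi n) /\
    SumZ (fun n => g (n - k)%Z * phi n) = SumZ (fun j => g j * phi (k + j)%Z) /\
    SumZ (fun n => Rabs (g (n - k)%Z * phi n)) <= c * wt k * SumZ (fun j => Rabs (g j) * wt j)).
  { intros k. destruct (weight_shift g phi c k Hp Hg) as [H1 H2].
    destruct (shift_sum _ (- k)%Z H1) as [H3 H4].
    destruct (shift_sum _ (- k)%Z (sumable_Rabs _ H1)) as [H5 H6].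
    split; [|split].
    - apply sumable_ext with (2 := H3). intros n. f_equal; f_equal; ring.
    - rewrite <- H4. apply SumZ_ext. intros n. f_equal; f_equal; ring.
    - rewrite <- H6 in H2. apply Rle_trans with (2 := H2). right.
      apply SumZ_ext. intros n. do 2 f_equal; f_equal; ring. }
  destruct (SumZ_Fubini a) as (H1 & H2 & H3 & H4).
  - intros k. apply sumable_scal, Hr.
  - apply sumable_le with (fun k => (c * SumZ (fun j => Rabs (g j) * wt j)) * (Rabs (f k) * wt k));
      [|now apply sumable_scal].
    intros k. unfold a. destruct (Hr k) as (Hr1 & Hr2 & Hr3).
    rewrite (SumZ_ext _ (fun n => Rabs (f k) * Rabs (g (n - k)%Z * phi n)))
      by (intros; apply Rabs_mult).
    rewrite SumZ_scal, Rabs_mult, Rabs_Rabsolu, (Rabs_pos_eq (SumZ _)).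
    + apply Rle_trans with (Rabs (f k) * (c * wt k * SumZ (fun j => Rabs (g j) * wt j))).
      * apply Rmult_le_compat_l; auto. apply Rabs_pos.
      * right; ring.
    + apply SumZ_pos; [intros; apply Rabs_pos|now apply sumable_Rabs].
  - assert (Hcv : forall n, SumZ (fun k => a k n) = convo f g n * phi n).
    { intros n. unfold a, convo. rewrite Rmult_comm, <- SumZ_scal. apply SumZ_ext. intros; ring. }
    split; [|split].
    + intros n Hn. specialize (H1 n).
      assert (Hne : phi n <> 0) by (intros E; rewrite E, Rabs_R0 in Hn; lra).
      apply (sumable_scal (/ phi n)) in H1. apply sumable_ext with (2 := H1).
      intros k. unfold a. now field.
    + apply sumable_ext with (2 := H3). exact Hcv.
    + rewrite <- (SumZ_ext _ _ Hcv), H4. apply SumZ_ext. intros k.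
      unfold a. rewrite SumZ_scal. f_equal. apply Hr.
Qed.

Lemma wt_self (n : Z) : Rabs (wt n) <= 1 * wt n.
Proof. rewrite Rabs_pos_eq by (apply Rlt_le, wt_pos). lra. Qed.

Lemma sumw_Rabs (f : Z -> R) : sumw f -> sumw (fun k => Rabs (f k)).
Proof. apply sumw_le. intros; rewrite Rabs_Rabsolu; lra. Qed.

Lemma convo_sumable (f g : Z -> R) (n : Z) : sumw f -> sumw g ->
  sumable (fun k => f k * g (n - k)%Z).
Proof.
  intros Hf Hg. apply (convo_test f g wt 1 wt_self Hf Hg).
  apply Rabs_pos_lt. generalize (wt_pos n). lra.
Qed.

Lemma Rabs_convo (f g : Z -> R) (n : Z) : sumw f -> sumw g ->
  Rabs (convo f g n) <= convo (fun k => Rabs (f k)) (fun k => Rabs (g k)) n.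
Proof.
  intros Hf Hg. apply SumZ_bound.
  - intros k. rewrite Rabs_mult. lra.
  - apply (convo_sumable (fun k => Rabs (f k)) (fun k => Rabs (g k))); now apply sumw_Rabs.
Qed.

Lemma sumw_convo (f g : Z -> R) : sumw f -> sumw g -> sumw (convo f g).
Proof.
  intros Hf Hg.
  destruct (convo_test _ _ wt 1 wt_self (sumw_Rabs _ Hf) (sumw_Rabs _ Hg)) as (_ & H & _).
  apply sumable_le with (2 := H). intros k.
  rewrite Rabs_mult, Rabs_Rabsolu, (Rabs_pos_eq (wt k)) by (apply Rlt_le, wt_pos).
  apply Rmult_le_compat_r; [apply Rlt_le, wt_pos|now apply Rabs_convo].
Qed.

Definition W0 : W := mkW _ sumw_zero.
Definition Wadd (f g : W) : W := toW (fun k => f k + g k).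
Definition Wm (m : Z -> R) (f : W) : W := toW (fun k => m k * f k).
Definition Wscal (c : R) (f : W) : W := Wm (fun _ => c) f.
Definition Wopp (f : W) : W := Wscal (-1) f.
Definition Wsub (f g : W) : W := Wadd f (Wopp g).
Definition Wmul (f g : W) : W := toW (convo f g).
Definition mon (n : Z) : W := toW (fun k => if Z.eq_dec k n then 1 else 0).
Definition W1 : W := mon 0.
Definition Wc (r : R) : W := Wscal r W1.
Definition conj (f : W) : W := toW (fun k => f (- k)%Z).
Definition nm (f : W) : R := SumZ (fun k => Rabs (f k) * wt k).

Lemma cf_add (f g : W) (k : Z) : Wadd f g k = f k + g k.
Proof. unfold Wadd. rewrite cf_toW; auto. apply sumw_plus; apply cf_sumw. Qed.

Lemma cf_m (m : Z -> R) (c : R) (f : W) (k : Z) :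
  (forall k, Rabs (m k) <= c) -> Wm m f k = m k * f k.
Proof. intros H. unfold Wm. rewrite cf_toW; auto. apply sumw_bound with c; auto. apply cf_sumw. Qed.

Lemma cf_scal (c : R) (f : W) (k : Z) : Wscal c f k = c * f k.
Proof. unfold Wscal. rewrite cf_m with (c := Rabs c); auto. intros; lra. Qed.

Lemma cf_opp (f : W) (k : Z) : Wopp f k = - f k.
Proof. unfold Wopp. rewrite cf_scal. ring. Qed.

Lemma cf_sub (f g : W) (k : Z) : Wsub f g k = f k - g k.
Proof. unfold Wsub. rewrite cf_add, cf_opp. ring. Qed.

Lemma cf_mul (f g : W) (k : Z) : Wmul f g k = convo f g k.
Proof. unfold Wmul. rewrite cf_toW; auto. apply sumw_convo; apply cf_sumw. Qed.

Lemma cf_mon (n k : Z) : mon n k = if Z.eq_dec k n then 1 else 0.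
Proof.
  unfold mon. rewrite cf_toW; auto.
  apply (SumZ_single (fun k => Rabs (if Z.eq_dec k n then 1 else 0) * wt k) n).
  intros j Hj. destruct (Z.eq_dec j n); [tauto|]. rewrite Rabs_R0. ring.
Qed.

Lemma cf_conj (f : W) (k : Z) : conj f k = f (- k)%Z.
Proof. unfold conj. rewrite cf_toW; auto. apply sumw_refl, cf_sumw. Qed.

Lemma cf_W0 (k : Z) : W0 k = 0.
Proof. reflexivity. Qed.

Lemma cf_Wc (r : R) (k : Z) : Wc r k = if Z.eq_dec k 0 then r else 0.
Proof. unfold Wc, W1. rewrite cf_scal, cf_mon. destruct (Z.eq_dec k 0); ring. Qed.

Lemma mul_test (f g : W) (phi : Z -> R) (c : R) :
  (forall n, Rabs (phi n) <= c * wt n) ->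
  SumZ (fun n => Wmul f g n * phi n) =
    SumZ (fun k => f k * SumZ (fun j => g j * phi (k + j)%Z)).
Proof.
  intros Hp. rewrite (SumZ_ext _ (fun n => convo f g n * phi n)) by (intros; now rewrite cf_mul).
  apply (convo_test f g phi c Hp); apply cf_sumw.
Qed.

Lemma cf_le_nm (f : W) (k : Z) : Rabs (f k) * wt k <= nm f.
Proof.
  apply (term_le_SumZ (fun k => Rabs (f k) * wt k)); [|apply cf_sumw].
  intros j. apply Rmult_le_pos; [apply Rabs_pos|apply Rlt_le, wt_pos].
Qed.

Lemma Wmul_comm (f g : W) : Wmul f g = Wmul g f.
Proof.
  apply W_ext. intros n. rewrite !cf_mul. unfold convo.
  assert (H : forall k, (n - (n - k) = k)%Z) by (intros; ring).
  destruct (SumZ_bij (fun k => f k * g (n - k)%Z) (fun k => n - k)%Z (fun k => n - k)%Z H H) as [_ E].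
  - apply convo_sumable; apply cf_sumw.
  - rewrite <- E. apply SumZ_ext. intros k. rewrite H. ring.
Qed.

(** This is [mul_test] with the test sequence [n |-> h (m - n)]. *)
Lemma Wmul_assoc (f g h : W) : Wmul f (Wmul g h) = Wmul (Wmul f g) h.
Proof.
  apply W_ext. intros m. rewrite (cf_mul (Wmul f g)). unfold convo.
  rewrite (mul_test f g (fun n => h (m - n)%Z) (nm h * wt m)).
  - rewrite cf_mul. apply SumZ_ext. intros k. f_equal.
    rewrite cf_mul. apply SumZ_ext. intros j. do 2 f_equal. ring.
  - intros n. 
    assert (H1 := cf_le_nm h (m - n)). assert (H2 := wt_ge1 (m - n)).
    apply Rle_trans with (nm h).
    + apply Rle_trans with (2 := H1). rewrite <- (Rmult_1_r (Rabs _)) at 1.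
      apply Rmult_le_compat_l; auto. apply Rabs_pos.
    + assert (0 <= nm h).
      { apply Rle_trans with (2 := H1). apply Rmult_le_pos; [apply Rabs_pos|lra]. }
      rewrite Rmult_assoc, <- (Rmult_1_r (nm h)) at 1. apply Rmult_le_compat_l; auto.
      generalize (wt_ge1 m) (wt_ge1 n). nra.
Qed.

Lemma Wmul_add (f g h : W) : Wmul (Wadd f g) h = Wadd (Wmul f h) (Wmul g h).
Proof.
  apply W_ext. intros n. rewrite cf_add, !cf_mul. unfold convo.
  rewrite <- SumZ_plus by (apply convo_sumable; apply cf_sumw).
  apply SumZ_ext. intros k. rewrite cf_add. ring.
Qed.

Lemma cf_mon_mul (n : Z) (f : W) (k : Z) : Wmul (mon n) f k = f (k - n)%Z.
Proof.
  rewrite cf_mul. unfold convo.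
  destruct (SumZ_single (fun j => mon n j * f (k - j)%Z) n) as [_ ->].
  - intros j Hj. rewrite cf_mon. destruct (Z.eq_dec j n); [tauto|ring].
  - rewrite cf_mon. destruct (Z.eq_dec n n); [ring|tauto].
Qed.

Lemma Wmul_1 (f : W) : Wmul W1 f = f.
Proof. apply W_ext. intros k. unfold W1. rewrite cf_mon_mul. f_equal. ring. Qed.

Lemma W_ring : ring_theory W0 W1 Wadd Wmul Wsub Wopp (@eq W).
Proof.
  constructor.
  - intros. apply W_ext. intros. rewrite cf_add, cf_W0. ring.
  - intros. apply W_ext. intros. rewrite !cf_add. ring.
  - intros. apply W_ext. intros. rewrite !cf_add. ring.
  - exact Wmul_1.
  - exact Wmul_comm.
  - exact Wmul_assoc.
  - exact Wmul_add.
  - reflexivity.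
  - intros. apply W_ext. intros. rewrite cf_add, cf_opp, cf_W0. ring.
Qed.

Declare Scope W_scope.
Delimit Scope W_scope with W.
Bind Scope W_scope with W.
Notation "f + g" := (Wadd f g) : W_scope.
Notation "f - g" := (Wsub f g) : W_scope.
Notation "f * g" := (Wmul f g) : W_scope.
Notation "- f" := (Wopp f) : W_scope.
Notation "0" := W0 : W_scope.
Notation "1" := W1 : W_scope.

Add Ring Wring : W_ring.

Lemma Wscal_Wc (c : R) (f : W) : Wscal c f = (Wc c * f)%W.
Proof.
  apply W_ext. intros k. unfold Wc, Wscal at 1.
  rewrite cf_m with (c := Rabs c) by (intros; lra).
  rewrite cf_mul. unfold convo.
  destruct (SumZ_single (fun j => Wscal c 1 j * f (k - j)%Z) 0) as [_ ->].
  - intros j Hj. unfold W1. rewrite cf_scal, cf_mon. destruct (Z.eq_dec j 0); [tauto|ring].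
  - unfold W1. rewrite cf_scal, cf_mon. destruct (Z.eq_dec 0 0); [|tauto].
    rewrite Z.sub_0_r. ring.
Qed.

Lemma cf_Wc_mul (c : R) (f : W) (k : Z) : (Wc c * f)%W k = c * f k.
Proof. rewrite <- Wscal_Wc. apply cf_scal. Qed.

Lemma Wc_mul (a b : R) : Wc (a * b) = (Wc a * Wc b)%W.
Proof. apply W_ext. intros k. rewrite cf_Wc_mul, !cf_Wc. destruct (Z.eq_dec k 0); ring. Qed.
Lemma Wc_add (a b : R) : Wc (a + b) = (Wc a + Wc b)%W.
Proof. apply W_ext. intros k. rewrite cf_add, !cf_Wc. destruct (Z.eq_dec k 0); ring. Qed.
Lemma Wc_opp (a : R) : Wc (- a) = (- Wc a)%W.
Proof. apply W_ext. intros k. rewrite cf_opp, !cf_Wc. destruct (Z.eq_dec k 0); ring. Qed.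
Lemma Wc_sub (a b : R) : Wc (a - b) = (Wc a - Wc b)%W.
Proof. apply W_ext. intros k. rewrite cf_sub, !cf_Wc. destruct (Z.eq_dec k 0); ring. Qed.
Lemma Wc_0 : Wc 0 = 0%W.
Proof. apply W_ext. intros k. rewrite cf_Wc. destruct (Z.eq_dec k 0); reflexivity. Qed.
Lemma Wc_1 : Wc 1 = 1%W.
Proof. apply W_ext. intros k. unfold W1. rewrite cf_Wc, cf_mon. reflexivity. Qed.
Lemma Wc_2 : Wc 2 = (1 + 1)%W.
Proof. now rewrite <- Wc_1, <- Wc_add. Qed.

Lemma mon_mul (m n : Z) : (mon m * mon n)%W = mon (m + n).
Proof.
  apply W_ext. intros k. rewrite cf_mon_mul, !cf_mon.
  destruct (Z.eq_dec (k - m) n), (Z.eq_dec k (m + n)); try lia; reflexivity.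
Qed.

Lemma conj_conj (f : W) : conj (conj f) = f.
Proof. apply W_ext. intros k. rewrite !cf_conj. f_equal. ring. Qed.
Lemma conj_add (f g : W) : conj (f + g) = (conj f + conj g)%W.
Proof. apply W_ext. intros k. rewrite cf_add, !cf_conj, cf_add. ring. Qed.
Lemma conj_opp (f : W) : conj (- f) = (- conj f)%W.
Proof. apply W_ext. intros k. rewrite cf_opp, !cf_conj, cf_opp. ring. Qed.
Lemma conj_sub (f g : W) : conj (f - g) = (conj f - conj g)%W.
Proof. apply W_ext. intros k. rewrite cf_sub, !cf_conj, cf_sub. ring. Qed.
Lemma conj_mul (f g : W) : conj (f * g) = (conj f * conj g)%W.
Proof.
  apply W_ext. intros n. rewrite cf_conj, !cf_mul. unfold convo.
  destruct (SumZ_bij (fun k => f k * g (- n - k)%Z) Z.opp Z.opp Z.opp_involutive Z.opp_involutive) as [_ E].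
  - apply convo_sumable; apply cf_sumw.
  - rewrite <- E. apply SumZ_ext. intros k. rewrite !cf_conj. do 2 f_equal. ring.
Qed.
Lemma conj_mon (n : Z) : conj (mon n) = mon (- n).
Proof.
  apply W_ext. intros k. rewrite cf_conj, !cf_mon.
  destruct (Z.eq_dec (- k) n), (Z.eq_dec k (- n)); try lia; reflexivity.
Qed.
Lemma conj_Wc (c : R) : conj (Wc c) = Wc c.
Proof.
  apply W_ext. intros k. rewrite cf_conj, !cf_Wc.
  destruct (Z.eq_dec (- k) 0), (Z.eq_dec k 0); try lia; reflexivity.
Qed.
Lemma conj_1 : conj 1 = 1%W.
Proof. rewrite <- Wc_1. apply conj_Wc. Qed.

(** ** Norm *)

Lemma nm_pos (f : W) : 0 <= nm f.
Proof.
  apply SumZ_pos; [|apply cf_sumw].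
  intros; apply Rmult_le_pos; [apply Rabs_pos|apply Rlt_le, wt_pos].
Qed.

Lemma cf_abs_le (f : W) (k : Z) : Rabs (f k) <= nm f.
Proof.
  apply Rle_trans with (2 := cf_le_nm f k).
  generalize (wt_ge1 k) (Rabs_pos (f k)). nra.
Qed.

Lemma nm_0 : nm 0 = 0.
Proof.
  unfold nm. rewrite (SumZ_ext _ (fun _ => 0)).
  - apply (SumZ_single (fun _ => 0) 0). auto.
  - intros. rewrite cf_W0, Rabs_R0. ring.
Qed.

Lemma nm_eq0 (f : W) : nm f <= 0 -> f = 0%W.
Proof.
  intros H. apply W_ext. intros k. rewrite cf_W0.
  assert (H1 := cf_abs_le f k). assert (H2 := Rabs_pos (f k)).
  destruct (Req_dec (f k) 0); auto. assert (0 < Rabs (f k)) by now apply Rabs_pos_lt. lra.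
Qed.

Lemma nm_add (f g : W) : nm (f + g) <= nm f + nm g.
Proof.
  unfold nm at 2 3. rewrite <- SumZ_plus by apply cf_sumw.
  apply SumZ_le; [|apply cf_sumw|apply sumable_plus; apply cf_sumw].
  intros k. rewrite <- Rmult_plus_distr_r, cf_add.
  apply Rmult_le_compat_r; [apply Rlt_le, wt_pos|apply Rabs_triang].
Qed.

Lemma nm_m (m : Z -> R) (c : R) (f : W) : (forall k, Rabs (m k) <= c) -> nm (Wm m f) <= c * nm f.
Proof.
  intros H. unfold nm. rewrite <- SumZ_scal.
  apply SumZ_le; [|apply cf_sumw|apply sumable_scal, cf_sumw].
  intros k. rewrite cf_m with (c := c), Rabs_mult, Rmult_assoc by auto.
  apply Rmult_le_compat_r; auto.
  apply Rmult_le_pos; [apply Rabs_pos|apply Rlt_le, wt_pos].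
Qed.

Lemma nm_scal (c : R) (f : W) : nm (Wc c * f) <= Rabs c * nm f.
Proof. rewrite <- Wscal_Wc. apply nm_m. intros; lra. Qed.

Lemma nm_opp (f : W) : nm (- f) = nm f.
Proof. apply SumZ_ext. intros k. now rewrite cf_opp, Rabs_Ropp. Qed.

Lemma nm_sub (f g : W) : nm (f - g) <= nm f + nm g.
Proof. rewrite <- (nm_opp g). apply nm_add. Qed.

Lemma nm_conj (f : W) : nm (conj f) = nm f.
Proof.
  unfold nm.
  destruct (SumZ_bij (fun k => Rabs (f k) * wt k) Z.opp Z.opp Z.opp_involutive Z.opp_involutive) as [_ E].
  - apply cf_sumw.
  - rewrite <- E. apply SumZ_ext. intros k. now rewrite cf_conj, wt_opp.
Qed.

Lemma nm_mul (f g : W) : nm (f * g) <= nm f * nm g.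
Proof.
  destruct (convo_test _ _ wt 1 wt_self (sumw_Rabs _ (cf_sumw f)) (sumw_Rabs _ (cf_sumw g))) as (_ & H & E).
  apply Rle_trans with (SumZ (fun n => convo (fun k => Rabs (f k)) (fun k => Rabs (g k)) n * wt n)).
  - apply SumZ_le; auto; [|apply cf_sumw].
    intros k. rewrite cf_mul. apply Rmult_le_compat_r; [apply Rlt_le, wt_pos|].
    apply Rabs_convo; apply cf_sumw.
  - rewrite E. unfold nm at 1. rewrite Rmult_comm, <- SumZ_scal.
    assert (Hk : forall k, SumZ (fun j => Rabs (g j) * wt (k + j)) <= wt k * nm g /\
                  0 <= SumZ (fun j => Rabs (g j) * wt (k + j))).
    { intros k. destruct (weight_shift (fun j => Rabs (g j)) wt 1 k wt_self) as [Ha Hb].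
      - apply sumw_Rabs, cf_sumw.
      - split.
        + apply Rle_trans with (SumZ (fun j => Rabs (Rabs (g j) * wt (k + j)))).
          * apply Rle_trans with (1 := Rle_abs _). now apply SumZ_Rabs.
          * apply Rle_trans with (1 := Hb). right. rewrite Rmult_1_l. f_equal.
            apply SumZ_ext. intros; now rewrite Rabs_Rabsolu.
        + apply SumZ_pos; auto. intros; apply Rmult_le_pos; [apply Rabs_pos|apply Rlt_le, wt_pos]. }
    apply Rle_trans with (Rabs (SumZ (fun k => Rabs (f k) * SumZ (fun j => Rabs (g j) * wt (k + j)))));
      [apply Rle_abs|].
    apply SumZ_bound; [|apply sumable_scal, cf_sumw].
    intros k. destruct (Hk k). rewrite Rabs_mult, Rabs_Rabsolu, (Rabs_pos_eq (SumZ _)) by auto.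
    replace (nm g * (Rabs (f k) * wt k)) with (Rabs (f k) * (wt k * nm g)) by ring.
    apply Rmult_le_compat_l; auto. apply Rabs_pos.
Qed.

(** ** Completeness *)

(** Completeness for geometrically converging sequences, the only ones that the iteration produces.
    Coefficientwise convergence is kept in the conclusion because it carries symmetry to the
    limit. *)
Lemma W_series (x : nat -> W) (c : R) :
  (forall n, nm (x (S n) - x n) <= c * (/ 2) ^ n) ->
  exists l : W, (forall n, nm (l - x n) <= 2 * c * (/ 2) ^ n) /\
    forall k, is_lim_seq (fun n => x n k) (l k).
Proof.
  intros Hx.
  assert (Hgeo : ex_series (fun n => (/ 2) ^ n) /\ Series (fun n => (/ 2) ^ n) = 2).
  { assert (Rabs (/ 2) < 1) by (rewrite Rabs_pos_eq; lra). split.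
    - now apply ex_series_geom.
    - rewrite Series_geom; auto. field. }
  assert (Hterm : forall k n, Rabs (x (S n) k - x n k) <= c * (/ 2) ^ n).
  { intros k n. rewrite <- cf_sub. apply Rle_trans with (1 := cf_abs_le _ k), Hx. }
  assert (Hser : forall k, ex_series (fun n => x (S n) k - x n k)).
  { intros k. apply ex_series_le_R with (1 := Hterm k). apply ex_series_scal_R, Hgeo. }
  assert (Htel : forall k n, sum_n (fun n => x (S n) k - x n k) n = x (S n) k - x 0%nat k).
  { intros k n. induction n; [now rewrite sum_O|]. rewrite sum_Sn, IHn. unfold plus; simpl. ring. }
  set (l0 := fun k => x 0%nat k + Series (fun n => x (S n) k - x n k)).
  assert (Hlim : forall k, is_lim_seq (fun n => x n k) (l0 k)).
  { intros k. apply is_lim_seq_incr_1.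
    apply is_lim_seq_ext with (fun n => x 0%nat k + sum_n (fun n => x (S n) k - x n k) n).
    - intros n. rewrite Htel. ring.
    - apply is_lim_seq_plus'; [apply is_lim_seq_const|].
      exact (Series_correct _ (Hser k)). }
  (* tail estimate, by Tonelli on [(m, k) |-> |x (n+m+1) k - x (n+m) k| wt k] *)
  assert (Htail : forall n, sumw (fun k => l0 k - x n k) /\
     SumZ (fun k => Rabs (l0 k - x n k) * wt k) <= 2 * c * (/ 2) ^ n).
  { intros n.
    set (a := fun m j => Rabs (x (S (n + m)) (zn j) - x (n + m)%nat (zn j)) * wt (zn j)).
    assert (Ha0 : forall m j, 0 <= a m j).
    { intros. apply Rmult_le_pos; [apply Rabs_pos|apply Rlt_le, wt_pos]. }
    assert (Ham : forall m, ex_series (a m) /\ Series (a m) <= c * (/ 2) ^ n * (/ 2) ^ m).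
    { intros m. split.
      - apply ex_series_ext with (fun j => Rabs ((x (S (n + m)) - x (n + m)%nat)%W (zn j)) * wt (zn j)).
        + intros j. unfold a. now rewrite cf_sub.
        + apply (sumable_ex _ (cf_sumw (x (S (n + m)) - x (n + m)%nat)%W)).
      - rewrite Rmult_assoc, <- pow_add. apply Rle_trans with (2 := Hx (n + m)%nat). right.
        apply Series_ext. intros j. unfold a. now rewrite cf_sub. }
    assert (Has : ex_series (fun m => Series (a m)) /\ Series (fun m => Series (a m)) <= 2 * c * (/ 2) ^ n).
    { assert (Hg : ex_series (fun m => c * (/ 2) ^ n * (/ 2) ^ m)) by (apply ex_series_scal_R, Hgeo).
      split.
      - apply ex_series_le_R with (2 := Hg). intros m. rewrite Rabs_pos_eq; [apply Ham|].
        apply Series_pos; auto. apply Ham.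
      - apply Rle_trans with (Series (fun m => c * (/ 2) ^ n * (/ 2) ^ m)).
        + apply Series_le; auto. intros m. split; [|apply Ham]. apply Series_pos; auto; apply Ham.
        + rewrite (Series_scal_l (c * (/ 2) ^ n) (fun m => (/ 2) ^ m)), (proj2 Hgeo). right; ring. }
    destruct (Tonelli_le a Ha0 (fun m => proj1 (Ham m)) (proj1 Has)) as (H1 & H2 & H3).
    assert (Hpt : forall j, Rabs (l0 (zn j) - x n (zn j)) * wt (zn j) <= Series (fun m => a m j)).
    { intros j. set (k := zn j).
      apply Rmult_le_reg_r with (/ wt k); [apply Rinv_0_lt_compat, wt_pos|].
      rewrite Rmult_assoc, Rinv_r, Rmult_1_r by (generalize (wt_pos k); lra).
      rewrite Rmult_comm, <- Series_scal_l.
      assert (E : forall m, / wt k * a m j = Rabs (x (S (n + m)) k - x (n + m)%nat k)).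
      { intros m. unfold a. fold k. field. generalize (wt_pos k); lra. }
      rewrite (Series_ext _ _ E).
      assert (Hl : is_series (fun m => x (S (n + m)) k - x (n + m)%nat k) (l0 k - x n k)).
      { change (is_lim_seq (sum_n (fun m => x (S (n + m)) k - x (n + m)%nat k)) (l0 k - x n k)).
        apply is_lim_seq_ext with (fun m => x (S m + n)%nat k - x n k).
        - intros m. induction m.
          + rewrite sum_O, Nat.add_0_r. reflexivity.
          + rewrite sum_Sn, <- IHm. unfold plus; simpl.
            replace (n + S m)%nat with (S (m + n)) by lia. ring.
        - apply is_lim_seq_minus'; [|apply is_lim_seq_const].
          apply (is_lim_seq_incr_1 (fun m => x (m + n)%nat k)).
          apply (is_lim_seq_incr_n (fun m => x m k)), Hlim. }
      rewrite <- (is_series_unique _ _ Hl). apply Series_Rabs.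
      apply ex_series_ext with (1 := E). apply ex_series_scal_R, H1. }
    split.
    - apply ex_series_le_R with (2 := H2). intros j. rewrite Rabs_Rabsolu, Rabs_pos_eq; auto.
      apply Rmult_le_pos; [apply Rabs_pos|apply Rlt_le, wt_pos].
    - apply Rle_trans with (2 := Rle_trans _ _ _ H3 (proj2 Has)).
      apply Series_le; auto. intros j. split; auto.
      apply Rmult_le_pos; [apply Rabs_pos|apply Rlt_le, wt_pos]. }
  assert (Hl0 : sumw l0).
  { apply sumw_ext with (fun k => (l0 k - x 0%nat k) + x 0%nat k); [intros; ring|].
    apply sumw_plus; [apply Htail|apply cf_sumw]. }
  exists (mkW l0 Hl0). split; [|exact Hlim].
  intros n. apply Rle_trans with (2 := proj2 (Htail n)). right.
  apply SumZ_ext. intros k. now rewrite cf_sub.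
Qed.

Lemma nm_eq (f : W) : nm f = SumZ (fun k => Rabs (f k) * wt k).
Proof. reflexivity. Qed.

Global Opaque Wadd Wm Wopp Wsub Wmul mon Wc conj nm toW.

(** * Strict differentiability with parameters, and the modified Newton method *)

(* [G -> 0] and [d -> +oo]. *)
Definition near (P : R -> R -> Prop) : Prop :=
  exists e K, 0 < e /\ forall G d, Rabs G < e -> K < d -> P G d.

Lemma near_and (P Q : R -> R -> Prop) : near P -> near Q -> near (fun G d => P G d /\ Q G d).
Proof.
  intros (e1 & K1 & H1 & HP) (e2 & K2 & H2 & HQ).
  exists (Rmin e1 e2), (Rmax K1 K2). split; [now apply Rmin_glb_lt|].
  intros G d HG Hd. split.
  - apply HP; [apply Rlt_le_trans with (1 := HG), Rmin_l|apply Rle_lt_trans with (2 := Hd), Rmax_l].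
  - apply HQ; [apply Rlt_le_trans with (1 := HG), Rmin_r|apply Rle_lt_trans with (2 := Hd), Rmax_r].
Qed.

Lemma near_imp (P Q : R -> R -> Prop) : (forall G d, P G d -> Q G d) -> near P -> near Q.
Proof. intros H (e & K & H1 & HP). exists e, K. auto. Qed.

Lemma near_true (P : R -> R -> Prop) : (forall G d, P G d) -> near P.
Proof. intros H. exists 1, 0. split; [lra|auto]. Qed.

Definition bounded_op (L : W -> W) : Prop := exists C, 0 <= C /\ forall h, nm (L h) <= C * nm h.

(** [F0] and [L] are the value and derivative of the limit problem, at a limit that no real [d]
    attains. For all nearby parameters [F G d - L] must have a small Lipschitz constant near [x0].
    This is what a contraction argument consumes, and it is stable under sums, products and the
    depth multiplier. *)
Definition sdiff (x0 : W) (F : R -> R -> W -> W) (F0 : W) (L : W -> W) : Prop :=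
  bounded_op L /\
  forall eps, 0 < eps -> exists delta, 0 < delta /\
    near (fun G d => nm (F G d x0 - F0) <= eps /\
      forall x y, nm (x - x0) <= delta -> nm (y - x0) <= delta ->
        nm (F G d x - F G d y - L (x - y)%W) <= eps * nm (x - y)).

Lemma sdiff_ext (x0 F0 F0' : W) (F F' : R -> R -> W -> W) (L L' : W -> W) :
  (forall G d x, F G d x = F' G d x) -> F0 = F0' -> (forall h, L h = L' h) ->
  sdiff x0 F F0 L -> sdiff x0 F' F0' L'.
Proof.
  intros HF <- HL [[C [HC Hb]] H]. split.
  - exists C. split; auto. intros h. rewrite <- HL. auto.
  - intros eps He. destruct (H eps He) as (delta & Hd & Hn). exists delta. split; auto.
    apply near_imp with (2 := Hn). intros G d [H1 H2]. rewrite <- HF. split; auto.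
    intros x y Hx Hy. rewrite <- !HF, <- HL. auto.
Qed.

Lemma sdiff_const (x0 c : W) : sdiff x0 (fun _ _ _ => c) c (fun _ => 0%W).
Proof.
  split.
  - exists 0. split; [lra|]. intros. rewrite nm_0. lra.
  - intros eps He. exists 1. split; [lra|]. apply near_true. intros _ _. split.
    + replace (c - c)%W with 0%W by ring. rewrite nm_0. lra.
    + intros. replace (c - c - 0)%W with 0%W by ring. rewrite nm_0.
      apply Rmult_le_pos; [lra|apply nm_pos].
Qed.

Lemma sdiff_G (x0 : W) : sdiff x0 (fun G _ _ => Wc G) 0 (fun _ => 0%W).
Proof.
  split.
  - exists 0. split; [lra|]. intros. rewrite nm_0. lra.
  - intros eps He. exists 1. split; [lra|].
    assert (H1 := nm_pos 1). 
    exists (eps / (1 + nm 1)), 0. split; [apply Rdiv_lt_0_compat; lra|].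
    intros G _ HG _. split.
    + replace (Wc G - 0)%W with (Wc G * 1)%W by ring.
      apply Rle_trans with (1 := nm_scal _ _).
      apply Rmult_lt_compat_r with (r := 1 + nm 1) in HG; [|lra].
      unfold Rdiv in HG. rewrite Rmult_assoc, Rinv_l, Rmult_1_r in HG by lra.
      generalize (Rabs_pos G); nra.
    + intros. replace (Wc G - Wc G - 0)%W with 0%W by ring. rewrite nm_0.
      apply Rmult_le_pos; [lra|apply nm_pos].
Qed.

Lemma sdiff_id (x0 : W) : sdiff x0 (fun _ _ x => x) x0 (fun h => h).
Proof.
  split.
  - exists 1. split; [lra|]. intros; lra.
  - intros eps He. exists 1. split; [lra|]. apply near_true. intros _ _. split.
    + replace (x0 - x0)%W with 0%W by ring. rewrite nm_0. lra.
    + intros. replace (x - y - (x - y))%W with 0%W by ring. rewrite nm_0.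
      apply Rmult_le_pos; [lra|apply nm_pos].
Qed.

Lemma sdiff_add (x0 F0 K0 : W) (F K : R -> R -> W -> W) (L M : W -> W) :
  sdiff x0 F F0 L -> sdiff x0 K K0 M ->
  sdiff x0 (fun G d x => F G d x + K G d x)%W (F0 + K0)%W (fun h => L h + M h)%W.
Proof.
  intros [(C1 & HC1 & Hb1) H1] [(C2 & HC2 & Hb2) H2]. split.
  - exists (C1 + C2). split; [lra|]. intros h. apply Rle_trans with (1 := nm_add _ _).
    generalize (Hb1 h) (Hb2 h). lra.
  - intros eps He.
    destruct (H1 (eps / 2)) as (d1 & Hd1 & Hn1); [lra|].
    destruct (H2 (eps / 2)) as (d2 & Hd2 & Hn2); [lra|].
    exists (Rmin d1 d2). split; [now apply Rmin_glb_lt|].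
    apply near_imp with (2 := near_and _ _ Hn1 Hn2). intros G d [[A1 A2] [B1 B2]]. split.
    + replace (F G d x0 + K G d x0 - (F0 + K0))%W
        with ((F G d x0 - F0) + (K G d x0 - K0))%W by ring.
      apply Rle_trans with (1 := nm_add _ _). lra.
    + intros x y Hx Hy.
      assert (M1 := Rmin_l d1 d2). assert (M2 := Rmin_r d1 d2).
      specialize (A2 x y ltac:(lra) ltac:(lra)). specialize (B2 x y ltac:(lra) ltac:(lra)).
      replace (F G d x + K G d x - (F G d y + K G d y) - (L (x - y)%W + M (x - y)%W))%W
        with ((F G d x - F G d y - L (x - y)%W) + (K G d x - K G d y - M (x - y)%W))%W by ring.
      apply Rle_trans with (1 := nm_add _ _). lra.
Qed.

Lemma sdiff_lip (x0 F0 : W) (F : R -> R -> W -> W) (L : W -> W) :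
  sdiff x0 F F0 L -> forall eps, 0 < eps -> exists delta, 0 < delta /\
    near (fun G d => forall x, nm (x - x0) <= delta -> nm (F G d x - F0) <= eps).
Proof.
  intros [(C & HC & Hb) H] eps He.
  set (e1 := Rmin 1 (eps / 2)).
  assert (He1 : 0 < e1) by (apply Rmin_glb_lt; lra).
  assert (He1' : e1 <= 1 /\ e1 <= eps / 2) by (split; [apply Rmin_l|apply Rmin_r]).
  destruct (H e1 He1) as (d1 & Hd1 & Hn).
  exists (Rmin d1 (eps / 2 / (C + 1))). 
  assert (Hq : 0 < eps / 2 / (C + 1)) by (apply Rdiv_lt_0_compat; lra).
  split; [now apply Rmin_glb_lt|].
  apply near_imp with (2 := Hn). intros G d [A1 A2] x Hx.
  assert (M1 := Rmin_l d1 (eps / 2 / (C + 1))). assert (M2 := Rmin_r d1 (eps / 2 / (C + 1))).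
  assert (Hx0 : nm (x0 - x0) <= d1).
  { replace (x0 - x0)%W with 0%W by ring. rewrite nm_0. lra. }
  specialize (A2 x x0 ltac:(lra) Hx0).
  replace (F G d x - F0)%W with ((F G d x - F G d x0 - L (x - x0)%W) + (L (x - x0)%W + (F G d x0 - F0)))%W by ring.
  apply Rle_trans with (1 := nm_add _ _).
  assert (Hs := nm_add (L (x - x0)%W) (F G d x0 - F0)%W). specialize (Hb (x - x0)%W).
  assert (nm (x - x0) * (C + 1) <= eps / 2).
  { apply Rmult_le_reg_r with (/ (C + 1)); [apply Rinv_0_lt_compat; lra|].
    rewrite Rmult_assoc, Rinv_r, Rmult_1_r by lra. unfold Rdiv in *; lra. }
  generalize (nm_pos (x - x0)). nra.
Qed.

Lemma sdiff_mul (x0 F0 K0 : W) (F K : R -> R -> W -> W) (L M : W -> W) :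
  sdiff x0 F F0 L -> sdiff x0 K K0 M ->
  sdiff x0 (fun G d x => F G d x * K G d x)%W (F0 * K0)%W (fun h => L h * K0 + F0 * M h)%W.
Proof.
  intros HF HK. assert (LF := sdiff_lip _ _ _ _ HF). assert (LK := sdiff_lip _ _ _ _ HK).
  destruct HF as [(C1 & HC1 & Hb1) H1], HK as [(C2 & HC2 & Hb2) H2].
  assert (P1 := nm_pos F0). assert (P2 := nm_pos K0).
  split.
  - exists (C1 * nm K0 + nm F0 * C2). split; [nra|]. intros h.
    apply Rle_trans with (1 := nm_add _ _).
    assert (A := nm_mul (L h) K0). assert (B := nm_mul F0 (M h)).
    specialize (Hb1 h). specialize (Hb2 h). assert (Hh := nm_pos h).
    assert (nm (L h) * nm K0 <= C1 * nm h * nm K0) by now apply Rmult_le_compat_r.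
    assert (nm F0 * nm (M h) <= nm F0 * (C2 * nm h)) by now apply Rmult_le_compat_l.
    nra.
  - intros eps He.
    (* S adds up the coefficients of the six remainder terms below; [e1 <= 1] makes the quadratic
       ones linear in [e1]. *)
    set (S := nm F0 + nm K0 + C1 + C2 + 2).
    set (e1 := Rmin 1 (eps / (2 * S))).
    assert (HS : 2 <= S) by (unfold S; lra).
    assert (He0 : 0 < eps / (2 * S)) by (apply Rdiv_lt_0_compat; lra).
    assert (He1 : 0 < e1) by (apply Rmin_glb_lt; lra).
    assert (He1' : e1 <= 1 /\ e1 * (2 * S) <= eps).
    { split; [apply Rmin_l|]. apply Rle_trans with (eps / (2 * S) * (2 * S)).
      - apply Rmult_le_compat_r; [lra|apply Rmin_r].
      - right; field; lra. }
    destruct (H1 e1 He1) as (d1 & Hd1 & Hn1). destruct (H2 e1 He1) as (d2 & Hd2 & Hn2).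
    destruct (LF e1 He1) as (d3 & Hd3 & Hn3). destruct (LK e1 He1) as (d4 & Hd4 & Hn4).
    exists (Rmin (Rmin d1 d2) (Rmin d3 d4)). split; [repeat apply Rmin_glb_lt; auto|].
    apply near_imp with (2 := near_and _ _ (near_and _ _ Hn1 Hn2) (near_and _ _ Hn3 Hn4)).
    intros G d [[[A1 A2] [B1 B2]] [A3 B3]].
    assert (M1 := Rmin_l (Rmin d1 d2) (Rmin d3 d4)). assert (M2 := Rmin_r (Rmin d1 d2) (Rmin d3 d4)).
    assert (M3 := Rmin_l d1 d2). assert (M4 := Rmin_r d1 d2).
    assert (M5 := Rmin_l d3 d4). assert (M6 := Rmin_r d3 d4).
    assert (Hx0 : nm (x0 - x0) = 0).
    { replace (x0 - x0)%W with 0%W by ring. apply nm_0. }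
    split.
    + specialize (A3 x0 ltac:(lra)). specialize (B3 x0 ltac:(lra)).
      replace (F G d x0 * K G d x0 - F0 * K0)%W
       with ((F G d x0 - F0) * (K G d x0 - K0) + ((F G d x0 - F0) * K0 + F0 * (K G d x0 - K0)))%W by ring.
      apply Rle_trans with (1 := nm_add _ _).
      assert (T1 := nm_mul (F G d x0 - F0) (K G d x0 - K0)).
      assert (T2 := nm_add ((F G d x0 - F0) * K0) (F0 * (K G d x0 - K0))).
      assert (T3 := nm_mul (F G d x0 - F0) K0).
      assert (T4 := nm_mul F0 (K G d x0 - K0)).
      assert (N1 := nm_pos (F G d x0 - F0)). assert (N2 := nm_pos (K G d x0 - K0)).
      assert (nm (F G d x0 - F0) * nm (K G d x0 - K0) <= e1 * 1) by (apply Rmult_le_compat; lra).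
      assert (nm (F G d x0 - F0) * nm K0 <= e1 * nm K0) by (apply Rmult_le_compat_r; lra).
      assert (nm F0 * nm (K G d x0 - K0) <= nm F0 * e1) by (apply Rmult_le_compat_l; lra).
      assert (e1 * (nm F0 + nm K0 + 1) <= e1 * (2 * S)) by (apply Rmult_le_compat_l; unfold S; lra).
      lra.
    + intros x y Hx Hy.
      specialize (A2 x y ltac:(lra) ltac:(lra)). specialize (B2 x y ltac:(lra) ltac:(lra)).
      assert (B3x := B3 x ltac:(lra)). assert (A3y := A3 y ltac:(lra)).
      set (h := (x - y)%W) in *.
      set (r1 := (F G d x - F G d y - L h)%W) in *. set (r2 := (K G d x - K G d y - M h)%W) in *.
      set (u := (K G d x - K0)%W) in *. set (v := (F G d y - F0)%W) in *.
      replace (F G d x * K G d x - F G d y * K G d y - (L h * K0 + F0 * M h))%W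
        with ((r1 * K0 + r1 * u) + (L h * u + (F0 * r2 + (v * r2 + v * M h))))%W
        by (unfold r1, r2, u, v; ring).
      assert (Hh := nm_pos h). specialize (Hb1 h). specialize (Hb2 h).
      assert (Q1 := nm_pos r1). assert (Q2 := nm_pos r2). assert (Q3 := nm_pos u). assert (Q4 := nm_pos v).
      assert (Q5 := nm_pos (L h)). assert (Q6 := nm_pos (M h)).
      assert (E1 := Rle_trans _ _ _ (nm_mul r1 K0) (Rmult_le_compat_r _ _ _ P2 A2)).
      assert (E2 : nm (r1 * u) <= e1 * nm h * 1).
      { apply Rle_trans with (1 := nm_mul _ _). apply Rmult_le_compat; lra. }
      assert (E3 : nm (L h * u) <= C1 * nm h * e1).
      { apply Rle_trans with (1 := nm_mul _ _). apply Rmult_le_compat; lra. }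
      assert (E4 := Rle_trans _ _ _ (nm_mul F0 r2) (Rmult_le_compat_l _ _ _ P1 B2)).
      assert (E5 : nm (v * r2) <= 1 * (e1 * nm h)).
      { apply Rle_trans with (1 := nm_mul _ _). apply Rmult_le_compat; lra. }
      assert (E6 : nm (v * M h) <= e1 * (C2 * nm h)).
      { apply Rle_trans with (1 := nm_mul _ _). apply Rmult_le_compat; lra. }
      assert (S1 := nm_add (r1 * K0 + r1 * u) (L h * u + (F0 * r2 + (v * r2 + v * M h)))).
      assert (S2 := nm_add (r1 * K0) (r1 * u)).
      assert (S3 := nm_add (L h * u) (F0 * r2 + (v * r2 + v * M h))).
      assert (S4 := nm_add (F0 * r2) (v * r2 + v * M h)).
      assert (S5 := nm_add (v * r2) (v * M h)).
      apply Rle_trans with (e1 * (2 * S) * nm h); [|apply Rmult_le_compat_r; lra].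
      apply Rle_trans with (e1 * (nm F0 + nm K0 + C1 + C2 + 2) * nm h); [lra|].
      apply Rmult_le_compat_r; auto. apply Rmult_le_compat_l; unfold S; lra.
Qed.

(** Convergence of [T d] to [T0] in operator norm is the hypothesis that matters; the bound on [T d]
    for large [d] follows from it. *)
Lemma sdiff_op (x0 F0 : W) (F : R -> R -> W -> W) (L : W -> W) (T : R -> W -> W) (T0 : W -> W) :
  (forall d f g, T d (f - g)%W = (T d f - T d g)%W) -> bounded_op T0 ->
  (forall eps, 0 < eps -> near (fun _ d => forall f, nm (T d f - T0 f) <= eps * nm f)) ->
  sdiff x0 F F0 L -> sdiff x0 (fun G d x => T d (F G d x)) (T0 F0) (fun h => T0 (L h)).
Proof.
  intros Tsub (C0 & HC0 & Hb0) HT [(C & HC & Hb) H]. split.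
  - exists (C0 * C). split; [nra|]. intros h. apply Rle_trans with (1 := Hb0 _).
    rewrite Rmult_assoc. now apply Rmult_le_compat_l.
  - intros eps He.
    set (S := nm F0 + C + C0 + 2). assert (P1 := nm_pos F0).
    set (e1 := Rmin 1 (eps / S)).
    assert (HS : 2 <= S) by (unfold S; lra).
    assert (He0 : 0 < eps / S) by (apply Rdiv_lt_0_compat; lra).
    assert (He1 : 0 < e1) by (apply Rmin_glb_lt; lra).
    assert (He1' : e1 <= 1 /\ e1 * S <= eps).
    { split; [apply Rmin_l|]. apply Rle_trans with (eps / S * S).
      - apply Rmult_le_compat_r; [lra|apply Rmin_r].
      - right; field; lra. }
    destruct (H e1 He1) as (d1 & Hd1 & Hn). exists d1. split; auto.
    apply near_imp with (2 := near_and _ _ Hn (HT e1 He1)).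
    intros G d [[A1 A2] B].
    assert (Hbd : forall f, nm (T d f) <= (C0 + e1) * nm f).
    { intros f. replace (T d f) with (T0 f + (T d f - T0 f))%W by ring.
      apply Rle_trans with (1 := nm_add _ _). specialize (B f). specialize (Hb0 f). lra. }
    split.
    + replace (T d (F G d x0) - T0 F0)%W with (T d (F G d x0 - F0)%W + (T d F0 - T0 F0))%W
        by (rewrite Tsub; ring).
      apply Rle_trans with (1 := nm_add _ _).
      assert (E1 := Hbd (F G d x0 - F0)%W). assert (E2 := B F0).
      assert (nm (F G d x0 - F0) * (C0 + e1) <= e1 * (C0 + 1)).
      { apply Rmult_le_compat; try lra. apply nm_pos. }
      apply Rle_trans with (2 := proj2 He1'). unfold S. nra.
    + intros x y Hx Hy. specialize (A2 x y Hx Hy). set (h := (x - y)%W) in *.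
      replace (T d (F G d x) - T d (F G d y) - T0 (L h))%W
        with (T d (F G d x - F G d y - L h)%W + (T d (L h) - T0 (L h)))%W by (rewrite !Tsub; ring).
      apply Rle_trans with (1 := nm_add _ _).
      assert (E1 := Hbd (F G d x - F G d y - L h)%W). assert (E2 := B (L h)). specialize (Hb h).
      assert (Hh := nm_pos h). assert (Q := nm_pos (F G d x - F G d y - L h)).
      assert ((C0 + e1) * nm (F G d x - F G d y - L h) <= (C0 + 1) * (e1 * nm h)).
      { apply Rmult_le_compat; lra. }
      assert (e1 * nm (L h) <= e1 * (C * nm h)) by (apply Rmult_le_compat_l; lra).
      apply Rle_trans with (e1 * S * nm h); [|apply Rmult_le_compat_r; lra].
      unfold S. assert (0 <= e1 * nm h) by nra. nra.
Qed.

Definition sym (f : W) : Prop := forall k, f (- k)%Z = f k.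

Lemma sym_sub (f g : W) : sym f -> sym g -> sym (f - g)%W.
Proof. intros Hf Hg k. now rewrite !cf_sub, Hf, Hg. Qed.
Lemma sym_conj (f : W) : sym f <-> conj f = f.
Proof.
  split.
  - intros H. apply W_ext. intros k. now rewrite cf_conj, H.
  - intros H k. now rewrite <- cf_conj, H.
Qed.

(* Modified Newton iteration [x - h] with [L h = F x]: a right inverse of the derivative at the
   base point suffices. *)
Theorem newton (x0 : W) (F : R -> R -> W -> W) (L : W -> W) (C : R) :
  sdiff x0 F 0 L -> sym x0 -> (forall G d x, sym x -> sym (F G d x)) ->
  (forall g, sym g -> exists h, sym h /\ L h = g /\ nm h <= C * nm g) ->
  forall eta, 0 < eta -> near (fun G d => exists x, sym x /\ nm (x - x0) <= eta /\ F G d x = 0%W).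
Proof.
  intros HF Hx0 HFs HL eta Heta.
  set (C1 := Rmax C 1).
  assert (HC1 : 1 <= C1) by apply Rmax_r.
  assert (HL1 : forall g, sym g -> exists h, sym h /\ L h = g /\ nm h <= C1 * nm g).
  { intros g Hg. destruct (HL g Hg) as (h & H1 & H2 & H3). exists h. repeat split; auto.
    apply Rle_trans with (1 := H3). apply Rmult_le_compat_r; [apply nm_pos|apply Rmax_l]. }
  destruct HF as [(CL & HCL & Hb) HF].
  assert (He1 : 0 < / (2 * C1)) by (apply Rinv_0_lt_compat; lra).
  destruct (HF _ He1) as (d1 & Hd1 & Hn1).
  set (r := Rmin d1 eta). assert (Hr : 0 < r) by now apply Rmin_glb_lt.
  assert (Hr1 : r <= d1) by apply Rmin_l. assert (Hr2 : r <= eta) by apply Rmin_r.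
  assert (He2 : 0 < r / (2 * C1)) by (apply Rdiv_lt_0_compat; lra).
  destruct (HF _ He2) as (d2 & Hd2 & Hn2).
  apply near_imp with (2 := near_and _ _ Hn1 Hn2).
  intros G d [[_ HA] [H0 _]].
  set (Fx := F G d) in *.
  set (f0 := nm (Fx x0)).
  assert (Hf0 : 2 * C1 * f0 <= r).
  { replace (Fx x0 - 0)%W with (Fx x0) in H0 by ring. fold f0 in H0.
    apply Rmult_le_compat_l with (r := 2 * C1) in H0; [|lra].
    apply Rle_trans with (1 := H0). right; field; lra. }
  (* The value 0 at non-symmetric points only makes the choice function total; the iterates never
     leave the symmetric subspace. *)
  assert (Hstep : forall x, exists h, sym x -> sym h /\ L h = Fx x /\ nm h <= C1 * nm (Fx x)).
  { intros x. destruct (classic (sym x)) as [Hx|Hx]; [|exists 0%W; tauto].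
    destruct (HL1 (Fx x) (HFs G d x Hx)) as (h & Hh). exists h; auto. }
  set (st := fun x => proj1_sig (constructive_indefinite_description _ (Hstep x))).
  assert (Hst : forall x, sym x -> sym (st x) /\ L (st x) = Fx x /\ nm (st x) <= C1 * nm (Fx x)).
  { intros x. unfold st. now destruct (constructive_indefinite_description _ (Hstep x)). }
  set (xs := fix xs n := match n with O => x0 | S n => (xs n - st (xs n))%W end).
  assert (Hinv : forall n, sym (xs n) /\ nm (xs n - x0) <= C1 * f0 * (2 - 2 * (/ 2) ^ n) /\
                   nm (Fx (xs n)) <= f0 * (/ 2) ^ n).
  { induction n as [|n (I1 & I2 & I3)]; simpl xs.
    - split; [auto|]. split.
      + replace (x0 - x0)%W with 0%W by ring. rewrite nm_0. simpl. lra.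
      + simpl. unfold f0. lra.
    - destruct (Hst _ I1) as (S1 & S2 & S3).
      set (x := xs n) in *. set (h := st x) in *.
      assert (Hp : 0 < (/ 2) ^ n) by (apply pow_lt; lra).
      assert (Hf0' : 0 <= f0) by apply nm_pos.
      assert (Hnh : nm h <= C1 * f0 * (/ 2) ^ n).
      { apply Rle_trans with (1 := S3). rewrite Rmult_assoc. apply Rmult_le_compat_l; lra. }
      assert (HC1f : 0 <= C1 * f0) by nra.
      assert (I2' : nm (x - h - x0) <= C1 * f0 * (2 - 2 * (/ 2) ^ S n)).
      { replace (x - h - x0)%W with ((x - x0) - h)%W by ring.
        apply Rle_trans with (1 := nm_sub _ _). simpl pow. lra. }
      split; [|split]; auto.
      + now apply sym_sub.
      + assert (Hp' : 0 < (/ 2) ^ S n) by (apply pow_lt; lra).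
        assert (D1 : nm (x - h - x0) <= d1) by nra.
        assert (D2 : nm (x - x0) <= d1) by nra.
        specialize (HA x (x - h)%W D2 D1).
        (* Since [L h = Fx x], the linear term cancels and the new residual is the remainder of
           strict differentiability. Its factor [/ (2 * C1)], against the bound [C1] on the step,
           halves the residual. *)
        replace (x - (x - h))%W with h in HA by ring. rewrite S2 in HA.
        replace (Fx x - Fx (x - h)%W - Fx x)%W with (- Fx (x - h)%W)%W in HA by ring.
        rewrite nm_opp in HA. apply Rle_trans with (1 := HA).
        apply Rle_trans with (/ (2 * C1) * (C1 * f0 * (/ 2) ^ n)).
        * apply Rmult_le_compat_l; lra.
        * right. simpl. field. lra. }
  assert (Hf0' : 0 <= f0) by apply nm_pos.
  destruct (W_series xs (C1 * f0)) as (l & Hl1 & Hl2).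
  { intros n. destruct (Hinv n) as (I1 & I2 & I3). destruct (Hst _ I1) as (S1 & S2 & S3).
    simpl xs. replace (xs n - st (xs n) - xs n)%W with (- st (xs n))%W by ring. rewrite nm_opp.
    apply Rle_trans with (1 := S3). rewrite Rmult_assoc. apply Rmult_le_compat_l; lra. }
  assert (Hlx : nm (l - x0) <= r).
  { specialize (Hl1 0%nat). simpl in Hl1. lra. }
  exists l. split; [|split].
  - intros k. assert (E1 := is_lim_seq_unique _ _ (Hl2 k)). assert (E2 := is_lim_seq_unique _ _ (Hl2 (- k)%Z)).
    rewrite (Lim_seq_ext _ (fun n => xs n k)) in E2 by (intros n; apply (proj1 (Hinv n))).
    rewrite E1 in E2. now injection E2.
  - lra.
  - apply nm_eq0.
    assert (Hb1 : forall n, nm (Fx l) <= (f0 + (CL + / (2 * C1)) * (2 * (C1 * f0))) * (/ 2) ^ n).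
    { intros n. destruct (Hinv n) as (I1 & I2 & I3). specialize (Hl1 n).
      assert (Hp : 0 < (/ 2) ^ n) by (apply pow_lt; lra).
      assert (0 <= C1 * f0 * (/ 2) ^ n) by (apply Rmult_le_pos; [apply Rmult_le_pos|]; lra).
      assert (D : nm (xs n - x0) <= d1) by lra.
      specialize (HA l (xs n) ltac:(lra) D).
      replace (Fx l) with ((Fx l - Fx (xs n) - L (l - xs n)%W) + (L (l - xs n)%W + Fx (xs n)))%W by ring.
      apply Rle_trans with (1 := nm_add _ _).
      assert (E := nm_add (L (l - xs n)%W) (Fx (xs n))). specialize (Hb (l - xs n)%W).
      assert ((CL + / (2 * C1)) * nm (l - xs n) <= (CL + / (2 * C1)) * (2 * (C1 * f0) * (/ 2) ^ n)).
      { apply Rmult_le_compat_l; [|lra]. lra. }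
      lra. }
    assert (Hlim : is_lim_seq (fun n => (f0 + (CL + / (2 * C1)) * (2 * (C1 * f0))) * (/ 2) ^ n)
      (Rbar_mult (f0 + (CL + / (2 * C1)) * (2 * (C1 * f0))) 0)).
    { apply is_lim_seq_scal_l, is_lim_seq_geom. rewrite Rabs_pos_eq; lra. }
    simpl in Hlim. rewrite Rmult_0_r in Hlim.
    apply (is_lim_seq_le (fun _ => nm (Fx l)) _ (nm (Fx l)) 0 Hb1); auto. apply is_lim_seq_const.
Qed.

(** * Hardy projections, division at a point, and the Euler derivation *)

(** [msg] is the limit of coth (k d) as the depth grows, [mJ] inverts the Euler derivation off the
    mean, and the other three are the projections onto the mean, the nonnegative and the positive
    frequencies. *)
Definition msg (k : Z) : R := IZR (Z.sgn k).
Definition mJ (k : Z) : R := if Z.eq_dec k 0 then 0 else / IZR k.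
Definition m0 (k : Z) : R := if Z.eq_dec k 0 then 1 else 0.
Definition mh (k : Z) : R := if Z_le_dec 0 k then 1 else 0.
Definition mp (k : Z) : R := if Z_lt_dec 0 k then 1 else 0.

Lemma IZR_ge1 (k : Z) : k <> 0%Z -> 1 <= Rabs (IZR k).
Proof. intros Hk. rewrite <- abs_IZR. apply IZR_le. lia. Qed.

Lemma msg_le k : Rabs (msg k) <= 1.
Proof. unfold msg. rewrite <- abs_IZR. apply IZR_le. lia. Qed.
Lemma mJ_le k : Rabs (mJ k) <= 1.
Proof.
  unfold mJ. destruct (Z.eq_dec k 0); [rewrite Rabs_R0; lra|].
  rewrite Rabs_inv, <- Rinv_1. apply Rinv_le_contravar; [lra|now apply IZR_ge1].
Qed.
Lemma m0_le k : Rabs (m0 k) <= 1.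
Proof. unfold m0. destruct (Z.eq_dec k 0); [rewrite Rabs_R1|rewrite Rabs_R0]; lra. Qed.
Lemma mh_le k : Rabs (mh k) <= 1.
Proof. unfold mh. destruct (Z_le_dec 0 k); [rewrite Rabs_R1|rewrite Rabs_R0]; lra. Qed.
Lemma mp_le k : Rabs (mp k) <= 1.
Proof. unfold mp. destruct (Z_lt_dec 0 k); [rewrite Rabs_R1|rewrite Rabs_R0]; lra. Qed.

Definition Hs (f : W) : W := Wm msg f.
Definition J (f : W) : W := Wm mJ f.
Definition Pz (f : W) : W := Wm m0 f.
Definition Ph (f : W) : W := Wm mh f.
Definition Pp (f : W) : W := Wm mp f.

Lemma cf_Hs f k : Hs f k = msg k * f k.
Proof. apply cf_m with 1, msg_le. Qed.
Lemma cf_J f k : J f k = mJ k * f k.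
Proof. apply cf_m with 1, mJ_le. Qed.
Lemma cf_Pz f k : Pz f k = m0 k * f k.
Proof. apply cf_m with 1, m0_le. Qed.
Lemma cf_Ph f k : Ph f k = mh k * f k.
Proof. apply cf_m with 1, mh_le. Qed.
Lemma cf_Pp f k : Pp f k = mp k * f k.
Proof. apply cf_m with 1, mp_le. Qed.

Lemma Pz_Wc (f : W) : Pz f = Wc (f 0%Z).
Proof.
  apply W_ext. intros k. rewrite cf_Pz, cf_Wc. unfold m0.
  destruct (Z.eq_dec k 0); subst; ring.
Qed.

(* Indices are powers of zeta = e^(- i alpha): [Hol] series extend to the unit disc (the lower
   half-plane), [AH] series to its exterior. *)
Definition Hol (f : W) : Prop := forall k, (k < 0)%Z -> f k = 0.
Definition AH (f : W) : Prop := forall k, (0 < k)%Z -> f k = 0.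

Lemma Hol_conj f : AH f -> Hol (conj f).
Proof. intros H k Hk. rewrite cf_conj. apply H. lia. Qed.
Lemma AH_conj f : Hol f -> AH (conj f).
Proof. intros H k Hk. rewrite cf_conj. apply H. lia. Qed.

Lemma Hol_add f g : Hol f -> Hol g -> Hol (f + g)%W.
Proof. intros Hf Hg k Hk. rewrite cf_add, Hf, Hg by auto. ring. Qed.
Lemma Hol_sub f g : Hol f -> Hol g -> Hol (f - g)%W.
Proof. intros Hf Hg k Hk. rewrite cf_sub, Hf, Hg by auto. ring. Qed.
Lemma Hol_opp f : Hol f -> Hol (- f)%W.
Proof. intros Hf k Hk. rewrite cf_opp, Hf by auto. ring. Qed.
Lemma Hol_mon n : (0 <= n)%Z -> Hol (mon n).
Proof. intros Hn k Hk. rewrite cf_mon. destruct (Z.eq_dec k n); [lia|auto]. Qed.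
Lemma Hol_Wc c : Hol (Wc c).
Proof. intros k Hk. rewrite cf_Wc. destruct (Z.eq_dec k 0); [lia|auto]. Qed.
Lemma Hol_1 : Hol 1%W.
Proof. apply Hol_mon. lia. Qed.
Lemma Hol_0 : Hol 0%W.
Proof. intros k Hk. apply cf_W0. Qed.
Lemma Hol_mul f g : Hol f -> Hol g -> Hol (f * g)%W.
Proof.
  intros Hf Hg k Hk. rewrite cf_mul. unfold convo.
  destruct (SumZ_single (fun j => f j * g (k - j)%Z) k) as [_ ->].
  - intros j _. destruct (Z_lt_dec j 0); [rewrite Hf by auto; ring|].
    rewrite (Hg (k - j)%Z) by lia. ring.
  - rewrite Hf by auto. ring.
Qed.
Lemma cf0_Hol_mul (f g : W) : Hol f -> Hol g -> (f * g)%W 0%Z = f 0%Z * g 0%Z.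
Proof.
  intros Hf Hg. rewrite cf_mul. unfold convo.
  destruct (SumZ_single (fun j => f j * g (0 - j)%Z) 0) as [_ E]; [|exact E].
  intros j Hj. destruct (Z_lt_dec j 0); [rewrite Hf by auto; ring|].
  rewrite (Hg (0 - j)%Z) by lia. ring.
Qed.
Lemma Hol_m m c f : (forall k, Rabs (m k) <= c) -> Hol f -> Hol (Wm m f).
Proof. intros Hm Hf k Hk. rewrite (cf_m m c), Hf by auto. ring. Qed.

Lemma AH_iff f : AH f <-> Hol (conj f).
Proof.
  split; [apply Hol_conj|]. intros H. rewrite <- (conj_conj f). now apply AH_conj.
Qed.
Lemma AH_add f g : AH f -> AH g -> AH (f + g)%W.
Proof. intros Hf Hg k Hk. rewrite cf_add, Hf, Hg by auto. ring. Qed.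
Lemma AH_sub f g : AH f -> AH g -> AH (f - g)%W.
Proof. intros Hf Hg k Hk. rewrite cf_sub, Hf, Hg by auto. ring. Qed.
Lemma AH_mul f g : AH f -> AH g -> AH (f * g)%W.
Proof. rewrite !AH_iff, conj_mul. apply Hol_mul. Qed.
Lemma AH_Wc c : AH (Wc c).
Proof. rewrite AH_iff, conj_Wc. apply Hol_Wc. Qed.
Lemma AH_1 : AH 1%W.
Proof. rewrite <- Wc_1. apply AH_Wc. Qed.
Lemma AH_mon n : (n <= 0)%Z -> AH (mon n).
Proof. intros Hn k Hk. rewrite cf_mon. destruct (Z.eq_dec k n); [lia|auto]. Qed.

(** The Liouville step: a function real on the circle and holomorphic in the disc is constant. In
    both later uses the constant is absorbed by the free mean of the unknown. *)
Lemma Hol_sym_const (f : W) : Hol f -> sym f -> f = Wc (f 0%Z).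
Proof.
  intros H Hs. apply W_ext. intros k. rewrite cf_Wc.
  destruct (Z.eq_dec k 0); [now subst|].
  destruct (Z_lt_dec k 0); [now apply H|]. rewrite <- Hs. apply H. lia.
Qed.

Lemma Hs_Hol (f : W) : Hol f -> f 0%Z = 0 -> Hs f = f.
Proof.
  intros H H0. apply W_ext. intros k. rewrite cf_Hs. unfold msg.
  destruct (Z.lt_trichotomy k 0) as [E|[E|E]].
  - rewrite H by auto. ring.
  - subst. rewrite H0. ring.
  - rewrite Z.sgn_pos by auto. ring.
Qed.
Lemma Hs_conj f : Hs (conj f) = (- conj (Hs f))%W.
Proof.
  apply W_ext. intros k. rewrite cf_opp, cf_Hs, !cf_conj, cf_Hs. unfold msg.
  rewrite Z.sgn_opp, opp_IZR. ring.
Qed.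
Lemma Hs_add f g : Hs (f + g) = (Hs f + Hs g)%W.
Proof. apply W_ext. intros k. rewrite cf_add, !cf_Hs, cf_add. ring. Qed.
Lemma Hs_sub f g : Hs (f - g) = (Hs f - Hs g)%W.
Proof. apply W_ext. intros k. rewrite cf_sub, !cf_Hs, cf_sub. ring. Qed.
Lemma Hs_Wc c : Hs (Wc c) = 0%W.
Proof.
  apply W_ext. intros k. rewrite cf_Hs, cf_Wc, cf_W0. unfold msg.
  destruct (Z.eq_dec k 0); subst; simpl; ring.
Qed.
(** Modulo [Hol], the transform [Hs f] can be traded for [- f], which removes it from the
    equations. *)
Lemma Hol_Hs_plus f : Hol (Hs f + f)%W.
Proof. intros k Hk. rewrite cf_add, cf_Hs. unfold msg. rewrite Z.sgn_neg by auto. ring. Qed.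
Lemma J_sub f g : J (f - g) = (J f - J g)%W.
Proof. apply W_ext. intros k. rewrite cf_sub, !cf_J, cf_sub. ring. Qed.
Lemma J_conj f : J (conj f) = (- conj (J f))%W.
Proof.
  apply W_ext. intros k. rewrite cf_opp, cf_J, !cf_conj, cf_J. unfold mJ.
  destruct (Z.eq_dec k 0), (Z.eq_dec (- k) 0); try lia; [ring|].
  rewrite opp_IZR. field. now apply IZR_neq.
Qed.

(** The Euler derivation zeta d/dzeta, kept as a relation because it is unbounded on [W]. *)
Definition isL (f f' : W) : Prop := forall k, f' k = IZR k * f k.

Lemma isL_add f f' g g' : isL f f' -> isL g g' -> isL (f + g)%W (f' + g')%W.
Proof. intros Hf Hg k. rewrite !cf_add, Hf, Hg. ring. Qed.
Lemma isL_Wc c : isL (Wc c) 0%W.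
Proof. intros k. rewrite cf_W0, cf_Wc. destruct (Z.eq_dec k 0); subst; ring. Qed.
Lemma isL_scal c f f' : isL f f' -> isL (Wc c * f)%W (Wc c * f')%W.
Proof. intros Hf k. rewrite !cf_Wc_mul, Hf. ring. Qed.
Lemma isL_mon n : isL (mon n) (Wc (IZR n) * mon n)%W.
Proof. intros k. rewrite cf_Wc_mul, cf_mon. destruct (Z.eq_dec k n); subst; ring. Qed.
Lemma isL_mul f f' g g' : isL f f' -> isL g g' -> isL (f * g)%W (f' * g + f * g')%W.
Proof.
  intros Hf Hg k. rewrite cf_add, !cf_mul. unfold convo.
  rewrite <- SumZ_plus by (apply convo_sumable; apply cf_sumw).
  rewrite <- SumZ_scal. apply SumZ_ext. intros j. rewrite Hf, Hg, minus_IZR. ring.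
Qed.
Lemma J_isL (f f' : W) : isL f f' -> f 0%Z = 0 -> J f' = f.
Proof.
  intros H H0. apply W_ext. intros k. rewrite cf_J, H. unfold mJ.
  destruct (Z.eq_dec k 0); [subst; rewrite H0; ring|]. field. now apply IZR_neq.
Qed.
Lemma isL_J (f : W) : f 0%Z = 0 -> isL (J f) f.
Proof.
  intros H0 k. rewrite cf_J. unfold mJ.
  destruct (Z.eq_dec k 0); [subst; rewrite H0; ring|]. field. now apply IZR_neq.
Qed.
Lemma isL_ext f f' f'' : isL f f' -> f' = f'' -> isL f f''.
Proof. now intros H <-. Qed.

Create HintDb hol.
Ltac hol :=
  repeat match goal with
  | H : Hol ?f |- Hol ?g => constr_eq f g; exact H
  | H : AH ?f |- AH ?g => constr_eq f g; exact H
  | |- Hol (_ + _)%W => apply Hol_add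
  | |- Hol (_ - _)%W => apply Hol_sub
  | |- Hol (_ * _)%W => apply Hol_mul
  | |- Hol (- _)%W => apply Hol_opp
  | |- Hol (Wc _) => apply Hol_Wc
  | |- Hol 1%W => apply Hol_1
  | |- Hol 0%W => apply Hol_0
  | |- Hol (mon _) => apply Hol_mon; lia
  | |- Hol (conj _) => apply Hol_conj
  | |- AH (_ + _)%W => apply AH_add
  | |- AH (_ - _)%W => apply AH_sub
  | |- AH (_ * _)%W => apply AH_mul
  | |- AH (Wc _) => apply AH_Wc
  | |- AH 1%W => apply AH_1
  | |- AH (mon _) => apply AH_mon; lia
  | |- AH (conj _) => apply AH_conj
  end; auto with hol.

(** ** Geometric series *)

Definition geo (c : R) : W := toW (fun k => if Z_le_dec 0 k then c ^ Z.abs_nat k else 0).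

Lemma geo_sumw (c : R) : Rabs c < 1 / 2 ->
  sumw (fun k => if Z_le_dec 0 k then c ^ Z.abs_nat k else 0).
Proof.
  intros Hc. unfold sumw, sumable.
  (* A nonnegative k sits at index 2 k of the enumeration, so its weighted term [(2 |c|)^k] equals
     [r] to the power of that index. *)
  set (r := sqrt (2 * Rabs c)). assert (Hc0 := Rabs_pos c).
  assert (Hr : 0 <= r < 1).
  { split; [apply sqrt_pos|]. unfold r. rewrite <- sqrt_1. apply sqrt_lt_1; lra. }
  apply ex_series_le_R with (fun n => r ^ n).
  2:{ apply ex_series_geom. rewrite Rabs_pos_eq; lra. }
  intros n. rewrite Rabs_Rabsolu.
  destruct (Z_le_dec 0 (zn n)) as [Hn|Hn].
  - set (j := Z.abs_nat (zn n)).
    assert (E : n = (2 * j)%nat).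
    { rewrite <- (nz_zn n). unfold nz, j. apply Z.leb_le in Hn. rewrite Hn.
      apply Z.leb_le in Hn. lia. }
    replace (r ^ n) with (r ^ (2 * j)) by (now rewrite <- E). rewrite pow_mult. unfold r. rewrite pow2_sqrt by lra.
    unfold wt. fold j. rewrite Rabs_mult, Rabs_Rabsolu, (Rabs_pos_eq (2 ^ j)) by (apply pow_le; lra).
    rewrite Rpow_mult_distr, RPow_abs. right; ring.
  - rewrite Rabs_R0, Rmult_0_l, Rabs_R0. apply pow_le; lra.
Qed.

Lemma cf_geo (c : R) (k : Z) : Rabs c < 1 / 2 ->
  geo c k = if Z_le_dec 0 k then c ^ Z.abs_nat k else 0.
Proof. intros Hc. unfold geo. rewrite cf_toW; auto. now apply geo_sumw. Qed.

Lemma Hol_geo (c : R) : Rabs c < 1 / 2 -> Hol (geo c).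
Proof. intros Hc k Hk. rewrite cf_geo by auto. destruct (Z_le_dec 0 k); [lia|auto]. Qed.

Notation zeta := (mon 1).
Notation zbar := (mon (-1)).

Lemma zeta_zbar : (zeta * zbar)%W = 1%W.
Proof. rewrite mon_mul. reflexivity. Qed.

Lemma geo_inv (c : R) : Rabs c < 1 / 2 -> ((1 - Wc c * zeta) * geo c)%W = 1%W.
Proof.
  intros Hc. replace ((1 - Wc c * zeta) * geo c)%W with (geo c - Wc c * (zeta * geo c))%W by ring.
  apply W_ext. intros k. unfold W1.
  rewrite cf_sub, cf_Wc_mul, cf_mon_mul, !cf_geo, cf_mon by auto.
  destruct (Z_le_dec 0 k), (Z_le_dec 0 (k - 1)), (Z.eq_dec k 0); try lia.
  - replace (Z.abs_nat k) with (S (Z.abs_nat (k - 1))) by lia. simpl. ring.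
  - subst. simpl. ring.
  - ring.
Qed.

(** The right side is the formal derivative of [1 / (1 - c zeta)]. The difference between its k-th
    coefficient and [k * geo c k] is multiplied by c from one index to the next and vanishes at
    index -1. *)
Lemma geo_isL (c : R) : Rabs c < 1 / 2 -> isL (geo c) (Wc c * zeta * geo c * geo c)%W.
Proof.
  intros Hc.
  set (X := (Wc c * zeta * geo c * geo c)%W).
  assert (E1 : geo c = (1 + Wc c * (zeta * geo c))%W).
  { assert (H := geo_inv c Hc). rewrite <- H at 1. ring_simplify in H.
    transitivity ((1 - Wc c * zeta) * geo c + Wc c * (zeta * geo c))%W; [ring|].
    now rewrite geo_inv. }
  assert (E2 : X = (Wc c * (zeta * geo c) + Wc c * (zeta * X))%W).
  { unfold X at 1. transitivity (Wc c * zeta * geo c * (1 + Wc c * (zeta * geo c)))%W.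
    - rewrite <- E1. ring.
    - unfold X. ring. }
  assert (HX : Hol X).
  { assert (Hg := Hol_geo c Hc). unfold X. hol. }
  assert (Hrec : forall k, X k - IZR k * geo c k = c * (X (k - 1)%Z - IZR (k - 1) * geo c (k - 1)%Z)).
  { intros k. rewrite E2 at 1. rewrite E1 at 2. unfold W1.
    rewrite !cf_add, !cf_Wc_mul, !cf_mon_mul, cf_mon, minus_IZR.
    destruct (Z.eq_dec k 0); subst; ring. }
  assert (Hz : forall n, X (Z.of_nat n - 1)%Z - IZR (Z.of_nat n - 1) * geo c (Z.of_nat n - 1)%Z = 0).
  { induction n.
    - rewrite HX, (Hol_geo c Hc) by lia. ring.
    - rewrite Hrec. replace (Z.of_nat (S n) - 1 - 1)%Z with (Z.of_nat n - 1)%Z by lia.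
      rewrite IHn. ring. }
  intros k. destruct (Z_lt_dec k 0).
  - rewrite HX, (Hol_geo c Hc) by lia. ring.
  - specialize (Hz (Z.to_nat (k + 1))). replace (Z.of_nat (Z.to_nat (k + 1)) - 1)%Z with k in Hz by lia. lra.
Qed.

Global Opaque geo.

(** ** Evaluation at, and division by, a point of the disc *)

(** For holomorphic f this is the sum of [f k * c^k], the value at c. On the circle
    [zbar * conj (geo c)] is [1 / (zeta - c)], so [dvp c f] is the holomorphic part of
    [f / (zeta - c)]. *)
Definition evp (c : R) (f : W) : R := (f * conj (geo c))%W 0%Z.
Definition dvp (c : R) (f : W) : W := Ph (zbar * (f * conj (geo c)))%W.

Lemma Hol_dvp c f : Hol (dvp c f).
Proof. intros k Hk. unfold dvp. rewrite cf_Ph. unfold mh. destruct (Z_le_dec 0 k); [lia|ring]. Qed.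

(** The discarded part N of [f / (zeta - c)] has negative frequencies only, so [(zeta - c) * N] has
    no positive ones; as a difference of holomorphic series it has no negative ones either, and is
    the constant [evp c f]. *)
Lemma dvp_spec (c : R) (f : W) : Rabs c < 1 / 2 -> Hol f ->
  f = (Wc (evp c f) + (zeta - Wc c) * dvp c f)%W.
Proof.
  intros Hc Hf.
  set (F := (f * conj (geo c))%W).
  assert (HF : f = ((zeta - Wc c) * (zbar * F))%W).
  { assert (H := f_equal conj (geo_inv c Hc)).
    rewrite conj_mul, conj_sub, conj_mul, conj_Wc, conj_mon, conj_1 in H. simpl in H.
    unfold F. transitivity (f * ((1 - Wc c * zbar) * conj (geo c)))%W; [rewrite H; ring|].
    rewrite <- zeta_zbar. ring. }
  set (N := (zbar * F - dvp c f)%W).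
  assert (HN : forall k, N k = if Z_lt_dec k 0 then F (k + 1)%Z else 0).
  { intros k. unfold N, dvp. fold F. rewrite cf_sub, cf_Ph, cf_mon_mul. unfold mh.
    replace (k - -1)%Z with (k + 1)%Z by ring.
    destruct (Z_le_dec 0 k), (Z_lt_dec k 0); try lia; ring. }
  set (K := ((zeta - Wc c) * N)%W).
  assert (HK : f = (K + (zeta - Wc c) * dvp c f)%W).
  { rewrite HF at 1. unfold K, N. ring. }
  assert (HKh : Hol K).
  { replace K with (f - (zeta - Wc c) * dvp c f)%W by (rewrite HK at 1; ring).
    apply Hol_sub; auto. apply Hol_mul; [|apply Hol_dvp].
    apply Hol_sub; [apply Hol_mon; lia|apply Hol_Wc]. }
  rewrite HK at 1. f_equal. apply W_ext. intros k. rewrite cf_Wc. unfold evp. fold F.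
  assert (HKk : K k = N (k - 1)%Z - c * N k).
  { unfold K. replace ((zeta - Wc c) * N)%W with (zeta * N - Wc c * N)%W by ring.
    now rewrite cf_sub, cf_Wc_mul, cf_mon_mul. }
  destruct (Z.eq_dec k 0) as [->|Hk].
  - rewrite HKk, !HN. simpl. destruct (Z_lt_dec 0 0); [lia|]. ring.
  - destruct (Z_lt_dec k 0); [now apply HKh|].
    rewrite HKk, !HN. destruct (Z_lt_dec (k - 1) 0), (Z_lt_dec k 0); try lia. ring.
Qed.

(** * The linearized problem *)

(** The right inverse is assembled explicitly from its datum g; these closure rules yield its bound
    without computing a constant. *)
Definition bOs (r : W -> R) : Prop := exists K, forall g, Rabs (r g) <= K * nm g.
Definition bO (X : W -> W) : Prop := exists K, forall g, nm (X g) <= K * nm g.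

Lemma bO_id : bO (fun g => g).
Proof. exists 1. intros; lra. Qed.
Lemma bO_add X Y : bO X -> bO Y -> bO (fun g => X g + Y g)%W.
Proof.
  intros [K1 H1] [K2 H2]. exists (K1 + K2). intros g. apply Rle_trans with (1 := nm_add _ _).
  generalize (H1 g) (H2 g). lra.
Qed.
Lemma bO_sub X Y : bO X -> bO Y -> bO (fun g => X g - Y g)%W.
Proof.
  intros [K1 H1] [K2 H2]. exists (K1 + K2). intros g. apply Rle_trans with (1 := nm_sub _ _).
  generalize (H1 g) (H2 g). lra.
Qed.
Lemma bO_opp X : bO X -> bO (fun g => - X g)%W.
Proof. intros [K H]. exists K. intros g. now rewrite nm_opp. Qed.
Lemma bO_mull c X : bO X -> bO (fun g => c * X g)%W.
Proof.
  intros [K H]. exists (nm c * K). intros g. apply Rle_trans with (1 := nm_mul _ _).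
  rewrite Rmult_assoc. apply Rmult_le_compat_l; auto. apply nm_pos.
Qed.
Lemma bO_mulr c X : bO X -> bO (fun g => X g * c)%W.
Proof.
  intros H. destruct (bO_mull c X H) as [K HK]. exists K. intros g. rewrite Wmul_comm. auto.
Qed.
Lemma bO_m m c X : (forall k, Rabs (m k) <= c) -> bO X -> bO (fun g => Wm m (X g)).
Proof.
  intros Hm [K H]. exists (c * K). intros g. apply Rle_trans with (1 := nm_m m c _ Hm).
  rewrite Rmult_assoc. apply Rmult_le_compat_l; auto.
  apply Rle_trans with (2 := Hm 0%Z), Rabs_pos.
Qed.
Lemma bO_conj X : bO X -> bO (fun g => conj (X g)).
Proof. intros [K H]. exists K. intros g. now rewrite nm_conj. Qed.
Lemma bO_scal r c : bOs r -> bO (fun g => Wc (r g) * c)%W.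
Proof.
  intros [K H]. exists (K * nm c). intros g. apply Rle_trans with (1 := nm_scal _ _).
  replace (K * nm c * nm g) with (K * nm g * nm c) by ring.
  apply Rmult_le_compat_r; auto. apply nm_pos.
Qed.
Lemma bO_Wc r : bOs r -> bO (fun g => Wc (r g)).
Proof.
  intros H. destruct (bO_scal r 1%W H) as [K HK]. exists K. intros g.
  specialize (HK g). now replace (Wc (r g)) with (Wc (r g) * 1)%W by ring.
Qed.
Lemma bOs_cf X k : bO X -> bOs (fun g => X g k).
Proof. intros [K H]. exists K. intros g. apply Rle_trans with (1 := cf_abs_le _ k), H. Qed.
Lemma bOs_add r s : bOs r -> bOs s -> bOs (fun g => r g + s g).
Proof.
  intros [K1 H1] [K2 H2]. exists (K1 + K2). intros g. apply Rle_trans with (1 := Rabs_triang _ _).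
  generalize (H1 g) (H2 g). lra.
Qed.
Lemma bOs_scal c r : bOs r -> bOs (fun g => c * r g).
Proof.
  intros [K H]. exists (Rabs c * K). intros g. rewrite Rabs_mult, Rmult_assoc.
  apply Rmult_le_compat_l; auto. apply Rabs_pos.
Qed.
Lemma bOs_ev c X : bO X -> bOs (fun g => evp c (X g)).
Proof. intros H. unfold evp. now apply (bOs_cf (fun g => X g * conj (geo c))%W), bO_mulr. Qed.
Lemma bO_dvp c X : bO X -> bO (fun g => dvp c (X g)).
Proof.
  intros H. unfold dvp, Ph. apply bO_m with 1; [apply mh_le|].
  now apply bO_mull, bO_mulr.
Qed.

(** The inverse matrix is produced before the right-hand sides, so that the solution visibly depends
    boundedly on them. *)
Lemma cramer3 (a11 a12 a13 a21 a22 a23 a31 a32 a33 : R) :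
  a11 * (a22 * a33 - a23 * a32) - a12 * (a21 * a33 - a23 * a31) + a13 * (a21 * a32 - a22 * a31) <> 0 ->
  exists n11 n12 n13 n21 n22 n23 n31 n32 n33, forall r1 r2 r3,
    let x := n11 * r1 + n12 * r2 + n13 * r3 in
    let y := n21 * r1 + n22 * r2 + n23 * r3 in
    let z := n31 * r1 + n32 * r2 + n33 * r3 in
    a11 * x + a12 * y + a13 * z = r1 /\ a21 * x + a22 * y + a23 * z = r2 /\
    a31 * x + a32 * y + a33 * z = r3.
Proof.
  set (D := a11 * (a22 * a33 - a23 * a32) - a12 * (a21 * a33 - a23 * a31) + a13 * (a21 * a32 - a22 * a31)).
  intros HD.
  exists ((a22 * a33 - a23 * a32) / D), ((a13 * a32 - a12 * a33) / D), ((a12 * a23 - a13 * a22) / D),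
    ((a23 * a31 - a21 * a33) / D), ((a11 * a33 - a13 * a31) / D), ((a13 * a21 - a11 * a23) / D),
    ((a21 * a32 - a22 * a31) / D), ((a12 * a31 - a11 * a32) / D), ((a11 * a22 - a12 * a21) / D).
  intros r1 r2 r3. unfold D in *. repeat split; field; auto.
Qed.

(** * The explicit solution for zero gravity and infinite depth *)

Section Base.
Variable b : R.
Hypothesis Hb : 0 < b < 1 / 2.

Let B := Wc b.
Let a := b * b.
(** Ratio of the vorticity to the surface speed: [Omega_of a] is [kap * q] with
    [q = (1 + a) / (1 - 3 a)]. *)
Definition kap : R := (1 - b * b) / (1 + b * b).
Let K := Wc kap.
Definition e1 : W := geo (- b).
Definition e2 : W := geo b.
Let f1 := conj e1.
Let f2 := conj e2.

Lemma Rabs_b : Rabs b < 1 / 2.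
Proof. rewrite Rabs_pos_eq; lra. Qed.
Lemma Rabs_mb : Rabs (- b) < 1 / 2.
Proof. rewrite Rabs_Ropp. apply Rabs_b. Qed.

Lemma e1_inv : ((1 + B * zeta) * e1)%W = 1%W.
Proof.
  transitivity ((1 - Wc (- b) * zeta) * geo (- b))%W; [|exact (geo_inv (- b) Rabs_mb)].
  fold e1. rewrite Wc_opp. fold B. ring.
Qed.
Lemma e2_inv : ((1 - B * zeta) * e2)%W = 1%W.
Proof. apply (geo_inv b Rabs_b). Qed.
Lemma f2_inv : ((1 - B * zbar) * f2)%W = 1%W.
Proof.
  assert (H := f_equal conj e2_inv). unfold B in *.
  now rewrite conj_mul, conj_sub, conj_mul, conj_Wc, conj_mon, conj_1 in H.
Qed.
Lemma Hol_e1 : Hol e1.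
Proof. apply Hol_geo, Rabs_mb. Qed.
Lemma Hol_e2 : Hol e2.
Proof. apply Hol_geo, Rabs_b. Qed.
Local Hint Resolve Hol_e1 Hol_e2 : hol.

(** The holomorphic square root of [z_alpha] for the explicit profile; [iv] is its inverse. *)
Definition vv : W := ((1 - Wc b * zeta) * e1)%W.
Definition iv : W := ((1 + Wc b * zeta) * e2)%W.

Lemma vv_iv : (vv * iv)%W = 1%W.
Proof.
  unfold vv, iv. fold B. transitivity (((1 + B * zeta) * e1) * ((1 - B * zeta) * e2))%W; [ring|].
  rewrite e1_inv, e2_inv. ring.
Qed.
Lemma vb_ivb : (conj vv * conj iv)%W = 1%W.
Proof. rewrite <- conj_mul, vv_iv. apply conj_1. Qed.
Lemma Hol_vv : Hol vv.
Proof. unfold vv. hol. Qed.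
Lemma Hol_iv : Hol iv.
Proof. unfold iv. hol. Qed.
Local Hint Resolve Hol_vv Hol_iv : hol.

Lemma ivb_eq : conj iv = ((1 + B * zbar) * f2)%W.
Proof.
  unfold iv. rewrite conj_mul, conj_add, conj_1, conj_mul, conj_Wc, conj_mon. reflexivity.
Qed.
Lemma vv_eq : vv = (e1 + e1 - 1)%W.
Proof.
  unfold vv. fold B. transitivity (e1 + e1 - (1 + B * zeta) * e1)%W; [ring|]. now rewrite e1_inv.
Qed.

Lemma kap_pos : 0 < kap < 1.
Proof.
  unfold kap. split.
  - apply Rdiv_lt_0_compat; nra.
  - apply Rmult_lt_reg_r with (1 + b * b); [nra|]. field_simplify; nra.
Qed.

(** [Y0] is [w / (2 i)], so [y0] is the elevation of the explicit profile. [P0] is the Euler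
    derivative of [Y0], and [p0] stands for [i y_alpha], as zeta d/dzeta is [i d/dalpha]. *)
Definition P0 : W := (- (Wc 2 * (Wc b * zeta * e1 * e1)))%W.
Definition Y0 : W := (- (Wc 2 * (Wc b * zeta * e1)))%W.
Definition p0 : W := (P0 - conj P0)%W.
Definition y0 : W := (Y0 + conj Y0)%W.

Lemma Hol_P0 : Hol P0.
Proof. unfold P0. hol. Qed.
Lemma Hol_Y0 : Hol Y0.
Proof. unfold Y0. hol. Qed.
Local Hint Resolve Hol_P0 Hol_Y0 : hol.

Lemma cf0_zeta (f : W) : Hol f -> (zeta * f)%W 0%Z = 0.
Proof. intros H. rewrite cf_mon_mul. apply H. lia. Qed.

Lemma P0_0 : P0 0%Z = 0.
Proof.
  unfold P0. rewrite cf_opp, cf_Wc_mul.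
  replace (Wc b * zeta * e1 * e1)%W with (Wc b * (zeta * (e1 * e1)))%W by ring.
  rewrite cf_Wc_mul, cf0_zeta by hol. ring.
Qed.
Lemma Y0_0 : Y0 0%Z = 0.
Proof.
  unfold Y0. rewrite cf_opp, cf_Wc_mul.
  replace (Wc b * zeta * e1)%W with (Wc b * (zeta * e1))%W by ring.
  rewrite cf_Wc_mul, cf0_zeta by hol. ring.
Qed.

Lemma e1_isL : isL e1 (- (B * zeta * e1 * e1))%W.
Proof.
  apply isL_ext with (1 := geo_isL (- b) Rabs_mb). fold e1. rewrite Wc_opp. fold B. ring.
Qed.

Lemma zeta_isL : isL zeta zeta.
Proof. apply isL_ext with (1 := isL_mon 1). rewrite Wc_1. ring. Qed.

Lemma Y0_isL : isL Y0 P0.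
Proof.
  assert (H := isL_scal (- (2 * b)) _ _ (isL_mul _ _ _ _ zeta_isL e1_isL)).
  unfold Y0, P0.
  replace (- (Wc 2 * (Wc b * zeta * e1)))%W with (Wc (- (2 * b)) * (zeta * e1))%W
    by (rewrite Wc_opp, Wc_mul; ring).
  apply isL_ext with (1 := H). rewrite Wc_opp, Wc_mul. fold B.
  transitivity (- (Wc 2 * (B * zeta * e1 * ((1 + B * zeta) * e1 - B * zeta * e1))))%W.
  - rewrite e1_inv. ring.
  - ring.
Qed.

Lemma y0_J : J p0 = y0.
Proof.
  unfold p0, y0. rewrite J_sub, J_conj, (J_isL _ _ Y0_isL Y0_0). ring.
Qed.

Lemma Hs_p0 : Hs p0 = (P0 + conj P0)%W.
Proof. unfold p0. rewrite Hs_sub, Hs_conj, Hs_Hol; [ring|apply Hol_P0|apply P0_0]. Qed.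

Definition Zb : W := (vv * vv)%W.
Lemma Zb_eq : Zb = (1 + Wc 2 * P0)%W.
Proof.
  unfold Zb, vv, P0. fold B. rewrite Wc_2.
  transitivity (((1 + B * zeta) * e1) * ((1 + B * zeta) * e1) - (1 + 1) * ((1 + 1) * (B * zeta * e1 * e1)))%W; [ring|].
  rewrite e1_inv. ring.
Qed.

(* kappa is the value of 1/v at the reflected pole -1/b of v; this makes the Crapper profile a
   solution. *)
Lemma ivb_kap : (conj iv - K)%W = (Wc (b * (1 + kap)) * (f2 * (B + zbar)))%W.
Proof.
  rewrite ivb_eq. transitivity ((1 + B * zbar) * f2 - K * ((1 - B * zbar) * f2))%W.
  { rewrite f2_inv. ring. }
  assert (E : (1 - K)%W = (Wc (b * (1 + kap)) * B)%W).
  { unfold K, B. rewrite <- Wc_1, <- Wc_sub, <- Wc_mul. f_equal. unfold kap. field. nra. }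
  assert (E' : (B * (1 + K))%W = Wc (b * (1 + kap))).
  { unfold K, B. now rewrite Wc_mul, Wc_add, Wc_1. }
  transitivity (f2 * ((1 - K) + (B * (1 + K)) * zbar))%W; [ring|]. rewrite E, E'. ring.
Qed.

Lemma e1_bt : (e1 * (B + zbar))%W = zbar.
Proof.
  transitivity (e1 * (B * (zeta * zbar) + zbar))%W; [rewrite zeta_zbar; ring|].
  transitivity (((1 + B * zeta) * e1) * zbar)%W; [ring|]. rewrite e1_inv. ring.
Qed.

(** Outside the disc, [vv * conj iv] has a single pole, that of [vv] at -1/b, where [conj iv] takes
    the value [kap]; [K * Y0] has the same principal part there. *)
Lemma base_AH : AH (vv * conj iv - K * Y0)%W.
Proof.
  assert (E : (K * Y0)%W = (Wc 2 * (K * e1) - Wc 2 * K)%W).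
  { unfold Y0. fold B. transitivity (- (Wc 2 * K * ((1 + B * zeta) * e1 - e1)))%W; [ring|].
    rewrite e1_inv. ring. }
  assert (E2 : (vv * conj iv - K * Y0)%W
     = (Wc 2 * (Wc (b * (1 + kap)) * (f2 * zbar)) - conj iv + Wc 2 * K)%W).
  { rewrite E, vv_eq, Wc_2.
    transitivity ((1 + 1) * (e1 * (conj iv - K)) - conj iv + (1 + 1) * K)%W; [ring|].
    rewrite ivb_kap.
    transitivity ((1 + 1) * (Wc (b * (1 + kap)) * (f2 * (e1 * (B + zbar)))) - conj iv + (1 + 1) * K)%W; [ring|].
    rewrite e1_bt. ring. }
  rewrite E2. unfold K, f2. hol.
Qed.

(** The conjugate form of [base_AH], used twice: to verify the explicit solution and to absorb a
    term of the linearization. *)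
Lemma base_Hol : Hol (K * y0 - conj vv * iv)%W.
Proof.
  assert (H := Hol_conj _ base_AH). rewrite conj_sub, !conj_mul, conj_conj in H.
  unfold K in *. rewrite conj_Wc in H.
  unfold y0. replace (Wc kap * (Y0 + conj Y0) - conj vv * iv)%W
    with (Wc kap * Y0 - (conj vv * iv - Wc kap * conj Y0))%W by ring.
  apply Hol_sub; [hol|exact H].
Qed.

(** ** The equation solved along the Riemann-Hilbert reduction *)

Let tau : W := (zeta - Wc (- b))%W.
Let tau_eq : tau = (zeta + B)%W.
Proof. unfold tau. rewrite Wc_opp. fold B. ring. Qed.

(** Taylor coefficients at -b with a holomorphic remainder, set up so that products can be expanded
    mechanically. *)
Definition jet (f : W) (j0 j1 j2 : R) : Prop :=
  exists S, Hol S /\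
    f = (Wc j0 + (zeta - Wc (- b)) * (Wc j1 + (zeta - Wc (- b)) * (Wc j2 + (zeta - Wc (- b)) * S)))%W.

Lemma Hol_tau : Hol (zeta - Wc (- b))%W.
Proof. hol. Qed.
Local Hint Resolve Hol_tau : hol.

Lemma jet_Wc c : jet (Wc c) c 0 0.
Proof. exists 0%W. split; [hol|]. rewrite Wc_0. ring. Qed.
Lemma jet_1 : jet 1%W 1 0 0.
Proof. rewrite <- Wc_1. apply jet_Wc. Qed.
Lemma jet_zeta : jet zeta (- b) 1 0.
Proof. exists 0%W. split; [hol|]. rewrite Wc_0, Wc_1. ring. Qed.
Lemma jet_add f g j0 j1 j2 k0 k1 k2 : jet f j0 j1 j2 -> jet g k0 k1 k2 ->
  jet (f + g)%W (j0 + k0) (j1 + k1) (j2 + k2).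
Proof.
  intros (S & HS & ->) (T & HT & ->). exists (S + T)%W. split; [hol|].
  rewrite !Wc_add. ring.
Qed.
Lemma jet_sub f g j0 j1 j2 k0 k1 k2 : jet f j0 j1 j2 -> jet g k0 k1 k2 ->
  jet (f - g)%W (j0 - k0) (j1 - k1) (j2 - k2).
Proof.
  intros (S & HS & ->) (T & HT & ->). exists (S - T)%W. split; [hol|].
  rewrite !Wc_sub. ring.
Qed.
Lemma jet_mul f g j0 j1 j2 k0 k1 k2 : jet f j0 j1 j2 -> jet g k0 k1 k2 ->
  jet (f * g)%W (j0 * k0) (j0 * k1 + j1 * k0) (j0 * k2 + j1 * k1 + j2 * k0).
Proof.
  fold tau. intros (S & HS & ->) (T & HT & ->). fold tau.
  exists (Wc j0 * T + S * Wc k0 + (Wc j1 * (Wc k2 + tau * T) + Wc j2 * Wc k1 + tau * S * Wc k1)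
     + tau * (Wc j2 + tau * S) * (Wc k2 + tau * T))%W.
  split; [unfold tau; hol|].
  rewrite !Wc_add, !Wc_mul. fold tau. ring.
Qed.
(** From [1 + b zeta = (1 - a) + b (zeta + b)] comes [e1 = al - b al (zeta + b) e1] with
    [al = 1 / (1 - a)]; substitute it into itself three times. *)
Lemma jet_e1 : jet e1 (/ (1 - a)) (- b * (/ (1 - a)) ^ 2) (a * (/ (1 - a)) ^ 3).
Proof.
  set (al := / (1 - a)).
  assert (Hal : 1 - a <> 0) by (unfold a; nra).
  assert (E : e1 = (Wc al - Wc (b * al) * (tau * e1))%W).
  { assert (H := e1_inv).
    assert (H2 : (1 + B * zeta)%W = (Wc (1 - a) + B * tau)%W).
    { rewrite tau_eq. unfold a. rewrite Wc_sub, Wc_1, Wc_mul. fold B. ring. }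
    rewrite H2 in H.
    transitivity (Wc al * (((Wc (1 - a) + B * tau)) * e1) - Wc (b * al) * (tau * e1))%W.
    - rewrite Wc_mul. fold B. transitivity ((Wc al * Wc (1 - a)) * e1)%W; [|ring].
      rewrite <- Wc_mul. unfold al. rewrite Rinv_l by auto. rewrite Wc_1. ring.
    - rewrite H. ring. }
  exists (- (Wc (b ^ 3 * al ^ 3) * e1))%W. split; [hol|]. fold tau.
  rewrite E at 1. rewrite E at 1. rewrite E at 1.
  replace (- b * al ^ 2) with (- (b * al * al)) by ring.
  replace (a * al ^ 3) with (b * al * (b * al * al)) by (unfold a; ring).
  replace (b ^ 3 * al ^ 3) with (b * al * (b * al * (b * al))) by ring.
  rewrite Wc_opp, !Wc_mul. ring.
Qed.

(** With [f'] the Euler derivative of [f], this is [iv * conj iv * f' - kap * f] multiplied by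
    [(1 - b zeta) (zeta - b)], which clears the pole at b. *)
Definition ode (f f' : W) : W :=
  ((1 + Wc b * zeta) * (zeta + Wc b) * f' - Wc kap * ((1 - Wc b * zeta) * (zeta - Wc b) * f))%W.

(** [C0] and [C3] carry the constants chi and c. [C1] and [C2] give the change of the right-hand
    side when zeta or zeta^2 is added to Phi: besides [- ode], chi changes, being [kap^3] times the
    value at -b of the Euler derivative, which is [- b] for zeta and [2 b^2] for zeta^2. *)
Definition C0 : W := (Wc 2 * ((1 - Wc b * zeta) * (zeta - Wc b) * (e1 - 1)))%W.
Definition C1 : W := (Wc (- (b * kap ^ 3)) * C0 - ode zeta zeta)%W.
Definition C2 : W := (Wc (2 * b * b * kap ^ 3) * C0 - ode (zeta * zeta) (Wc 2 * (zeta * zeta)))%W.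
Definition C3 : W := ((1 - Wc b * zeta) * zeta)%W.

Ltac jets := repeat match goal with
  | |- jet (_ + _)%W _ _ _ => apply jet_add
  | |- jet (_ - _)%W _ _ _ => apply jet_sub
  | |- jet (_ * _)%W _ _ _ => apply jet_mul
  | |- jet 1%W _ _ _ => apply jet_1
  | |- jet (Wc _) _ _ _ => apply jet_Wc
  | |- jet (mon 1) _ _ _ => apply jet_zeta
  | |- jet e1 _ _ _ => apply jet_e1
  end.

(** Solvability of the three conditions for q1, q2 and c. The jets are filled in by unification, and
    the determinant simplifies to [4 b^5 (1 - b^2)]. *)
Lemma columns : exists m01 m02 m03 m11 m12 m13 m21 m22 m23,
  jet C1 m01 m11 m21 /\ jet C2 m02 m12 m22 /\ jet C3 m03 m13 m23 /\
  m01 * (m12 * m23 - m13 * m22) - m02 * (m11 * m23 - m13 * m21) + m03 * (m11 * m22 - m12 * m21) <> 0.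
Proof.
  do 9 eexists. split; [|split; [|split]].
  - unfold C1, C0, ode. jets.
  - unfold C2, C0, ode. jets.
  - unfold C3. jets.
  - match goal with |- ?x <> 0 => assert (E : x = 4 * b ^ 5 * (1 - b * b)) end.
    + unfold kap, a. field. nra.
    + rewrite E. apply Rgt_not_eq. apply Rmult_lt_0_compat; [|nra].
      apply Rmult_lt_0_compat; [lra|apply pow_lt; lra].
Qed.

Lemma division3 (f : W) : Hol f ->
  jet f (evp (- b) f) (evp (- b) (dvp (- b) f)) (evp (- b) (dvp (- b) (dvp (- b) f))) /\
  f = (Wc (evp (- b) f) + (zeta - Wc (- b)) * (Wc (evp (- b) (dvp (- b) f)) + (zeta - Wc (- b)) *
        (Wc (evp (- b) (dvp (- b) (dvp (- b) f))) + (zeta - Wc (- b)) *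
          dvp (- b) (dvp (- b) (dvp (- b) f)))))%W.
Proof.
  intros Hf.
  assert (E : f = (Wc (evp (- b) f) + (zeta - Wc (- b)) * (Wc (evp (- b) (dvp (- b) f)) + (zeta - Wc (- b)) *
        (Wc (evp (- b) (dvp (- b) (dvp (- b) f))) + (zeta - Wc (- b)) *
          dvp (- b) (dvp (- b) (dvp (- b) f)))))%W).
  { assert (H1 := dvp_spec _ _ Rabs_mb Hf).
    assert (H2 := dvp_spec _ _ Rabs_mb (Hol_dvp (- b) f)).
    assert (H3 := dvp_spec _ _ Rabs_mb (Hol_dvp (- b) (dvp (- b) f))).
    now rewrite <- H3, <- H2. }
  split; [|exact E]. exists (dvp (- b) (dvp (- b) (dvp (- b) f))). split; [apply Hol_dvp|exact E].
Qed.

(** Inverts [Psi |-> Psi' + kap Psi] on holomorphic series, the part of the equation due to the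
    factor [z^(-kap)]; [kap > 0] excludes resonance. *)
Definition mK (k : Z) : R := if Z_le_dec 0 k then / (IZR k + kap) else 0.
Lemma mK_le k : Rabs (mK k) <= / kap.
Proof.
  assert (Hk := kap_pos). unfold mK. destruct (Z_le_dec 0 k) as [H|H].
  - apply IZR_le in H. rewrite Rabs_pos_eq.
    + apply Rinv_le_contravar; lra.
    + apply Rlt_le, Rinv_0_lt_compat; lra.
  - rewrite Rabs_R0. apply Rlt_le, Rinv_0_lt_compat; lra.
Qed.

Lemma M_isL : isL ((zeta + Wc b) * e1)%W (Wc (1 - b * b) * zeta * e1 * e1)%W.
Proof.
  assert (H := isL_mul _ _ _ _ (isL_add _ _ _ _ zeta_isL (isL_Wc b)) e1_isL).
  apply isL_ext with (1 := H). fold B. rewrite Wc_sub, Wc_1, Wc_mul. fold B.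
  transitivity (zeta * e1 * ((1 + B * zeta) * e1) - zeta * e1 * (B * zeta * e1) - B * B * zeta * e1 * e1)%W.
  - rewrite e1_inv. ring.
  - ring.
Qed.

Lemma kap_W : Wc (1 - b * b) = (K * (1 + B * B))%W.
Proof.
  unfold K, B. rewrite <- Wc_1, <- Wc_mul, <- Wc_add, <- Wc_mul. f_equal. unfold kap. field. nra.
Qed.

(* M^2 z^(-kappa) with M = (z + b) / (1 + b z) is the homogeneous solution. *)
Lemma ode_M (Psi Psi' : W) :
  ode ((zeta + Wc b) * e1 * ((zeta + Wc b) * e1) * Psi)%W
    (Wc 2 * ((zeta + Wc b) * e1) * (Wc (1 - b * b) * zeta * e1 * e1) * Psi
       + (zeta + Wc b) * e1 * ((zeta + Wc b) * e1) * Psi')%W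
  = ((zeta + Wc b) * (zeta + Wc b) * (zeta + Wc b) * (e1 * (Psi' + Wc kap * Psi)))%W.
Proof.
  unfold ode. rewrite kap_W, Wc_2. fold B K.
  set (T := (zeta + B)%W). set (E := (1 + B * zeta)%W).
  assert (HE : (E * e1)%W = 1%W) by apply e1_inv.
  transitivity (T * T * ((E * e1) * ((1 + 1) * (K * (1 + B * B)) * zeta * (e1 * e1) * Psi + T * e1 * Psi')
     - K * ((1 - B * zeta) * (zeta - B)) * (e1 * e1) * Psi))%W; [ring|].
  rewrite HE.
  transitivity (T * T * (T * e1 * Psi' + K * (E * e1) * T * e1 * Psi))%W; [unfold E, T; ring|].
  rewrite HE. ring.
Qed.

(** [kap] is the value of [iv] at -b. Its cube enters below because the conjugate unknown carries
    the factor [conj iv] cubed. *)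
Lemma iv_kap : exists Y, Hol Y /\ iv = (K + (zeta + Wc b) * Y)%W.
Proof.
  set (be := / (1 + b * b)).
  assert (Hbe : e2 = (Wc be + (zeta + B) * (Wc be * B * e2))%W).
  { assert (Ha : Wc be = (Wc be * ((1 - B * zeta) * e2))%W) by (rewrite e2_inv; ring).
    assert (Hb2 : (Wc be * (1 + B * B))%W = 1%W).
    { unfold B. rewrite <- Wc_1, <- !Wc_mul, <- Wc_add, <- Wc_mul. f_equal. unfold be. field. nra. }
    rewrite Ha at 1.
    transitivity ((Wc be * (1 + B * B)) * e2)%W; [rewrite Hb2; ring|ring]. }
  exists (Wc (1 - b * b) * (Wc be * B * e2) + B * e2)%W. split.
  - unfold B. hol.
  - unfold iv. fold B.
    assert (HK : K = (Wc (1 - b * b) * Wc be)%W).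
    { unfold K, kap, be. rewrite <- Wc_mul. reflexivity. }
    transitivity ((Wc (1 - b * b) + B * (zeta + B)) * e2)%W.
    + rewrite Wc_sub, Wc_1, Wc_mul. fold B. ring.
    + transitivity (Wc (1 - b * b) * e2 + (zeta + B) * (B * e2))%W; [ring|].
      rewrite Hbe at 1. rewrite HK. ring.
Qed.

Lemma iv3_kap : exists Y, Hol Y /\ (iv * iv * iv = K * K * K + (zeta + Wc b) * Y)%W.
Proof.
  destruct iv_kap as (Y & HY & E).
  exists (Y * iv * iv + K * Y * iv + K * K * Y)%W. split; [unfold K; hol|].
  rewrite E. ring.
Qed.

Lemma e1_0 : e1 0%Z = 1.
Proof. unfold e1. rewrite cf_geo by apply Rabs_mb. reflexivity. Qed.

Lemma W1_0 : W1 0%Z = 1.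
Proof. rewrite <- Wc_1, cf_Wc. reflexivity. Qed.
Lemma zeta_0 : zeta 0%Z = 0.
Proof. rewrite cf_mon. reflexivity. Qed.
Lemma Wc_00 c : Wc c 0%Z = c.
Proof. rewrite cf_Wc. reflexivity. Qed.

Ltac cf0 := repeat first [rewrite cf_add | rewrite cf_sub | rewrite cf_opp | rewrite cf0_Hol_mul by hol
  | rewrite e1_0 | rewrite W1_0 | rewrite zeta_0 | rewrite Wc_00].

(** The ansatz is [Phi = q1 zeta + q2 zeta^2 + M^2 Psi]. Once q1, q2 and c make the right side equal
    to [(zeta + b)^3 S], [ode_M] leaves [Psi' + kap Psi = (1 + b zeta) S]. The clause on chi closes
    a loop: the chi in the equation must be the value of [U * iv^3] at -b for the solution itself,
    to which [M^2 Psi] contributes nothing. *)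
Lemma solve_ode : exists (chi c : W -> R) (U Phi : W -> W),
  bOs chi /\ bOs c /\ bO U /\ bO Phi /\
  forall g, (Hol (U g) /\ Hol (Phi g) /\ isL (Phi g) (U g) /\ Phi g 0%Z = 0 /\
    (exists X, Hol X /\ (U g * (iv * iv * iv) = Wc (chi g) + (zeta + Wc b) * X)%W) /\
    ode (Phi g) (U g) = (Wc (c g) * C3 + Wc (chi g) * C0 
       - (1 - Wc b * zeta) * (zeta - Wc b) * Pp g)%W).
Proof.
  destruct columns as (m01 & m02 & m03 & m11 & m12 & m13 & m21 & m22 & m23 & J1 & J2 & J3 & HD).
  destruct (cramer3 _ _ _ _ _ _ _ _ _ HD) as (n11 & n12 & n13 & n21 & n22 & n23 & n31 & n32 & n33 & HC).
  set (Ga := fun g => (- ((1 - Wc b * zeta) * (zeta - Wc b) * Pp g))%W).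
  assert (HGa : bO Ga).
  { apply bO_opp, bO_mull. unfold Pp. apply bO_m with 1; [apply mp_le|apply bO_id]. }
  assert (HPp : forall g, Hol (Pp g)).
  { intros g k Hk. rewrite cf_Pp. unfold mp. destruct (Z_lt_dec 0 k); [lia|ring]. }
  assert (HGh : forall g, Hol (Ga g)).
  { intros g. unfold Ga. specialize (HPp g). hol. }
  set (D1 := fun g => dvp (- b) (Ga g)). set (D2 := fun g => dvp (- b) (D1 g)).
  set (D3 := fun g => dvp (- b) (D2 g)).
  assert (HD1 : bO D1) by now apply bO_dvp. assert (HD2 : bO D2) by now apply bO_dvp.
  assert (HD3 : bO D3) by now apply bO_dvp.
  set (r0 := fun g => evp (- b) (Ga g)). set (r1 := fun g => evp (- b) (D1 g)).
  set (r2 := fun g => evp (- b) (D2 g)).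
  assert (Hr0 : bOs r0) by now apply bOs_ev. assert (Hr1 : bOs r1) by now apply bOs_ev.
  assert (Hr2 : bOs r2) by now apply bOs_ev.
  set (cr := fun n1 n2 n3 g => n1 * (-1 * r0 g) + n2 * (-1 * r1 g) + n3 * (-1 * r2 g)).
  assert (Hcr : forall n1 n2 n3, bOs (cr n1 n2 n3)).
  { intros. unfold cr. repeat first [apply bOs_add | apply bOs_scal]; auto. }
  set (q1 := cr n11 n12 n13). set (q2 := cr n21 n22 n23). set (c := cr n31 n32 n33).
  set (chi := fun g => - (b * kap ^ 3) * q1 g + 2 * b * b * kap ^ 3 * q2 g).
  assert (Hchi : bOs chi) by (apply bOs_add; apply bOs_scal; apply Hcr).
  destruct J1 as (S1 & HS1 & E1), J2 as (S2 & HS2 & E2), J3 as (S3 & HS3 & E3).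
  fold tau in E1, E2, E3.
  set (S := fun g => (D3 g + Wc (q1 g) * S1 + Wc (q2 g) * S2 + Wc (c g) * S3)%W).
  assert (HSb : bO S).
  { unfold S. repeat apply bO_add; auto; apply bO_scal; apply Hcr. }
  assert (HSh : forall g, Hol (S g)).
  { intros g. unfold S, D3. assert (Hol (dvp (- b) (D2 g))) by apply Hol_dvp. hol. }
  assert (HQ : forall g, (Ga g + Wc (q1 g) * C1 + Wc (q2 g) * C2 + Wc (c g) * C3)%W
     = (tau * tau * tau * S g)%W).
  { intros g. destruct (division3 (Ga g) (HGh g)) as [_ EG].
    fold (D1 g) in EG. fold (D2 g) in EG. fold (D3 g) in EG.
    fold (r0 g) in EG. fold (r1 g) in EG. fold (r2 g) in EG. fold tau in EG.
    destruct (HC (-1 * r0 g) (-1 * r1 g) (-1 * r2 g)) as (L0 & L1 & L2).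
    fold (cr n11 n12 n13 g) in L0, L1, L2. fold (cr n21 n22 n23 g) in L0, L1, L2.
    fold (cr n31 n32 n33 g) in L0, L1, L2. fold q1 q2 c in L0, L1, L2.
    assert (forall x0 x1 x2 x3 y1 y2 y3, x1 * y1 + x2 * y2 + x3 * y3 = -1 * x0 ->
       (Wc x0 + Wc y1 * Wc x1 + Wc y2 * Wc x2 + Wc y3 * Wc x3)%W = 0%W) as HW.
    { intros. rewrite <- !Wc_mul, <- !Wc_add, <- Wc_0. f_equal. lra. }
    apply HW in L0. apply HW in L1. apply HW in L2.
    rewrite EG, E1, E2, E3. unfold S.
    match type of L0 with ?A = _ => match type of L1 with ?A1 = _ => match type of L2 with ?A2 = _ =>
      transitivity (A + tau * (A1 + tau * A2) + 
        tau * tau * tau * (D3 g + Wc (q1 g) * S1 + Wc (q2 g) * S2 + Wc (c g) * S3))%W end end end.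
    - ring.
    - rewrite L0, L1, L2. ring. }
  set (Sg := fun g => ((1 + Wc b * zeta) * S g)%W).
  set (Psi := fun g => Wm mK (Sg g)). set (Psi' := fun g => (Sg g - Wc kap * Psi g)%W).
  set (M := ((zeta + Wc b) * e1)%W). set (M' := (Wc (1 - b * b) * zeta * e1 * e1)%W).
  set (Phi := fun g => (Wc (q1 g) * zeta + Wc (q2 g) * (zeta * zeta) + M * M * Psi g)%W).
  set (U := fun g => (Wc (q1 g) * zeta + Wc (q2 g) * (Wc 2 * (zeta * zeta))
                + (Wc 2 * M * M' * Psi g + M * M * Psi' g))%W).
  assert (HSg : bO Sg) by now apply bO_mull.
  assert (HPsi : bO Psi) by (apply bO_m with (/ kap); [apply mK_le|auto]).
  assert (HPsi' : bO Psi') by (apply bO_sub; auto; now apply bO_mull).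
  assert (HPsih : forall g, Hol (Psi g)).
  { intros g. apply Hol_m with (/ kap); [apply mK_le|]. unfold Sg. specialize (HSh g). hol. }
  exists chi, c, U, Phi. split; [auto|]. split; [apply Hcr|]. split; [|split].
  { unfold U. repeat first [apply bO_add | apply bO_scal | apply bO_mull]; auto; apply Hcr. }
  { unfold Phi. repeat first [apply bO_add | apply bO_scal | apply bO_mull]; auto; apply Hcr. }
  intros g. specialize (HPsih g). specialize (HSh g). specialize (HPp g).
  assert (HM : Hol M) by (unfold M; hol). assert (HM' : Hol M') by (unfold M'; hol).
  assert (HPsih' : Hol (Psi' g)) by (unfold Psi', Sg; hol).
  assert (HPsiL : isL (Psi g) (Psi' g)).
  { intros k. unfold Psi'. rewrite cf_sub, cf_Wc_mul. unfold Psi.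
    rewrite (cf_m mK (/ kap)) by apply mK_le. unfold mK.
    destruct (Z_le_dec 0 k) as [H|H].
    - field. apply IZR_le in H. assert (Hk := kap_pos). lra.
    - assert (HSgh : Hol (Sg g)) by (unfold Sg; hol). rewrite HSgh by lia. ring. }
  assert (HPhL : isL (Phi g) (U g)).
  { assert (Hz2 := isL_mul _ _ _ _ zeta_isL zeta_isL).
    assert (HMM := isL_mul _ _ _ _ M_isL M_isL).
    assert (H := isL_add _ _ _ _ (isL_add _ _ _ _ (isL_scal (q1 g) _ _ zeta_isL) (isL_scal (q2 g) _ _ Hz2))
       (isL_mul _ _ _ _ HMM HPsiL)).
    apply isL_ext with (1 := H). fold M M'. unfold U. rewrite Wc_2. ring. }
  assert (Hode : ode (Phi g) (U g) = (Wc (c g) * C3 + Wc (chi g) * C0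
       - (1 - Wc b * zeta) * (zeta - Wc b) * Pp g)%W).
  { assert (HM2 := ode_M (Psi g) (Psi' g)).
    replace (Psi' g + Wc kap * Psi g)%W with (Sg g) in HM2 by (unfold Psi'; ring).
    fold M M' in HM2. unfold Sg in HM2.
    replace (e1 * ((1 + Wc b * zeta) * S g))%W with ((1 + B * zeta) * e1 * S g)%W in HM2 by (unfold B; ring).
    rewrite e1_inv in HM2.
    specialize (HQ g). rewrite tau_eq in HQ.
    replace (ode (Phi g) (U g)) with (Wc (q1 g) * ode zeta zeta + Wc (q2 g) * ode (zeta * zeta) (Wc 2 * (zeta * zeta))
      + ode (M * M * Psi g) (Wc 2 * M * M' * Psi g + M * M * Psi' g))%W by (unfold ode, Phi, U; ring).
    rewrite HM2. fold B.
    transitivity (Wc (q1 g) * ode zeta zeta + Wc (q2 g) * ode (zeta * zeta) (Wc 2 * (zeta * zeta))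
      + (zeta + B) * (zeta + B) * (zeta + B) * S g)%W; [ring|].
    rewrite <- HQ. unfold C1, C2, Ga. fold B.
    replace (Wc (chi g)) with (Wc (- (b * kap ^ 3)) * Wc (q1 g) + Wc (2 * b * b * kap ^ 3) * Wc (q2 g))%W
      by (unfold chi; now rewrite Wc_add, <- !Wc_mul).
    ring. }
  split; [unfold U; hol|]. split; [unfold Phi; hol|]. split; [auto|]. split; [|split].
  (* At zeta = 0 every term of the right-hand side vanishes: [Pp g] has no mean, [e1 - 1] vanishes,
     and the other terms carry a factor zeta. The mean of [Phi g] is therefore zero. *)
  - assert (H0 : S g 0%Z = 0).
    { specialize (HQ g). rewrite tau_eq in HQ. apply (f_equal (fun f => cf f 0%Z)) in HQ.
      revert HQ. unfold C1, C2, C3, C0, ode, Ga, B. cf0.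
      rewrite cf_Pp. unfold mp. simpl. intros HQ.
      apply Rmult_eq_reg_l with (b * b * b); [|apply Rgt_not_eq; repeat apply Rmult_lt_0_compat; lra].
      destruct (Z_lt_dec 0 0); [lia|]. lra. }
    unfold Phi. cf0. unfold Psi. rewrite (cf_m mK (/ kap)) by apply mK_le.
    unfold Sg. cf0. rewrite H0. ring.
  - destruct iv3_kap as (Y & HY & EY).
    (* The value of [U g] at -b; everything except the two monomials has a factor [zeta + b]. *)
    set (u0 := (- (B * Wc (q1 g)) + Wc 2 * B * B * Wc (q2 g))%W).
    set (u1 := (Wc (q1 g) + Wc 2 * Wc (q2 g) * (zeta - B) + (Wc 2 * e1 * M' * Psi g + e1 * M * Psi' g))%W).
    assert (EU : U g = (u0 + (zeta + B) * u1)%W).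
    { unfold U, u0, u1, M. fold B. ring. }
    exists (u0 * Y + u1 * (iv * iv * iv))%W. split; [unfold u0, u1, B; hol|].
    rewrite EU. fold B.
    transitivity (u0 * (iv * iv * iv) + (zeta + B) * (u1 * (iv * iv * iv)))%W; [ring|].
    rewrite EY at 1. fold B.
    replace (Wc (chi g)) with (u0 * (K * K * K))%W; [ring|].
    unfold u0, chi, B, K. rewrite <- !Wc_mul, <- Wc_opp, <- Wc_add, <- Wc_mul. f_equal. ring.
  - exact Hode.
Qed.
End Base.

Lemma Hs_opp f : Hs (- f) = (- Hs f)%W.
Proof. apply W_ext. intros k. rewrite cf_opp, !cf_Hs, cf_opp. ring. Qed.

Lemma conj_sym_part (m : R) (u : W) : conj (Wc m + (u + conj u))%W = (Wc m + (u + conj u))%W.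
Proof. rewrite !conj_add, conj_conj, conj_Wc. ring. Qed.

(** * A bounded right inverse of the linearization *)

Section Solve.
Variables b q : R.
Hypothesis Hb : 0 < b < 1 / 2.
Hypothesis Hq : q <> 0.

Let v := vv b.
Let i := iv b.
Let vb := conj v.
Let ib := conj i.
Let om := kap b * q.
Let X1 := (1 + Hs (p0 b))%W.

(** The surface speed of the explicit flow is the constant q, and [vv * conj vv] is [|z_alpha|]. *)
Definition Nbase : W := (- (Wc q * (vv b * conj (vv b))))%W.

Definition dNz (h : W) : W :=
  (Wc (kap b * q) * (Hs (J (Hs h) * p0 b + y0 b * Hs h)
      - (J (Hs h) * (1 + Hs (p0 b)) + y0 b * Hs (Hs h))))%W.

(** Left in the unsimplified form of the product rule, so that it matches the output of the [sdiff]
    rules. *)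
Definition Lin (h : W) : W :=
  ((Pz h + dNz h) * Nbase + Nbase * (Pz h + dNz h)
    - Wc (q * q) * ((Hs (Hs h) * (1 + Hs (p0 b)) + (1 + Hs (p0 b)) * Hs (Hs h))
                     - (Hs h * p0 b + p0 b * Hs h)))%W.

Let vi : (v * i)%W = 1%W := vv_iv b Hb.
Let vbi : (vb * ib)%W = 1%W := vb_ivb b Hb.

(** Count positive frequencies. In [v * ib^3 * conj U] they come only from the pole of [v] at -1/b
    and amount to [2 chi * e1] up to a constant. The equation says that [U * i * ib - kap * Phi] has
    the same ones, less those of [ga], plus [c * F2], which is antiholomorphic. *)
Lemma T_AH (ga U Phi X : W) (chi c : R) : Hol U -> Hol X ->
  (U * (i * i * i) = Wc chi + (zeta + Wc b) * X)%W ->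
  ode b Phi U = (Wc c * C3 b + Wc chi * C0 b - (1 - Wc b * zeta) * (zeta - Wc b) * Pp ga)%W ->
  AH (ga + U * i * ib - v * (ib * ib * ib) * conj U - Wc (kap b) * Phi)%W.
Proof.
  intros HU HX EX EO.
  assert (EXb : (conj U * (ib * ib * ib))%W = (Wc chi + (zbar + Wc b) * conj X)%W).
  { apply (f_equal conj) in EX.
    now rewrite !conj_mul, !conj_add, !conj_mul, !conj_add, !conj_Wc, conj_mon in EX. }
  set (E1 := e1 b) in *. set (E2 := e2 b) in *. set (F2 := conj E2).
  assert (He1 : ((1 + Wc b * zeta) * E1)%W = 1%W) by apply (e1_inv b Hb).
  assert (He2 : ((1 - Wc b * zeta) * E2)%W = 1%W) by apply (e2_inv b Hb).
  assert (Hf2 : ((1 - Wc b * zbar) * F2)%W = 1%W) by apply (f2_inv b Hb).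
  assert (Hi : i = ((1 + Wc b * zeta) * E2)%W) by reflexivity.
  assert (Hib : ib = ((1 + Wc b * zbar) * F2)%W) by apply ivb_eq.
  assert (EV : (v * (conj U * (ib * ib * ib)))%W =
     (Wc 2 * Wc chi * E1 + Wc 2 * zbar * conj X - (conj U * (ib * ib * ib)))%W).
  { unfold v. rewrite (vv_eq b Hb), EXb, Wc_2. fold E1.
    transitivity ((1 + 1) * Wc chi * E1 + (1 + 1) * (E1 * (Wc b + zbar)) * conj X
       - (Wc chi + (zbar + Wc b) * conj X))%W; [ring|].
    unfold E1. rewrite (e1_bt b Hb). ring. }
  assert (EU : (U * i * ib - Wc (kap b) * Phi)%W =
     (Wc c * F2 + Wc 2 * Wc chi * (E1 - 1) - Pp ga)%W).
  (* On the circle m is [1 / ((1 - b zeta) (zeta - b))]; multiplication by it undoes the clearing of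
     denominators in [ode]. *)
  { set (m := (zbar * E2 * F2)%W).
    assert (M1 : ((zeta - Wc b) * m)%W = E2).
    { transitivity ((zeta * zbar - Wc b * zbar) * F2 * E2)%W; [unfold m; ring|].
      rewrite zeta_zbar, Hf2. ring. }
    assert (M2 : ((zeta + Wc b) * m)%W = ((1 + Wc b * zbar) * F2 * E2)%W).
    { transitivity ((zeta * zbar + Wc b * zbar) * F2 * E2)%W; [unfold m; ring|].
      rewrite zeta_zbar. ring. }
    assert (M3 : ((1 - Wc b * zeta) * zeta * m)%W = F2).
    { transitivity (((1 - Wc b * zeta) * E2) * (zeta * zbar) * F2)%W; [unfold m; ring|].
      rewrite zeta_zbar, He2. ring. }
    apply (f_equal (fun f => (f * m)%W)) in EO.
    unfold ode, C3, C0 in EO. fold E1 in EO. rewrite Hi, Hib.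
    transitivity ((1 + Wc b * zeta) * ((zeta + Wc b) * m) * U
      - Wc (kap b) * ((1 - Wc b * zeta) * ((zeta - Wc b) * m)) * Phi)%W.
    { rewrite M1, M2, He2. ring. }
    transitivity (((1 + Wc b * zeta) * (zeta + Wc b) * U -
        Wc (kap b) * ((1 - Wc b * zeta) * (zeta - Wc b) * Phi)) * m)%W; [ring|].
    rewrite EO.
    transitivity (Wc c * ((1 - Wc b * zeta) * zeta * m) +
       ((1 - Wc b * zeta) * ((zeta - Wc b) * m)) * (Wc chi * Wc 2 * (E1 - 1) - Pp ga))%W; [ring|].
    rewrite M1, M3, He2. ring. }
  replace (ga + U * i * ib - v * (ib * ib * ib) * conj U - Wc (kap b) * Phi)%W
    with (ga + (U * i * ib - Wc (kap b) * Phi) - v * (conj U * (ib * ib * ib)))%W by ring.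
  rewrite EU, EV.
  replace (ga + (Wc c * F2 + Wc 2 * Wc chi * (E1 - 1) - Pp ga) -
    (Wc 2 * Wc chi * E1 + Wc 2 * zbar * conj X - conj U * (ib * ib * ib)))%W
    with ((ga - Pp ga) + Wc c * F2 - Wc 2 * Wc chi - Wc 2 * zbar * conj X + conj U * (ib * ib * ib))%W by ring.
  assert (HA : AH (ga - Pp ga)%W).
  { intros k Hk. rewrite cf_sub, cf_Pp. unfold mp. destruct (Z_lt_dec 0 k); [ring|lia]. }
  assert (HE2 := Hol_e2 b Hb). fold E2 in HE2. assert (HI := Hol_iv b Hb). fold i in HI.
  unfold F2, ib. hol.
Qed.

(** With [h = mu + U + conj U], the equation [Lin h = g] can be solved pointwise for [mu + dN],
    since [|z_alpha|] is invertible; the result is [R1]. It remains to make [R1 - dN] constant. It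
    is real, so holomorphy suffices, and modulo [Hol] this is the condition of [T_AH]. *)
Theorem lin_solve : exists C, forall g, sym g -> exists h, sym h /\ Lin h = g /\ nm h <= C * nm g.
Proof.
  destruct (solve_ode b Hb) as (chi & c & U0 & Phi0 & Hchi & Hc & HU & HPhi & HH).
  set (s := / (2 * (q * q))).
  (* Dividing by [v * conj v ^ 3] is the normalization in which U and its conjugate have the
     coefficients of [T_AH]. *)
  set (ga := fun g => (Wc s * g * (i * (ib * ib * ib)))%W).
  assert (Hga : forall X : W -> W, bO X -> bO (fun g => X (ga g))).
  { intros X [K1 H1]. assert (Hg : bO ga) by (apply bO_mulr, bO_mull, bO_id).
    destruct Hg as [K2 H2]. exists (Rmax K1 0 * K2). intros g. apply Rle_trans with (1 := H1 _).
    rewrite Rmult_assoc. apply Rle_trans with (Rmax K1 0 * nm (ga g)).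
    - apply Rmult_le_compat_r; [apply nm_pos|apply Rmax_l].
    - apply Rmult_le_compat_l; auto. apply Rmax_r. }
  set (U := fun g => U0 (ga g)). set (Phi := fun g => Phi0 (ga g)).
  assert (HUb : bO U) by now apply Hga. assert (HPb : bO Phi) by now apply Hga.
  set (eta := fun g => (Phi g + conj (Phi g))%W).
  set (pi := fun g => (U g - conj (U g))%W).
  set (hpi := fun g => (U g + conj (U g))%W).
  set (R1 := fun g => (- (Wc q * (Wc s * g + Zb b * conj (U g) + conj (Zb b) * U g) * (i * ib)))%W).
  set (dN := fun g => (Wc om * (Hs (eta g * p0 b + y0 b * pi g) - (eta g * X1 + y0 b * hpi g)))%W).
  (* Neither [R1] nor [dN] involves the mean of h, so it can be chosen last. *)
  set (mu := fun g => (R1 g - dN g)%W 0%Z).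
  set (h := fun g => (Wc (mu g) + (U g + conj (U g)))%W).
  assert (Heta : bO eta) by (apply bO_add; auto; now apply bO_conj).
  assert (Hpi : bO pi) by (apply bO_sub; auto; now apply bO_conj).
  assert (Hhpi : bO hpi) by (apply bO_add; auto; now apply bO_conj).
  assert (Hh : bO h).
  { apply bO_add; [|exact Hhpi]. apply bO_Wc, (bOs_cf (fun g => (R1 g - dN g)%W)). apply bO_sub.
    - apply bO_opp, bO_mulr, bO_mull, bO_add; [apply bO_add|].
      + apply bO_mull, bO_id.
      + now apply bO_mull, bO_conj.
      + now apply bO_mull.
    - apply bO_mull, bO_sub.
      + unfold Hs. apply bO_m with 1; [apply msg_le|]. apply bO_add; [now apply bO_mulr|now apply bO_mull].
      + apply bO_add; [now apply bO_mulr|now apply bO_mull]. }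
  destruct Hh as [Ch HCh]. exists Ch. intros g Hg. exists (h g).
  destruct (HH (ga g)) as (HUh & HPh & HL & HP0 & (X & HX & EX) & EO).
  fold (U g) in HUh, HL, EX, EO. fold (Phi g) in HPh, HL, HP0, EO.
  assert (HT := T_AH (ga g) (U g) (Phi g) X _ _ HUh HX EX EO).
  apply Hol_conj in HT.
  assert (Hgc : conj g = g) by now apply sym_conj.
  assert (HU0 : U g 0%Z = 0) by (rewrite HL; ring).
  assert (HHU : Hs (U g) = U g) by now apply Hs_Hol.
  assert (HHUb : Hs (conj (U g)) = (- conj (U g))%W) by now rewrite Hs_conj, HHU.
  assert (HJ : J (U g) = Phi g) by now apply J_isL.
  assert (Ehs : Hs (h g) = pi g).
  { unfold h, pi. rewrite !Hs_add, Hs_Wc, HHU, HHUb. ring. }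
  assert (Ehs2 : Hs (pi g) = hpi g).
  { unfold hpi, pi. rewrite Hs_sub, HHU, HHUb. ring. }
  assert (EJ : J (pi g) = eta g).
  { unfold pi, eta. rewrite J_sub, J_conj, HJ. ring. }
  assert (Eetac : conj (eta g) = eta g) by (unfold eta; rewrite conj_add, conj_conj; ring).
  assert (Epic : conj (pi g) = (- pi g)%W) by (unfold pi; rewrite conj_sub, conj_conj; ring).
  assert (Ehpic : conj (hpi g) = hpi g) by (unfold hpi; rewrite conj_add, conj_conj; ring).
  assert (Ep0c : conj (p0 b) = (- p0 b)%W) by (unfold p0; rewrite conj_sub, conj_conj; ring).
  assert (Ey0c : conj (y0 b) = y0 b) by (unfold y0; rewrite conj_add, conj_conj; ring).
  assert (EX1 : X1 = (1 + P0 b + conj (P0 b))%W) by (unfold X1; rewrite (Hs_p0 b Hb); ring).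
  assert (EX1c : conj X1 = X1) by (rewrite EX1, !conj_add, conj_conj, conj_1; ring).
  assert (Eibc : conj ib = i) by apply conj_conj.
  assert (HR1c : conj (R1 g) = R1 g).
  { unfold R1. rewrite conj_opp, !conj_mul, !conj_add, !conj_mul, !conj_conj, !conj_Wc, Hgc, Eibc.
    fold ib. ring. }
  set (Y := (eta g * p0 b + y0 b * pi g)%W).
  assert (EYc : conj Y = (- Y)%W).
  { unfold Y. rewrite conj_add, !conj_mul, Eetac, Ep0c, Ey0c, Epic. ring. }
  assert (HdNc : conj (dN g) = dN g).
  { unfold dN. fold Y. rewrite conj_mul, conj_Wc, conj_sub, conj_add, !conj_mul, Eetac, Ey0c, Ehpic, EX1c.
    assert (H := Hs_conj Y). rewrite EYc, Hs_opp in H.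
    assert (E : conj (Hs Y) = Hs Y); [|rewrite E; reflexivity]. symmetry.
    transitivity (- - Hs Y)%W; [ring|]. rewrite H. ring. }
  assert (HZi : (Zb b * (i * i))%W = 1%W).
  { unfold Zb. fold v. transitivity ((v * i) * (v * i))%W; [ring|]. rewrite vi. ring. }
  assert (Hom : Wc om = (Wc (kap b) * Wc q)%W) by (unfold om; apply Wc_mul).
  (* After [Zb] is factored out, what remains is [- conj T], holomorphic by [T_AH], plus products of
     holomorphic factors; [A0] is one of them by [base_Hol]. *)
  assert (HRH : Hol (R1 g + Wc om * (eta g * Zb b + (1 + 1) * (y0 b * U g)))%W).
  { set (A0 := (Wc (kap b) * y0 b - vb * i)%W).
    assert (HA0 : Hol A0) by apply (base_Hol b Hb).
    set (T := (ga g + U g * i * ib - v * (ib * ib * ib) * conj (U g) - Wc (kap b) * Phi g)%W) in HT.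
    assert (ET : conj T = (Wc s * g * (ib * (i * i * i)) + conj (U g) * ib * i
       - vb * (i * i * i) * U g - Wc (kap b) * conj (Phi g))%W).
    { unfold T, ga. rewrite !conj_sub, conj_add, !conj_mul, !conj_conj, !conj_Wc, Hgc, Eibc. reflexivity. }
    assert (E : (R1 g + Wc om * (eta g * Zb b + (1 + 1) * (y0 b * U g)))%W
      = (Zb b * (Wc q * (- conj T + Wc (kap b) * Phi g + (1 + 1) * A0 * U g * (i * i))))%W).
    { rewrite ET, Hom. unfold A0, R1, eta.
      assert (EZ : conj (Zb b) = (vb * vb)%W) by apply conj_mul.
      set (q' := Wc q). set (k' := Wc (kap b)). set (sg := (Wc s * g)%W).
      set (Ub := conj (U g)). set (Pb := conj (Phi g)). set (z := Zb b) in *. set (u := U g).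
      transitivity (q' * (- (sg * (i * ib) * (z * (i * i)) + z * Ub * (i * ib) * (z * (i * i))
          + vb * (vb * ib) * i * u * (z * (i * i)))
          + k' * ((Phi g + Pb) * z + (1 + 1) * (y0 b * u) * (z * (i * i))) ))%W.
      - rewrite HZi, EZ. unfold q', k', sg, Ub, Pb, u. ring.
      - rewrite vbi.
        transitivity (z * (q' * (- (sg * (ib * (i * i * i)) + (z * (i * i)) * Ub * ib * i
          - vb * (i * i * i) * u - k' * Pb) + k' * Phi g +
          (1 + 1) * (k' * y0 b - vb * i) * u * (i * i))))%W.
        + ring.
        + rewrite HZi. unfold q', k', sg, Ub, Pb, u. ring. }
    rewrite E. assert (HI := Hol_iv b Hb). fold i in HI. assert (HV := Hol_vv b Hb).
    unfold Zb. hol. }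
  assert (HdH : Hol (dN g + Wc om * (eta g * Zb b + (1 + 1) * (y0 b * U g)))%W).
  { assert (E : (dN g + Wc om * (eta g * Zb b + (1 + 1) * (y0 b * U g)))%W = (Wc om * (Hs Y + Y))%W).
    { unfold dN. fold Y. rewrite (Zb_eq b Hb), EX1, Wc_2. unfold Y, p0, pi, hpi. ring. }
    rewrite E. apply Hol_mul; [apply Hol_Wc|apply Hol_Hs_plus]. }
  assert (Hmu : (R1 g - dN g)%W = Wc (mu g)).
  { apply Hol_sym_const.
    - replace (R1 g - dN g)%W with
       ((R1 g + Wc om * (eta g * Zb b + (1 + 1) * (y0 b * U g))) -
        (dN g + Wc om * (eta g * Zb b + (1 + 1) * (y0 b * U g))))%W by ring.
      now apply Hol_sub.
    - apply sym_conj. rewrite conj_sub, HR1c, HdNc. reflexivity. }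
  split; [|split; [|apply HCh]].
  - exact (proj2 (sym_conj (h g)) (conj_sym_part (mu g) (U g))).
  - unfold Lin, dNz. rewrite Ehs, EJ, Ehs2. fold om X1. fold (dN g).
    assert (EPz : Pz (h g) = Wc (mu g)).
    { rewrite Pz_Wc. f_equal. unfold h. rewrite cf_add, cf_add, cf_conj. change (- 0)%Z with 0%Z.
      rewrite HU0, cf_Wc. simpl. ring. }
    rewrite EPz, <- Hmu. replace (R1 g - dN g + dN g)%W with (R1 g) by ring.
    unfold Nbase. fold v. fold vb.
    assert (E1 : (hpi g * X1 - pi g * p0 b)%W = (Zb b * conj (U g) + conj (Zb b) * U g)%W).
    { rewrite EX1, (Zb_eq b Hb), conj_add, conj_mul, conj_1, conj_Wc, Wc_2. unfold hpi, pi, p0. ring. }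
    transitivity ((1 + 1) * (- (Wc q * (v * vb)) * R1 g) - (1 + 1) * Wc (q * q) * (hpi g * X1 - pi g * p0 b))%W;
      [ring|].
    rewrite E1. unfold R1.
    set (V := (Zb b * conj (U g) + conj (Zb b) * U g)%W).
    transitivity ((1 + 1) * (Wc q * Wc q * ((v * i) * (vb * ib)) * (Wc s * g + V)) - (1 + 1) * Wc (q * q) * V)%W.
    { unfold V. ring. }
    rewrite vi, vbi, <- Wc_mul.
    transitivity (((1 + 1) * Wc (q * q) * Wc s) * g)%W; [ring|].
    rewrite <- Wc_2, <- !Wc_mul. replace (2 * (q * q) * s) with 1 by (unfold s; field; auto).
    rewrite Wc_1. ring.
Qed.
End Solve.

(** * The nonlinear problem *)

(* The Dirichlet-to-Neumann multiplier of the strip of depth d is k * mH d k; the cut-off at depth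
   1 keeps it bounded for every real d. *)
Definition mH (d : R) (k : Z) : R :=
  if Z.eq_dec k 0 then 0 else cosh (IZR k * Rmax 1 d) / sinh (IZR k * Rmax 1 d).

Lemma sinh_opp x : sinh (- x) = - sinh x.
Proof. unfold sinh. rewrite Ropp_involutive. field. Qed.
Lemma cosh_opp x : cosh (- x) = cosh x.
Proof. unfold cosh. rewrite Ropp_involutive. field. Qed.

Lemma sinh_ge (x : R) : 0 <= x -> x / 2 <= sinh x.
Proof.
  intros Hx. unfold sinh. assert (H1 := exp_ineq1_le x).
  assert (H2 : exp (- x) <= 1) by (rewrite <- exp_0; destruct (Req_dec x 0); [subst; rewrite Ropp_0; lra|left; apply exp_increasing; lra]).
  lra.
Qed.

Lemma coth_minus_1 (x : R) : 0 < x -> cosh x / sinh x - 1 = exp (- x) / sinh x.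
Proof.
  intros Hx. assert (0 < sinh x) by (generalize (sinh_ge x); lra).
  unfold cosh, sinh in *. field. lra.
Qed.

Lemma mH_opp d k : mH d (- k) = - mH d k.
Proof.
  unfold mH. destruct (Z.eq_dec k 0), (Z.eq_dec (- k) 0); try lia; [ring|].
  rewrite opp_IZR, Ropp_mult_distr_l_reverse, sinh_opp, cosh_opp.
  assert (sinh (IZR k * Rmax 1 d) <> 0).
  { assert (Hm := Rmax_l 1 d). intros E. 
    assert (IZR k * Rmax 1 d <> 0) by (apply Rmult_integral_contrapositive; split; [now apply IZR_neq|lra]).
    destruct (Rtotal_order (IZR k * Rmax 1 d) 0) as [H1|[H1|H1]]; [|lra|].
    - generalize (sinh_lt _ _ H1). rewrite sinh_0. lra.
    - generalize (sinh_lt _ _ H1). rewrite sinh_0. lra. }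
  field. auto.
Qed.

(** From [coth x - 1 = exp (- x) / sinh x] and [sinh x >= x / 2]. The rate is crude but uniform in
    k, which gives convergence in operator norm. *)
Lemma mH_sgn d k : Rabs (mH d k - msg k) <= 2 / Rmax 1 d.
Proof.
  assert (Hm := Rmax_l 1 d).
  assert (Hpos : forall k, (0 < k)%Z -> Rabs (mH d k - msg k) <= 2 / Rmax 1 d).
  { clear k. intros k Hk. unfold mH, msg. destruct (Z.eq_dec k 0); [lia|].
    rewrite Z.sgn_pos by auto.
    assert (H1 : 1 <= IZR k) by (apply IZR_le; lia).
    set (D := Rmax 1 d) in *. set (x := IZR k * D).
    assert (Hx : D <= x) by (unfold x; nra).
    rewrite coth_minus_1 by lra.
    assert (Hs := sinh_ge x ltac:(lra)).
    assert (He : 0 < exp (- x) <= 1).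
    { split; [apply exp_pos|]. rewrite <- exp_0. left. apply exp_increasing. lra. }
    rewrite Rabs_pos_eq by (apply Rlt_le, Rdiv_lt_0_compat; lra).
    apply Rmult_le_reg_r with (sinh x * D); [apply Rmult_lt_0_compat; lra|].
    replace (exp (- x) / sinh x * (sinh x * D)) with (exp (- x) * D) by (field; lra).
    replace (2 / D * (sinh x * D)) with (2 * sinh x) by (field; lra). nra. }
  assert (H2 : 0 <= 2 / Rmax 1 d) by (apply Rlt_le, Rdiv_lt_0_compat; lra).
  destruct (Z.lt_trichotomy k 0) as [H|[->|H]]; auto.
  - specialize (Hpos (- k)%Z ltac:(lia)). rewrite mH_opp in Hpos. unfold msg in *.
    rewrite Z.sgn_opp, opp_IZR in Hpos. rewrite <- Rabs_Ropp.
    now replace (- (mH d k - IZR (Z.sgn k))) with (- mH d k - - IZR (Z.sgn k)) by ring.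
  - unfold mH, msg. simpl. rewrite Rminus_0_r, Rabs_R0. auto.
Qed.

Lemma mH_le d k : Rabs (mH d k) <= 3.
Proof.
  assert (H := mH_sgn d k). assert (H1 := msg_le k). assert (Hm := Rmax_l 1 d).
  assert (2 / Rmax 1 d <= 2).
  { apply Rmult_le_reg_r with (Rmax 1 d); [lra|]. unfold Rdiv. rewrite Rmult_assoc, Rinv_l by lra. lra. }
  assert (H2 := Rabs_triang (mH d k - msg k) (msg k)).
  replace (mH d k - msg k + msg k) with (mH d k) in H2 by ring. lra.
Qed.

Definition Hd (d : R) (f : W) : W := Wm (mH d) f.
Lemma cf_Hd d f k : Hd d f k = mH d k * f k.
Proof. apply cf_m with 3, mH_le. Qed.

Lemma Hd_sub d f g : Hd d (f - g)%W = (Hd d f - Hd d g)%W.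
Proof. apply W_ext. intros k. rewrite cf_sub, !cf_Hd, cf_sub. ring. Qed.
Lemma Hd_opp d f : Hd d (- f)%W = (- Hd d f)%W.
Proof. apply W_ext. intros k. rewrite cf_opp, !cf_Hd, cf_opp. ring. Qed.
Lemma Hd_conj d f : Hd d (conj f) = (- conj (Hd d f))%W.
Proof. apply W_ext. intros k. rewrite cf_opp, cf_Hd, !cf_conj, cf_Hd, mH_opp. ring. Qed.

Lemma sdiff_Hd x0 F F0 L : sdiff x0 F F0 L ->
  sdiff x0 (fun G d x => Hd d (F G d x)) (Hs F0) (fun h => Hs (L h)).
Proof.
  apply sdiff_op.
  - apply Hd_sub.
  - exists 1. split; [lra|]. intros h. apply nm_m, msg_le.
  - intros eps He. exists 1, (2 / eps). split; [lra|]. intros _ d _ Hd2 f.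
    replace (Hd d f - Hs f)%W with (Wm (fun k => mH d k - msg k) f).
    + apply Rle_trans with (2 / Rmax 1 d * nm f).
      * apply nm_m, mH_sgn.
      * apply Rmult_le_compat_r; [apply nm_pos|].
        assert (Hm1 := Rmax_l 1 d). assert (Hm2 := Rmax_r 1 d).
        apply Rmult_le_reg_r with (Rmax 1 d / eps); [apply Rdiv_lt_0_compat; lra|].
        replace (2 / Rmax 1 d * (Rmax 1 d / eps)) with (2 / eps) by (field; lra).
        replace (eps * (Rmax 1 d / eps)) with (Rmax 1 d) by (field; lra). lra.
    + apply W_ext. intros k. rewrite cf_sub, cf_Hd, cf_Hs.
      rewrite cf_m with (c := 2 / Rmax 1 d) by apply mH_sgn. ring.
Qed.

Lemma sdiff_fix (m : Z -> R) x0 F F0 L : (forall k, Rabs (m k) <= 1) -> sdiff x0 F F0 L ->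
  sdiff x0 (fun G d x => Wm m (F G d x)) (Wm m F0) (fun h => Wm m (L h)).
Proof.
  intros Hm. apply (sdiff_op x0 F0 F L (fun _ => Wm m) (Wm m)).
  - intros _ f g. apply W_ext. intros k. rewrite cf_sub, !(cf_m m 1), cf_sub by auto. ring.
  - exists 1. split; [lra|]. intros h. apply nm_m, Hm.
  - intros eps He. apply near_true. intros _ _ f.
    replace (Wm m f - Wm m f)%W with 0%W by ring. rewrite nm_0.
    apply Rmult_le_pos; [lra|apply nm_pos].
Qed.

(* The unknown x encodes the wave: x 0 is the mean on the surface of g', the derivative of [gf],
   and sgn(k) x_k = k y_k, where y (of mean zero) is the surface elevation.  [Xd] is
   x_alpha, [Nd] the tangential velocity times |z_alpha|. *)
Definition yx (x : W) : W := J (Hs x).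
Definition Xd (d : R) (x : W) : W := (1 + Hd d (Hs x))%W.
Definition Nd (Om d : R) (x : W) : W :=
  (Pz x + Wc Om * (Hd d (yx x * Hs x) - yx x * Xd d x))%W.
(** Bernoulli's law multiplied by [2 |z_alpha|^2]; [B2] is twice the Bernoulli constant. As [Hs x]
    is imaginary on the circle, [Xd^2 - (Hs x)^2] is [|z_alpha|^2]. *)
Definition EE (Om B2 G d : R) (x : W) : W :=
  (Nd Om d x * Nd Om d x - (Wc B2 - Wc 2 * Wc G * yx x) * (Xd d x * Xd d x - Hs x * Hs x))%W.

Section Syms.
Variable x : W.
Hypothesis Hx : sym x.
Lemma Hs_anti : conj (Hs x) = (- Hs x)%W.
Proof. apply sym_conj in Hx. assert (H := Hs_conj x). rewrite Hx in H.
  transitivity (- - conj (Hs x))%W; [ring|]. rewrite <- H. ring. Qed.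
Lemma yx_sym : conj (yx x) = yx x.
Proof.
  unfold yx. assert (H := J_conj (Hs x)). rewrite Hs_anti in H.
  replace (- Hs x)%W with (0 - Hs x)%W in H by ring. rewrite J_sub in H.
  assert (H0 : J 0 = 0%W) by (apply W_ext; intros k; rewrite cf_J, cf_W0; ring).
  rewrite H0 in H. transitivity (- - conj (J (Hs x)))%W; [ring|]. rewrite <- H. ring.
Qed.
Lemma Xd_sym d : conj (Xd d x) = Xd d x.
Proof.
  unfold Xd. rewrite conj_add, conj_1. f_equal. assert (H := Hd_conj d (Hs x)).
  rewrite Hs_anti, Hd_opp in H. transitivity (- - conj (Hd d (Hs x)))%W; [ring|]. rewrite <- H. ring.
Qed.
Lemma Nd_sym Om d : conj (Nd Om d x) = Nd Om d x.
Proof.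
  unfold Nd. rewrite conj_add, conj_mul, conj_Wc, conj_sub, conj_mul, yx_sym, Xd_sym.
  assert (H := Hd_conj d (yx x * Hs x)%W). rewrite conj_mul, yx_sym, Hs_anti in H.
  replace (yx x * - Hs x)%W with (- (yx x * Hs x))%W in H by ring. rewrite Hd_opp in H.
  replace (conj (Hd d (yx x * Hs x)%W)) with (Hd d (yx x * Hs x)%W).
  - rewrite Pz_Wc, conj_Wc. reflexivity.
  - transitivity (- - Hd d (yx x * Hs x))%W; [ring|]. rewrite H. ring.
Qed.
Lemma EE_sym Om B2 G d : sym (EE Om B2 G d x).
Proof.
  apply sym_conj. unfold EE.
  rewrite conj_sub, !conj_mul, !conj_sub, !conj_mul, !conj_Wc, Nd_sym, Xd_sym, yx_sym, Hs_anti. ring.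
Qed.
End Syms.

(** * Existence of solutions near the explicit one *)

Section Exist.
Variables b q : R.
Hypothesis Hb : 0 < b < 1 / 2.
Hypothesis Hq : q <> 0.

(** The mean is read off from the zeroth coefficient of [N_x0]; that all other coefficients of that
    identity agree is its actual content. *)
Definition x0 : W :=
  (Wc ((Nbase b q - Wc (kap b * q) * (Hs (y0 b * p0 b) - y0 b * (1 + Hs (p0 b))))%W 0%Z) + Hs (p0 b))%W.

Lemma Hs_x0 : Hs x0 = p0 b.
Proof.
  unfold x0. rewrite Hs_add, Hs_Wc, (Hs_p0 b Hb), Hs_add, Hs_conj, Hs_Hol;
    [unfold p0; ring|now apply Hol_P0|now apply P0_0].
Qed.

Lemma x0_sym : sym x0.
Proof.
  apply sym_conj. unfold x0. rewrite conj_add, conj_Wc, (Hs_p0 b Hb), conj_add, conj_conj. ring.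
Qed.

Lemma yx_x0 : yx x0 = y0 b.
Proof. unfold yx. rewrite Hs_x0. now apply y0_J. Qed.

(** The difference D is real on the circle. Trading [Hs Y] for [- Y] and factoring out [Zb] leaves
    the expression of [base_Hol], so D is also holomorphic, hence constant. *)
Lemma N_x0 : (Pz x0 + Wc (kap b * q) * (Hs (y0 b * p0 b) - y0 b * (1 + Hs (p0 b))))%W = Nbase b q.
Proof.
  set (D := (Nbase b q - Wc (kap b * q) * (Hs (y0 b * p0 b) - y0 b * (1 + Hs (p0 b))))%W).
  assert (Ep0c : conj (p0 b) = (- p0 b)%W) by (unfold p0; rewrite conj_sub, conj_conj; ring).
  assert (Ey0c : conj (y0 b) = y0 b) by (unfold y0; rewrite conj_add, conj_conj; ring).
  assert (EX1 : (1 + Hs (p0 b))%W = (1 + P0 b + conj (P0 b))%W) by (rewrite (Hs_p0 b Hb); ring).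
  assert (EX1c : conj (1 + Hs (p0 b)) = (1 + Hs (p0 b))%W) by (rewrite EX1, !conj_add, conj_conj, conj_1; ring).
  set (Y := (y0 b * p0 b)%W) in *.
  assert (EYc : conj Y = (- Y)%W) by (unfold Y; rewrite conj_mul, Ep0c, Ey0c; ring).
  assert (EYs : conj (Hs Y) = Hs Y).
  { assert (H := Hs_conj Y). rewrite EYc, Hs_opp in H. symmetry.
    transitivity (- - Hs Y)%W; [ring|]. rewrite H. ring. }
  assert (HD : D = Wc (D 0%Z)).
  { apply Hol_sym_const.
    - replace D with (Zb b * (Wc q * (Wc (kap b) * y0 b - conj (vv b) * iv b)) - Wc (kap b * q) * (Hs Y + Y))%W.
      + assert (H1 := base_Hol b Hb). assert (H2 := Hol_vv b Hb). assert (H3 := Hol_Hs_plus Y).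
        unfold Zb. apply Hol_sub; apply Hol_mul; try exact H3; try apply Hol_Wc.
        * now apply Hol_mul.
        * apply Hol_mul; [apply Hol_Wc|exact H1].
      + assert (E : (1 + Hs (p0 b))%W = (Zb b - p0 b)%W).
        { rewrite EX1, (Zb_eq b Hb), Wc_2. unfold p0. ring. }
        unfold D. rewrite E. unfold Nbase, Y. rewrite Wc_mul.
        assert (EZ : (Zb b * iv b)%W = vv b).
        { unfold Zb. transitivity (vv b * (vv b * iv b))%W; [ring|]. rewrite vv_iv by auto. ring. }
        transitivity (Wc q * Wc (kap b) * y0 b * Zb b - Wc q * conj (vv b) * (Zb b * iv b)
          - Wc (kap b) * Wc q * (Hs (y0 b * p0 b) + y0 b * p0 b))%W; [ring|].
        rewrite EZ. ring.
    - apply sym_conj. unfold D. rewrite conj_sub, conj_mul, conj_sub, conj_mul, conj_Wc, EYs, Ey0c, EX1c.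
      unfold Nbase. rewrite conj_opp, !conj_mul, conj_Wc, conj_conj. ring. }
  assert (HP : Pz x0 = Wc (D 0%Z)).
  { rewrite Pz_Wc. unfold x0. fold Y. fold D. rewrite cf_add, cf_Wc, cf_Hs. unfold msg. simpl.
    f_equal. ring. }
  rewrite HP, <- HD. unfold D. ring.
Qed.

(** The residual at [x0] vanishes since [Nbase^2 = q^2 * Zb * conj Zb] and [Zb = 1 + 2 P0]; the
    derivative is the rules of [sdiff] put together. *)
Lemma EE_sdiff : sdiff x0 (fun G d x => EE (kap b * q) (q * q) G d x) 0%W (Lin b q).
Proof.
  assert (Dp := sdiff_fix msg x0 _ _ _ msg_le (sdiff_id x0)).
  fold (Hs x0) in Dp. rewrite Hs_x0 in Dp.
  assert (Dy := sdiff_fix mJ x0 _ _ _ mJ_le Dp).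
  fold (J (p0 b)) in Dy. rewrite (y0_J b Hb) in Dy.
  assert (DX := sdiff_add _ _ _ _ _ _ _ (sdiff_const x0 1%W) (sdiff_Hd _ _ _ _ Dp)).
  assert (DN := sdiff_add _ _ _ _ _ _ _ (sdiff_fix m0 x0 _ _ _ m0_le (sdiff_id x0))
    (sdiff_mul _ _ _ _ _ _ _ (sdiff_const x0 (Wc (kap b * q)))
      (sdiff_add _ _ _ _ _ _ _ (sdiff_Hd _ _ _ _ (sdiff_mul _ _ _ _ _ _ _ Dy Dp))
         (sdiff_mul _ _ _ _ _ _ _ (sdiff_const x0 (Wc (-1))) (sdiff_mul _ _ _ _ _ _ _ Dy DX))))).
  assert (Dq := sdiff_add _ _ _ _ _ _ _ (sdiff_const x0 (Wc (q * q)))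
     (sdiff_mul _ _ _ _ _ _ _ (sdiff_mul _ _ _ _ _ _ _ (sdiff_const x0 (Wc (-2))) (sdiff_G x0)) Dy)).
  assert (DZ := sdiff_add _ _ _ _ _ _ _ (sdiff_mul _ _ _ _ _ _ _ DX DX)
    (sdiff_mul _ _ _ _ _ _ _ (sdiff_const x0 (Wc (-1))) (sdiff_mul _ _ _ _ _ _ _ Dp Dp))).
  assert (DE := sdiff_add _ _ _ _ _ _ _ (sdiff_mul _ _ _ _ _ _ _ DN DN)
    (sdiff_mul _ _ _ _ _ _ _ (sdiff_const x0 (Wc (-1))) (sdiff_mul _ _ _ _ _ _ _ Dq DZ))).
  assert (Em1 : Wc (-1) = (- (1))%W) by (rewrite <- Wc_1, <- Wc_opp; reflexivity).
  assert (Em2 : Wc (-2) = (- (1 + 1))%W) by (rewrite <- Wc_2, <- Wc_opp; reflexivity).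
  refine (sdiff_ext _ _ _ _ _ _ _ _ _ _ DE); clear - Em1 Em2 Hb Hq.
  - intros G d x. rewrite Em1, Em2. fold (Hs x) (J (Hs x)) (Pz x). unfold EE, Nd, Xd, yx. rewrite Wc_2. ring.
  - rewrite Em1. fold (Pz x0).
    assert (HN := N_x0).
    transitivity ((Pz x0 + Wc (kap b * q) * (Hs (y0 b * p0 b) - y0 b * (1 + Hs (p0 b)))) *
      (Pz x0 + Wc (kap b * q) * (Hs (y0 b * p0 b) - y0 b * (1 + Hs (p0 b))))
      - Wc (q * q) * ((1 + Hs (p0 b)) * (1 + Hs (p0 b)) - p0 b * p0 b))%W; [ring|].
    rewrite HN, (Hs_p0 b Hb). unfold Nbase, p0.
    transitivity (Wc q * Wc q * (Zb b * conj (Zb b)) - Wc (q * q) * ((1 + Wc 2 * P0 b) * (1 + Wc 2 * conj (P0 b))))%W.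
    { unfold Zb. rewrite conj_mul, Wc_2. ring. }
    rewrite (Zb_eq b Hb), conj_add, conj_mul, conj_1, conj_Wc, Wc_mul. ring.
  - intros h. rewrite Em1, Em2. fold (Hs h) (J (Hs h)) (Pz h) (Pz x0).
    assert (HN := N_x0). unfold Lin, dNz. rewrite <- HN.
    set (A1 := Hs (J (Hs h) * p0 b + y0 b * Hs h)%W). set (A2 := Hs (y0 b * p0 b)). ring.
Qed.

Theorem wave_exists (eta : R) : 0 < eta ->
  near (fun G d => exists x, sym x /\ nm (x - x0) <= eta /\ EE (kap b * q) (q * q) G d x = 0%W).
Proof.
  destruct (lin_solve b q Hb Hq) as [C HC].
  apply (newton x0 (fun G d x => EE (kap b * q) (q * q) G d x) (Lin b q) C EE_sdiff x0_sym).
  - intros G d x Hx. now apply EE_sym.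
  - exact HC.
Qed.
End Exist.

(** * Exponential series in a strip *)

Lemma Re_le_Cmod (z : C) : Rabs (Re z) <= Cmod z.
Proof. apply Rle_trans with (2 := Rmax_Cmod z), Rmax_l. Qed.
Lemma Im_le_Cmod (z : C) : Rabs (Im z) <= Cmod z.
Proof. apply Rle_trans with (2 := Rmax_Cmod z), Rmax_r. Qed.
Lemma Cmod_le_sum (z : C) : Cmod z <= Rabs (Re z) + Rabs (Im z).
Proof.
  destruct z as [x y]. unfold Cmod; simpl.
  apply Rsqr_incr_0_var.
  - rewrite Rsqr_sqrt by nra. unfold Rsqr.
    assert (H1 := Rabs_pos x). assert (H2 := Rabs_pos y).
    assert (H3 : Rabs x * Rabs x = x * x) by (rewrite <- Rabs_mult; apply Rabs_pos_eq; nra).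
    assert (H4 : Rabs y * Rabs y = y * y) by (rewrite <- Rabs_mult; apply Rabs_pos_eq; nra).
    nra.
  - apply Rplus_le_le_0_compat; apply Rabs_pos.
Qed.

Lemma C_ext (z w : C) : Re z = Re w -> Im z = Im w -> z = w.
Proof. destruct z, w. simpl. now intros -> ->. Qed.

Lemma Re_plus (z w : C) : Re (z + w)%C = Re z + Re w.
Proof. reflexivity. Qed.
Lemma Im_plus (z w : C) : Im (z + w)%C = Im z + Im w.
Proof. reflexivity. Qed.
Lemma Re_minus (z w : C) : Re (z - w)%C = Re z - Re w.
Proof. reflexivity. Qed.
Lemma Im_minus (z w : C) : Im (z - w)%C = Im z - Im w.
Proof. reflexivity. Qed.

Definition CS (f : Z -> C) : C := (SumZ (fun k => Re (f k)), SumZ (fun k => Im (f k))).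

Lemma CS_bound (f : Z -> C) (g : Z -> R) : (forall k, Cmod (f k) <= g k) -> sumable g ->
  sumable (fun k => Re (f k)) /\ sumable (fun k => Im (f k)) /\ Cmod (CS f) <= 2 * SumZ g.
Proof.
  intros H Hg.
  assert (H1 : forall k, Rabs (Re (f k)) <= g k) by (intros k; apply Rle_trans with (1 := Re_le_Cmod _), H).
  assert (H2 : forall k, Rabs (Im (f k)) <= g k) by (intros k; apply Rle_trans with (1 := Im_le_Cmod _), H).
  split; [|split].
  - now apply sumable_le with g.
  - now apply sumable_le with g.
  - apply Rle_trans with (1 := Cmod_le_sum _). simpl.
    generalize (SumZ_bound _ _ H1 Hg) (SumZ_bound _ _ H2 Hg). lra.
Qed.

Definition Csumable (f : Z -> C) : Prop :=
  sumable (fun k => Re (f k)) /\ sumable (fun k => Im (f k)).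

Lemma Csumable_le (f : Z -> C) (g : Z -> R) : (forall k, Cmod (f k) <= g k) -> sumable g -> Csumable f.
Proof. intros H Hg. destruct (CS_bound f g H Hg) as (H1 & H2 & _). now split. Qed.

Lemma CS_ext (f g : Z -> C) : (forall k, f k = g k) -> CS f = CS g.
Proof. intros H. unfold CS. f_equal; apply SumZ_ext; intros; now rewrite H. Qed.

Lemma Csumable_scal (c : C) (f : Z -> C) : Csumable f -> Csumable (fun k => c * f k)%C.
Proof.
  intros [H1 H2]. split.
  - apply sumable_ext with (fun k => Re c * Re (f k) + (- Im c) * Im (f k)).
    + intros k. destruct c, (f k). simpl. ring.
    + apply sumable_plus; now apply sumable_scal.
  - apply sumable_ext with (fun k => Re c * Im (f k) + Im c * Re (f k)).
    + intros k. destruct c, (f k). simpl. ring.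
    + apply sumable_plus; now apply sumable_scal.
Qed.

Lemma CS_scal (c : C) (f : Z -> C) : Csumable f -> CS (fun k => c * f k)%C = (c * CS f)%C.
Proof.
  intros [H1 H2]. apply C_ext; simpl.
  - rewrite (SumZ_ext _ (fun k => Re c * Re (f k) + (- Im c) * Im (f k))).
    + rewrite SumZ_plus, !SumZ_scal by now apply sumable_scal. unfold Re, Im. simpl. ring.
    + intros k. destruct c, (f k). simpl. ring.
  - rewrite (SumZ_ext _ (fun k => Re c * Im (f k) + Im c * Re (f k))).
    + rewrite SumZ_plus, !SumZ_scal by now apply sumable_scal. unfold Re, Im. simpl. ring.
    + intros k. destruct c, (f k). simpl. ring.
Qed.

Lemma CS_minus (f g : Z -> C) : Csumable f -> Csumable g ->
  Csumable (fun k => f k - g k)%C /\ CS (fun k => f k - g k)%C = (CS f - CS g)%C.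
Proof.
  intros [H1 H2] [H3 H4]. 
  assert (S1 := sumable_scal (-1) _ H3). assert (S2 := sumable_scal (-1) _ H4).
  assert (T1 := sumable_plus _ _ H1 S1). assert (T2 := sumable_plus _ _ H2 S2).
  split; [split|].
  - apply sumable_ext with (2 := T1). intros k. destruct (f k), (g k). simpl. ring.
  - apply sumable_ext with (2 := T2). intros k. destruct (f k), (g k). simpl. ring.
  - apply C_ext; simpl.
    + exact (SumZ_minus _ _ H1 H3).
    + exact (SumZ_minus _ _ H2 H4).
Qed.

(* [ee k p] is exp (- i k p). *)
Definition ee (k : Z) (p : C) : C :=
  (exp (IZR k * Im p) * cos (IZR k * Re p), - (exp (IZR k * Im p) * sin (IZR k * Re p)))%R.

Lemma Cmod_polar (r t : R) : 0 <= r -> Cmod (r * cos t, - (r * sin t)) = r.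
Proof.
  intros Hr. unfold Cmod; simpl.
  replace (r * cos t * (r * cos t * 1) + - (r * sin t) * (- (r * sin t) * 1))
    with (r ^ 2 * (Rsqr (sin t) + Rsqr (cos t))) by (unfold Rsqr; ring).
  rewrite sin2_cos2, Rmult_1_r. now apply sqrt_pow2.
Qed.

Lemma Cmod_ee (k : Z) (p : C) : Cmod (ee k p) = exp (IZR k * Im p).
Proof. apply Cmod_polar. left; apply exp_pos. Qed.

Lemma exp_m1 (x : R) : Rabs (exp x - 1) <= Rabs x * Rmax (exp x) 1.
Proof.
  assert (H1 := exp_ineq1_le x). assert (H2 := exp_ineq1_le (- x)).
  assert (H3 : exp x * exp (- x) = 1) by (rewrite <- exp_plus, <- exp_0; f_equal; ring).
  assert (H4 := exp_pos x). assert (M1 := Rmax_l (exp x) 1). assert (M2 := Rmax_r (exp x) 1).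
  destruct (Rle_dec 0 x).
  - rewrite (Rabs_pos_eq x), Rabs_pos_eq by lra. nra.
  - assert (exp x < 1) by (rewrite <- exp_0; apply exp_increasing; lra).
    rewrite !Rabs_left by lra. nra.
Qed.

Lemma exp_m1x (x : R) : Rabs (exp x - 1 - x) <= x ^ 2 * Rmax (exp x) 1.
Proof.
  assert (H1 := exp_ineq1_le x). assert (H2 := exp_m1 x).
  rewrite Rabs_pos_eq by lra.
  assert (H2' := exp_ineq1_le (- x)).
  assert (H3 : exp x * exp (- x) = 1) by (rewrite <- exp_plus, <- exp_0; f_equal; ring).
  assert (H4 := exp_pos x). assert (M1 := Rmax_l (exp x) 1). assert (M2 := Rmax_r (exp x) 1).
  (* exp x - 1 - x <= x (exp x - 1) since (1 - x) exp x <= 1 *)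
  assert (H5 : exp x - 1 - x <= x * (exp x - 1)) by nra.
  assert (H6 : x * (exp x - 1) <= Rabs x * Rabs (exp x - 1)).
  { rewrite <- Rabs_mult. apply Rle_abs. }
  assert (H7 : Rabs x * Rabs (exp x - 1) <= Rabs x * (Rabs x * Rmax (exp x) 1)).
  { apply Rmult_le_compat_l; auto. apply Rabs_pos. }
  assert (H8 : Rabs x * Rabs x = x ^ 2) by (rewrite <- Rabs_mult, Rabs_pos_eq; [ring|nra]).
  rewrite <- Rmult_assoc, H8 in H7. lra.
Qed.

Lemma MVT_bound (f f' : R -> R) (M : R) (y : R) :
  (forall t, is_derive f t (f' t)) -> (forall t, Rabs t <= Rabs y -> Rabs (f' t) <= M) ->
  Rabs (f y - f 0) <= M * Rabs y.
Proof.
  intros Hd HM.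
  destruct (MVT_gen f 0 y f') as (c & Hc & E).
  - intros t _. apply Hd.
  - intros t _. apply continuity_pt_filterlim, (ex_derive_continuous f).
    now exists (f' t).
  - rewrite E, Rabs_mult, Rminus_0_r. apply Rmult_le_compat_r; [apply Rabs_pos|].
    apply HM. unfold Rmin, Rmax in Hc. destruct (Rle_dec 0 y).
    + rewrite !Rabs_pos_eq; lra.
    + rewrite !Rabs_left1; lra.
Qed.

Lemma cos_m1 (y : R) : Rabs (cos y - 1) <= Rabs y.
Proof.
  rewrite <- cos_0 at 1. rewrite <- (Rmult_1_l (Rabs y)).
  apply (MVT_bound cos (fun t => - sin t)).
  - intros t. auto_derive; auto. ring.
  - intros t _. rewrite Rabs_Ropp. generalize (SIN_bound t). intros. apply Rabs_le. lra.
Qed.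
Lemma sin_le (y : R) : Rabs (sin y) <= Rabs y.
Proof.
  replace (sin y) with (sin y - sin 0) by (rewrite sin_0; ring). rewrite <- (Rmult_1_l (Rabs y)).
  apply (MVT_bound sin cos).
  - intros t. auto_derive; auto. ring.
  - intros t _. generalize (COS_bound t). intros. apply Rabs_le. lra.
Qed.
Lemma sin_mx (y : R) : Rabs (sin y - y) <= y ^ 2.
Proof.
  replace (sin y - y) with ((sin y - y) - (sin 0 - 0)) by (rewrite sin_0; ring).
  replace (y ^ 2) with (Rabs y * Rabs y) by (rewrite <- Rabs_mult, Rabs_pos_eq; [ring|nra]).
  apply (MVT_bound (fun t => sin t - t) (fun t => cos t - 1)).
  - intros t. auto_derive; auto. ring.
  - intros t Ht. apply Rle_trans with (1 := cos_m1 t), Ht.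
Qed.
Lemma cos_m1_2 (y : R) : Rabs (cos y - 1) <= y ^ 2.
Proof.
  replace (y ^ 2) with (Rabs y * Rabs y) by (rewrite <- Rabs_mult, Rabs_pos_eq; [ring|nra]).
  rewrite <- cos_0 at 1.
  apply (MVT_bound cos (fun t => - sin t)).
  - intros t. auto_derive; auto. ring.
  - intros t Ht. rewrite Rabs_Ropp. apply Rle_trans with (1 := sin_le t), Ht.
Qed.

(** This is exp (x + i y). The next two lemmas are its Taylor remainders, with a growth factor valid
    for either sign of x. *)
Definition eL (x y : R) : C := (exp x * cos y, exp x * sin y)%R.

Lemma eL_1 (x y : R) : Cmod (eL x y - 1)%C <= 2 * (Rabs x + Rabs y) * Rmax (exp x) 1.
Proof.
  apply Rle_trans with (1 := Cmod_le_sum _). simpl.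
  set (m := Rmax (exp x) 1). assert (M1 : exp x <= m) by apply Rmax_l. assert (He := exp_pos x).
  assert (H1 := exp_m1 x). fold m in H1.
  assert (H2 : Rabs (exp x * cos y + - (1)) <= (Rabs x + Rabs y) * m).
  { replace (exp x * cos y + - (1)) with ((exp x - 1) + exp x * (cos y - 1)) by ring.
    apply Rle_trans with (1 := Rabs_triang _ _). rewrite Rabs_mult, (Rabs_pos_eq (exp x)) by lra.
    assert (exp x * Rabs (cos y - 1) <= m * Rabs y); [|lra].
    apply Rmult_le_compat; [lra|apply Rabs_pos|lra|apply cos_m1]. }
  assert (H3 : Rabs (exp x * sin y + -0) <= Rabs y * m).
  { rewrite Ropp_0, Rplus_0_r, Rabs_mult, (Rabs_pos_eq (exp x)) by lra.
    rewrite (Rmult_comm (Rabs y)). apply Rmult_le_compat; [lra|apply Rabs_pos|lra|apply sin_le]. }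
  assert (0 <= Rabs x * m) by (apply Rmult_le_pos; [apply Rabs_pos|lra]). lra.
Qed.

Lemma eL_2 (x y D : R) : Rabs x <= D -> Rabs y <= D ->
  Cmod (eL x y - 1 - (x, y))%C <= 4 * D ^ 2 * Rmax (exp x) 1.
Proof.
  intros Hx Hy. apply Rle_trans with (1 := Cmod_le_sum _). simpl Re. simpl Im. 
  set (m := Rmax (exp x) 1). assert (M1 : exp x <= m) by apply Rmax_l. assert (He := exp_pos x).
  assert (H1 := exp_m1 x). assert (H1' := exp_m1x x). fold m in H1, H1'.
  assert (Hx2 : x ^ 2 <= D ^ 2).
  { rewrite <- (Rabs_pos_eq (x ^ 2)), <- RPow_abs by nra. apply pow_incr. split; [apply Rabs_pos|auto]. }
  assert (Hy2 : y ^ 2 <= D ^ 2).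
  { rewrite <- (Rabs_pos_eq (y ^ 2)), <- RPow_abs by nra. apply pow_incr. split; [apply Rabs_pos|auto]. }
  assert (P1 := Rabs_pos x). assert (P2 := Rabs_pos y).
  assert (H2 : Rabs (exp x * cos y + - (1) + - x) <= 2 * D ^ 2 * m).
  { replace (exp x * cos y + - (1) + - x) with ((exp x - 1 - x) + exp x * (cos y - 1)) by ring.
    apply Rle_trans with (1 := Rabs_triang _ _). rewrite Rabs_mult, (Rabs_pos_eq (exp x)) by lra.
    assert (H := cos_m1_2 y). assert (H' := Rabs_pos (cos y - 1)).
    assert (exp x * Rabs (cos y - 1) <= m * D ^ 2) by (apply Rmult_le_compat; lra).
    assert (x ^ 2 * m <= D ^ 2 * m) by (apply Rmult_le_compat_r; lra). lra. }
  assert (H3 : Rabs (exp x * sin y + -0 + - y) <= 2 * D ^ 2 * m).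
  { replace (exp x * sin y + -0 + - y) with (exp x * (sin y - y) + y * (exp x - 1)) by ring.
    apply Rle_trans with (1 := Rabs_triang _ _). rewrite !Rabs_mult, (Rabs_pos_eq (exp x)) by lra.
    assert (H := sin_mx y). assert (H' := Rabs_pos (sin y - y)).
    assert (exp x * Rabs (sin y - y) <= m * D ^ 2) by (apply Rmult_le_compat; lra).
    assert (Rabs y * Rabs (exp x - 1) <= D * (D * m)).
    { apply Rmult_le_compat; try lra; try apply Rabs_pos. apply Rle_trans with (1 := H1).
      apply Rmult_le_compat_r; lra. }
    lra. }
  lra.
Qed.

Lemma ee_shift (k : Z) (p q : C) :
  ee k p = (ee k q * eL (IZR k * Im (p - q)%C) (- (IZR k * Re (p - q)%C)))%C.
Proof.
  destruct p as [p1 p2], q as [q1 q2]. unfold ee, eL. simpl.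
  set (K := IZR k).
  replace (K * p2) with (K * q2 + K * (p2 + - q2)) by ring.
  replace (K * p1) with (K * q1 + K * (p1 + - q1)) by ring.
  rewrite exp_plus, cos_plus, sin_plus, cos_neg, sin_neg.
  apply C_ext; simpl; ring.
Qed.

(** Bounds on the exponential at the two end points are enough; the segment between them needs no
    separate treatment. *)
Lemma exp_max (k : Z) (p q : C) (M : R) :
  exp (IZR k * Im p) <= M -> exp (IZR k * Im q) <= M ->
  exp (IZR k * Im q) * Rmax (exp (IZR k * Im (p - q)%C)) 1 <= M.
Proof.
  intros H1 H2.
  assert (E : exp (IZR k * Im q) * exp (IZR k * Im (p - q)%C) = exp (IZR k * Im p)).
  { rewrite <- exp_plus. f_equal. destruct p, q; simpl; ring. }
  unfold Rmax. destruct (Rle_dec (exp (IZR k * Im (p - q)%C)) 1); lra.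
Qed.

Lemma ee_lip (k : Z) (p q : C) (c M : R) : 0 <= c ->
  c * exp (IZR k * Im p) <= M -> c * exp (IZR k * Im q) <= M ->
  c * Cmod (ee k p - ee k q)%C <= 4 * (Rabs (IZR k) * M) * Cmod (p - q)%C.
Proof.
  intros Hc H1 H2. rewrite (ee_shift k p q).
  replace (ee k q * eL (IZR k * Im (p - q)%C) (- (IZR k * Re (p - q)%C)) - ee k q)%C
    with (ee k q * (eL (IZR k * Im (p - q)%C) (- (IZR k * Re (p - q)%C)) - 1))%C by ring.
  rewrite Cmod_mult, Cmod_ee.
  assert (H := eL_1 (IZR k * Im (p - q)%C) (- (IZR k * Re (p - q)%C))).
  rewrite Rabs_Ropp, !Rabs_mult in H.
  set (m := Rmax (exp (IZR k * Im (p - q)%C)) 1) in *.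
  assert (Hm : c * (exp (IZR k * Im q) * m) <= M).
  { destruct Hc as [Hc| <-]; [|lra]. apply Rmult_le_reg_l with (/ c); [now apply Rinv_0_lt_compat|].
    replace (/ c * (c * (exp (IZR k * Im q) * m))) with (exp (IZR k * Im q) * m) by (field; lra).
    apply exp_max.
    - apply Rmult_le_reg_l with c; auto. replace (c * (/ c * M)) with M by (field; lra). auto.
    - apply Rmult_le_reg_l with c; auto. replace (c * (/ c * M)) with M by (field; lra). auto. }
  assert (R1 := Re_le_Cmod (p - q)%C). assert (R2 := Im_le_Cmod (p - q)%C).
  set (D := Cmod (p - q)%C) in *. assert (HK := Rabs_pos (IZR k)).
  assert (He := exp_pos (IZR k * Im q)).
  assert (Hm0 : 0 <= m) by (apply Rle_trans with 1; [lra|apply Rmax_r]).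
  assert (HD : 0 <= D) by apply Cmod_ge_0.
  assert (Hs : Rabs (IZR k) * Rabs (Im (p - q)%C) + Rabs (IZR k) * Rabs (Re (p - q)%C) <= 2 * (Rabs (IZR k) * D)) by nra.
  assert (HKD : 0 <= Rabs (IZR k) * D) by now apply Rmult_le_pos.
  apply Rle_trans with (c * (exp (IZR k * Im q) * (2 * (2 * (Rabs (IZR k) * D)) * m))).
  - apply Rmult_le_compat_l; auto. apply Rmult_le_compat_l; [lra|]. apply Rle_trans with (1 := H).
    apply Rmult_le_compat_r; lra.
  - replace (c * (exp (IZR k * Im q) * (2 * (2 * (Rabs (IZR k) * D)) * m)))
      with (4 * (Rabs (IZR k) * D) * (c * (exp (IZR k * Im q) * m))) by ring.
    replace (4 * (Rabs (IZR k) * M) * D) with (4 * (Rabs (IZR k) * D) * M) by ring.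
    apply Rmult_le_compat_l; lra.
Qed.

Lemma ee_taylor (k : Z) (p q : C) (c M : R) : 0 <= c ->
  c * exp (IZR k * Im p) <= M -> c * exp (IZR k * Im q) <= M ->
  c * Cmod (ee k p - ee k q - (- Ci * RtoC (IZR k) * ee k q) * (p - q))%C
    <= 4 * (IZR k ^ 2 * M) * Cmod (p - q)%C ^ 2.
Proof.
  intros Hc H1 H2. rewrite (ee_shift k p q).
  set (x := IZR k * Im (p - q)%C). set (y := - (IZR k * Re (p - q)%C)).
  assert (Exy : (- Ci * RtoC (IZR k) * (p - q))%C = (x, y)).
  { unfold x, y. destruct p, q. apply C_ext; simpl; ring. }
  replace (ee k q * eL x y - ee k q - (- Ci * RtoC (IZR k) * ee k q) * (p - q))%C
    with (ee k q * (eL x y - 1 - (- Ci * RtoC (IZR k) * (p - q))))%C by ring.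
  rewrite Exy, Cmod_mult, Cmod_ee.
  assert (R1 := Re_le_Cmod (p - q)%C). assert (R2 := Im_le_Cmod (p - q)%C).
  set (D := Cmod (p - q)%C) in *. assert (HK := Rabs_pos (IZR k)).
  assert (HD : 0 <= D) by apply Cmod_ge_0.
  assert (H := eL_2 x y (Rabs (IZR k) * D)).
  specialize (H ltac:(unfold x; rewrite Rabs_mult; apply Rmult_le_compat_l; auto)).
  specialize (H ltac:(unfold y; rewrite Rabs_Ropp, Rabs_mult; apply Rmult_le_compat_l; auto)).
  replace ((Rabs (IZR k) * D) ^ 2) with (IZR k ^ 2 * D ^ 2) in H.
  2:{ rewrite Rpow_mult_distr, RPow_abs, (Rabs_pos_eq (IZR k ^ 2)); nra. }
  set (m := Rmax (exp x) 1) in *.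
  assert (Hm : c * (exp (IZR k * Im q) * m) <= M).
  { destruct Hc as [Hc| <-]; [|lra]. apply Rmult_le_reg_l with (/ c); [now apply Rinv_0_lt_compat|].
    replace (/ c * (c * (exp (IZR k * Im q) * m))) with (exp (IZR k * Im q) * m) by (field; lra).
    apply exp_max.
    - apply Rmult_le_reg_l with c; auto. replace (c * (/ c * M)) with M by (field; lra). auto.
    - apply Rmult_le_reg_l with c; auto. replace (c * (/ c * M)) with M by (field; lra). auto. }
  assert (He := exp_pos (IZR k * Im q)).
  apply Rle_trans with (c * (exp (IZR k * Im q) * (4 * (IZR k ^ 2 * D ^ 2) * m))).
  - apply Rmult_le_compat_l; auto. apply Rmult_le_compat_l; lra.
  - replace (c * (exp (IZR k * Im q) * (4 * (IZR k ^ 2 * D ^ 2) * m)))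
      with (4 * (IZR k ^ 2 * D ^ 2) * (c * (exp (IZR k * Im q) * m))) by ring.
    replace (4 * (IZR k ^ 2 * M) * D ^ 2) with (4 * (IZR k ^ 2 * D ^ 2) * M) by ring.
    apply Rmult_le_compat_l; auto.
    assert (0 <= IZR k ^ 2 * D ^ 2); [|lra]. apply Rmult_le_pos; nra.
Qed.

(** ** Series with a majorant *)

(** The modulus of [ee k p] depends on [Im p] alone, so one majorant over a set of heights reduces
    every estimate of the series and its derivatives to moments of M. *)
Definition maj (S : R -> Prop) (u M : Z -> R) : Prop :=
  forall k t, S t -> Rabs (u k) * exp (IZR k * t) <= M k.

Definition FF (u : Z -> R) (p : C) : C := CS (fun k => RtoC (u k) * ee k p)%C.
Definition kU (u : Z -> R) (k : Z) : R := IZR k * u k.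
Definition mom (n : nat) (M : Z -> R) (k : Z) : R := Rabs (IZR k) ^ n * M k.

Lemma maj_kU S u M : maj S u M -> maj S (kU u) (mom 1 M).
Proof.
  intros H k t Ht. unfold kU, mom. rewrite Rabs_mult, pow_1, Rmult_assoc.
  apply Rmult_le_compat_l; [apply Rabs_pos|now apply H].
Qed.

Lemma maj_Csum S u M p : maj S u M -> sumable M -> S (Im p) -> Csumable (fun k => RtoC (u k) * ee k p)%C.
Proof.
  intros H HM Hp. apply Csumable_le with (2 := HM). intros k.
  rewrite Cmod_mult, Cmod_R, Cmod_ee. now apply H.
Qed.

Lemma FF_bound S u M p : maj S u M -> sumable M -> S (Im p) -> Cmod (FF u p) <= 2 * SumZ M.
Proof.
  intros H HM Hp. apply CS_bound; auto. intros k.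
  rewrite Cmod_mult, Cmod_R, Cmod_ee. now apply H.
Qed.

Lemma FF_lip S u M p q : maj S u M -> sumable M -> sumable (mom 1 M) -> S (Im p) -> S (Im q) ->
  Cmod (FF u p - FF u q)%C <= 8 * SumZ (mom 1 M) * Cmod (p - q)%C.
Proof.
  intros H HM HM1 Hp Hq. unfold FF.
  destruct (CS_minus _ _ (maj_Csum S u M p H HM Hp) (maj_Csum S u M q H HM Hq)) as [_ <-].
  assert (Hb := CS_bound (fun k => RtoC (u k) * ee k p - RtoC (u k) * ee k q)%C
    (fun k => 4 * Cmod (p - q)%C * mom 1 M k)).
  destruct Hb as (_ & _ & Hb).
  - intros k. replace (RtoC (u k) * ee k p - RtoC (u k) * ee k q)%C
      with (RtoC (u k) * (ee k p - ee k q))%C by ring.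
    rewrite Cmod_mult, Cmod_R. apply Rle_trans with (4 * (Rabs (IZR k) * M k) * Cmod (p - q)%C).
    + apply ee_lip; [apply Rabs_pos|now apply H|now apply H].
    + unfold mom. right; ring.
  - now apply sumable_scal.
  - rewrite SumZ_scal in Hb. lra.
Qed.

Definition dFF (u : Z -> R) (p : C) : C := (- Ci * FF (kU u) p)%C.

Lemma FF_taylor S u M p q : maj S u M -> sumable M -> sumable (mom 1 M) -> sumable (mom 2 M) ->
  S (Im p) -> S (Im q) ->
  Cmod (FF u p - FF u q - dFF u q * (p - q))%C <= 8 * SumZ (mom 2 M) * Cmod (p - q)%C ^ 2.
Proof.
  intros H HM HM1 HM2 Hp Hq. unfold dFF, FF.
  destruct (CS_minus _ _ (maj_Csum S u M p H HM Hp) (maj_Csum S u M q H HM Hq)) as [S1 E1].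
  assert (S2 := maj_Csum S (kU u) _ q (maj_kU _ _ _ H) HM1 Hq).
  assert (S3 := Csumable_scal ((p - q) * - Ci)%C _ S2).
  rewrite <- E1.
  replace (- Ci * CS (fun k => RtoC (kU u k) * ee k q) * (p - q))%C
    with (((p - q) * - Ci) * CS (fun k => RtoC (kU u k) * ee k q))%C by ring.
  rewrite <- CS_scal by auto.
  destruct (CS_minus _ _ S1 S3) as [_ <-].
  assert (Hb := CS_bound (fun k => RtoC (u k) * ee k p - RtoC (u k) * ee k q -
     (p - q) * - Ci * (RtoC (kU u k) * ee k q))%C
    (fun k => 4 * Cmod (p - q)%C ^ 2 * mom 2 M k)).
  destruct Hb as (_ & _ & Hb).
  - intros k. replace (RtoC (u k) * ee k p - RtoC (u k) * ee k q - (p - q) * - Ci * (RtoC (kU u k) * ee k q))%C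
      with (RtoC (u k) * (ee k p - ee k q - (- Ci * RtoC (IZR k) * ee k q) * (p - q)))%C
      by (unfold kU; rewrite RtoC_mult; ring).
    rewrite Cmod_mult, Cmod_R.
    apply Rle_trans with (4 * (IZR k ^ 2 * M k) * Cmod (p - q)%C ^ 2).
    + apply ee_taylor; [apply Rabs_pos|now apply H|now apply H].
    + unfold mom. rewrite RPow_abs, (Rabs_pos_eq (IZR k ^ 2)) by nra. right; ring.
  - now apply sumable_scal.
  - rewrite SumZ_scal in Hb. lra.
Qed.

Lemma cos_period_Z (x : R) (k : Z) : cos (x + 2 * IZR k * PI) = cos x /\ sin (x + 2 * IZR k * PI) = sin x.
Proof.
  destruct k as [|n|n].
  - replace (x + 2 * 0 * PI) with x by ring. auto.
  - rewrite <- (positive_nat_Z n), <- INR_IZR_INZ, cos_period, sin_period. auto.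
  - rewrite <- (cos_period (x + 2 * IZR (Z.neg n) * PI) (Pos.to_nat n)),
      <- (sin_period (x + 2 * IZR (Z.neg n) * PI) (Pos.to_nat n)).
    assert (E : x + 2 * IZR (Z.neg n) * PI + 2 * INR (Pos.to_nat n) * PI = x).
    { rewrite INR_IZR_INZ, positive_nat_Z, <- Pos2Z.opp_pos, opp_IZR. ring. }
    rewrite E. auto.
Qed.

Lemma ee_period (k : Z) (p : C) : ee k (p + RtoC (2 * PI))%C = ee k p.
Proof.
  destruct p as [x y]. unfold ee. simpl. rewrite Rplus_0_r.
  replace (IZR k * (x + 2 * PI)) with (IZR k * x + 2 * IZR k * PI) by ring.
  destruct (cos_period_Z (IZR k * x) k) as [-> ->]. reflexivity.
Qed.

Lemma FF_period u p : FF u (p + RtoC (2 * PI))%C = FF u p.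
Proof. apply CS_ext. intros k. now rewrite ee_period. Qed.

Lemma ee_reflect (k : Z) (p : C) : ee k (- Cconj p)%C = Cconj (ee k p).
Proof.
  destruct p as [x y]. unfold ee, Cconj. simpl. rewrite Ropp_involutive.
  rewrite Ropp_mult_distr_r_reverse, cos_neg, sin_neg. f_equal. ring.
Qed.

Lemma FF_reflect u p : FF u (- Cconj p)%C = Cconj (FF u p).
Proof.
  transitivity (CS (fun k => Cconj (RtoC (u k) * ee k p))%C).
  - apply CS_ext. intros k. rewrite ee_reflect. apply C_ext; simpl; ring.
  - unfold CS, Cconj. simpl. f_equal. exact (SumZ_opp _).
Qed.

Definition absW (f : W) (k : Z) : R := Rabs (f k).

(** The constants close the binomial recursion: 3 + 2 + 1 = 2 * 3 and 13 + 9 + 3 + 1 = 2 * 13. The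
    13 reappears in all later numerical constants. *)
Lemma pow_le_2pow (n : nat) : INR n <= 2 ^ n /\ INR n ^ 2 <= 3 * 2 ^ n /\ INR n ^ 3 <= 13 * 2 ^ n.
Proof.
  induction n as [|n (H1 & H2 & H3)].
  - simpl. lra.
  - rewrite S_INR. simpl (2 ^ S n).
    assert (1 <= 2 ^ n) by (apply pow_R1_Rle; lra). assert (H0 := pos_INR n).
    repeat split; [lra| |].
    + replace ((INR n + 1) ^ 2) with (INR n ^ 2 + 2 * INR n + 1) by ring. lra.
    + replace ((INR n + 1) ^ 3) with (INR n ^ 3 + 3 * INR n ^ 2 + 3 * INR n + 1) by ring. lra.
Qed.

Lemma mom_W (f : W) (n : nat) : (n <= 3)%nat ->
  sumable (mom n (absW f)) /\ SumZ (mom n (absW f)) <= 13 * nm f.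
Proof.
  intros Hn.
  assert (Hb : forall k, Rabs (mom n (absW f) k) <= 13 * (Rabs (f k) * wt k)).
  { intros k. unfold mom, absW.
    assert (E : Rabs (IZR k) = INR (Z.abs_nat k)).
    { rewrite INR_IZR_INZ, Zabs2Nat.id_abs. now rewrite abs_IZR. }
    rewrite Rabs_mult, Rabs_Rabsolu, E, Rabs_pos_eq by (apply pow_le, pos_INR).
    destruct (pow_le_2pow (Z.abs_nat k)) as (H1 & H2 & H3).
    fold (wt k) in *. assert (Hw := wt_ge1 k). assert (Hf := Rabs_pos (f k)).
    assert (INR (Z.abs_nat k) ^ n <= 13 * wt k).
    { destruct n as [|[|[|[|n]]]]; try lia; simpl in *; unfold wt in *; lra. }
    replace (13 * (Rabs (f k) * wt k)) with ((13 * wt k) * Rabs (f k)) by ring.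
    apply Rmult_le_compat_r; auto. }
  assert (Hs := sumable_scal 13 _ (cf_sumw f)).
  split; [now apply sumable_le with (1 := Hb)|].
  apply Rle_trans with (1 := Rle_abs _). rewrite nm_eq, <- SumZ_scal.
  now apply SumZ_bound.
Qed.

(** ** Evaluation on the unit circle *)

Definition cs (f : W) (al : R) : R := SumZ (fun k => f k * cos (IZR k * al)).
Definition sn (f : W) (al : R) : R := SumZ (fun k => f k * sin (IZR k * al)).
Definition Ev (f : W) (al : R) : C := (cs f al, - sn f al).

Lemma cos_bd (x : R) : Rabs (cos x) <= 1.
Proof. apply Rabs_le. generalize (COS_bound x). lra. Qed.
Lemma sin_bd (x : R) : Rabs (sin x) <= 1.
Proof. apply Rabs_le. generalize (SIN_bound x). lra. Qed.
Lemma cos_wt al (k : Z) : Rabs (cos (IZR k * al)) <= 1 * wt k.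
Proof. generalize (cos_bd (IZR k * al)) (wt_ge1 k). lra. Qed.
Lemma sin_wt al (k : Z) : Rabs (sin (IZR k * al)) <= 1 * wt k.
Proof. generalize (sin_bd (IZR k * al)) (wt_ge1 k). lra. Qed.

Lemma cs_sum (f : W) al : sumable (fun k => f k * cos (IZR k * al)).
Proof. apply sumw_sumable with 1; [apply cos_wt|apply cf_sumw]. Qed.
Lemma sn_sum (f : W) al : sumable (fun k => f k * sin (IZR k * al)).
Proof. apply sumw_sumable with 1; [apply sin_wt|apply cf_sumw]. Qed.

Lemma Ev_add f g al : Ev (f + g)%W al = (Ev f al + Ev g al)%C.
Proof.
  unfold Ev, cs, sn. apply C_ext; simpl.
  - rewrite <- SumZ_plus by apply cs_sum. apply SumZ_ext. intros k. rewrite cf_add. ring.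
  - rewrite <- Ropp_plus_distr. f_equal.
    rewrite <- SumZ_plus by apply sn_sum. apply SumZ_ext. intros k. rewrite cf_add. ring.
Qed.

Lemma Ev_scal c f al : Ev (Wc c * f)%W al = (RtoC c * Ev f al)%C.
Proof.
  unfold Ev, cs, sn. apply C_ext; simpl.
  - rewrite (SumZ_ext _ (fun k => c * (f k * cos (IZR k * al)))), SumZ_scal; [ring|].
    intros k. rewrite cf_Wc_mul. ring.
  - rewrite (SumZ_ext _ (fun k => c * (f k * sin (IZR k * al)))), SumZ_scal; [ring|].
    intros k. rewrite cf_Wc_mul. ring.
Qed.

Lemma Ev_mul f g al : Ev (f * g)%W al = (Ev f al * Ev g al)%C.
Proof.
  assert (Hc : cs (f * g)%W al = cs f al * cs g al - sn f al * sn g al).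
  { unfold cs at 1. rewrite (mul_test f g _ 1 (cos_wt al)).
    rewrite (SumZ_ext _ (fun k => cs g al * (f k * cos (IZR k * al)) + (- sn g al) * (f k * sin (IZR k * al)))).
    - rewrite SumZ_plus, !SumZ_scal by (apply sumable_scal; apply cs_sum || apply sn_sum).
      unfold cs, sn. ring.
    - intros k.
      rewrite (SumZ_ext _ (fun j => cos (IZR k * al) * (g j * cos (IZR j * al)) +
         (- sin (IZR k * al)) * (g j * sin (IZR j * al)))).
      + rewrite SumZ_plus, !SumZ_scal by (apply sumable_scal; apply cs_sum || apply sn_sum).
        unfold cs, sn. ring.
      + intros j. rewrite plus_IZR, Rmult_plus_distr_r, cos_plus. ring. }
  assert (Hs : sn (f * g)%W al = sn f al * cs g al + cs f al * sn g al).
  { unfold sn at 1. rewrite (mul_test f g _ 1 (sin_wt al)).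
    rewrite (SumZ_ext _ (fun k => cs g al * (f k * sin (IZR k * al)) + sn g al * (f k * cos (IZR k * al)))).
    - rewrite SumZ_plus, !SumZ_scal by (apply sumable_scal; apply cs_sum || apply sn_sum).
      unfold cs, sn. ring.
    - intros k.
      rewrite (SumZ_ext _ (fun j => sin (IZR k * al) * (g j * cos (IZR j * al)) +
         cos (IZR k * al) * (g j * sin (IZR j * al)))).
      + rewrite SumZ_plus, !SumZ_scal by (apply sumable_scal; apply cs_sum || apply sn_sum).
        unfold cs, sn. ring.
      + intros j. rewrite plus_IZR, Rmult_plus_distr_r, sin_plus. ring. }
  apply C_ext; unfold Ev; simpl; rewrite ?Hc, ?Hs; ring.
Qed.

Lemma Ev_mon n al : Ev (mon n) al = (cos (IZR n * al), - sin (IZR n * al)).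
Proof.
  unfold Ev, cs, sn. 
  destruct (SumZ_single (fun k => mon n k * cos (IZR k * al)) n) as [_ ->].
  { intros k Hk. rewrite cf_mon. destruct (Z.eq_dec k n); [tauto|ring]. }
  destruct (SumZ_single (fun k => mon n k * sin (IZR k * al)) n) as [_ ->].
  { intros k Hk. rewrite cf_mon. destruct (Z.eq_dec k n); [tauto|ring]. }
  rewrite cf_mon. destruct (Z.eq_dec n n); [|tauto]. apply C_ext; simpl; ring.
Qed.

Lemma Ev_1 al : Ev 1%W al = RtoC 1.
Proof. unfold W1. rewrite Ev_mon. apply C_ext; simpl; rewrite Rmult_0_l, ?cos_0, ?sin_0; ring. Qed.
Lemma Ev_Wc c al : Ev (Wc c) al = RtoC c.
Proof. replace (Wc c) with (Wc c * 1)%W by ring. rewrite Ev_scal, Ev_1. ring. Qed.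
Lemma Ev_opp f al : Ev (- f)%W al = (- Ev f al)%C.
Proof.
  replace (- f)%W with (Wc (-1) * f)%W.
  - rewrite Ev_scal. apply C_ext; simpl; ring.
  - rewrite <- Wscal_Wc. reflexivity.
Qed.
Lemma Ev_sub f g al : Ev (f - g)%W al = (Ev f al - Ev g al)%C.
Proof. replace (f - g)%W with (f + - g)%W by ring. now rewrite Ev_add, Ev_opp. Qed.
Lemma Ev_0 al : Ev 0%W al = RtoC 0.
Proof. rewrite <- Wc_0. apply Ev_Wc. Qed.

Lemma Ev_conj f al : Ev (conj f) al = Cconj (Ev f al).
Proof.
  assert (H1 := SumZ_bij _ Z.opp Z.opp Z.opp_involutive Z.opp_involutive (cs_sum f al)).
  assert (H2 := SumZ_bij _ Z.opp Z.opp Z.opp_involutive Z.opp_involutive (sn_sum f al)).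
  unfold Ev, cs, sn, Cconj. simpl. rewrite <- (proj2 H1), <- (proj2 H2). f_equal.
  - apply SumZ_ext. intros k. rewrite cf_conj, opp_IZR, Ropp_mult_distr_l_reverse, cos_neg. ring.
  - rewrite <- SumZ_opp. rewrite Ropp_involutive. apply SumZ_ext. intros k.
    rewrite cf_conj, opp_IZR, Ropp_mult_distr_l_reverse, sin_neg. ring.
Qed.

Lemma FF_Ev (f : W) al : FF f (al, 0)%R = Ev f al.
Proof.
  unfold FF, CS, Ev, cs, sn. f_equal.
  - apply SumZ_ext. intros k. simpl. rewrite Rmult_0_r, exp_0. ring.
  - rewrite <- SumZ_opp. apply SumZ_ext. intros k. simpl. rewrite Rmult_0_r, exp_0. ring.
Qed.

Lemma FF_scaled (u : Z -> R) (f : W) al be : (forall k, f k = u k * exp (IZR k * be)) ->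
  FF u (al, be)%R = Ev f al.
Proof.
  intros H. rewrite <- FF_Ev. apply CS_ext. intros k. rewrite H.
  unfold ee. apply C_ext; simpl; rewrite Rmult_0_r, exp_0; ring.
Qed.

(** * Local surjectivity and compactness in the plane *)

(** Reals are embedded as constant series, so that the completeness of [W] can be reused. *)
Lemma geom_Cauchy (x : nat -> R) (c : R) : (forall n, Rabs (x (S n) - x n) <= c * (/ 2) ^ n) ->
  exists l, forall n, Rabs (l - x n) <= 2 * c * (/ 2) ^ n.
Proof.
  intros H.
  assert (Hnm : forall r, nm (Wc r) = Rabs r).
  { intros r. rewrite nm_eq. destruct (SumZ_single (fun k => Rabs (Wc r k) * wt k) 0) as [_ ->].
    - intros k Hk. rewrite cf_Wc. destruct (Z.eq_dec k 0); [tauto|]. rewrite Rabs_R0. ring.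
    - rewrite cf_Wc. unfold wt. simpl. ring. }
  destruct (W_series (fun n => Wc (x n)) c) as (l & Hl & _).
  - intros n. rewrite <- Wc_sub, Hnm. apply H.
  - exists (l 0%Z). intros n. apply Rle_trans with (2 := Hl n).
    replace (l 0%Z - x n) with ((l - Wc (x n))%W 0%Z) by (rewrite cf_sub, cf_Wc; reflexivity).
    apply cf_abs_le.
Qed.

Lemma geom_Cauchy_C (x : nat -> C) (c : R) : (forall n, Cmod (x (S n) - x n)%C <= c * (/ 2) ^ n) ->
  exists l, forall n, Cmod (l - x n)%C <= 4 * c * (/ 2) ^ n.
Proof.
  intros H.
  destruct (geom_Cauchy (fun n => Re (x n)) c) as (l1 & H1).
  { intros n. apply Rle_trans with (2 := H n). exact (Re_le_Cmod (x (S n) - x n)%C). }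
  destruct (geom_Cauchy (fun n => Im (x n)) c) as (l2 & H2).
  { intros n. apply Rle_trans with (2 := H n). exact (Im_le_Cmod (x (S n) - x n)%C). }
  exists (l1, l2). intros n. apply Rle_trans with (1 := Cmod_le_sum _).
  specialize (H1 n). specialize (H2 n). unfold Rminus in H1, H2. simpl in *. unfold Re, Im in *. lra.
Qed.

Lemma half_pow_small (c eps : R) : 0 < eps -> exists n, c * (/ 2) ^ n < eps.
Proof.
  intros He. destruct (Rle_dec c 0) as [Hc|Hc].
  - exists 0%nat. simpl. lra.
  - destruct (pow_lt_1_zero (/ 2) ltac:(rewrite Rabs_pos_eq; lra) (eps / c)) as [N HN].
    + apply Rdiv_lt_0_compat; lra.
    + exists N. specialize (HN N (le_n N)). rewrite Rabs_pos_eq in HN by (apply pow_le; lra).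
      apply Rmult_lt_reg_l with (/ c); [apply Rinv_0_lt_compat; lra|].
      replace (/ c * (c * (/ 2) ^ N)) with ((/ 2) ^ N) by (field; lra).
      unfold Rdiv in HN. lra.
Qed.

Definition strict_at (f : C -> C) (S : C -> Prop) (p D : C) (r : R) : Prop :=
  forall x y, S x -> S y -> Cmod (x - p)%C <= r -> Cmod (y - p)%C <= r ->
    Cmod (f x - f y - D * (x - y))%C <= Cmod D / 2 * Cmod (x - y)%C.

Lemma local_surj (f : C -> C) (p D w : C) (r : R) :
  D <> RtoC 0 -> 0 < r -> strict_at f (fun _ => True) p D r ->
  Cmod (w - f p)%C <= Cmod D * r / 2 ->
  exists x, Cmod (x - p)%C <= r /\ f x = w.
Proof.
  intros HD Hr Hs Hw.
  assert (HD0 : 0 < Cmod D) by now apply Cmod_gt_0.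
  set (T := fun x => (x - (f x - w) / D)%C).
  set (xs := fix xs n := match n with O => p | S n => T (xs n) end).
  assert (Hstep : forall x, (x - T x)%C = ((f x - w) / D)%C) by (intros; unfold T; ring).
  assert (Hinv : forall n, Cmod (xs n - p)%C <= r * (1 - (/ 2) ^ n) /\
                   Cmod (f (xs n) - w)%C <= Cmod D * r / 2 * (/ 2) ^ n).
  { induction n as [|n [I1 I2]].
    - simpl. split.
      + replace (p - p)%C with (RtoC 0) by ring. rewrite Cmod_0. lra.
      + replace (f p - w)%C with (- (w - f p))%C by ring. rewrite Cmod_opp. lra.
    - simpl xs. set (x := xs n) in *.
      assert (Hp : 0 < (/ 2) ^ n) by (apply pow_lt; lra).
      assert (Hx : Cmod (x - T x)%C <= r / 2 * (/ 2) ^ n).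
      { rewrite Hstep, Cmod_div by auto. apply Rmult_le_reg_r with (Cmod D); auto.
        unfold Rdiv at 1. rewrite Rmult_assoc, Rinv_l by lra. lra. }
      assert (HT : Cmod (T x - p)%C <= r * (1 - (/ 2) ^ S n)).
      { replace (T x - p)%C with ((x - p) + - (x - T x))%C by ring.
        apply Rle_trans with (1 := Cmod_triangle _ _). rewrite Cmod_opp. simpl. lra. }
      split; [exact HT|].
      assert (Hxr : Cmod (x - p)%C <= r) by nra.
      assert (HTr : Cmod (T x - p)%C <= r).
      { assert (0 < (/ 2) ^ S n) by (apply pow_lt; lra). nra. }
      assert (H := Hs x (T x) I I Hxr HTr).
      replace (f x - f (T x) - D * (x - T x))%C with (- (f (T x) - w))%C in H.
      2:{ rewrite Hstep. field. auto. }
      rewrite Cmod_opp in H. apply Rle_trans with (1 := H).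
      apply Rle_trans with (Cmod D / 2 * (r / 2 * (/ 2) ^ n)).
      + apply Rmult_le_compat_l; lra.
      + simpl. right. field. }
  destruct (geom_Cauchy_C xs (r / 2)) as (l & Hl).
  { intros n. destruct (Hinv n) as [I1 I2]. simpl xs.
    replace (T (xs n) - xs n)%C with (- (xs n - T (xs n)))%C by ring.
    rewrite Cmod_opp, Hstep, Cmod_div by auto. apply Rmult_le_reg_r with (Cmod D); auto.
    unfold Rdiv at 1. rewrite Rmult_assoc, Rinv_l by lra. lra. }
  assert (Hlp : Cmod (l - p)%C <= r).
  { apply le_epsilon. intros eps He. destruct (half_pow_small (4 * (r / 2)) eps He) as [n Hn].
    destruct (Hinv n) as [I1 _]. specialize (Hl n).
    replace (l - p)%C with ((l - xs n) + (xs n - p))%C by ring.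
    apply Rle_trans with (1 := Cmod_triangle _ _).
    assert (0 < (/ 2) ^ n) by (apply pow_lt; lra). nra. }
  exists l. split; auto.
  assert (H0 : Cmod (f l - w)%C <= 0).
  { apply le_epsilon. intros eps He.
    destruct (half_pow_small (Cmod D * r / 2 + 2 * Cmod D * (4 * (r / 2))) eps He) as [n Hn].
    destruct (Hinv n) as [I1 I2]. specialize (Hl n).
    assert (0 < (/ 2) ^ n) by (apply pow_lt; lra).
    assert (Hxr : Cmod (xs n - p)%C <= r) by nra.
    assert (H1 := Hs l (xs n) I I Hlp Hxr).
    replace (f l - w)%C with ((f l - f (xs n) - D * (l - xs n)) + (D * (l - xs n) + (f (xs n) - w)))%C by ring.
    apply Rle_trans with (1 := Cmod_triangle _ _).
    assert (H2 := Cmod_triangle (D * (l - xs n)) (f (xs n) - w)). rewrite Cmod_mult in H2.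
    assert (Cmod D * Cmod (l - xs n)%C <= Cmod D * (4 * (r / 2) * (/ 2) ^ n)) by (apply Rmult_le_compat_l; lra).
    assert (H4 := Cmod_ge_0 (l - xs n)%C). nra. }
  assert (H1 := Cmod_ge_0 (f l - w)%C).
  assert (H2 : (f l - w)%C = RtoC 0) by (apply Cmod_eq_0; lra).
  replace (f l) with ((f l - w) + w)%C by ring. rewrite H2. ring.
Qed.

Lemma BW_real (u : nat -> R) (M : R) : (forall n, Rabs (u n) <= M) ->
  exists (phi : nat -> nat) (l : R), (forall n, (n <= phi n)%nat) /\ 
    forall eps, 0 < eps -> exists N, forall n, (N <= n)%nat -> Rabs (u (phi n) - l) < eps.
Proof.
  intros HM.
  destruct (Bolzano_Weierstrass u (fun x => - M <= x <= M) (compact_P3 (- M) M)) as [l Hl].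
  { intros n. specialize (HM n). apply Rabs_le_between in HM. exact HM. }
  assert (Hc : forall n, exists p, (n <= p)%nat /\ Rabs (u p - l) < / INR (S n)).
  { intros n. assert (Hp : 0 < / INR (S n)) by (apply Rinv_0_lt_compat, lt_0_INR; lia).
    destruct (Hl (disc l (mkposreal _ Hp)) n) as (p & Hp1 & Hp2).
    - exists (mkposreal _ Hp). intros x Hx. exact Hx.
    - exists p. split; auto. }
  exists (fun n => proj1_sig (constructive_indefinite_description _ (Hc n))), l. split.
  - intros n. destruct (constructive_indefinite_description _ (Hc n)) as [p [H1 H2]]. exact H1.
  - intros eps He. destruct (archimed_cor1 eps He) as (N & HN1 & HN2). exists N. intros n Hn.
    destruct (constructive_indefinite_description _ (Hc n)) as [p [H1 H2]]. simpl.
    apply Rlt_trans with (1 := H2). apply Rle_lt_trans with (2 := HN1).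
    apply Rinv_le_contravar; [now apply lt_0_INR|]. apply le_INR. lia.
Qed.

Lemma cluster2 (P Q : nat -> C) (M : R) : (forall n, Cmod (P n) <= M) -> (forall n, Cmod (Q n) <= M) ->
  exists p q, forall eps N, 0 < eps -> exists n, (N <= n)%nat /\
    Cmod (P n - p)%C < eps /\ Cmod (Q n - q)%C < eps.
Proof.
  intros HP HQ.
  destruct (BW_real (fun n => Re (P n)) M) as (f1 & l1 & F1 & L1).
  { intros n. apply Rle_trans with (1 := Re_le_Cmod _), HP. }
  destruct (BW_real (fun n => Im (P (f1 n))) M) as (f2 & l2 & F2 & L2).
  { intros n. apply Rle_trans with (1 := Im_le_Cmod _), HP. }
  destruct (BW_real (fun n => Re (Q (f1 (f2 n)))) M) as (f3 & l3 & F3 & L3).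
  { intros n. apply Rle_trans with (1 := Re_le_Cmod _), HQ. }
  destruct (BW_real (fun n => Im (Q (f1 (f2 (f3 n))))) M) as (f4 & l4 & F4 & L4).
  { intros n. apply Rle_trans with (1 := Im_le_Cmod _), HQ. }
  exists (l1, l2), (l3, l4). intros eps N He.
  destruct (L1 (eps / 2)) as (N1 & H1); [lra|]. destruct (L2 (eps / 2)) as (N2 & H2); [lra|].
  destruct (L3 (eps / 2)) as (N3 & H3); [lra|]. destruct (L4 (eps / 2)) as (N4 & H4); [lra|].
  set (n := Nat.max N (Nat.max (Nat.max N1 N2) (Nat.max N3 N4))).
  assert (G4 := F4 n). assert (G3 := F3 (f4 n)). assert (G2 := F2 (f3 (f4 n))). assert (G1 := F1 (f2 (f3 (f4 n)))).
  exists (f1 (f2 (f3 (f4 n)))). split; [lia|].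
  specialize (H4 n ltac:(lia)). specialize (H3 (f4 n) ltac:(lia)).
  specialize (H2 (f3 (f4 n)) ltac:(lia)). specialize (H1 (f2 (f3 (f4 n))) ltac:(lia)).
  unfold Rminus in *.
  split; (apply Rle_lt_trans with (1 := Cmod_le_sum _)); simpl; unfold Re, Im in *; lra.
Qed.

(** * The explicit profile in the lower half-plane *)

Section Crapper.
Variable b : R.
Hypothesis Hb : 0 < b < 1 / 2.

(** [Ci * FF u0] extends [w (b ^ 2)] holomorphically to the lower half-plane, which exp (- i p) maps
    into the unit disc. *)
Definition u0 : W := (Wc 2 * Y0 b)%W.
Definition zz (p : C) : C := (p + Ci * FF u0 p)%C.
Definition dzz (p : C) : C := (1 + FF (kU u0) p)%C.
Definition lower (t : R) : Prop := t <= 0.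

Lemma cf_u0 (k : Z) : u0 k = if Z_lt_dec 0 k then 4 * (- b) ^ Z.abs_nat k else 0.
Proof.
  unfold u0, Y0. rewrite cf_Wc_mul, cf_opp, cf_Wc_mul.
  replace (Wc b * zeta * e1 b)%W with (Wc b * (zeta * e1 b))%W by ring.
  rewrite cf_Wc_mul, cf_mon_mul. unfold e1. rewrite cf_geo by (apply Rabs_mb; auto).
  destruct (Z_le_dec 0 (k - 1)), (Z_lt_dec 0 k); try lia.
  - replace (Z.abs_nat k) with (S (Z.abs_nat (k - 1))) by lia. simpl. ring.
  - ring.
Qed.

Lemma exp_neg_le1 (x : R) : x <= 0 -> exp x <= 1.
Proof. intros H. rewrite <- exp_0. destruct H as [H| ->]; [left; now apply exp_increasing|lra]. Qed.

Lemma u0_maj : maj lower u0 (absW u0).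
Proof.
  intros k t Ht. unfold lower in Ht. unfold absW. rewrite cf_u0.
  destruct (Z_lt_dec 0 k) as [Hk|Hk]; [|rewrite Rabs_R0; lra].
  rewrite <- (Rmult_1_r (Rabs _)) at 2. apply Rmult_le_compat_l; [apply Rabs_pos|].
  apply exp_neg_le1. assert (0 < IZR k) by now apply IZR_lt. nra.
Qed.
End Crapper.

Lemma exp_pow (t : R) (n : nat) : exp t ^ n = exp (INR n * t).
Proof.
  induction n; [simpl; rewrite Rmult_0_l, exp_0; auto|].
  rewrite S_INR. simpl. rewrite IHn, <- exp_plus. f_equal. ring.
Qed.

Section Crapper2.
Variable b : R.
Hypothesis Hb : 0 < b < 1 / 2.

Lemma depth_range (t : R) : t <= 0 -> 0 < b * exp t <= b.
Proof.
  intros Ht. assert (H := exp_pos t). assert (H1 := exp_neg_le1 t Ht). nra.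
Qed.

(** Descending to height t multiplies zeta by exp t, and the explicit profile depends on b and zeta
    only through their product. *)
Lemma u0_scaled (t : R) (k : Z) : t <= 0 -> u0 (b * exp t) k = u0 b k * exp (IZR k * t).
Proof.
  intros Ht. assert (Hr := depth_range t Ht). rewrite !cf_u0 by lra.
  destruct (Z_lt_dec 0 k) as [Hk|Hk]; [|ring].
  replace (- (b * exp t)) with (- b * exp t) by ring. rewrite Rpow_mult_distr, exp_pow.
  replace (INR (Z.abs_nat k)) with (IZR k); [ring|]. rewrite INR_IZR_INZ. f_equal. lia.
Qed.

Lemma FF_u0_level (al t : R) : t <= 0 -> FF (u0 b) (al, t)%R = Ev (u0 (b * exp t)) al.
Proof. intros Ht. apply FF_scaled. intros k. now apply u0_scaled. Qed.

Lemma FF_ku0_level (al t : R) : t <= 0 -> FF (kU (u0 b)) (al, t)%R = Ev (Wc 2 * P0 (b * exp t))%W al.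
Proof.
  intros Ht. apply FF_scaled. intros k. assert (Hr := depth_range t Ht).
  assert (Hr' : 0 < b * exp t < 1 / 2) by lra.
  assert (H := Y0_isL _ Hr' k). unfold kU. rewrite Rmult_assoc, <- u0_scaled by auto.
  unfold u0. rewrite !cf_Wc_mul, H. ring.
Qed.
End Crapper2.

Lemma zeta_C_nonzero (b al : R) : 0 < b < 1 / 2 -> (1 + RtoC b * (cos al, - sin al)%R)%C <> RtoC 0.
Proof.
  intros Hb E. apply (f_equal fst) in E. simpl in E. generalize (COS_bound al). nra.
Qed.

Lemma Ev_zeta al : Ev zeta al = (cos al, - sin al)%R.
Proof. rewrite Ev_mon. now rewrite Rmult_1_l. Qed.

Lemma Ev_e1 (b al : R) : 0 < b < 1 / 2 -> Ev (e1 b) al = (/ (1 + RtoC b * (cos al, - sin al)%R))%C.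
Proof.
  intros Hb. assert (H := f_equal (fun f => Ev f al) (e1_inv b Hb)). simpl in H.
  rewrite Ev_mul, Ev_add, Ev_mul, Ev_1, Ev_Wc, Ev_zeta in H.
  assert (Hz := zeta_C_nonzero b al Hb).
  set (Z := (1 + RtoC b * (cos al, - sin al)%R)%C) in *.
  transitivity (/ Z * (Z * Ev (e1 b) al))%C; [field; auto|]. rewrite H. ring.
Qed.

Lemma Ev_u0 (b al : R) : 0 < b < 1 / 2 ->
  Ev (u0 b) al = (- (RtoC 4 * RtoC b * (cos al, - sin al)%R / (1 + RtoC b * (cos al, - sin al)%R)))%C.
Proof.
  intros Hb. unfold u0, Y0.
  rewrite Ev_scal, Ev_opp, Ev_scal, !Ev_mul, Ev_Wc, Ev_zeta, Ev_e1 by auto.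
  replace (RtoC 4) with (RtoC 2 * RtoC 2)%C by (rewrite <- RtoC_mult; f_equal; ring).
  unfold Cdiv. ring.
Qed.

Lemma zz_explicit (b al : R) : 0 < b < 1 / 2 -> zz b (al, 0)%R = explicit_curve (b ^ 2) al.
Proof.
  intros Hb. unfold zz, explicit_curve, w. rewrite FF_Ev, Ev_u0 by auto.
  rewrite sqrt_pow2 by lra. unfold Cdiv. replace (al, 0)%R with (RtoC al) by reflexivity. ring.
Qed.

Lemma Ev_Zb_ne0 (b al : R) : 0 < b < 1 / 2 -> Ev (Zb b) al <> RtoC 0.
Proof.
  intros Hb E. unfold Zb in E. rewrite Ev_mul in E.
  assert (H := f_equal (fun f => Ev f al) (vv_iv b Hb)). simpl in H. rewrite Ev_mul, Ev_1 in H.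
  assert (H2 : (Ev (vv b) al * Ev (vv b) al * (Ev (iv b) al * Ev (iv b) al))%C = RtoC 1).
  { transitivity ((Ev (vv b) al * Ev (iv b) al) * (Ev (vv b) al * Ev (iv b) al))%C; [ring|].
    rewrite H. ring. }
  rewrite E in H2. apply (f_equal fst) in H2. simpl in H2. lra.
Qed.

Section Bilip.
Variable b : R.
Hypothesis Hb : 0 < b < 1 / 2.

Lemma dzz_level (al t : R) : t <= 0 -> dzz b (al, t)%R = Ev (Zb (b * exp t)) al.
Proof.
  intros Ht. assert (Hr := depth_range b Hb t Ht). assert (Hr' : 0 < b * exp t < 1 / 2) by lra.
  unfold dzz. rewrite (FF_ku0_level b Hb) by auto. rewrite (Zb_eq _ Hr'), Ev_add, Ev_1. reflexivity.
Qed.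

Lemma dzz_ne0 (p : C) : Im p <= 0 -> dzz b p <> RtoC 0.
Proof.
  destruct p as [al t]. simpl. intros Ht. rewrite dzz_level by auto.
  assert (Hr := depth_range b Hb t Ht). apply Ev_Zb_ne0. lra.
Qed.

Lemma zz_level (al t : R) : t <= 0 ->
  zz b (al, t)%R = (explicit_curve ((b * exp t) ^ 2) al + (0, t)%R)%C.
Proof.
  intros Ht. assert (Hr := depth_range b Hb t Ht). assert (Hr' : 0 < b * exp t < 1 / 2) by lra.
  rewrite <- zz_explicit by auto. unfold zz. rewrite (FF_u0_level b Hb), FF_Ev by auto.
  apply C_ext; simpl; ring.
Qed.

Lemma zz_period (p : C) : zz b (p + RtoC (2 * PI))%C = (zz b p + RtoC (2 * PI))%C.
Proof. unfold zz. rewrite FF_period. ring. Qed.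

Lemma zz_period_Z (k : Z) (p : C) : zz b (p + RtoC (2 * IZR k * PI))%C = (zz b p + RtoC (2 * IZR k * PI))%C.
Proof.
  assert (Hn : forall (n : nat) p, zz b (p + RtoC (2 * INR n * PI))%C = (zz b p + RtoC (2 * INR n * PI))%C).
  { clear p. intros n0. induction n0 as [|n IHn]; intros p.
    - simpl. replace (RtoC (2 * 0 * PI)) with (RtoC 0) by (f_equal; ring). now rewrite !Cplus_0_r.
    - rewrite S_INR. replace (RtoC (2 * (INR n + 1) * PI)) with (RtoC (2 * INR n * PI) + RtoC (2 * PI))%C
        by (rewrite <- RtoC_plus; f_equal; ring).
      rewrite !Cplus_assoc, zz_period, IHn. reflexivity. }
  destruct (Z_le_dec 0 k) as [Hk|Hk].
  - assert (E : IZR k = INR (Z.to_nat k)) by (rewrite INR_IZR_INZ; f_equal; lia).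
    rewrite E. apply Hn.
  - assert (E : IZR k = - INR (Z.to_nat (- k))).
    { rewrite INR_IZR_INZ, Z2Nat.id, opp_IZR by lia. ring. }
    rewrite E. set (n := Z.to_nat (- k)).
    assert (H := Hn n (p + RtoC (2 * - INR n * PI))%C).
    replace (p + RtoC (2 * - INR n * PI) + RtoC (2 * INR n * PI))%C with p in H.
    + rewrite H. rewrite <- Cplus_assoc, <- RtoC_plus.
      replace (2 * INR n * PI + 2 * - INR n * PI) with 0 by ring. ring.
    + rewrite <- Cplus_assoc, <- RtoC_plus.
      replace (2 * - INR n * PI + 2 * INR n * PI) with 0 by ring. ring.
Qed.

Lemma u0_sum n : (n <= 3)%nat -> sumable (mom n (absW (u0 b))).
Proof. intros Hn. now apply mom_W. Qed.
Lemma u0_sum0 : sumable (absW (u0 b)).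
Proof. apply sumable_ext with (2 := u0_sum 0 ltac:(lia)). intros k. unfold mom. ring. Qed.

Definition low (p : C) : Prop := Im p <= 0.

Lemma zz_lip : exists L, 0 < L /\ forall p q, low p -> low q ->
  Cmod (zz b p - zz b q)%C <= L * Cmod (p - q)%C.
Proof.
  set (c := 8 * SumZ (mom 1 (absW (u0 b)))).
  assert (Hc : 0 <= c).
  { apply Rmult_le_pos; [lra|]. apply SumZ_pos; [|now apply u0_sum; lia].
    intros k. unfold mom, absW. apply Rmult_le_pos; [apply pow_le, Rabs_pos|apply Rabs_pos]. }
  exists (1 + c). split; [lra|]. intros p q Hp Hq. unfold zz.
  replace (p + Ci * FF (u0 b) p - (q + Ci * FF (u0 b) q))%C
    with ((p - q) + Ci * (FF (u0 b) p - FF (u0 b) q))%C by ring.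
  apply Rle_trans with (1 := Cmod_triangle _ _). rewrite Cmod_mult, Cmod_Ci.
  assert (H := FF_lip lower _ _ p q (u0_maj b Hb) u0_sum0 (u0_sum 1 ltac:(lia)) Hp Hq). fold c in H. lra.
Qed.

Lemma zz_strict (p : C) : low p -> exists r, 0 < r /\ strict_at (zz b) low p (dzz b p) r.
Proof.
  intros Hp.
  set (c1 := 8 * SumZ (mom 1 (mom 1 (absW (u0 b))))).
  set (c2 := 8 * SumZ (mom 2 (absW (u0 b)))).
  assert (Hm2 : sumable (mom 1 (mom 1 (absW (u0 b))))).
  { apply sumable_ext with (2 := u0_sum 2 ltac:(lia)). intros k. unfold mom. ring. }
  assert (Hc1 : 0 <= c1).
  { apply Rmult_le_pos; [lra|]. apply SumZ_pos; auto.
    intros k. unfold mom, absW. repeat apply Rmult_le_pos; try apply pow_le; apply Rabs_pos || lra. }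
  assert (Hc2 : 0 <= c2).
  { apply Rmult_le_pos; [lra|]. apply SumZ_pos; [|now apply u0_sum; lia].
    intros k. unfold mom, absW. repeat apply Rmult_le_pos; try apply pow_le; apply Rabs_pos || lra. }
  assert (HD : 0 < Cmod (dzz b p)) by (apply Cmod_gt_0, dzz_ne0, Hp).
  (* Points of the ball are at most 2 r apart, so the Taylor remainder contributes [2 * c2 * r] and
     the variation of the derivative [c1 * r]. *)
  set (r := Cmod (dzz b p) / 2 / (c1 + 2 * c2 + 1)).
  assert (Hr : 0 < r) by (apply Rdiv_lt_0_compat; lra).
  assert (Hr1 : (c1 + 2 * c2) * r <= Cmod (dzz b p) / 2).
  { unfold r. apply Rmult_le_reg_r with (c1 + 2 * c2 + 1); [lra|].
    replace ((c1 + 2 * c2) * (Cmod (dzz b p) / 2 / (c1 + 2 * c2 + 1)) * (c1 + 2 * c2 + 1))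
      with ((c1 + 2 * c2) * (Cmod (dzz b p) / 2)) by (field; lra). nra. }
  exists r. split; auto. intros x y Hx Hy Hxp Hyp.
  assert (T := FF_taylor lower _ _ x y (u0_maj b Hb) u0_sum0 (u0_sum 1 ltac:(lia)) (u0_sum 2 ltac:(lia)) Hx Hy).
  assert (L := FF_lip lower _ _ y p (maj_kU _ _ _ (u0_maj b Hb)) (u0_sum 1 ltac:(lia)) Hm2 Hy Hp).
  fold c2 in T. fold c1 in L.
  set (e := (FF (u0 b) x - FF (u0 b) y - dFF (u0 b) y * (x - y))%C) in *.
  replace (zz b x - zz b y - dzz b p * (x - y))%C
    with (Ci * e + (FF (kU (u0 b)) y - FF (kU (u0 b)) p) * (x - y))%C.
  - apply Rle_trans with (1 := Cmod_triangle _ _). rewrite !Cmod_mult, Cmod_Ci.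
    assert (Hxy : Cmod (x - y)%C <= 2 * r).
    { replace (x - y)%C with ((x - p) + - (y - p))%C by ring.
      apply Rle_trans with (1 := Cmod_triangle _ _). rewrite Cmod_opp. lra. }
    assert (H0 := Cmod_ge_0 (x - y)%C).
    assert (E1 : c2 * Cmod (x - y)%C ^ 2 <= c2 * (2 * r) * Cmod (x - y)%C).
    { simpl. rewrite Rmult_1_r, <- Rmult_assoc. apply Rmult_le_compat_r; auto.
      now apply Rmult_le_compat_l. }
    assert (E2 : Cmod (FF (kU (u0 b)) y - FF (kU (u0 b)) p)%C <= c1 * r).
    { apply Rle_trans with (1 := L). now apply Rmult_le_compat_l. }
    apply Rle_trans with ((c1 + 2 * c2) * r * Cmod (x - y)%C).
    + assert (Cmod (FF (kU (u0 b)) y - FF (kU (u0 b)) p)%C * Cmod (x - y)%C <= c1 * r * Cmod (x - y)%C)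
        by (apply Rmult_le_compat_r; auto).
      lra.
    + apply Rmult_le_compat_r; auto.
  - unfold zz, dzz, e, dFF. set (A := FF (u0 b) x). set (B := FF (u0 b) y).
    set (K1 := FF (kU (u0 b)) y). set (K2 := FF (kU (u0 b)) p).
    assert (HCi : (Ci * Ci)%C = (- (1))%C) by (apply C_ext; simpl; ring).
    transitivity (Ci * (A - B) + (Ci * Ci) * K1 * (x - y) + (K1 - K2) * (x - y))%C; [ring|].
    rewrite HCi. ring.
Qed.

(** [zz] is a perturbation of the identity that is harmless in two regimes: deep down, where every
    mode carries at least [exp (- K0)], and for distant points, where its boundedness suffices. This
    confines the compactness argument to a bounded set modulo the period. *)
Lemma zz_far : exists K0, 0 < K0 /\
  (forall p q, Im p <= - K0 -> Im q <= - K0 -> / 2 * Cmod (p - q)%C <= Cmod (zz b p - zz b q)%C) /\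
  (forall p q, low p -> low q -> K0 <= Cmod (p - q)%C -> / 2 * Cmod (p - q)%C <= Cmod (zz b p - zz b q)%C).
Proof.
  set (m0 := SumZ (absW (u0 b))). set (m1 := SumZ (mom 1 (absW (u0 b)))).
  assert (Hm0 : 0 <= m0) by (apply SumZ_pos; [intros; apply Rabs_pos|apply u0_sum0]).
  assert (Hm1 : 0 <= m1).
  { apply SumZ_pos; [|now apply u0_sum; lia].
    intros k. unfold mom, absW. apply Rmult_le_pos; [apply pow_le|]; apply Rabs_pos. }
  exists (1 + 16 * m1 + 8 * m0). split; [lra|].
  assert (Hred : forall p q, Cmod (FF (u0 b) p - FF (u0 b) q)%C <= / 2 * Cmod (p - q)%C ->
     / 2 * Cmod (p - q)%C <= Cmod (zz b p - zz b q)%C).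
  { intros p q H. assert (T := Cmod_triangle (zz b p - zz b q) (- (Ci * (FF (u0 b) p - FF (u0 b) q)))).
    replace (zz b p - zz b q + - (Ci * (FF (u0 b) p - FF (u0 b) q)))%C with (p - q)%C in T
      by (unfold zz; ring).
    rewrite Cmod_opp, Cmod_mult, Cmod_Ci in T. lra. }
  split.
  - intros p q Hp Hq. apply Hred.
    set (K0 := 1 + 16 * m1 + 8 * m0) in *.
    assert (Hmaj : maj (fun t => t <= - K0) (u0 b) (fun k => exp (- K0) * absW (u0 b) k)).
    { intros k t Ht. unfold absW. rewrite cf_u0 by auto.
      destruct (Z_lt_dec 0 k) as [Hk|Hk]; [|rewrite Rabs_R0; lra].
      rewrite Rmult_comm. apply Rmult_le_compat_r; [apply Rabs_pos|].
      assert (1 <= IZR k) by (apply IZR_le; lia).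
      assert (IZR k * t <= - K0) by (unfold K0 in *; nra).
      destruct (Rle_lt_or_eq_dec _ _ H0) as [H1|H1]; [left; now apply exp_increasing|rewrite H1; lra]. }
    assert (S1 : sumable (mom 1 (fun k => exp (- K0) * absW (u0 b) k))).
    { apply sumable_ext with (2 := sumable_scal (exp (- K0)) _ (u0_sum 1 ltac:(lia))).
      intros k. unfold mom. ring. }
    assert (L := FF_lip _ _ _ p q Hmaj (sumable_scal _ _ u0_sum0) S1 Hp Hq).
    apply Rle_trans with (1 := L). apply Rmult_le_compat_r; [apply Cmod_ge_0|].
    rewrite (SumZ_ext _ (fun k => exp (- K0) * mom 1 (absW (u0 b)) k)) by (intros k; unfold mom; ring).
    rewrite SumZ_scal. fold m1.
    assert (He : exp (- K0) * exp K0 = 1) by (rewrite <- exp_plus, <- exp_0; f_equal; ring).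
    assert (Hx := exp_ineq1_le K0). assert (Hp0 := exp_pos (- K0)).
    assert (exp (- K0) * (1 + K0) <= 1) by nra. unfold K0 in H |- *.
    set (E := exp (- (1 + 16 * m1 + 8 * m0))) in *.
    assert (E * (16 * m1) <= 1) by nra. lra.
  - intros p q Hp Hq Hpq. apply Hred.
    assert (B1 := FF_bound lower _ _ p (u0_maj b Hb) u0_sum0 Hp).
    assert (B2 := FF_bound lower _ _ q (u0_maj b Hb) u0_sum0 Hq). fold m0 in B1, B2.
    replace (FF (u0 b) p - FF (u0 b) q)%C with (FF (u0 b) p + - FF (u0 b) q)%C by ring.
    apply Rle_trans with (1 := Cmod_triangle _ _). rewrite Cmod_opp. lra.
Qed.
End Bilip.

(** * Univalence in the closed half-plane, up to the bi-Lipschitz bound *)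

Section Univalent.
Variable b : R.
Hypothesis Hb : 0 < b < 1 / 2.
Hypothesis Hinj : forall b', 0 < b' <= b -> explicit_curve_injective (b' ^ 2).

Lemma zz_level_inj (p q : C) : low p -> Im p = Im q -> zz b p = zz b q -> p = q.
Proof.
  destruct p as [x t], q as [y t']. unfold low. simpl. intros Ht <- E.
  rewrite !(zz_level b Hb) in E by auto.
  assert (E2 : explicit_curve ((b * exp t) ^ 2) x = explicit_curve ((b * exp t) ^ 2) y).
  { transitivity (explicit_curve ((b * exp t) ^ 2) x + (0, t)%R - (0, t)%R)%C; [ring|]. rewrite E. ring. }
  apply Hinj in E2; [now subst|]. now apply depth_range.
Qed.

(** Both points of a pair are moved by the same multiple of the period, which brings the first into
    a fixed cell and leaves the difference of the images unchanged. *)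
Lemma cluster_pairs (K : R) (P Q : nat -> C) :
  (forall n, - K <= Im (P n) <= 0) -> (forall n, Cmod (P n - Q n)%C <= K) ->
  exists p q, forall eps N, 0 < eps -> exists n s, (N <= n)%nat /\ Im s = 0 /\
    (zz b (P n + s) - zz b (Q n + s) = zz b (P n) - zz b (Q n))%C /\
    Cmod (P n + s - p)%C < eps /\ Cmod (Q n + s - q)%C < eps.
Proof.
  intros HP HPQ. assert (Hpi := PI_RGT_0).
  set (s := fun n => RtoC (2 * IZR (- Int_part (Re (P n) / (2 * PI))) * PI)).
  assert (Hs : forall n, Cmod (P n + s n)%C <= 2 * PI + K).
  { intros n. apply Rle_trans with (1 := Cmod_le_sum _).
    destruct (base_Int_part (Re (P n) / (2 * PI))) as [H1 H2].
    set (k := Int_part (Re (P n) / (2 * PI))) in *.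
    assert (E : Re (P n + s n)%C = 2 * PI * (Re (P n) / (2 * PI) - IZR k)).
    { unfold s. fold k. rewrite opp_IZR.
      change (Re (P n) + 2 * - IZR k * PI = 2 * PI * (Re (P n) / (2 * PI) - IZR k)). field. lra. }
    assert (E2 : Im (P n + s n)%C = Im (P n)) by (change (Im (P n) + 0 = Im (P n)); ring).
    rewrite E, E2, Rabs_mult, !Rabs_pos_eq by lra. rewrite Rabs_left1 by apply HP.
    specialize (HP n). assert (2 * PI * (Re (P n) / (2 * PI) - IZR k) <= 2 * PI * 1) by (apply Rmult_le_compat_l; lra).
    lra. }
  destruct (cluster2 (fun n => (P n + s n)%C) (fun n => (Q n + s n)%C) (2 * PI + K + K)) as (p & q & H).
  - intros n. specialize (Hs n). assert (0 <= K) by (apply Rle_trans with (2 := HPQ n), Cmod_ge_0). lra.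
  - intros n. replace (Q n + s n)%C with ((P n + s n) + - (P n - Q n))%C by ring.
    apply Rle_trans with (1 := Cmod_triangle _ _). rewrite Cmod_opp. specialize (Hs n). specialize (HPQ n). lra.
  - exists p, q. intros eps N He. destruct (H eps N He) as (n & H1 & H2 & H3).
    exists n, (s n). repeat split; auto.
    unfold s. rewrite !(zz_period_Z b). ring.
Qed.

(** Serves both [no_double] and [zz_bilip]. The two limits cannot coincide: near a single point
    [zz_strict], with a nonzero derivative, bounds the ratio of distances from below. The last
    clause transports bounds on the height of the upper point. *)
Lemma cluster_pairs_limit (K : R) (P Q : nat -> C) :
  (forall n, - K <= Im (P n) <= 0) -> (forall n, Cmod (P n - Q n)%C <= K) ->
  (forall n, Im (Q n) <= Im (P n)) -> (forall n, P n <> Q n) ->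
  (forall n, Cmod (zz b (P n) - zz b (Q n))%C <= / INR (S n) * Cmod (P n - Q n)%C) ->
  exists p q, p <> q /\ Im q <= Im p /\ low p /\ zz b p = zz b q /\
    forall m, (forall n, Im (P n) <= m + / INR (S n)) -> Im p <= m.
Proof.
  intros HP HPQ Hle Hne Hz.
  destruct (cluster_pairs K P Q HP HPQ) as (p & q & H).
  assert (Hn : forall eps, 0 < eps -> exists N, forall n, (N <= n)%nat -> / INR (S n) < eps).
  { intros eps He. destruct (archimed_cor1 eps He) as (N & HN1 & HN2). exists N. intros n Hn.
    apply Rle_lt_trans with (2 := HN1). apply Rinv_le_contravar; [now apply lt_0_INR|]. apply le_INR. lia. }
  assert (Hlim : forall m, (forall n, Im (P n) <= m + / INR (S n)) -> Im p <= m).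
  { intros m Hm. apply le_epsilon. intros eps He. destruct (Hn (eps / 2)) as [N HN]; [lra|].
    destruct (H (eps / 2) N) as (n & s & H1 & H2 & H3 & H4 & H5); [lra|].
    assert (E := Im_le_Cmod (P n + s - p)%C). specialize (HN n H1). specialize (Hm n).
    assert (E2 : Im (P n + s - p)%C = Im (P n) - Im p) by (rewrite Im_minus, Im_plus; lra). rewrite E2 in E.
    apply Rabs_le_between in E. lra. }
  assert (Hp : low p).
  { unfold low. apply Hlim. intros n. assert (0 < / INR (S n)) by (apply Rinv_0_lt_compat, lt_0_INR; lia).
    specialize (HP n). lra. }
  assert (Hqp : Im q <= Im p).
  { apply le_epsilon. intros eps He.
    destruct (H (eps / 2) 0%nat) as (n & s & H1 & H2 & H3 & H4 & H5); [lra|].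
    assert (E := Im_le_Cmod (P n + s - p)%C). assert (E' := Im_le_Cmod (Q n + s - q)%C).
    assert (E2 : Im (P n + s - p)%C = Im (P n) - Im p) by (rewrite Im_minus, Im_plus; lra). rewrite E2 in E.
    assert (E3 : Im (Q n + s - q)%C = Im (Q n) - Im q) by (rewrite Im_minus, Im_plus; lra). rewrite E3 in E'.
    apply Rabs_le_between in E. apply Rabs_le_between in E'. specialize (Hle n). lra. }
  assert (Hq : low q) by (unfold low in *; lra).
  exists p, q. split; [|split; [|split; [|split]]]; auto.
  - intros <-.
    destruct (zz_strict b Hb p Hp) as (r & Hr & Hs).
    assert (HD : 0 < Cmod (dzz b p)) by (apply Cmod_gt_0, (dzz_ne0 b Hb); exact Hp).
    destruct (Hn (Cmod (dzz b p) / 2)) as [N HN]; [lra|].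
    destruct (H r N Hr) as (n & s & H1 & H2 & H3 & H4 & H5).
    specialize (HP n). specialize (Hle n). specialize (HN n H1). specialize (Hz n).
    assert (LP : low (P n + s)%C) by (unfold low in *; rewrite Im_plus; lra).
    assert (LQ : low (Q n + s)%C) by (unfold low in *; rewrite Im_plus; lra).
    specialize (Hs _ _ LP LQ ltac:(lra) ltac:(lra)).
    rewrite H3 in Hs. replace (P n + s - (Q n + s))%C with (P n - Q n)%C in Hs by ring.
    assert (T := Cmod_triangle (- (zz b (P n) - zz b (Q n) - dzz b p * (P n - Q n))) (zz b (P n) - zz b (Q n))).
    replace (- (zz b (P n) - zz b (Q n) - dzz b p * (P n - Q n)) + (zz b (P n) - zz b (Q n)))%C
      with (dzz b p * (P n - Q n))%C in T by ring.
    rewrite Cmod_opp, Cmod_mult in T.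
    assert (Hpos : 0 < Cmod (P n - Q n)%C).
    { apply Cmod_gt_0. intros E. apply (Hne n). replace (P n) with (P n - Q n + Q n)%C by ring. rewrite E. ring. }
    assert (/ INR (S n) * Cmod (P n - Q n)%C < Cmod (dzz b p) / 2 * Cmod (P n - Q n)%C) by now apply Rmult_lt_compat_r.
    lra.
  - destruct (zz_lip b Hb) as (L & HL & Hl).
    assert (H0 : Cmod (zz b p - zz b q)%C <= 0).
    { apply le_epsilon. intros eps He.
      assert (HK : 0 <= K) by (apply Rle_trans with (2 := HPQ 0%nat), Cmod_ge_0).
      destruct (Hn (eps / 2 / (K + 1))) as [N HN]; [apply Rdiv_lt_0_compat; lra|].
      destruct (H (eps / 4 / L) N) as (n & s & H1 & H2 & H3 & H4 & H5); [apply Rdiv_lt_0_compat; lra|].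
      specialize (HP n). specialize (Hle n). specialize (HN n H1). specialize (Hz n). specialize (HPQ n).
      assert (LP : low (P n + s)%C) by (unfold low in *; rewrite Im_plus; lra).
      assert (LQ : low (Q n + s)%C) by (unfold low in *; rewrite Im_plus; lra).
      assert (A1 := Hl _ _ LP Hp). assert (A2 := Hl _ _ LQ Hq).
      assert (B1 : L * Cmod (P n + s - p)%C <= eps / 4).
      { replace (eps / 4) with (L * (eps / 4 / L)) by (field; lra). apply Rmult_le_compat_l; lra. }
      assert (B2 : L * Cmod (Q n + s - q)%C <= eps / 4).
      { replace (eps / 4) with (L * (eps / 4 / L)) by (field; lra). apply Rmult_le_compat_l; lra. }
      assert (B3 : / INR (S n) * Cmod (P n - Q n)%C <= eps / 2).
      { apply Rle_trans with (eps / 2 / (K + 1) * (K + 1)).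
        - apply Rmult_le_compat; try lra; [|apply Cmod_ge_0].
          left. apply Rinv_0_lt_compat, lt_0_INR. lia.
        - right; field; lra. }
      replace (zz b p - zz b q)%C with (- (zz b (P n + s) - zz b p) + ((zz b (Q n + s) - zz b q) +
         (zz b (P n + s) - zz b (Q n + s))))%C by ring.
      apply Rle_trans with (1 := Cmod_triangle _ _). rewrite Cmod_opp.
      assert (T := Cmod_triangle (zz b (Q n + s) - zz b q) (zz b (P n + s) - zz b (Q n + s))).
      rewrite H3 in T |- *. lra. }
    assert (H1 := Cmod_ge_0 (zz b p - zz b q)%C).
    assert (H2 : (zz b p - zz b q)%C = RtoC 0) by (apply Cmod_eq_0; lra).
    replace (zz b p) with ((zz b p - zz b q) + zz b q)%C by ring. rewrite H2. ring.
Qed.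

Definition double (p q : C) : Prop := p <> q /\ Im q <= Im p /\ low p /\ zz b p = zz b q.

Lemma double_bounds : exists K, 0 < K /\ forall p q, Im q <= Im p -> low p ->
  p <> q -> Cmod (zz b p - zz b q)%C < / 2 * Cmod (p - q)%C -> - K <= Im p /\ Cmod (p - q)%C <= K.
Proof.
  destruct (zz_far b Hb) as (K & HK & H1 & H2). exists K. split; auto.
  intros p q Hqp Hp Hne Hz. split.
  - destruct (Rle_dec (- K) (Im p)); auto. specialize (H1 p q ltac:(lra) ltac:(lra)). lra.
  - destruct (Rle_dec (Cmod (p - q)%C) K); auto.
    specialize (H2 p q Hp ltac:(unfold low in *; lra) ltac:(lra)). lra.
Qed.

Lemma Cmod_ne (p q : C) : p <> q -> 0 < Cmod (p - q)%C.
Proof.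
  intros H. apply Cmod_gt_0. intros E. apply H. replace p with (p - q + q)%C by ring. rewrite E. ring.
Qed.

(* Take a double point whose upper preimage p is as deep as possible: by injectivity of the level
   curves the other preimage q is strictly deeper, and since zz is open at q one can lower p. *)
Lemma no_double (p q : C) : ~ double p q.
Proof.
  intros H0. destruct double_bounds as (K & HK & Hbd).
  assert (Hz0 : forall p q, double p q -> Cmod (zz b p - zz b q)%C = 0).
  { intros x y (_ & _ & _ & ->). replace (zz b y - zz b y)%C with (RtoC 0) by ring. apply Cmod_0. }
  assert (Hbd' : forall p q, double p q -> - K <= Im p /\ Cmod (p - q)%C <= K).
  { intros x y Hd. assert (E := Hz0 _ _ Hd). destruct Hd as (D1 & D2 & D3 & D4). apply Hbd; auto.
    rewrite E. generalize (Cmod_ne x y D1). lra. }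
  (* Its supremum is the greatest depth of an upper preimage, finite by [double_bounds]. *)
  set (E := fun x => exists p q, double p q /\ x = - Im p).
  destruct (completeness E) as [M [HM1 HM2]].
  { exists K. intros x (x1 & x2 & Hd & ->). destruct (Hbd' _ _ Hd). lra. }
  { exists (- Im p), p, q. auto. }
  assert (Hseq : forall n : nat, exists pq : C * C, double (fst pq) (snd pq) /\ Im (fst pq) <= - M + / INR (S n)).
  { intros n. apply NNPP. intros Hn.
    assert (Hpos : 0 < / INR (S n)) by (apply Rinv_0_lt_compat, lt_0_INR; lia).
    assert (Hub : is_upper_bound E (M - / INR (S n))).
    { intros x (x1 & x2 & Hd & ->). destruct (Rle_dec (- Im x1) (M - / INR (S n))); auto.
      exfalso. apply Hn. exists (x1, x2). cbn [fst snd]. split; auto. lra. }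
    specialize (HM2 _ Hub). lra. }
  set (PQ := fun n => proj1_sig (constructive_indefinite_description _ (Hseq n))).
  assert (HPQ : forall n, double (fst (PQ n)) (snd (PQ n)) /\ Im (fst (PQ n)) <= - M + / INR (S n)).
  { intros n. unfold PQ. destruct (constructive_indefinite_description _ (Hseq n)). auto. }
  destruct (cluster_pairs_limit K (fun n => fst (PQ n)) (fun n => snd (PQ n))) as (x & y & X1 & X2 & X3 & X4 & X5).
  - intros n. destruct (HPQ n) as [Hd _]. split; [now apply (Hbd' _ _ Hd)|apply Hd].
  - intros n. destruct (HPQ n) as [Hd _]. now apply (Hbd' _ _ Hd).
  - intros n. apply (HPQ n).
  - intros n. apply (HPQ n).
  - intros n. destruct (HPQ n) as [Hd _]. rewrite (Hz0 _ _ Hd).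
    apply Rmult_le_pos; [|apply Cmod_ge_0]. left. apply Rinv_0_lt_compat, lt_0_INR. lia.
  - specialize (X5 (- M) (fun n => proj2 (HPQ n))).
    destruct (Rle_lt_or_eq_dec _ _ X2) as [Hlt|Heq].
    2:{ apply X1. apply zz_level_inj; auto. }
    assert (Hy : low y) by (unfold low in *; lra).
    destruct (zz_strict b Hb y Hy) as (r0 & Hr0 & Hs).
    set (dl := Im x - Im y) in *.
    assert (Hdl : 0 < dl) by (unfold dl; lra).
    (* Displacements of at most a quarter of the height gap keep the ball around y in the
       half-plane, and keep the new lower point below the new upper one. *)
    set (r := Rmin r0 (dl / 4)). assert (Hr : 0 < r) by (apply Rmin_glb_lt; lra).
    assert (Hr1 : r <= r0) by apply Rmin_l. assert (Hr2 : r <= dl / 4) by apply Rmin_r.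
    destruct (zz_lip b Hb) as (L & HL & Hl).
    assert (HD0 := dzz_ne0 b Hb y Hy). assert (HD : 0 < Cmod (dzz b y)) by now apply Cmod_gt_0.
    set (e := Rmin (dl / 4) (Cmod (dzz b y) * r / 2 / L)).
    assert (HDr : 0 < Cmod (dzz b y) * r / 2) by (apply Rdiv_lt_0_compat; [apply Rmult_lt_0_compat|]; lra).
    assert (He : 0 < e) by (apply Rmin_glb_lt; [lra|apply Rdiv_lt_0_compat; lra]).
    assert (He1 : e <= dl / 4) by apply Rmin_l.
    assert (He2 : L * e <= Cmod (dzz b y) * r / 2).
    { replace (Cmod (dzz b y) * r / 2) with (L * (Cmod (dzz b y) * r / 2 / L)) by (field; lra).
      apply Rmult_le_compat_l; [lra|apply Rmin_r]. }
    set (x' := (x + (0, - e)%R)%C).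
    assert (Ix' : Im x' = Im x - e) by reflexivity.
    assert (Hx' : low x') by (unfold low in *; lra).
    destruct (local_surj (zz b) y (dzz b y) (zz b x') r) as (y' & Y1 & Y2); auto.
    + intros u v _ _ Hu Hv.
      assert (Lu : low u).
      { assert (A := Im_le_Cmod (u - y)%C). rewrite Im_minus in A. apply Rabs_le_between in A. unfold low, dl in *. lra. }
      assert (Lv : low v).
      { assert (A := Im_le_Cmod (v - y)%C). rewrite Im_minus in A. apply Rabs_le_between in A. unfold low, dl in *. lra. }
      apply Hs; auto; lra.
    + rewrite <- X4.
      apply Rle_trans with (1 := Hl _ _ Hx' X3). apply Rle_trans with (2 := He2).
      apply Rmult_le_compat_l; [lra|]. unfold x'.
      replace (x + (0, - e)%R - x)%C with (RtoC e * - Ci)%C by (apply C_ext; simpl; ring).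
      rewrite Cmod_mult, Cmod_opp, Cmod_Ci, Cmod_R, Rabs_pos_eq; lra.
    + assert (Y2' : zz b y' = zz b x') by exact Y2.
      assert (A := Im_le_Cmod (y' - y)%C). rewrite Im_minus in A. apply Rabs_le_between in A.
      assert (Hd : double x' y').
      { assert (Im y' < Im x') by (rewrite Ix'; unfold dl in *; lra).
        split; [|split; [|split]]; auto; [|lra].
        intros E'. rewrite E' in H. lra. }
      assert (HE : E (- Im x')) by (exists x', y'; auto).
      specialize (HM1 _ HE). lra.
Qed.

Lemma zz_bilip : exists c, 0 < c /\ forall p q, low p -> low q ->
  c * Cmod (p - q)%C <= Cmod (zz b p - zz b q)%C.
Proof.
  apply NNPP. intros Hno.
  (* The ratios start at 1/3 so that all of them are below 1/2, as [double_bounds] demands. *)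
  assert (Hseq : forall n : nat, exists pq : C * C, Im (snd pq) <= Im (fst pq) /\ low (fst pq) /\
     Cmod (zz b (fst pq) - zz b (snd pq))%C < / INR (S (S (S n))) * Cmod (fst pq - snd pq)%C).
  { intros n. apply NNPP. intros Hn. apply Hno. exists (/ INR (S (S (S n)))).
    split; [apply Rinv_0_lt_compat, lt_0_INR; lia|].
    intros p q Hp Hq. destruct (Rle_dec (/ INR (S (S (S n))) * Cmod (p - q)%C) (Cmod (zz b p - zz b q)%C)); auto.
    exfalso. apply Hn. destruct (Rle_dec (Im q) (Im p)).
    - exists (p, q). cbn [fst snd]. repeat split; auto. lra.
    - exists (q, p). cbn [fst snd]. repeat split; auto; [lra|].
      replace (q - p)%C with (- (p - q))%C by ring.
      replace (zz b q - zz b p)%C with (- (zz b p - zz b q))%C by ring. rewrite !Cmod_opp. lra. }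
  set (PQ := fun n => proj1_sig (constructive_indefinite_description _ (Hseq n))).
  assert (HPQ : forall n, Im (snd (PQ n)) <= Im (fst (PQ n)) /\ low (fst (PQ n)) /\
     Cmod (zz b (fst (PQ n)) - zz b (snd (PQ n)))%C < / INR (S (S (S n))) * Cmod (fst (PQ n) - snd (PQ n))%C).
  { intros n. unfold PQ. destruct (constructive_indefinite_description _ (Hseq n)). auto. }
  assert (Hne : forall n, fst (PQ n) <> snd (PQ n)).
  { intros n E. destruct (HPQ n) as (_ & _ & H). rewrite E in H.
    replace (snd (PQ n) - snd (PQ n))%C with (RtoC 0) in H by ring. rewrite Cmod_0 in H.
    generalize (Cmod_ge_0 (zz b (snd (PQ n)) - zz b (snd (PQ n)))%C). lra. }
  destruct double_bounds as (K & HK & Hbd).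
  assert (HB : forall n, - K <= Im (fst (PQ n)) /\ Cmod (fst (PQ n) - snd (PQ n))%C <= K).
  { intros n. destruct (HPQ n) as (H1 & H2 & H3). apply Hbd; auto.
    apply Rlt_le_trans with (1 := H3). apply Rmult_le_compat_r; [apply Cmod_ge_0|].
    apply Rinv_le_contravar; [lra|]. rewrite !S_INR. generalize (pos_INR n). lra. }
  destruct (cluster_pairs_limit K (fun n => fst (PQ n)) (fun n => snd (PQ n))) as (x & y & X1 & X2 & X3 & X4 & X5).
  - intros n. split; [apply HB|apply (HPQ n)].
  - intros n. apply HB.
  - intros n. apply (HPQ n).
  - exact Hne.
  - intros n. destruct (HPQ n) as (H1 & H2 & H3). left. apply Rlt_le_trans with (1 := H3).
    apply Rmult_le_compat_r; [apply Cmod_ge_0|].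
    apply Rinv_le_contravar; [apply lt_0_INR; lia|]. apply le_INR. lia.
  - apply (no_double x y). repeat split; auto.
Qed.
End Univalent.

(** * From a bi-Lipschitz conformal parametrization to a solution *)

Lemma Cmod_zero_eq (p q : C) : Cmod (p - q)%C <= 0 -> p = q.
Proof.
  intros H. assert (H1 := Cmod_ge_0 (p - q)%C).
  assert (H2 : (p - q)%C = RtoC 0) by (apply Cmod_eq_0; lra).
  replace p with ((p - q) + q)%C by ring. rewrite H2. ring.
Qed.

Lemma Cmod_small (p : C) (r : R) : Rabs (Re p) < r / 2 -> Rabs (Im p) < r / 2 -> Cmod p < r.
Proof. intros H1 H2. apply Rle_lt_trans with (1 := Cmod_le_sum _). lra. Qed.

Lemma locally_Cmod (p : C) (P : C -> Prop) :
  locally p P <-> exists e, 0 < e /\ forall w, Cmod (w - p)%C < e -> P w.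
Proof.
  split.
  - intros [e He]. exists e. split; [apply cond_pos|]. intros w Hw. apply He. split.
    + apply Rle_lt_trans with (2 := Hw). exact (Re_le_Cmod (w - p)%C).
    + apply Rle_lt_trans with (2 := Hw). exact (Im_le_Cmod (w - p)%C).
  - intros (e & He & H). assert (He2 : 0 < e / 2) by lra. exists (mkposreal _ He2).
    intros w [H1 H2]. apply H. now apply Cmod_small.
Qed.

Lemma closure_C (A : C -> Prop) (p : C) :
  closure A p <-> forall e, 0 < e -> exists q, A q /\ Cmod (q - p)%C < e.
Proof.
  split.
  - intros H e He. destruct (H (fun w => Cmod (w - p)%C < e)) as (q & H1 & H2).
    + apply locally_Cmod. exists e. auto.
    + exists q. auto.
  - intros H U HU. apply locally_Cmod in HU. destruct HU as (e & He & HU).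
    destruct (H e He) as (q & H1 & H2). exists q. auto.
Qed.

Lemma lip_continuous_on (S : C -> Prop) (f : C -> C) (K : R) :
  (forall x y, S x -> S y -> Cmod (f x - f y)%C <= K * Cmod (x - y)%C) -> continuous_on S f.
Proof.
  intros H x Hx P HP. apply locally_Cmod in HP. destruct HP as (e & He & HP).
  apply locally_Cmod. set (K' := Rabs K + 1). assert (HK : 0 < K') by (unfold K'; generalize (Rabs_pos K); lra).
  exists (e / K'). split; [now apply Rdiv_lt_0_compat|]. intros w Hw HSw. apply HP.
  apply Rle_lt_trans with (1 := H w x HSw Hx).
  apply Rle_lt_trans with (K' * Cmod (w - x)%C).
  - apply Rmult_le_compat_r; [apply Cmod_ge_0|]. unfold K'. generalize (Rle_abs K). lra.
  - replace e with (K' * (e / K')) by (field; lra). now apply Rmult_lt_compat_l.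
Qed.

Lemma lip_continuous_on_R (S : C -> Prop) (f : C -> R) :
  (forall x, S x -> exists K r, 0 < r /\ forall y, S y -> Cmod (y - x)%C < r -> Rabs (f y - f x) <= K * Cmod (y - x)%C) ->
  continuous_on S f.
Proof.
  intros H x Hx P [e HP]. destruct (H x Hx) as (K & r & Hr & HK).
  apply locally_Cmod. set (K' := Rabs K + 1). assert (HK0 : 0 < K') by (unfold K'; generalize (Rabs_pos K); lra).
  assert (He := cond_pos e).
  exists (Rmin r (e / K')). split; [apply Rmin_glb_lt; [auto|now apply Rdiv_lt_0_compat]|].
  intros w Hw HSw. apply HP.
  assert (H1 : Cmod (w - x)%C < r) by (apply Rlt_le_trans with (1 := Hw), Rmin_l).
  assert (H2 : Cmod (w - x)%C < e / K') by (apply Rlt_le_trans with (1 := Hw), Rmin_r).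
  apply Rle_lt_trans with (1 := HK w HSw H1).
  apply Rle_lt_trans with (K' * Cmod (w - x)%C).
  - apply Rmult_le_compat_r; [apply Cmod_ge_0|]. unfold K'. generalize (Rle_abs K). lra.
  - replace (pos e) with (K' * (e / K')) by (field; lra). now apply Rmult_lt_compat_l.
Qed.

Lemma is_derive_taylor (f : R -> R) (x l K r : R) : 0 < r ->
  (forall t, Rabs (t - x) < r -> Rabs (f t - f x - l * (t - x)) <= K * (t - x) ^ 2) ->
  is_derive f x l.
Proof.
  intros Hr H. apply is_derive_Reals. intros e He.
  set (K' := Rabs K + 1). assert (HK0 : 0 < K') by (unfold K'; generalize (Rabs_pos K); lra).
  assert (Hm : 0 < Rmin r (e / K')) by (apply Rmin_glb_lt; [auto|now apply Rdiv_lt_0_compat]).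
  exists (mkposreal _ Hm). intros h Hh Hhd. simpl in Hhd.
  assert (H1 : Rabs h < r) by (apply Rlt_le_trans with (1 := Hhd), Rmin_l).
  assert (H2 : Rabs h < e / K') by (apply Rlt_le_trans with (1 := Hhd), Rmin_r).
  specialize (H (x + h)). replace (x + h - x) with h in H by ring. specialize (H H1).
  replace ((f (x + h) - f x) / h - l) with ((f (x + h) - f x - l * h) / h) by (field; auto).
  unfold Rdiv. rewrite Rabs_mult, Rabs_inv. assert (Ha := Rabs_pos_lt h Hh).
  apply Rmult_lt_reg_r with (Rabs h); auto. rewrite Rmult_assoc, Rinv_l, Rmult_1_r by lra.
  apply Rle_lt_trans with (1 := H). 
  assert (E : h ^ 2 = Rabs h * Rabs h) by (rewrite <- Rabs_mult, Rabs_pos_eq; [ring|nra]). rewrite E.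
  apply Rle_lt_trans with (K' * (Rabs h * Rabs h)).
  - apply Rmult_le_compat_r; [nra|]. unfold K'. generalize (Rle_abs K). lra.
  - rewrite <- Rmult_assoc. apply Rmult_lt_compat_r; auto.
    replace e with (K' * (e / K')) by (field; lra). now apply Rmult_lt_compat_l.
Qed.

Lemma is_derive_C_taylor (f : C -> C) (p l : C) (K r : R) : 0 < r ->
  (forall w, Cmod (w - p)%C < r -> Cmod (f w - f p - l * (w - p))%C <= K * Cmod (w - p)%C ^ 2) ->
  is_derive (K := C_AbsRing) (V := C_NormedModule) f p l.
Proof.
  intros Hr H. split; [apply is_linear_scal_l|].
  intros x Hx. assert (E : x = p).
  { symmetry. apply (is_filter_lim_locally_unique (K := C_AbsRing) (V := AbsRing_NormedModule C_AbsRing)). exact Hx. }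
  subst x. intros eps.
  set (K' := Rabs K + 1). assert (HK0 : 0 < K') by (unfold K'; generalize (Rabs_pos K); lra).
  assert (He := cond_pos eps).
  assert (Hm : 0 < Rmin r (eps / K')) by (apply Rmin_glb_lt; [auto|now apply Rdiv_lt_0_compat]).
  exists (mkposreal _ Hm). intros w Hw. 
  assert (Hw' : Cmod (w - p)%C < Rmin r (eps / K')) by exact Hw.
  assert (H1 : Cmod (w - p)%C < r) by (apply Rlt_le_trans with (1 := Hw'), Rmin_l).
  assert (H2 : Cmod (w - p)%C < eps / K') by (apply Rlt_le_trans with (1 := Hw'), Rmin_r).
  specialize (H w H1).
  assert (E : minus (minus (f w) (f p)) (scal (minus w p) l) = (f w - f p - l * (w - p))%C).
  { unfold minus, plus, opp, scal; simpl. unfold mult; simpl. ring. }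
  change (norm (minus (minus (f w) (f p)) (scal (minus w p) l)) <= eps * norm (minus w p)).
  rewrite E. change (Cmod (f w - f p - l * (w - p))%C <= eps * Cmod (w - p)%C).
  apply Rle_trans with (1 := H). simpl. rewrite Rmult_1_r, <- Rmult_assoc.
  apply Rmult_le_compat_r; [apply Cmod_ge_0|].
  apply Rle_trans with (K' * Cmod (w - p)%C).
  - apply Rmult_le_compat_r; [apply Cmod_ge_0|]. unfold K'. generalize (Rle_abs K). lra.
  - replace (pos eps) with (K' * (eps / K')) by (field; lra). apply Rmult_le_compat_l; lra.
Qed.

(** ** The stream function of a holomorphic function *)

Definition lip (S : C -> Prop) (F : C -> C) : Prop :=
  exists K, 0 <= K /\ forall P Q, S P -> S Q -> Cmod (F P - F Q)%C <= K * Cmod (P - Q)%C.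
(** A quadratic Taylor estimate makes sense on sets that are not open, so it yields derivatives in
    the interior and regularity up to the boundary at once. *)
Definition nice (S : C -> Prop) (F F' : C -> C) : Prop :=
  lip S F /\ exists K, 0 <= K /\ forall P Q, S P -> S Q ->
    Cmod (F P - F Q - F' Q * (P - Q))%C <= K * Cmod (P - Q)%C ^ 2.

(** The common shape of psi and its partial derivatives. Differentiation in x replaces F by its
    derivative, in y it also multiplies k by [Ci]; one lemma thus covers all orders. *)
Definition quad (a e : R) (k : C) (F : C -> C) (x y : R) : R :=
  a * y ^ 2 + e * y + Re (k * F (x, y))%C.

Section Holo.
Variable D : C -> Prop.
Hypothesis HD : open D.

Lemma open_ball (P : C) : D P -> exists r, 0 < r /\ forall Q, Cmod (Q - P)%C < r -> D Q.
Proof. intros H. exact (proj1 (locally_Cmod P D) (HD P H)). Qed.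

Lemma quad_deriv (phi : R -> R -> R) (a e : R) (k : C) (F F' : C -> C) (x y : R) :
  (forall u v, D (u, v) -> phi u v = quad a e k F u v) -> nice D F F' -> D (x, y) ->
  is_derive (fun t => phi t y) x (quad 0 0 k F' x y) /\
  is_derive (fun t => phi x t) y (quad 0 (2 * a) (k * Ci) F' x y + e).
Proof.
  intros Hphi (_ & K & HK & HF) Hxy.
  destruct (open_ball _ Hxy) as (r & Hr & Hb).
  split.
  - apply is_derive_taylor with (K := Cmod k * K) (r := r); auto.
    intros t Ht. 
    assert (Et : ((t, y) - (x, y))%C = RtoC (t - x)) by (apply C_ext; simpl; ring).
    assert (Dt : D (t, y)) by (apply Hb; rewrite Et, Cmod_R; auto).
    rewrite !Hphi by auto. specialize (HF _ _ Dt Hxy). rewrite Et in HF.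
    unfold quad.
    replace (a * y ^ 2 + e * y + Re (k * F (t, y))%C - (a * y ^ 2 + e * y + Re (k * F (x, y))%C)
       - (0 * y ^ 2 + 0 * y + Re (k * F' (x, y))%C) * (t - x))
      with (Re (k * (F (t, y) - F (x, y) - F' (x, y) * RtoC (t - x)))%C).
    + apply Rle_trans with (1 := Re_le_Cmod _). rewrite Cmod_mult, Rmult_assoc.
      apply Rmult_le_compat_l; [apply Cmod_ge_0|]. apply Rle_trans with (1 := HF). right.
      now rewrite Cmod_R, pow2_abs.
    + destruct k as [k1 k2], (F (t, y)) as [a1 a2], (F (x, y)) as [b1 b2], (F' (x, y)) as [c1 c2]. simpl. ring.
  - apply is_derive_taylor with (K := Cmod k * K + Rabs a) (r := r); auto.
    intros t Ht.
    assert (Et : ((x, t) - (x, y))%C = (RtoC (t - y) * Ci)%C) by (apply C_ext; simpl; ring).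
    assert (Dt : D (x, t)) by (apply Hb; rewrite Et, Cmod_mult, Cmod_Ci, Cmod_R; lra).
    rewrite !Hphi by auto. specialize (HF _ _ Dt Hxy). rewrite Et in HF.
    unfold quad.
    replace (a * t ^ 2 + e * t + Re (k * F (x, t))%C - (a * y ^ 2 + e * y + Re (k * F (x, y))%C)
       - (0 * y ^ 2 + 2 * a * y + Re (k * Ci * F' (x, y))%C + e) * (t - y))
      with (Re (k * (F (x, t) - F (x, y) - F' (x, y) * (RtoC (t - y) * Ci)))%C + a * (t - y) ^ 2).
    + apply Rle_trans with (1 := Rabs_triang _ _). rewrite Rmult_plus_distr_r. apply Rplus_le_compat.
      * apply Rle_trans with (1 := Re_le_Cmod _). rewrite Cmod_mult, Rmult_assoc.
        apply Rmult_le_compat_l; [apply Cmod_ge_0|]. apply Rle_trans with (1 := HF). right.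
        now rewrite Cmod_mult, Cmod_R, Cmod_Ci, Rmult_1_r, pow2_abs.
      * rewrite Rabs_mult, (Rabs_pos_eq ((t - y) ^ 2)) by apply pow2_ge_0. apply Rle_refl.
    + destruct k as [k1 k2], (F (x, t)) as [a1 a2], (F (x, y)) as [b1 b2], (F' (x, y)) as [c1 c2]. simpl. ring.
Qed.

Lemma quad_cont (phi : R -> R -> R) (a e : R) (k : C) (F : C -> C) (x y : R) :
  (forall u v, D (u, v) -> phi u v = quad a e k F u v) -> lip D F -> D (x, y) ->
  continuity_2d_pt phi x y.
Proof.
  intros Hphi (K & HK & HF) Hxy eps.
  destruct (open_ball _ Hxy) as (r & Hr & Hb).
  set (L := Rabs a * (2 * Rabs y + 1) + Rabs e + Cmod k * K + 1).
  assert (Ha := Rabs_pos a). assert (He := Rabs_pos e). assert (Hy := Rabs_pos y).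
  assert (Hk := Cmod_ge_0 k). assert (Heps := cond_pos eps).
  assert (HL : 1 <= L) by (unfold L; assert (0 <= Cmod k * K) by nra; assert (0 <= Rabs a * (2 * Rabs y + 1)) by nra; lra).
  set (dl := Rmin (Rmin 1 r) (eps / L) / 2).
  assert (Hm : 0 < Rmin (Rmin 1 r) (eps / L)).
  { repeat apply Rmin_glb_lt; auto; try lra. apply Rdiv_lt_0_compat; lra. }
  assert (Hdl : 0 < dl) by (unfold dl; lra).
  exists (mkposreal _ Hdl). intros u v Hu Hv. simpl in Hu, Hv.
  set (w := ((u, v) - (x, y))%C).
  assert (Hw : Cmod w < Rmin (Rmin 1 r) (eps / L)) by (apply Cmod_small; [exact Hu|exact Hv]).
  assert (W1 : Cmod w < 1) by (apply Rlt_le_trans with (1 := Hw); apply Rle_trans with (1 := Rmin_l _ _), Rmin_l).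
  assert (W2 : Cmod w < r) by (apply Rlt_le_trans with (1 := Hw); apply Rle_trans with (1 := Rmin_l _ _), Rmin_r).
  assert (W3 : Cmod w < eps / L) by (apply Rlt_le_trans with (1 := Hw), Rmin_r).
  assert (Duv : D (u, v)) by now apply Hb.
  rewrite !Hphi by auto. specialize (HF _ _ Duv Hxy). fold w in HF.
  assert (Hvy : Rabs (v - y) <= Cmod w) by exact (Im_le_Cmod w).
  unfold quad.
  replace (a * v ^ 2 + e * v + Re (k * F (u, v))%C - (a * y ^ 2 + e * y + Re (k * F (x, y))%C))
    with (a * ((v - y) + 2 * y) * (v - y) + e * (v - y) + Re (k * (F (u, v) - F (x, y)))%C)
    by (destruct k as [k1 k2], (F (u, v)) as [a1 a2], (F (x, y)) as [b1 b2]; simpl; ring).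
  apply Rle_lt_trans with (L * Cmod w).
  2:{ replace (pos eps) with (L * (eps / L)) by (field; lra). apply Rmult_lt_compat_l; lra. }
  assert (T1 : Rabs (a * ((v - y) + 2 * y) * (v - y)) <= Rabs a * (2 * Rabs y + 1) * Cmod w).
  { rewrite !Rabs_mult. apply Rmult_le_compat; auto; try apply Rabs_pos.
    - apply Rmult_le_pos; apply Rabs_pos.
    - apply Rmult_le_compat_l; auto. apply Rle_trans with (1 := Rabs_triang _ _).
      rewrite Rabs_mult, (Rabs_pos_eq 2) by lra. lra. }
  assert (T2 : Rabs (e * (v - y)) <= Rabs e * Cmod w).
  { rewrite Rabs_mult. now apply Rmult_le_compat_l. }
  assert (T3 : Rabs (Re (k * (F (u, v) - F (x, y)))%C) <= Cmod k * K * Cmod w).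
  { apply Rle_trans with (1 := Re_le_Cmod _). rewrite Cmod_mult, Rmult_assoc. now apply Rmult_le_compat_l. }
  assert (T4 := Rabs_triang (a * ((v - y) + 2 * y) * (v - y) + e * (v - y)) (Re (k * (F (u, v) - F (x, y)))%C)).
  assert (T5 := Rabs_triang (a * ((v - y) + 2 * y) * (v - y)) (e * (v - y))).
  assert (T6 := Cmod_ge_0 w). unfold L. lra.
Qed.

Variables (f f1 f2 : C -> C) (psi : R -> R -> R) (Om : R).
Hypothesis Hf : nice D f f1.
Hypothesis Hf1 : nice D f1 f2.
Hypothesis Hf2 : lip D f2.
Hypothesis Hpsi : forall x y, D (x, y) -> psi x y = - Om / 2 * y ^ 2 + Im (f (x, y)).

Let psi_quad u v : D (u, v) -> psi u v = quad (- Om / 2) 0 (- Ci)%C f u v.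
Proof. intros H. rewrite Hpsi by auto. unfold quad. destruct (f (u, v)). simpl. ring. Qed.

Let psix u v := Derive (fun t => psi t v) u.
Let psiy u v := Derive (fun t => psi u t) v.

Lemma psix_quad u v : D (u, v) -> psix u v = quad 0 0 (- Ci)%C f1 u v.
Proof. intros H. apply is_derive_unique. now apply (quad_deriv psi _ _ _ _ _ u v psi_quad Hf H). Qed.
Lemma psiy_quad u v : D (u, v) -> psiy u v = quad 0 (- Om) (- Ci * Ci)%C f1 u v.
Proof.
  intros H. destruct (quad_deriv psi _ _ _ _ _ u v psi_quad Hf H) as [_ H2].
  apply is_derive_unique in H2. unfold psiy. etransitivity; [exact H2|]. unfold quad. field.
Qed.

Lemma second_quad (phi : R -> R -> R) e k : (forall u v, D (u, v) -> phi u v = quad 0 e k f1 u v) ->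
  forall u v, D (u, v) -> Derive (fun t => phi t v) u = quad 0 0 k f2 u v /\
     Derive (fun t => phi u t) v = quad 0 0 (k * Ci) f2 u v + e.
Proof.
  intros Hp u v H. destruct (quad_deriv phi _ _ _ _ _ u v Hp Hf1 H) as [H1 H2]. split.
  - now apply is_derive_unique.
  - apply is_derive_unique in H2. etransitivity; [exact H2|]. unfold quad. ring.
Qed.

Lemma second_C1 (phi : R -> R -> R) e k : (forall u v, D (u, v) -> phi u v = quad 0 e k f1 u v) ->
  forall u v, D (u, v) -> ex_diff_n phi 1 u v.
Proof.
  intros Hp u v H. destruct (quad_deriv phi _ _ _ _ _ u v Hp Hf1 H) as [H1 H2].
  split; [|split; [|split; [|split; split]]]; auto.
  - apply (quad_cont phi _ _ _ _ u v Hp); auto. apply Hf1.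
  - eexists; exact H1.
  - eexists; exact H2.
  - apply (quad_cont _ 0 0 k f2); auto. intros x y Hxy. now apply (second_quad phi e k Hp).
  - assert (Hc : continuity_2d_pt (fun x y => Derive (fun t => phi x t) y + - e) u v).
    { apply (quad_cont _ 0 0 (k * Ci)%C f2); auto. intros x y Hxy.
      rewrite (proj2 (second_quad phi e k Hp x y Hxy)). ring. }
    intros eps. destruct (Hc eps) as [dl Hdl]. exists dl. intros x y Hx Hy.
    specialize (Hdl x y Hx Hy).
    now replace (Derive (fun t => phi x t) y - Derive (fun t => phi u t) v)
      with (Derive (fun t => phi x t) y + - e - (Derive (fun t => phi u t) v + - e)) by ring.
Qed.

Lemma stream_C2 x y : D (x, y) -> ex_diff_n psi 2 x y.
Proof.
  intros H. destruct (quad_deriv psi _ _ _ _ _ x y psi_quad Hf H) as [H1 H2].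
  split; [|split; [|split; [|split]]].
  - apply (quad_cont psi _ _ _ _ x y psi_quad); auto. apply Hf.
  - eexists; exact H1.
  - eexists; exact H2.
  - exact (second_C1 psix _ _ psix_quad x y H).
  - exact (second_C1 psiy _ _ psiy_quad x y H).
Qed.

Lemma stream_gradient x y : D (x, y) ->
  partial_derive 1 0 psi x y = Im (f1 (x, y)) /\ partial_derive 0 1 psi x y = Re (f1 (x, y)) - Om * y.
Proof.
  intros H. split.
  - change (psix x y = Im (f1 (x, y))). rewrite psix_quad by auto. unfold quad. destruct (f1 (x, y)). simpl. ring.
  - change (psiy x y = Re (f1 (x, y)) - Om * y). rewrite psiy_quad by auto. unfold quad.
    destruct (f1 (x, y)). simpl. ring.
Qed.

Lemma stream_laplacian x y : D (x, y) -> laplacian psi x y = - Om.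
Proof.
  intros H. unfold laplacian.
  change (Derive (fun t => psix t y) x + Derive (fun t => psiy x t) y = - Om).
  rewrite (proj1 (second_quad psix _ _ psix_quad x y H)), (proj2 (second_quad psiy _ _ psiy_quad x y H)).
  unfold quad. destruct (f2 (x, y)). simpl. ring.
Qed.
End Holo.

(** * Products and inverses of functions with Taylor estimates *)

Section NiceAlgebra.
Variable S : C -> Prop.

Definition bdd (F : C -> C) : Prop := exists K, 0 <= K /\ forall p, S p -> Cmod (F p) <= K.

Lemma bdd_mul F G : bdd F -> bdd G -> bdd (fun p => F p * G p)%C.
Proof.
  intros (K & HK & HF) (L & HL & HG). exists (K * L). split; [nra|]. intros p Hp.
  rewrite Cmod_mult. apply Rmult_le_compat; auto; apply Cmod_ge_0.
Qed.
Lemma bdd_add F G : bdd F -> bdd G -> bdd (fun p => F p + G p)%C.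
Proof.
  intros (K & HK & HF) (L & HL & HG). exists (K + L). split; [lra|]. intros p Hp.
  apply Rle_trans with (1 := Cmod_triangle _ _). specialize (HF p Hp). specialize (HG p Hp). lra.
Qed.
Lemma bdd_opp F : bdd F -> bdd (fun p => - F p)%C.
Proof. intros (K & HK & HF). exists K. split; auto. intros p Hp. rewrite Cmod_opp. auto. Qed.

Lemma lip_mul F G : bdd F -> bdd G -> lip S F -> lip S G -> lip S (fun p => F p * G p)%C.
Proof.
  intros (K & HK & HF) (L & HL & HG) (M & HM & LF) (N & HN & LG).
  exists (M * L + K * N). split; [nra|]. intros p q Hp Hq.
  replace (F p * G p - F q * G q)%C with ((F p - F q) * G p + F q * (G p - G q))%C by ring.
  apply Rle_trans with (1 := Cmod_triangle _ _). rewrite !Cmod_mult.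
  specialize (LF p q Hp Hq). specialize (LG p q Hp Hq). assert (H0 := Cmod_ge_0 (p - q)%C).
  assert (Cmod (F p - F q)%C * Cmod (G p) <= M * Cmod (p - q)%C * L) by (apply Rmult_le_compat; auto; apply Cmod_ge_0).
  assert (Cmod (F q) * Cmod (G p - G q)%C <= K * (N * Cmod (p - q)%C)) by (apply Rmult_le_compat; auto; apply Cmod_ge_0).
  lra.
Qed.
Lemma lip_add F G : lip S F -> lip S G -> lip S (fun p => F p + G p)%C.
Proof.
  intros (M & HM & LF) (N & HN & LG). exists (M + N). split; [lra|]. intros p q Hp Hq.
  replace (F p + G p - (F q + G q))%C with ((F p - F q) + (G p - G q))%C by ring.
  apply Rle_trans with (1 := Cmod_triangle _ _). specialize (LF p q Hp Hq). specialize (LG p q Hp Hq). lra.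
Qed.
Lemma lip_opp F : lip S F -> lip S (fun p => - F p)%C.
Proof.
  intros (M & HM & LF). exists M. split; auto. intros p q Hp Hq.
  replace (- F p - - F q)%C with (- (F p - F q))%C by ring. rewrite Cmod_opp. auto.
Qed.

Lemma nice_mul F F' G G' : bdd F -> bdd F' -> bdd G -> nice S F F' -> nice S G G' ->
  nice S (fun p => F p * G p)%C (fun p => F' p * G p + F p * G' p)%C.
Proof.
  intros BF BF' BG [LF NF] [LG NG]. split; [now apply lip_mul|].
  destruct BF as (K & HK & HF), BF' as (K' & HK' & HF'), BG as (L & HL & HG), NF as (M & HM & NF), NG as (N & HN & NG),
    LG as (N' & HN' & LG).
  exists (M * L + K' * N' + K * N).
  assert (0 <= M * L) by now apply Rmult_le_pos. assert (0 <= K' * N') by now apply Rmult_le_pos.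
  assert (0 <= K * N) by now apply Rmult_le_pos.
  split; [lra|]. intros p q Hp Hq. set (h := (p - q)%C).
  replace (F p * G p - F q * G q - (F' q * G q + F q * G' q) * h)%C
    with ((F p - F q - F' q * h) * G p + (F' q * h * (G p - G q) + F q * (G p - G q - G' q * h)))%C by ring.
  apply Rle_trans with (1 := Cmod_triangle _ _).
  assert (T := Cmod_triangle (F' q * h * (G p - G q)) (F q * (G p - G q - G' q * h))).
  rewrite !Cmod_mult in *.
  specialize (NF p q Hp Hq). specialize (NG p q Hp Hq). specialize (LG p q Hp Hq). fold h in NF, NG, LG.
  assert (Hh0 := Cmod_ge_0 h).
  assert (E1 : Cmod (F p - F q - F' q * h)%C * Cmod (G p) <= M * Cmod h ^ 2 * L) by (apply Rmult_le_compat; auto; apply Cmod_ge_0).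
  assert (E2 : Cmod (F' q) * Cmod h * Cmod (G p - G q)%C <= K' * Cmod h * (N' * Cmod h)).
  { apply Rmult_le_compat; auto; try apply Cmod_ge_0; [apply Rmult_le_pos; apply Cmod_ge_0|].
    apply Rmult_le_compat_r; auto. }
  assert (E3 : Cmod (F q) * Cmod (G p - G q - G' q * h)%C <= K * (N * Cmod h ^ 2)) by (apply Rmult_le_compat; auto; apply Cmod_ge_0).
  replace ((M * L + K' * N' + K * N) * Cmod h ^ 2)
    with (M * Cmod h ^ 2 * L + (K' * Cmod h * (N' * Cmod h) + K * (N * Cmod h ^ 2))) by ring.
  lra.
Qed.

Variable c : R.
Hypothesis Hc : 0 < c.

Lemma ne0_of_bound (x : C) : c <= Cmod x -> x <> RtoC 0.
Proof. intros H ->. rewrite Cmod_0 in H. lra. Qed.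

Lemma Cmod_inv_le (x : C) : c <= Cmod x -> Cmod (/ x)%C <= / c.
Proof.
  intros H. rewrite Cmod_inv by now apply ne0_of_bound. apply Rinv_le_contravar; auto.
Qed.

Lemma bdd_inv F : (forall p, S p -> c <= Cmod (F p)) -> bdd (fun p => / F p)%C.
Proof.
  intros H. exists (/ c). split; [left; now apply Rinv_0_lt_compat|]. intros p Hp. apply Cmod_inv_le, H, Hp.
Qed.

Lemma lip_inv F : (forall p, S p -> c <= Cmod (F p)) -> lip S F -> lip S (fun p => / F p)%C.
Proof.
  intros H (K & HK & LF). exists (K * (/ c * / c)).
  assert (Hc' : 0 < / c) by now apply Rinv_0_lt_compat.
  split; [apply Rmult_le_pos; nra|]. intros p q Hp Hq.
  assert (Np := ne0_of_bound _ (H p Hp)). assert (Nq := ne0_of_bound _ (H q Hq)).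
  replace (/ F p - / F q)%C with (- (F p - F q) * (/ F p * / F q))%C by (field; auto).
  rewrite !Cmod_mult, Cmod_opp.
  assert (I1 := Cmod_inv_le _ (H p Hp)). assert (I2 := Cmod_inv_le _ (H q Hq)).
  assert (E : Cmod (/ F p)%C * Cmod (/ F q)%C <= / c * / c) by (apply Rmult_le_compat; auto; apply Cmod_ge_0).
  specialize (LF p q Hp Hq).
  apply Rle_trans with (K * Cmod (p - q)%C * (/ c * / c)); [|right; ring].
  apply Rmult_le_compat; auto; [apply Cmod_ge_0|]. apply Rmult_le_pos; apply Cmod_ge_0.
Qed.

Lemma nice_inv F F' : (forall p, S p -> c <= Cmod (F p)) -> bdd F' -> nice S F F' ->
  nice S (fun p => / F p)%C (fun p => - (F' p * (/ F p * / F p)))%C.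
Proof.
  intros H BF' [LF NF]. split; [now apply lip_inv|].
  destruct (lip_inv F H LF) as (L & HL & LI).
  destruct BF' as (K' & HK' & HF'), NF as (M & HM & NF).
  exists (K' * L * / c + M * (/ c * / c)).
  assert (Hc' : 0 < / c) by now apply Rinv_0_lt_compat.
  assert (0 <= K' * L * / c) by (apply Rmult_le_pos; [nra|lra]). assert (0 <= M * (/ c * / c)) by (apply Rmult_le_pos; nra).
  split; [lra|]. intros p q Hp Hq. set (h := (p - q)%C).
  assert (Np := ne0_of_bound _ (H p Hp)). assert (Nq := ne0_of_bound _ (H q Hq)).
  replace (/ F p - / F q - - (F' q * (/ F q * / F q)) * h)%C
    with (- (F' q * h * (/ F p - / F q) * / F q) - (F p - F q - F' q * h) * (/ F p * / F q))%C by (field; auto).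
  unfold Cminus at 1. apply Rle_trans with (1 := Cmod_triangle _ _). rewrite !Cmod_opp, !Cmod_mult.
  specialize (NF p q Hp Hq). specialize (LI p q Hp Hq). fold h in NF, LI.
  assert (I1 := Cmod_inv_le _ (H p Hp)). assert (I2 := Cmod_inv_le _ (H q Hq)).
  assert (H0' := Cmod_ge_0 h).
  assert (E1 : Cmod (F' q) * Cmod h * Cmod (/ F p - / F q)%C * Cmod (/ F q)%C <= K' * Cmod h * (L * Cmod h) * / c).
  { apply Rmult_le_compat; auto; try apply Cmod_ge_0; [repeat apply Rmult_le_pos; apply Cmod_ge_0|].
    apply Rmult_le_compat; auto; try apply Cmod_ge_0; [apply Rmult_le_pos; apply Cmod_ge_0|].
    apply Rmult_le_compat_r; auto. }
  assert (E2 : Cmod (F p - F q - F' q * h)%C * (Cmod (/ F p)%C * Cmod (/ F q)%C) <= M * Cmod h ^ 2 * (/ c * / c)).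
  { apply Rmult_le_compat; auto; [apply Cmod_ge_0|apply Rmult_le_pos; apply Cmod_ge_0|].
    apply Rmult_le_compat; auto; apply Cmod_ge_0. }
  replace ((K' * L * / c + M * (/ c * / c)) * Cmod h ^ 2)
    with (K' * Cmod h * (L * Cmod h) * / c + M * Cmod h ^ 2 * (/ c * / c)) by ring.
  lra.
Qed.
End NiceAlgebra.

Lemma lip_subset (S T : C -> Prop) F : (forall p, T p -> S p) -> lip S F -> lip T F.
Proof. intros H (K & HK & L). exists K. auto. Qed.
Lemma nice_subset (S T : C -> Prop) F F' : (forall p, T p -> S p) -> nice S F F' -> nice T F F'.
Proof.
  intros H [L (K & HK & N)]. split; [now apply lip_subset with S|]. exists K. auto.
Qed.

(** * The fluid domain and the stream function in physical coordinates *)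

Section Geom.
Variables (d c Om B G Qb : R) (z dz ddz g dg ddg : C -> C).
Let S := strip_closed d.
Hypothesis Hd : 0 < d.
Hypothesis Hc : 0 < c.
Hypothesis Hbil : forall p q, S p -> S q -> c * Cmod (p - q)%C <= Cmod (z p - z q)%C.
Hypothesis Nz : nice S z dz.
Hypothesis Ndz : nice S dz ddz.
Hypothesis Lddz : lip S ddz.
Hypothesis Ng : nice S g dg.
Hypothesis Ndg : nice S dg ddg.
Hypothesis Lddg : lip S ddg.
Hypothesis Bddz : bdd S ddz.
Hypothesis Bdg : bdd S dg.
Hypothesis Bddg : bdd S ddg.
Hypothesis Hper : forall p, z (p + RtoC (2 * PI))%C = (z p + RtoC (2 * PI))%C.
Hypothesis Hgper : forall p, Im (g (p + RtoC (2 * PI))%C) = Im (g p).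
Hypothesis Href : forall p, z (- Cconj p)%C = (- Cconj (z p))%C.
Hypothesis Hgref : forall p, Im (g (- Cconj p)%C) = Im (g p).
Hypothesis Hbot : forall al, Im (z (al, - d)%R) = - d.
Hypothesis Habove : forall p, strip_top d p -> - d < Im (z p).
Hypothesis Hid : exists K, forall p, S p -> Cmod (z p - p)%C <= K.
Hypothesis Hgtop : forall al, Im (g (al, 0)%R) = Om / 2 * Im (z (al, 0)%R) ^ 2.
Hypothesis Hgbot : forall al, Im (g (al, - d)%R) = Qb.
Hypothesis Hbern : forall al, 
  Cmod (dg (al, 0)%R - RtoC (Om * Im (z (al, 0)%R)) * dz (al, 0)%R)%C ^ 2
   = 2 * (B - G * Im (z (al, 0)%R)) * Cmod (dz (al, 0)%R) ^ 2.
Hypothesis Hcrest : forall al, Im (z (al, 0)%R) <= Im (z (PI, 0)%R).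
Hypothesis Htrough : forall al, Im (z (0, 0)%R) <= Im (z (al, 0)%R).

Definition Dom (P : C) : Prop := exists q, strip d q /\ z q = P.
Definition Dbar (P : C) : Prop := exists q, S q /\ z q = P.

Lemma strip_S q : strip d q -> S q.
Proof. unfold strip, S, strip_closed. lra. Qed.
Lemma top_S q : strip_top d q -> S q.
Proof. unfold strip_top, S, strip_closed. lra. Qed.
Lemma Dom_Dbar P : Dom P -> Dbar P.
Proof. intros (q & Hq & E). exists q. split; auto. now apply strip_S. Qed.

Lemma z_inj p q : S p -> S q -> z p = z q -> p = q.
Proof.
  intros Hp Hq E. apply Cmod_zero_eq. specialize (Hbil p q Hp Hq). rewrite E in Hbil.
  replace (z q - z q)%C with (RtoC 0) in Hbil by ring. rewrite Cmod_0 in Hbil.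
  apply Rmult_le_reg_l with c; lra.
Qed.

(** The bi-Lipschitz bound is applied to p and [p + t] with t small: a horizontal shift stays in the
    closed strip even from a boundary point. *)
Lemma dz_lower p : S p -> c <= Cmod (dz p).
Proof.
  intros Hp. destruct Nz as [_ (K & HK & N)]. apply le_epsilon. intros e He.
  set (t := e / (K + 1)). assert (Ht : 0 < t) by (apply Rdiv_lt_0_compat; lra).
  assert (HtK : K * t <= e).
  { unfold t. apply Rmult_le_reg_r with (K + 1); [lra|].
    replace (K * (e / (K + 1)) * (K + 1)) with (K * e) by (field; lra). nra. }
  set (p' := (p + RtoC t)%C).
  assert (Hp' : S p') by (unfold S, strip_closed in *; unfold p'; rewrite Im_plus; simpl Im; lra).
  assert (E : (p' - p)%C = RtoC t) by (unfold p'; ring).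
  specialize (N p' p Hp' Hp). specialize (Hbil p' p Hp' Hp). rewrite E, Cmod_R, Rabs_pos_eq in * by lra.
  assert (T := Cmod_triangle (z p' - z p - dz p * RtoC t) (dz p * RtoC t)).
  replace (z p' - z p - dz p * RtoC t + dz p * RtoC t)%C with (z p' - z p)%C in T by ring.
  rewrite Cmod_mult, Cmod_R, Rabs_pos_eq in T by lra.
  apply Rmult_le_reg_r with t; auto. nra.
Qed.

(** The inverse of z on [Dbar]; the value elsewhere is arbitrary. *)
Definition iz (P : C) : C := epsilon (inhabits (RtoC 0)) (fun q => S q /\ z q = P).

Lemma iz_spec P : Dbar P -> S (iz P) /\ z (iz P) = P.
Proof. intros H. unfold iz. apply (epsilon_spec (inhabits (RtoC 0)) (fun q => S q /\ z q = P)). exact H. Qed.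
Lemma iz_z q : S q -> iz (z q) = q.
Proof.
  intros Hq. destruct (iz_spec (z q)) as [H1 H2]; [exists q; auto|]. now apply z_inj.
Qed.
Lemma iz_lip P Q : Dbar P -> Dbar Q -> Cmod (iz P - iz Q)%C <= / c * Cmod (P - Q)%C.
Proof.
  intros HP HQ. destruct (iz_spec P HP) as [H1 E1]. destruct (iz_spec Q HQ) as [H2 E2].
  specialize (Hbil _ _ H1 H2). rewrite E1, E2 in Hbil.
  apply Rmult_le_reg_l with c; auto. rewrite <- Rmult_assoc, Rinv_r, Rmult_1_l; lra.
Qed.

Lemma comp_lip F : lip S F -> lip Dbar (fun P => F (iz P)).
Proof.
  intros (K & HK & L). exists (K * / c). assert (0 < / c) by now apply Rinv_0_lt_compat.
  split; [nra|]. intros P Q HP HQ.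
  apply Rle_trans with (1 := L _ _ (proj1 (iz_spec P HP)) (proj1 (iz_spec Q HQ))).
  rewrite Rmult_assoc. apply Rmult_le_compat_l; auto. now apply iz_lip.
Qed.

Lemma comp_nice F F' : bdd S F' -> nice S F F' ->
  nice Dbar (fun P => F (iz P)) (fun P => F' (iz P) * / dz (iz P))%C.
Proof.
  intros BF' [LF NF]. split; [now apply comp_lip|].
  destruct BF' as (K' & HK' & HF'), NF as (M & HM & NF), Nz as [_ (N & HN & NZ)].
  assert (Hc' : 0 < / c) by now apply Rinv_0_lt_compat.
  set (A := M + K' * / c * N).
  assert (HA : 0 <= A) by (unfold A; assert (0 <= K' * / c * N) by (repeat apply Rmult_le_pos; lra); lra).
  exists (A * (/ c) ^ 2). split; [apply Rmult_le_pos; auto; apply pow_le; lra|].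
  intros P Q HP HQ. assert (LI := iz_lip P Q HP HQ).
  destruct (iz_spec P HP) as [H1 E1]. destruct (iz_spec Q HQ) as [H2 E2].
  set (p := iz P) in *. set (q := iz Q) in *.
  rewrite <- E1, <- E2 at 1.
  assert (Hq0 := ne0_of_bound c Hc _ (dz_lower q H2)).
  replace (F p - F q - F' q * / dz q * (z p - z q))%C
    with ((F p - F q - F' q * (p - q)) + - (F' q * / dz q * (z p - z q - dz q * (p - q))))%C by (field; auto).
  apply Rle_trans with (1 := Cmod_triangle _ _). rewrite Cmod_opp, !Cmod_mult.
  specialize (NF p q H1 H2). specialize (NZ p q H1 H2).
  assert (T : Cmod (F' q) * Cmod (/ dz q)%C * Cmod (z p - z q - dz q * (p - q))%C <= K' * / c * (N * Cmod (p - q)%C ^ 2)).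
  { apply Rmult_le_compat; auto; try apply Cmod_ge_0; [apply Rmult_le_pos; apply Cmod_ge_0|].
    apply Rmult_le_compat; auto; try apply Cmod_ge_0. apply (Cmod_inv_le c Hc), dz_lower, H2. }
  apply Rle_trans with (A * Cmod (p - q)%C ^ 2); [unfold A; lra|].
  rewrite Rmult_assoc, <- Rpow_mult_distr. apply Rmult_le_compat_l; auto.
  apply pow_incr. split; [apply Cmod_ge_0|auto].
Qed.

(** The derivative of g composed with the inverse of z, pulled back to the strip. *)
Definition RR (q : C) : C := (dg q * / dz q)%C.
Definition RR' (q : C) : C := (ddg q * / dz q + dg q * - (ddz q * (/ dz q * / dz q)))%C.

Lemma Binv : bdd S (fun p => / dz p)%C.
Proof. apply (bdd_inv S c Hc). apply dz_lower. Qed.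
Lemma Linv : lip S (fun p => / dz p)%C.
Proof. apply (lip_inv S c Hc); [apply dz_lower|apply Ndz]. Qed.
Lemma RR_nice : nice S RR RR'.
Proof.
  apply nice_mul; auto; [apply Binv|]. apply (nice_inv S c Hc); auto. apply dz_lower.
Qed.
Lemma RR'_bdd : bdd S RR'.
Proof.
  assert (H := Binv). unfold RR'. apply bdd_add; [now apply bdd_mul|].
  apply bdd_mul; auto. apply bdd_opp. apply bdd_mul; auto. now apply bdd_mul.
Qed.
Lemma RR'_lip : lip S RR'.
Proof.
  assert (H := Binv). assert (H2 := Linv). assert (B2 := bdd_mul S _ _ H H).
  assert (L2 := lip_mul S _ _ H H H2 H2).
  unfold RR'. apply lip_add; [now apply lip_mul|].
  apply lip_mul; auto.
  - apply bdd_opp. now apply bdd_mul.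
  - apply Ndg.
  - apply lip_opp. now apply lip_mul.
Qed.

(** [local_surj] at each interior point; r keeps the ball inside the strip and the derivative within
    c/2 of its central value. *)
Lemma Dom_open : open Dom.
Proof.
  intros P (q & Hq & E). apply locally_Cmod.
  assert (HqS := strip_S q Hq).
  assert (Hl := dz_lower q HqS). assert (HD0 := ne0_of_bound c Hc _ Hl).
  destruct Nz as [_ (N & HN & NZ)], Ndz as [(M & HM & LM) _].
  unfold strip in Hq.
  set (r := Rmin (Rmin (- Im q / 2) ((Im q + d) / 2)) (c / 2 / (2 * N + M + 1))).
  assert (Hr : 0 < r).
  { repeat apply Rmin_glb_lt; try lra. apply Rdiv_lt_0_compat; lra. }
  assert (R1 : r <= - Im q / 2) by (apply Rle_trans with (1 := Rmin_l _ _), Rmin_l).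
  assert (R2 : r <= (Im q + d) / 2) by (apply Rle_trans with (1 := Rmin_l _ _), Rmin_r).
  assert (R3 : (2 * N + M) * r <= c / 2).
  { apply Rle_trans with ((2 * N + M + 1) * (c / 2 / (2 * N + M + 1))); [|right; field; lra].
    apply Rmult_le_compat; try lra. apply Rmin_r. }
  assert (Hin : forall x, Cmod (x - q)%C <= r -> strip d x).
  { intros x Hx. assert (A := Im_le_Cmod (x - q)%C). rewrite Im_minus in A.
    apply Rabs_le_between in A. unfold strip. lra. }
  exists (Cmod (dz q) * r / 2). split; [apply Rdiv_lt_0_compat; [apply Rmult_lt_0_compat|]; lra|].
  intros w Hw.
  destruct (local_surj z q (dz q) w r) as (x & X1 & X2); auto.
  - intros x y _ _ Hx Hy. assert (Sx := strip_S x (Hin x Hx)). assert (Sy := strip_S y (Hin y Hy)).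
    specialize (NZ x y Sx Sy). specialize (LM y q Sy HqS).
    replace (z x - z y - dz q * (x - y))%C with ((z x - z y - dz y * (x - y)) + (dz y - dz q) * (x - y))%C by ring.
    apply Rle_trans with (1 := Cmod_triangle _ _). rewrite Cmod_mult.
    assert (Hxy : Cmod (x - y)%C <= 2 * r).
    { replace (x - y)%C with ((x - q) + - (y - q))%C by ring.
      apply Rle_trans with (1 := Cmod_triangle _ _). rewrite Cmod_opp. lra. }
    assert (H0 := Cmod_ge_0 (x - y)%C).
    assert (E1 : N * Cmod (x - y)%C ^ 2 <= N * (2 * r) * Cmod (x - y)%C).
    { simpl. rewrite Rmult_1_r, <- Rmult_assoc. apply Rmult_le_compat_r; auto. now apply Rmult_le_compat_l. }
    assert (E2 : Cmod (dz y - dz q)%C * Cmod (x - y)%C <= M * r * Cmod (x - y)%C).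
    { apply Rmult_le_compat_r; auto. apply Rle_trans with (1 := LM). now apply Rmult_le_compat_l. }
    assert (E3 : (2 * N + M) * r * Cmod (x - y)%C <= Cmod (dz q) / 2 * Cmod (x - y)%C).
    { apply Rmult_le_compat_r; auto. lra. }
    lra.
  - rewrite E. lra.
  - exists x. split; auto.
Qed.

Lemma z_lip : exists L, 0 < L /\ forall p q, S p -> S q -> Cmod (z p - z q)%C <= L * Cmod (p - q)%C.
Proof.
  destruct Nz as [(L & HL & H) _]. exists (L + 1). split; [lra|]. intros p q Hp Hq.
  apply Rle_trans with (1 := H p q Hp Hq). apply Rmult_le_compat_r; [apply Cmod_ge_0|lra].
Qed.

(** The lower bi-Lipschitz bound turns convergence of images into convergence of preimages, and the
    closed strip is closed. *)
Lemma closure_Dom P : closure Dom P <-> Dbar P.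
Proof.
  rewrite closure_C. destruct z_lip as (L & HL & HzL). split.
  - intros H.
    assert (Hseq : forall n : nat, exists q, strip d q /\ Cmod (z q - P)%C < c / 2 * (/ 2) ^ n).
    { intros n. destruct (H (c / 2 * (/ 2) ^ n)) as (Q & (q & Hq & <-) & HQ).
      - apply Rmult_lt_0_compat; [lra|apply pow_lt; lra].
      - exists q. auto. }
    set (qs := fun n => proj1_sig (constructive_indefinite_description _ (Hseq n))).
    assert (Hqs : forall n, strip d (qs n) /\ Cmod (z (qs n) - P)%C < c / 2 * (/ 2) ^ n).
    { intros n. unfold qs. destruct (constructive_indefinite_description _ (Hseq n)). auto. }
    destruct (geom_Cauchy_C qs 1) as (l & Hl).
    { intros n. destruct (Hqs n) as [H1 H2]. destruct (Hqs (Datatypes.S n)) as [H3 H4].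
      assert (A := Hbil _ _ (strip_S _ H3) (strip_S _ H1)).
      assert (T := Cmod_triangle (z (qs (Datatypes.S n)) - P) (- (z (qs n) - P))). rewrite Cmod_opp in T.
      replace (z (qs (Datatypes.S n)) - P + - (z (qs n) - P))%C with (z (qs (Datatypes.S n)) - z (qs n))%C in T by ring.
      assert (Hp : 0 < (/ 2) ^ n) by (apply pow_lt; lra). simpl in H4.
      apply Rmult_le_reg_l with c; auto. nra. }
    assert (Sl : S l).
    { assert (Hlim : forall e, 0 < e -> - d - e <= Im l <= e).
      { intros e He. destruct (half_pow_small (4 * 1) e He) as [n Hn]. specialize (Hl n).
        assert (A := Im_le_Cmod (l - qs n)%C). rewrite Im_minus in A. apply Rabs_le_between in A.
        destruct (Hqs n) as [H1 _]. unfold strip in H1. lra. }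
      split; apply le_epsilon; intros e He; specialize (Hlim e He); lra. }
    exists l. split; auto. apply Cmod_zero_eq. apply le_epsilon. intros e He.
    destruct (half_pow_small (L * (4 * 1) + c / 2) e He) as [n Hn]. specialize (Hl n).
    destruct (Hqs n) as [H1 H2]. assert (A := HzL _ _ Sl (strip_S _ H1)).
    replace (z l - P)%C with ((z l - z (qs n)) + (z (qs n) - P))%C by ring.
    apply Rle_trans with (1 := Cmod_triangle _ _).
    assert (L * Cmod (l - qs n)%C <= L * (4 * 1 * (/ 2) ^ n)) by (apply Rmult_le_compat_l; lra). lra.
  - intros (q & Hq & <-) e He.
    (* move q slightly towards the middle of the strip *)
    set (t := Rmin (/ 2) (e / 2 / (L * d))).
    assert (HLd : 0 < L * d) by now apply Rmult_lt_0_compat.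
    assert (Ht : 0 < t <= / 2).
    { split; [apply Rmin_glb_lt; [lra|apply Rdiv_lt_0_compat; lra]|apply Rmin_l]. }
    assert (Ht2 : L * d * t <= e / 2).
    { replace (e / 2) with (L * d * (e / 2 / (L * d))) by (field; split; lra).
      apply Rmult_le_compat_l; [lra|apply Rmin_r]. }
    set (q' := (q + (0, t * (- d / 2 - Im q))%R)%C).
    unfold S, strip_closed in Hq.
    assert (Hq' : strip d q').
    { unfold strip, q'. rewrite Im_plus. simpl (Im (_, _)).
      assert (0 <= (1 - t) * (Im q + d)) by (apply Rmult_le_pos; lra).
      assert (0 <= (1 - t) * (- Im q)) by (apply Rmult_le_pos; lra).
      assert (0 < t * d) by (apply Rmult_lt_0_compat; lra). split; lra. }
    exists (z q'). split; [exists q'; auto|].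
    apply Rle_lt_trans with (1 := HzL _ _ (strip_S _ Hq') Hq).
    apply Rle_lt_trans with (L * (d * t)); [|lra].
    apply Rmult_le_compat_l; [lra|]. unfold q'.
    replace (q + (0, t * (- d / 2 - Im q))%R - q)%C with (RtoC (t * (- d / 2 - Im q)) * Ci)%C
      by (apply C_ext; simpl; ring).
    rewrite Cmod_mult, Cmod_Ci, Cmod_R, Rabs_mult, (Rabs_pos_eq t), Rmult_1_r, Rmult_comm by lra.
    apply Rmult_le_compat_r; [lra|]. apply Rabs_le. lra.
Qed.

Lemma S_bot al : S (al, - d)%R.
Proof. unfold S, strip_closed. simpl. lra. Qed.
Lemma S_top al : S (al, 0)%R.
Proof. unfold S, strip_closed. simpl. lra. Qed.

(** On the bottom line [Re z] stays within a bounded distance of the parameter, so it takes every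
    real value. *)
Lemma bottom_surj (P : C) : Im P = - d <-> exists al : R, z (al, - d)%R = P.
Proof.
  split.
  - intros HP. destruct Hid as [K HK]. destruct z_lip as (L & HL & HzL).
    set (f := fun al => Re (z (al, - d)%R)).
    assert (Hf : forall al, Rabs (f al - al) <= K).
    { intros al. apply Rle_trans with (2 := HK _ (S_bot al)).
      exact (Re_le_Cmod (z (al, - d)%R - (al, - d)%R)%C). }
    assert (HfL : forall x y : R, Rabs (f y - f x) <= L * Rabs (y - x)).
    { intros x y. apply Rle_trans with (Cmod (z (y, - d)%R - z (x, - d)%R)%C).
      - exact (Re_le_Cmod (z (y, - d)%R - z (x, - d)%R)%C).
      - apply Rle_trans with (1 := HzL _ _ (S_bot y) (S_bot x)).
        assert (E : ((y, - d)%R - (x, - d)%R)%C = RtoC (y - x)) by (apply C_ext; simpl; ring).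
        rewrite E, Cmod_R. lra. }
    assert (Hcont : continuity f).
    { intros x. apply continuity_pt_filterlim.
      apply (filterlim_locally (F := locally x) f (f x)). intros e.
      assert (He := cond_pos e). assert (Hr : 0 < e / L) by now apply Rdiv_lt_0_compat.
      exists (mkposreal _ Hr). intros y Hy. change (Rabs (y - x) < e / L) in Hy.
      change (Rabs (f y - f x) < e). apply Rle_lt_trans with (1 := HfL x y).
      replace (pos e) with (L * (e / L)) by (field; lra).
      now apply Rmult_lt_compat_l. }
    assert (HK0 : 0 <= K) by (apply Rle_trans with (2 := Hf 0), Rabs_pos).
    destruct (IVT_gen f (Re P - K) (Re P + K) (Re P) Hcont) as (al & _ & Hal).
    { assert (A1 := Hf (Re P - K)). assert (A2 := Hf (Re P + K)).
      apply Rabs_le_between in A1. apply Rabs_le_between in A2.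
      split; [apply Rle_trans with (1 := Rmin_l _ _); lra|apply Rle_trans with (2 := Rmax_r _ _); lra]. }
    exists al. apply C_ext; [exact Hal|]. rewrite Hbot. auto.
  - intros [al <-]. apply Hbot.
Qed.

Lemma not_Dom_edge q : S q -> ~ strip d q -> ~ Dom (z q).
Proof.
  intros Hq Hn (q' & Hq' & E). apply z_inj in E; auto; [now subst|now apply strip_S].
Qed.

Lemma frontier_Dom P : frontier Dom P <-> (Im P = - d \/ free_surface z P).
Proof.
  assert (Hn : closure (fun q => ~ Dom q) P <-> ~ Dom P).
  { rewrite closure_C. split.
    - intros H HP. assert (Ho := Dom_open P HP). apply locally_Cmod in Ho. destruct Ho as (e & He & Ho).
      destruct (H e He) as (q & Hq & Hqe). apply Hq, Ho, Hqe.
    - intros H e He. exists P. split; auto. replace (P - P)%C with (RtoC 0) by ring. rewrite Cmod_0. auto. }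
  unfold frontier. rewrite Hn, closure_Dom. split.
  - intros [(q & Hq & <-) HP].
    destruct (Req_dec (Im q) (- d)) as [E|E].
    + left. apply bottom_surj. exists (Re q). rewrite <- E. now destruct q.
    + right. exists (Re q). f_equal. apply C_ext; auto. simpl.
      destruct (Req_dec (Im q) 0) as [E2|E2]; auto. exfalso. apply HP. exists q. split; auto.
      unfold S, strip_closed in Hq. unfold strip. lra.
  - intros [H|[al ->]].
    + apply bottom_surj in H. destruct H as [al <-]. split.
      * exists (al, - d)%R. split; auto. apply S_bot.
      * apply not_Dom_edge; [apply S_bot|]. unfold strip. simpl. lra.
    + split.
      * exists (al, 0)%R. split; auto. apply S_top.
      * apply not_Dom_edge; [apply S_top|]. unfold strip. simpl. lra.
Qed.

(** The preimages are joined by a segment in the convex strip; at the last parameter for which the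
    image belongs to U, the two open sets meet. *)
Lemma Dom_connected : connected Dom.
Proof.
  intros U V HU HV Hcov (p1 & (q1 & Hq1 & E1) & Hp1) (p2 & (q2 & Hq2 & E2) & Hp2).
  apply NNPP. intros Hno.
  destruct z_lip as (L & HL & HzL).
  set (ga := fun t : R => (q1 + RtoC t * (q2 - q1))%C).
  assert (Hga : forall t, 0 <= t <= 1 -> strip d (ga t)).
  { intros t Ht. unfold strip in *. unfold ga. rewrite Im_plus.
    replace (Im (RtoC t * (q2 - q1))%C) with (t * (Im q2 - Im q1)) by (simpl; unfold Im; ring).
    destruct (Req_dec t 0) as [->|Ht0]; [lra|].
    assert (0 < t * (Im q2 + d)) by (apply Rmult_lt_0_compat; lra).
    assert (0 < t * (- Im q2)) by (apply Rmult_lt_0_compat; lra).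
    assert (0 <= (1 - t) * (Im q1 + d)) by (apply Rmult_le_pos; lra).
    assert (0 <= (1 - t) * (- Im q1)) by (apply Rmult_le_pos; lra).
    split; lra. }
  set (D0 := Cmod (q2 - q1)%C + 1). assert (HD0 : 1 <= D0) by (unfold D0; generalize (Cmod_ge_0 (q2 - q1)%C); lra).
  assert (Hlip : forall s t, 0 <= s <= 1 -> 0 <= t <= 1 -> Cmod (z (ga s) - z (ga t))%C <= L * D0 * Rabs (s - t)).
  { intros s t Hs Ht. apply Rle_trans with (1 := HzL _ _ (strip_S _ (Hga s Hs)) (strip_S _ (Hga t Ht))).
    rewrite Rmult_assoc. apply Rmult_le_compat_l; [lra|].
    replace (ga s - ga t)%C with (RtoC (s - t) * (q2 - q1))%C.
    - rewrite Cmod_mult, Cmod_R, Rmult_comm. apply Rmult_le_compat_r; [apply Rabs_pos|]. unfold D0. lra.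
    - unfold ga. rewrite RtoC_minus. ring. }
  assert (HLD : 0 < L * D0) by nra.
  assert (Hop : forall O : C -> Prop, open O -> forall t, 0 <= t <= 1 -> O (z (ga t)) ->
     exists r, 0 < r /\ forall s, 0 <= s <= 1 -> Rabs (s - t) < r -> O (z (ga s))).
  { intros O HO t Ht HOt. assert (H := HO _ HOt). apply locally_Cmod in H. destruct H as (e & He & H).
    exists (e / (L * D0)). split; [now apply Rdiv_lt_0_compat|]. intros s Hs Hst. apply H.
    apply Rle_lt_trans with (1 := Hlip s t Hs Ht).
    replace e with (L * D0 * (e / (L * D0))) by (field; split; lra). now apply Rmult_lt_compat_l. }
  assert (HDom : forall t, 0 <= t <= 1 -> Dom (z (ga t))) by (intros t Ht; exists (ga t); auto).
  set (E := fun t => 0 <= t <= 1 /\ U (z (ga t))).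
  assert (HE0 : E 0).
  { split; [lra|]. replace (ga 0) with q1 by (unfold ga; ring). now rewrite E1. }
  assert (HV1 : V (z (ga 1))) by (replace (ga 1) with q2 by (unfold ga; ring); now rewrite E2).
  destruct (completeness E) as [T [HT1 HT2]].
  { exists 1. intros t [Ht _]. lra. }
  { exists 0. exact HE0. }
  assert (HT : 0 <= T <= 1).
  { split; [now apply HT1|]. apply HT2. intros t [Ht _]. lra. }
  destruct (Hcov _ (HDom T HT)) as [HUT|HVT].
  - destruct (Hop U HU T HT HUT) as (r & Hr & HrU).
    destruct (Rlt_le_dec T 1) as [Hlt|Hge].
    + set (s := T + Rmin (r / 2) (1 - T)).
      assert (M1 := Rmin_l (r / 2) (1 - T)). assert (M2 := Rmin_r (r / 2) (1 - T)).
      assert (M3 : 0 < Rmin (r / 2) (1 - T)) by (apply Rmin_glb_lt; lra).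
      assert (Hs : E s).
      { split; [unfold s; lra|]. apply HrU; [unfold s; lra|]. unfold s.
        replace (T + Rmin (r / 2) (1 - T) - T) with (Rmin (r / 2) (1 - T)) by ring.
        rewrite Rabs_pos_eq; lra. }
      specialize (HT1 s Hs). unfold s in HT1. lra.
    + assert (T = 1) by lra. subst T. apply Hno. exists (z (ga 1)). repeat split; auto.
  - destruct (Hop V HV T HT HVT) as (r & Hr & HrV).
    assert (Hex : exists t, E t /\ T - r < t).
    { apply NNPP. intros Hn. assert (Hub : is_upper_bound E (T - r)).
      { intros t Ht. destruct (Rle_dec t (T - r)); auto. exfalso. apply Hn. exists t. split; auto. lra. }
      specialize (HT2 _ Hub). lra. }
    destruct Hex as (t & [Ht HUt] & Htr). assert (t <= T) by (apply HT1; split; auto).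
    apply Hno. exists (z (ga t)). repeat split; auto.
    apply HrV; auto. rewrite Rabs_left1; lra.
Qed.

(** A particular solution of the Poisson equation plus a harmonic function. *)
Definition psi (x y : R) : R := - Om / 2 * y ^ 2 + Im (g (iz (x, y)%R)).

Lemma Dbar_shift P : Dbar P -> Dbar (P + RtoC (2 * PI))%C /\ iz (P + RtoC (2 * PI))%C = (iz P + RtoC (2 * PI))%C.
Proof.
  intros HP. destruct (iz_spec P HP) as [H1 H2].
  assert (H3 : S (iz P + RtoC (2 * PI))%C).
  { unfold S, strip_closed in *. rewrite Im_plus. simpl (Im (RtoC _)). lra. }
  assert (E : z (iz P + RtoC (2 * PI))%C = (P + RtoC (2 * PI))%C) by (rewrite Hper, H2; auto).
  split; [eexists; split; eauto|]. rewrite <- E at 1. now apply iz_z.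
Qed.

Lemma Dbar_reflect P : Dbar P -> iz (- Cconj P)%C = (- Cconj (iz P))%C.
Proof.
  intros HP. destruct (iz_spec P HP) as [H1 H2].
  assert (H3 : S (- Cconj (iz P))%C).
  { unfold S, strip_closed in *. replace (Im (- Cconj (iz P))%C) with (Im (iz P)) by (simpl; unfold Im; ring). auto. }
  assert (E : z (- Cconj (iz P))%C = (- Cconj P)%C) by (rewrite Href, H2; auto).
  rewrite <- E at 1. now apply iz_z.
Qed.

Lemma psi_period x y : closure Dom (x, y) -> psi (x + 2 * PI) y = psi x y.
Proof.
  intros H. apply closure_Dom in H. destruct (Dbar_shift _ H) as [_ E].
  unfold psi. replace (x + 2 * PI, y)%R with ((x, y) + RtoC (2 * PI))%C by (apply C_ext; simpl; ring).
  now rewrite E, Hgper.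
Qed.

Lemma Dom_period x y : Dom (x + 2 * PI, y)%R <-> Dom (x, y).
Proof.
  assert (E : (x + 2 * PI, y)%R = ((x, y) + RtoC (2 * PI))%C) by (apply C_ext; simpl; ring).
  rewrite E. split.
  - intros (q & Hq & Eq). exists (q - RtoC (2 * PI))%C. split.
    + unfold strip in *. rewrite Im_minus. simpl (Im (RtoC _)). lra.
    + assert (H := Hper (q - RtoC (2 * PI))%C).
      replace (q - RtoC (2 * PI) + RtoC (2 * PI))%C with q in H by ring. rewrite Eq in H.
      replace (z (q - RtoC (2 * PI))%C) with (z (q - RtoC (2 * PI)) + RtoC (2 * PI) - RtoC (2 * PI))%C by ring.
      rewrite <- H. ring.
  - intros (q & Hq & Eq). exists (q + RtoC (2 * PI))%C. split.
    + unfold strip in *. rewrite Im_plus. simpl (Im (RtoC _)). lra.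
    + now rewrite Hper, Eq.
Qed.

Lemma Dom_reflect x y : Dom (x, y) -> Dom (- x, y)%R.
Proof.
  intros (q & Hq & Eq). exists (- Cconj q)%C. split.
  - unfold strip in *. replace (Im (- Cconj q)%C) with (Im q) by (simpl; unfold Im; ring). auto.
  - rewrite Href, Eq. apply C_ext; simpl; ring.
Qed.

Lemma psi_reflect x y : closure Dom (x, y) -> psi (- x) y = psi x y.
Proof.
  intros H. apply closure_Dom in H. unfold psi.
  replace (- x, y)%R with (- Cconj (x, y))%C by (apply C_ext; simpl; ring).
  now rewrite Dbar_reflect, Hgref.
Qed.

Lemma closure_reflect x y : closure Dom (x, y) -> closure Dom (- x, y)%R.
Proof.
  rewrite !closure_Dom. intros (q & Hq & Eq). exists (- Cconj q)%C. split.
  - unfold S, strip_closed in *. replace (Im (- Cconj q)%C) with (Im q) by (simpl; unfold Im; ring). auto.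
  - rewrite Href, Eq. apply C_ext; simpl; ring.
Qed.

(** Locates the symmetry lines. At PI the reflection is combined with a period, since - PI and PI
    differ by one. *)
Lemma z_axis : Re (z (0, 0)%R) = 0 /\ Re (z (PI, 0)%R) = PI.
Proof.
  split.
  - assert (H := Href (0, 0)%R). replace (- Cconj (0, 0)%R)%C with ((0, 0)%R : C) in H by (apply C_ext; simpl; ring).
    apply (f_equal Re) in H. change (Re (z (0, 0)%R) = - Re (z (0, 0)%R)) in H. lra.
  - assert (H := Href (PI, 0)%R). assert (H2 := Hper (- Cconj (PI, 0)%R)%C).
    replace (- Cconj (PI, 0)%R + RtoC (2 * PI))%C with ((PI, 0)%R : C) in H2 by (apply C_ext; simpl; ring).
    rewrite H in H2. apply (f_equal Re) in H2.
    change (Re (z (PI, 0)%R) = - Re (z (PI, 0)%R) + 2 * PI) in H2. lra.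
Qed.

Theorem geometry_solution :
  water_wave_solution G Om B (- Om / 2 * d ^ 2 + Qb) d Dom psi d z.
Proof.
  destruct z_axis as [A0 A1].
  set (f := fun P => g (iz P)). set (f1 := fun P => RR (iz P)).
  set (f2 := fun P => (RR' (iz P) * / dz (iz P))%C).
  assert (N1 : nice Dbar f f1) by (apply (comp_nice g dg); auto).
  assert (N2 : nice Dbar f1 f2) by (apply (comp_nice RR RR'); [apply RR'_bdd|apply RR_nice]).
  assert (L2 : lip Dbar f2).
  { apply (comp_lip (fun q => RR' q * / dz q)%C). apply lip_mul.
    - apply RR'_bdd.
    - apply Binv.
    - apply RR'_lip.
    - apply Linv. }
  assert (M1 := nice_subset _ _ _ _ Dom_Dbar N1). assert (M2 := nice_subset _ _ _ _ Dom_Dbar N2).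
  assert (M3 := lip_subset _ _ _ Dom_Dbar L2).
  assert (Hpsi : forall x y, Dom (x, y) -> psi x y = - Om / 2 * y ^ 2 + Im (f (x, y))) by reflexivity.
  constructor.
  - split; [apply Dom_open|split; [apply Dom_connected|]].
    exists (z (0, - d / 2)%R). exists (0, - d / 2)%R. split; auto. unfold strip. simpl. lra.
  - constructor.
    + exact Hd.
    + intros P. reflexivity.
    + destruct z_lip as (L & HL & H). now apply lip_continuous_on with L.
    + exact bottom_surj.
    + intros p q Hp Hq. apply z_inj; now apply top_S.
    + exists dz. split; [|split].
      * intros p Hp. destruct Nz as [_ (K & HK & H)]. assert (Hp' := Hp). unfold strip in Hp.
        apply is_derive_C_taylor with (K := K) (r := Rmin (- Im p) (Im p + d)); [apply Rmin_glb_lt; lra|].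
        intros w Hw. apply H; [|now apply strip_S].
        assert (E := Im_le_Cmod (w - p)%C). rewrite Im_minus in E. apply Rabs_le_between in E.
        assert (E1 := Rmin_l (- Im p) (Im p + d)). assert (E2 := Rmin_r (- Im p) (Im p + d)).
        unfold S, strip_closed. lra.
      * destruct Ndz as [(K & HK & H) _]. apply lip_continuous_on with K.
        intros x y Hx Hy. apply H; now apply top_S.
      * intros al. apply (ne0_of_bound c Hc), dz_lower, S_top.
    + intros p _. apply Hper.
  - exact frontier_Dom.
  - intros P [(q & Hq & <-)|[al ->]]; apply Habove; unfold strip, strip_top in *; simpl; lra.
  - exact Dom_period.
  - exact psi_period.
  - exists PI. split; [exact Hcrest|]. rewrite A1. split.
    + intros x y H. replace (2 * PI - x) with (- x + 2 * PI) by ring. apply Dom_period, Dom_reflect, H.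
    + intros x y H. replace (2 * PI - x) with (- x + 2 * PI) by ring.
      rewrite psi_period by now apply closure_reflect. now apply psi_reflect.
  - exists 0. split; [exact Htrough|]. rewrite A0. split.
    + intros x y H. replace (2 * 0 - x) with (- x) by ring. now apply Dom_reflect.
    + intros x y H. replace (2 * 0 - x) with (- x) by ring. now apply psi_reflect.
  - apply lip_continuous_on_R. intros P HP. apply closure_Dom in HP.
    destruct N1 as [(K & HK & HL) _].
    exists (Rabs Om / 2 * (2 * Rabs (Im P) + 1) + K), 1. split; [lra|].
    intros P' HP' Hclose. apply closure_Dom in HP'. specialize (HL P' P HP' HP).
    assert (E1 := Im_le_Cmod (P' - P)%C). rewrite Im_minus in E1.
    assert (E2 : Rabs (Im (f P') - Im (f P)) <= K * Cmod (P' - P)%C).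
    { rewrite <- Im_minus. apply Rle_trans with (1 := Im_le_Cmod _). exact HL. }
    unfold psi. replace (Re P', Im P')%R with P' by (now destruct P'). replace (Re P, Im P)%R with P by (now destruct P).
    fold (f P') (f P).
    replace (- Om / 2 * Im P' ^ 2 + Im (f P') - (- Om / 2 * Im P ^ 2 + Im (f P)))
      with (- (Om / 2 * ((Im P' - Im P) + 2 * Im P) * (Im P' - Im P)) + (Im (f P') - Im (f P))) by field.
    apply Rle_trans with (1 := Rabs_triang _ _). rewrite Rabs_Ropp, !Rabs_mult.
    assert (Eo : Rabs (Om / 2) = Rabs Om / 2) by (unfold Rdiv; rewrite Rabs_mult, (Rabs_pos_eq (/ 2)); lra).
    rewrite Eo. rewrite Rmult_plus_distr_r. apply Rplus_le_compat; auto.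
    assert (Ho := Rabs_pos Om).
    apply Rmult_le_compat; try apply Rabs_pos; auto.
    + apply Rmult_le_pos; [lra|apply Rabs_pos].
    + apply Rmult_le_compat_l; [lra|]. apply Rle_trans with (1 := Rabs_triang _ _).
      rewrite Rabs_mult, (Rabs_pos_eq 2) by lra. lra.
  - exact (stream_C2 Dom Dom_open f f1 f2 psi Om M1 M2 M3 Hpsi).
  - exact (stream_laplacian Dom Dom_open f f1 f2 psi Om M1 M2 Hpsi).
  - intros P [al ->]. unfold psi.
    replace (Re (z (al, 0)%R), Im (z (al, 0)%R))%R with (z (al, 0)%R) by (now destruct (z (al, 0)%R)).
    rewrite iz_z by apply S_top. rewrite Hgtop. field.
  - exists (fun P => Im (f1 P)), (fun P => Re (f1 P) - Om * Im P).
    destruct N2 as [(K & HK & HL) _].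
    split; [|split; [|split]].
    + apply lip_continuous_on_R. intros P HP. apply closure_Dom in HP.
      exists K, 1. split; [lra|]. intros P' HP' _. apply closure_Dom in HP'.
      rewrite <- Im_minus. apply Rle_trans with (1 := Im_le_Cmod _). now apply HL.
    + apply lip_continuous_on_R. intros P HP. apply closure_Dom in HP.
      exists (K + Rabs Om), 1. split; [lra|]. intros P' HP' _. apply closure_Dom in HP'.
      replace (Re (f1 P') - Om * Im P' - (Re (f1 P) - Om * Im P))
        with (Re (f1 P' - f1 P)%C + - (Om * Im (P' - P)%C)) by (rewrite Re_minus, Im_minus; ring).
      apply Rle_trans with (1 := Rabs_triang _ _). rewrite Rabs_Ropp, Rabs_mult, Rmult_plus_distr_r.
      apply Rplus_le_compat.
      * apply Rle_trans with (1 := Re_le_Cmod _). now apply HL.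
      * apply Rmult_le_compat_l; [apply Rabs_pos|apply Im_le_Cmod].
    + intros x y H. destruct (stream_gradient Dom Dom_open f f1 psi Om M1 Hpsi x y H) as [-> ->].
      split; reflexivity.
    + intros P [al ->]. unfold f1. rewrite iz_z by apply S_top.
      set (q := (al, 0)%R : C) in *. assert (Hbq := Hbern al). fold q in Hbq.
      assert (Hq0 := ne0_of_bound c Hc _ (dz_lower q (S_top al))).
      assert (E : (Im (RR q) ^ 2 + (Re (RR q) - Om * Im (z q)) ^ 2) =
         Cmod (RR q - RtoC (Om * Im (z q)))%C ^ 2).
      { unfold Cmod. rewrite pow2_sqrt by (apply Rplus_le_le_0_compat; apply pow2_ge_0).
        destruct (RR q) as [r1 r2]. simpl. ring. }
      rewrite E. unfold RR.
      replace (dg q * / dz q - RtoC (Om * Im (z q)))%C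
        with ((dg q - RtoC (Om * Im (z q)) * dz q) * / dz q)%C by (field; auto).
      rewrite Cmod_mult, Rpow_mult_distr, Hbq, Cmod_inv by auto.
      assert (Cmod (dz q) <> 0) by (apply Rgt_not_eq; now apply Cmod_gt_0).
      field; auto.
  - intros x. unfold psi. destruct (proj1 (bottom_surj (x, - d)%R) eq_refl) as [al Eal].
    rewrite <- Eal, iz_z by apply S_bot. rewrite Hgbot. field.
Qed.
End Geom.

(** * Series in the finite strip *)

Lemma mom_mom (M : Z -> R) (i j : nat) (k : Z) : mom i (mom j M) k = mom (i + j) M k.
Proof. unfold mom. rewrite pow_add. ring. Qed.

Lemma FF_ext u u' p : (forall k, u k = u' k) -> FF u p = FF u' p.
Proof. intros H. apply CS_ext. intros k. now rewrite H. Qed.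

Section Pack.
Variables (d : R) (u M : Z -> R).
Hypothesis Hmaj : maj (fun t => - d <= t <= 0) u M.

Let S := strip_closed d.

Lemma pack_sum0 : sumable (mom 0 M) -> sumable M.
Proof. apply sumable_ext. intros k. unfold mom. ring. Qed.

Lemma pack_bdd : sumable (mom 0 M) -> bdd S (FF u).
Proof.
  intros H0. exists (Rabs (2 * SumZ M)). split; [apply Rabs_pos|]. intros p Hp.
  apply Rle_trans with (2 := Rle_abs _).
  apply (FF_bound (fun t => - d <= t <= 0)); auto. now apply pack_sum0.
Qed.

Lemma pack_lip : sumable (mom 0 M) -> sumable (mom 1 M) -> lip S (FF u).
Proof.
  intros H0 H1. exists (Rabs (8 * SumZ (mom 1 M))). split; [apply Rabs_pos|]. intros p q Hp Hq.
  apply Rle_trans with (8 * SumZ (mom 1 M) * Cmod (p - q)%C).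
  - apply (FF_lip (fun t => - d <= t <= 0)); auto. now apply pack_sum0.
  - apply Rmult_le_compat_r; [apply Cmod_ge_0|apply Rle_abs].
Qed.

Lemma pack_nice : sumable (mom 0 M) -> sumable (mom 1 M) -> sumable (mom 2 M) -> nice S (FF u) (dFF u).
Proof.
  intros H0 H1 H2. split; [now apply pack_lip|].
  exists (Rabs (8 * SumZ (mom 2 M))). split; [apply Rabs_pos|]. intros p q Hp Hq.
  apply Rle_trans with (8 * SumZ (mom 2 M) * Cmod (p - q)%C ^ 2).
  - apply (FF_taylor (fun t => - d <= t <= 0)); auto. now apply pack_sum0.
  - apply Rmult_le_compat_r; [apply pow_le, Cmod_ge_0|apply Rle_abs].
Qed.
End Pack.

Lemma bdd_scal S c F : bdd S F -> bdd S (fun p => c * F p)%C.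
Proof.
  intros (K & HK & H). exists (Cmod c * K). split; [apply Rmult_le_pos; auto; apply Cmod_ge_0|].
  intros p Hp. rewrite Cmod_mult. apply Rmult_le_compat_l; auto. apply Cmod_ge_0.
Qed.
Lemma bdd_const S c : bdd S (fun _ => c).
Proof. exists (Cmod c). split; [apply Cmod_ge_0|]. intros; lra. Qed.
Lemma lip_scal S c F : lip S F -> lip S (fun p => c * F p)%C.
Proof.
  intros (K & HK & H). exists (Cmod c * K). split; [apply Rmult_le_pos; auto; apply Cmod_ge_0|].
  intros p q Hp Hq. replace (c * F p - c * F q)%C with (c * (F p - F q))%C by ring.
  rewrite Cmod_mult, Rmult_assoc. apply Rmult_le_compat_l; auto. apply Cmod_ge_0.
Qed.

Lemma nice_affine S (m : C) u u' : (forall k, kU u k = u' k) -> nice S (FF u) (dFF u) ->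
  nice S (fun p => m * p + Ci * FF u p)%C (fun p => m + FF u' p)%C.
Proof.
  intros Hu [(L & HL & Lip) (K & HK & H)].
  assert (HCi : (Ci * Ci)%C = (- (1))%C) by (apply C_ext; simpl; ring).
  split.
  - exists (Cmod m + L). split; [generalize (Cmod_ge_0 m); lra|]. intros p q Hp Hq.
    replace (m * p + Ci * FF u p - (m * q + Ci * FF u q))%C
      with (m * (p - q) + Ci * (FF u p - FF u q))%C by ring.
    apply Rle_trans with (1 := Cmod_triangle _ _). rewrite !Cmod_mult, Cmod_Ci.
    specialize (Lip p q Hp Hq). lra.
  - exists K. split; auto. intros p q Hp Hq. rewrite <- (FF_ext _ _ q Hu).
    replace (m * p + Ci * FF u p - (m * q + Ci * FF u q) - (m + FF (kU u) q) * (p - q))%C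
      with (Ci * (FF u p - FF u q - dFF u q * (p - q)))%C.
    + rewrite Cmod_mult, Cmod_Ci, Rmult_1_l. now apply H.
    + unfold dFF. transitivity (Ci * (FF u p - FF u q) + (Ci * Ci) * FF (kU u) q * (p - q))%C; [ring|].
      rewrite HCi. ring.
Qed.

Lemma nice_shift S (m : C) u : nice S (FF u) (dFF u) -> nice S (fun p => m + FF u p)%C (dFF u).
Proof.
  intros [(L & HL & Lip) (K & HK & H)]. split.
  - exists L. split; auto. intros p q Hp Hq.
    replace (m + FF u p - (m + FF u q))%C with (FF u p - FF u q)%C by ring. auto.
  - exists K. split; auto. intros p q Hp Hq.
    replace (m + FF u p - (m + FF u q) - dFF u q * (p - q))%C
      with (FF u p - FF u q - dFF u q * (p - q))%C by ring. auto.
Qed.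

(** For symmetric f, these are the coefficients of the holomorphic function in the strip whose real
    part is f on the top and the mean of f on the bottom. *)
Definition upd (d : R) (f : W) : W := (f + Hd d f)%W.

Lemma cf_up d f k : upd d f k = (1 + mH d k) * f k.
Proof. unfold upd. rewrite cf_add, cf_Hd. ring. Qed.

Lemma exp_sinh_bound (d x t : R) : 1 <= d -> d <= x -> 0 <= t <= x -> exp (- x) / sinh x * exp t <= 2 / d.
Proof.
  intros Hd Hx Ht. assert (Hs := sinh_ge x ltac:(lra)).
  assert (E : exp (- x) * exp t <= 1).
  { rewrite <- exp_plus. apply exp_neg_le1. lra. }
  apply Rmult_le_reg_r with (sinh x * d); [apply Rmult_lt_0_compat; lra|].
  replace (exp (- x) / sinh x * exp t * (sinh x * d)) with ((exp (- x) * exp t) * d) by (field; lra).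
  replace (2 / d * (sinh x * d)) with (2 * sinh x) by (field; lra). nra.
Qed.

Lemma mH_neg (d : R) (k : Z) : 1 <= d -> (k < 0)%Z ->
  mH d k + 1 = - (exp (- (- IZR k * d)) / sinh (- IZR k * d)) /\ d <= - IZR k * d.
Proof.
  intros Hd Hk. assert (H1 : 1 <= - IZR k) by (rewrite <- opp_IZR; apply IZR_le; lia).
  assert (Hx : d <= - IZR k * d) by nra. split; auto.
  rewrite <- coth_minus_1 by lra. replace k with (- (- k))%Z at 1 by lia. rewrite mH_opp. unfold mH.
  destruct (Z.eq_dec (- k) 0); [lia|]. rewrite Rmax_right, opp_IZR by auto. ring.
Qed.

(* On the strip, |1 + coth (k d)| e^(k t) is bounded for both signs of k. *)
Lemma up_maj (d : R) (f : W) : 1 <= d -> maj (fun t => - d <= t <= 0) (upd d f) (fun k => 4 * absW f k).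
Proof.
  intros Hd k t Ht. rewrite cf_up, Rabs_mult. unfold absW.
  replace (Rabs (1 + mH d k) * Rabs (f k) * exp (IZR k * t))
    with ((Rabs (1 + mH d k) * exp (IZR k * t)) * Rabs (f k)) by ring.
  apply Rmult_le_compat_r; [apply Rabs_pos|].
  destruct (Z_lt_dec k 0) as [Hk|Hk].
  - destruct (mH_neg d k Hd Hk) as [E Hx]. rewrite Rplus_comm, E, Rabs_Ropp.
    set (x := - IZR k * d) in *.
    assert (H1 : 1 <= - IZR k) by (rewrite <- opp_IZR; apply IZR_le; lia).
    assert (Hs := sinh_ge x ltac:(lra)).
    rewrite Rabs_pos_eq by (apply Rlt_le, Rdiv_lt_0_compat; [apply exp_pos|lra]).
    apply Rle_trans with (2 / d).
    + apply exp_sinh_bound; auto. unfold x. split; nra.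
    + apply Rmult_le_reg_r with d; [lra|]. unfold Rdiv. rewrite Rmult_assoc, Rinv_l by lra. lra.
  - assert (H0 : 0 <= IZR k) by (apply IZR_le; lia).
    assert (E : exp (IZR k * t) <= 1) by (apply exp_neg_le1; nra).
    assert (H := mH_le d k). assert (T := Rabs_triang 1 (mH d k)). rewrite Rabs_R1 in T.
    assert (Hp := exp_pos (IZR k * t)). assert (Hp2 := Rabs_pos (1 + mH d k)). nra.
Qed.

Lemma mom_scal n c M : sumable (mom n M) -> sumable (mom n (fun k => c * M k)).
Proof.
  intros H. apply sumable_ext with (2 := sumable_scal c _ H). intros k. unfold mom. ring.
Qed.

Lemma up_mom (f : W) n : (n <= 3)%nat -> sumable (mom n (fun k => 4 * absW f k)).
Proof. intros Hn. apply mom_scal. now apply mom_W. Qed.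

Lemma up_pack (d : R) (f : W) : 1 <= d ->
  bdd (strip_closed d) (FF (upd d f)) /\ nice (strip_closed d) (FF (upd d f)) (dFF (upd d f)) /\
  bdd (strip_closed d) (dFF (upd d f)) /\ lip (strip_closed d) (dFF (upd d f)).
Proof.
  intros Hd. assert (H := up_maj d f Hd).
  assert (H1 := maj_kU _ _ _ H).
  assert (HM : forall n, (n <= 2)%nat -> sumable (mom n (mom 1 (fun k => 4 * absW f k)))).
  { intros n Hn. apply sumable_ext with (2 := up_mom f (n + 1) ltac:(lia)). intros k. now rewrite mom_mom. }
  split; [|split; [|split]].
  - apply (pack_bdd d _ _ H). now apply up_mom; lia.
  - apply (pack_nice d _ _ H); apply up_mom; lia.
  - unfold dFF. apply bdd_scal. apply (pack_bdd d _ _ H1). apply HM; lia.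
  - unfold dFF. apply lip_scal. apply (pack_lip d _ _ H1); apply HM; lia.
Qed.

Lemma kU_up (d : R) (f f' : W) : isL f f' -> forall k, kU (upd d f) k = upd d f' k.
Proof. intros H k. unfold kU. rewrite !cf_up, H. ring. Qed.

(** ** Boundary values *)

(** The modes k and -k cancel, because [(1 + coth x) exp (- x) + (1 - coth x) exp x = 0] for
    [x = k d]. *)
Lemma up_bottom (d : R) (f : W) (al : R) : 1 <= d -> sym f -> Re (FF (upd d f) (al, - d)%R) = f 0%Z.
Proof.
  intros Hd Hf.
  assert (Hs : Csumable (fun k => RtoC (upd d f k) * ee k (al, - d)%R)%C).
  { apply (maj_Csum (fun t => - d <= t <= 0) _ (fun k => 4 * absW f k)).
    - now apply up_maj.
    - apply pack_sum0. apply up_mom. lia.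
    - simpl. lra. }
  destruct Hs as [Hs _].
  set (F := fun k => Re (RtoC (upd d f k) * ee k (al, - d)%R)%C) in *.
  change (SumZ F = f 0%Z).
  destruct (SumZ_bij F Z.opp Z.opp Z.opp_involutive Z.opp_involutive Hs) as [H1 H2].
  assert (HF : forall k, F k = (1 + mH d k) * f k * (exp (- (IZR k * d)) * cos (IZR k * al))).
  { intros k. unfold F. rewrite cf_up. simpl. replace (IZR k * - d) with (- (IZR k * d)) by ring. ring. }
  destruct (SumZ_single (fun k => F k + F (- k)%Z) 0) as [_ H3].
  - intros k Hk. rewrite !HF, Hf, mH_opp, opp_IZR.
    replace (- IZR k * al) with (- (IZR k * al)) by ring. rewrite cos_neg.
    replace (- (- IZR k * d)) with (IZR k * d) by ring.
    assert (E : (1 + mH d k) * exp (- (IZR k * d)) + (1 - mH d k) * exp (IZR k * d) = 0).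
    { unfold mH. destruct (Z.eq_dec k 0); [tauto|]. rewrite Rmax_right by auto.
      set (x := IZR k * d). assert (Hx : sinh x <> 0).
      { intros E. assert (x <> 0) by (apply Rmult_integral_contrapositive; split; [now apply IZR_neq|lra]).
        destruct (Rtotal_order x 0) as [Hl|[Hl|Hl]]; auto; generalize (sinh_lt _ _ Hl); rewrite sinh_0; lra. }
      replace ((1 + cosh x / sinh x) * exp (- x) + (1 - cosh x / sinh x) * exp x)
        with (((sinh x + cosh x) * exp (- x) + (sinh x - cosh x) * exp x) / sinh x) by (field; auto).
      assert (En : (sinh x + cosh x) * exp (- x) + (sinh x - cosh x) * exp x = 0) by (unfold sinh, cosh; field).
      rewrite En. field. exact Hx. }
    replace ((1 + mH d k) * f k * (exp (- (IZR k * d)) * cos (IZR k * al)) +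
      (1 + - mH d k) * f k * (exp (IZR k * d) * cos (IZR k * al)))
      with (((1 + mH d k) * exp (- (IZR k * d)) + (1 - mH d k) * exp (IZR k * d)) * (f k * cos (IZR k * al))) by ring.
    rewrite E. ring.
  - rewrite SumZ_plus in H3 by auto. rewrite H2 in H3. simpl in H3.
    rewrite HF in H3. unfold mH in H3. simpl in H3.
    replace (0 * d) with 0 in H3 by ring. rewrite Ropp_0, exp_0, Rmult_0_l, cos_0 in H3. lra.
Qed.

Lemma Ev_sym (f : W) al : conj f = f -> Im (Ev f al) = 0.
Proof.
  intros H. assert (E := Ev_conj f al). rewrite H in E. apply (f_equal Im) in E.
  change (Im (Ev f al) = - Im (Ev f al)) in E. lra.
Qed.
Lemma Ev_anti (f : W) al : conj f = (- f)%W -> Re (Ev f al) = 0.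
Proof.
  intros H. assert (E := Ev_conj f al). rewrite H, Ev_opp in E. apply (f_equal Re) in E.
  change (- Re (Ev f al) = Re (Ev f al)) in E. lra.
Qed.

Lemma Hd_sym d f : conj f = f -> conj (Hd d f) = (- Hd d f)%W.
Proof.
  intros H. assert (E := Hd_conj d f). rewrite H in E.
  transitivity (- - conj (Hd d f))%W; [ring|]. now rewrite <- E.
Qed.

(** * From a zero of the equation to a solution of the free boundary problem *)

Section Wave.
Variables (d Om B G c : R) (x : W).
Hypothesis Hd1 : 1 <= d.
Hypothesis Hx : sym x.
Hypothesis HE : EE Om (2 * B) G d x = 0%W.

Let y := yx x.
Let p := Hs x.
Let V := (Wc (Om / 2) * (y * y))%W.
Let V' := (Wc Om * (y * p))%W.
(* z = [zf], and psi = - Om y^2 / 2 + Im (g o z^-1), with g = [gf]. *)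
Definition zf (P : C) : C := (1 * P + Ci * FF (upd d (yx x)) P)%C.
Definition dzf (P : C) : C := (1 + FF (upd d (Hs x)) P)%C.
Definition gf (P : C) : C := (RtoC (x 0%Z) * P + Ci * FF (upd d (Wc (Om / 2) * (yx x * yx x))%W) P)%C.
Definition dgf (P : C) : C := (RtoC (x 0%Z) + FF (upd d (Wc Om * (yx x * Hs x))%W) P)%C.

Lemma y_isL : isL y p.
Proof.
  apply isL_J. unfold p. rewrite cf_Hs. unfold msg. simpl. ring.
Qed.
Lemma V_isL : isL V V'.
Proof.
  assert (H := isL_scal (Om / 2) _ _ (isL_mul _ _ _ _ y_isL y_isL)).
  apply isL_ext with (1 := H). unfold V'.
  replace (p * y + y * p)%W with (Wc 2 * (y * p))%W by (rewrite Wc_2; ring).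
  transitivity (Wc (Om / 2) * Wc 2 * (y * p))%W; [ring|]. rewrite <- Wc_mul. do 2 f_equal. field.
Qed.

Let Sd := strip_closed d.

Lemma zf_nice : nice Sd zf dzf.
Proof.
  apply nice_affine; [apply kU_up, y_isL|]. now apply up_pack.
Qed.
Lemma gf_nice : nice Sd gf dgf.
Proof.
  apply nice_affine; [apply kU_up, V_isL|]. now apply up_pack.
Qed.

Lemma yc : conj y = y.
Proof. now apply yx_sym. Qed.
Lemma pc : conj p = (- p)%W.
Proof. now apply Hs_anti. Qed.
Lemma Vc : conj V = V.
Proof. unfold V. now rewrite !conj_mul, conj_Wc, yc. Qed.
Lemma C_real (w : C) : Im w = 0 -> w = RtoC (Re w).
Proof. intros H. apply C_ext; auto. Qed.

Lemma Ev_y al : Ev y al = RtoC (cs y al).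
Proof. apply C_real, Ev_sym, yc. Qed.

Lemma zf_top_im al : Im (zf (al, 0)%R) = cs y al.
Proof.
  unfold zf. fold y. rewrite FF_Ev. unfold upd. rewrite Ev_add, Ev_y.
  assert (H := Ev_anti (Hd d y) al (Hd_sym d y yc)).
  replace (Im (1 * (al, 0)%R + Ci * (RtoC (cs y al) + Ev (Hd d y) al))%C)
    with (cs y al + Re (Ev (Hd d y) al)) by (simpl; unfold Re; ring).
  rewrite H. ring.
Qed.

Lemma gf_top_im al : Im (gf (al, 0)%R) = Om / 2 * cs y al ^ 2.
Proof.
  unfold gf. fold y. fold V. rewrite FF_Ev. unfold upd. rewrite Ev_add.
  assert (H := Ev_anti (Hd d V) al (Hd_sym d V Vc)).
  replace (Im (RtoC (x 0%Z) * (al, 0)%R + Ci * (Ev V al + Ev (Hd d V) al))%C)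
    with (Re (Ev V al) + Re (Ev (Hd d V) al)) by (simpl; unfold Re; ring).
  rewrite H. unfold V at 1. rewrite Ev_scal, Ev_mul, Ev_y. simpl. ring.
Qed.

Lemma dzf_top al : dzf (al, 0)%R = (Ev (Xd d x) al + Ev p al)%C.
Proof.
  unfold dzf. fold p. rewrite FF_Ev. unfold upd, Xd. fold p. rewrite !Ev_add, Ev_1. ring.
Qed.

(** On the surface the term [V'] of [dgf] cancels against [Om * y * p], so that [dgf - Om y dzf] is
    the real number given by [Nd]; the claim is then the equation [EE = 0] evaluated on the
    circle. *)
Lemma bern_top al :
  Cmod (dgf (al, 0)%R - RtoC (Om * Im (zf (al, 0)%R)) * dzf (al, 0)%R)%C ^ 2
   = 2 * (B - G * Im (zf (al, 0)%R)) * Cmod (dzf (al, 0)%R) ^ 2.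
Proof.
  rewrite (zf_top_im al), (dzf_top al). set (Y := cs y al).
  assert (HX := Ev_sym _ al (Xd_sym x Hx d)). apply C_real in HX. set (X := Re (Ev (Xd d x) al)) in *.
  assert (HP : Ev p al = (RtoC (Im (Ev p al)) * Ci)%C).
  { assert (H := Ev_anti p al pc). destruct (Ev p al) as [r s]. simpl in H. rewrite H.
    apply C_ext; simpl; ring. }
  set (P := Im (Ev p al)) in *.
  assert (HN := Ev_sym _ al (Nd_sym x Hx Om d)). apply C_real in HN. set (N := Re (Ev (Nd Om d x) al)) in *.
  assert (E1 : (dgf (al, 0)%R - RtoC (Om * Y) * (Ev (Xd d x) al + Ev p al))%C = RtoC N).
  { rewrite <- HN. unfold dgf, Nd. fold y p. fold V'. rewrite FF_Ev. unfold upd.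
    rewrite !Ev_add, Ev_scal, Ev_sub, Ev_mul, Ev_y. fold Y.
    assert (EV : Ev V' al = (RtoC Om * (RtoC Y * Ev p al))%C) by (unfold V'; now rewrite Ev_scal, Ev_mul, Ev_y).
    assert (EH : Hd d V' = (Wc Om * Hd d (y * p))%W).
    { apply W_ext. intros k. unfold V'. rewrite cf_Hd, !cf_Wc_mul, cf_Hd. ring. }
    rewrite EH, Ev_scal, EV, Pz_Wc, Ev_Wc, RtoC_mult. ring. }
  rewrite E1.
  assert (E2 : N ^ 2 = (2 * B - 2 * G * Y) * (X ^ 2 + P ^ 2)).
  { assert (H := f_equal (fun f => Ev f al) HE). cbn beta in H. unfold EE in H. fold y p in H.
    rewrite Ev_0, Ev_sub, !Ev_mul, !Ev_sub, !Ev_mul, !Ev_Wc, HN, HX, HP, Ev_y in H. fold Y in H.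
    apply (f_equal Re) in H. simpl in H. lra. }
  assert (E3 : Cmod (Ev (Xd d x) al + Ev p al)%C ^ 2 = X ^ 2 + P ^ 2).
  { rewrite HX, HP. unfold Cmod. rewrite pow2_sqrt by (apply Rplus_le_le_0_compat; apply pow2_ge_0).
    simpl. ring. }
  rewrite E3, Cmod_R, pow2_abs, E2. ring.
Qed.

Lemma zf_per P : zf (P + RtoC (2 * PI))%C = (zf P + RtoC (2 * PI))%C.
Proof. unfold zf. rewrite FF_period. ring. Qed.

Lemma zf_ref P : zf (- Cconj P)%C = (- Cconj (zf P))%C.
Proof.
  unfold zf. rewrite FF_reflect. destruct P as [p1 p2], (FF (upd d (yx x)) (p1, p2)) as [f1 f2].
  apply C_ext; simpl; ring.
Qed.

Lemma zf_bottom al : Im (zf (al, - d)%R) = - d.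
Proof.
  assert (H := up_bottom d y al Hd1 (proj2 (sym_conj y) yc)). 
  assert (Hy0 : y 0%Z = 0).
  { unfold y, yx. rewrite cf_J. unfold mJ. simpl. ring. }
  rewrite Hy0 in H. unfold zf. fold y. 
  replace (Im (1 * (al, - d)%R + Ci * FF (upd d y) (al, - d)%R)%C)
    with (- d + Re (FF (upd d y) (al, - d)%R)) by (simpl; unfold Re; ring).
  rewrite H. ring.
Qed.

Lemma gf_bottom al : Im (gf (al, - d)%R) = V 0%Z - x 0%Z * d.
Proof.
  assert (H := up_bottom d V al Hd1 (proj2 (sym_conj V) Vc)).
  unfold gf. fold y. fold V.
  replace (Im (RtoC (x 0%Z) * (al, - d)%R + Ci * FF (upd d V) (al, - d)%R)%C)
    with (- (x 0%Z * d) + Re (FF (upd d V) (al, - d)%R)) by (simpl; unfold Re; ring).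
  rewrite H. ring.
Qed.

Lemma wave_solution : 0 < c ->
  (forall P Q, Sd P -> Sd Q -> c * Cmod (P - Q)%C <= Cmod (zf P - zf Q)%C) ->
  (forall P, strip_top d P -> - d < Im (zf P)) ->
  (forall al, cs y al <= cs y PI) -> (forall al, cs y 0 <= cs y al) ->
  exists Q D psi, water_wave_solution G Om B Q d D psi d zf.
Proof.
  intros Hc Hbil Habove Hcrest Htrough.
  destruct (up_pack d p Hd1) as (B1 & N1 & B2 & L2).
  destruct (up_pack d V' Hd1) as (B3 & N3 & B4 & L4).
  destruct (up_pack d y Hd1) as (B5 & _).
  eexists _, _, _.
  apply (geometry_solution d c Om B G (V 0%Z - x 0%Z * d) zf dzf (dFF (upd d p)) gf dgf (dFF (upd d V'))).
  - lra.
  - exact Hc.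
  - exact Hbil.
  - exact zf_nice.
  - now apply nice_shift.
  - exact L2.
  - exact gf_nice.
  - now apply nice_shift.
  - exact L4.
  - exact B2.
  - apply bdd_add; [apply bdd_const|exact B3].
  - exact B4.
  - exact zf_per.
  - intros P. unfold gf. rewrite FF_period.
    destruct P as [p1 p2], (FF (upd d (Wc (Om / 2) * (yx x * yx x))%W) (p1, p2)) as [f1 f2]. simpl. ring.
  - exact zf_ref.
  - intros P. unfold gf. rewrite FF_reflect.
    destruct P as [p1 p2], (FF (upd d (Wc (Om / 2) * (yx x * yx x))%W) (p1, p2)) as [f1 f2]. simpl. ring.
  - exact zf_bottom.
  - exact Habove.
  - destruct B5 as (K & HK & H). exists K. intros P HP. unfold zf. fold y.
    replace (1 * P + Ci * FF (upd d y) P - P)%C with (Ci * FF (upd d y) P)%C by ring.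
    rewrite Cmod_mult, Cmod_Ci, Rmult_1_l. now apply H.
  - intros al. now rewrite gf_top_im, zf_top_im.
  - exact gf_bottom.
  - exact bern_top.
  - intros al. now rewrite !zf_top_im.
  - intros al. now rewrite !zf_top_im.
Qed.

Lemma zf_derive al : Derive (fun t => Re (zf (t, 0)%R)) al = Re (dzf (al, 0)%R).
Proof.
  apply is_derive_unique. destruct zf_nice as [_ (K & HK & H)].
  apply is_derive_taylor with (K := K) (r := 1); [lra|].
  intros t _.
  assert (St : Sd (t, 0)%R) by (unfold Sd, strip_closed; simpl; lra).
  assert (Sa : Sd (al, 0)%R) by (unfold Sd, strip_closed; simpl; lra).
  specialize (H _ _ St Sa).
  assert (E : ((t, 0)%R - (al, 0)%R)%C = RtoC (t - al)) by (apply C_ext; simpl; ring).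
  rewrite E, Cmod_R, pow2_abs in H. apply Rle_trans with (2 := H).
  apply Rle_trans with (2 := Re_le_Cmod _). right. f_equal. simpl. unfold Re. ring.
Qed.
End Wave.

(** * Perturbation of the explicit profile *)

Lemma FF_minus T u u' M M' P : maj T u M -> maj T u' M' -> sumable M -> sumable M' -> T (Im P) ->
  FF (fun k => u k - u' k) P = (FF u P - FF u' P)%C.
Proof.
  intros H H' HM HM' HP. unfold FF.
  destruct (CS_minus _ _ (maj_Csum T u M P H HM HP) (maj_Csum T u' M' P H' HM' HP)) as [_ <-].
  apply CS_ext. intros k. rewrite RtoC_minus. ring.
Qed.

Lemma sin_mult_le (n : nat) (t : R) : Rabs (sin (INR n * t)) <= INR n * Rabs (sin t).
Proof.
  induction n.
  - simpl. rewrite !Rmult_0_l, sin_0, Rabs_R0. lra.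
  - rewrite S_INR. replace ((INR n + 1) * t) with (INR n * t + t) by ring. rewrite sin_plus.
    apply Rle_trans with (1 := Rabs_triang _ _). rewrite !Rabs_mult.
    assert (H1 := cos_bd t). assert (H2 := cos_bd (INR n * t)).
    assert (H3 := Rabs_pos (sin t)). assert (H4 := Rabs_pos (sin (INR n * t))).
    assert (H5 := Rabs_pos (cos t)). assert (H6 := Rabs_pos (cos (INR n * t))).
    assert (Rabs (sin (INR n * t)) * Rabs (cos t) <= Rabs (sin (INR n * t)) * 1) by (apply Rmult_le_compat_l; auto).
    assert (Rabs (cos (INR n * t)) * Rabs (sin t) <= 1 * Rabs (sin t)) by (apply Rmult_le_compat_r; auto).
    lra.
Qed.

Lemma cos_half (t : R) : 1 - cos t = 2 * Rabs (sin (t / 2)) ^ 2.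
Proof. rewrite pow2_abs. replace t with (2 * (t / 2)) at 1 by field. rewrite cos_2a_sin. ring. Qed.

Lemma cos_mult_le (k : Z) (t : R) : Rabs (1 - cos (IZR k * t)) <= Rabs (IZR k) ^ 2 * (1 - cos t).
Proof.
  assert (E : cos (IZR k * t) = cos (INR (Z.abs_nat k) * t)).
  { rewrite INR_IZR_INZ. destruct (Z_le_dec 0 k).
    - do 2 f_equal. f_equal. lia.
    - rewrite <- cos_neg. f_equal. rewrite Ropp_mult_distr_l, <- opp_IZR. do 2 f_equal. lia. }
  assert (E2 : Rabs (IZR k) = INR (Z.abs_nat k)).
  { rewrite INR_IZR_INZ, Zabs2Nat.id_abs. now rewrite abs_IZR. }
  rewrite E, E2. set (n := Z.abs_nat k).
  rewrite Rabs_pos_eq by (generalize (COS_bound (INR n * t)); lra).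
  rewrite !cos_half. replace (INR n * t / 2) with (INR n * (t / 2)) by field.
  assert (H := sin_mult_le n (t / 2)).
  assert (Rabs (sin (INR n * (t / 2))) ^ 2 <= (INR n * Rabs (sin (t / 2))) ^ 2).
  { apply pow_incr. split; [apply Rabs_pos|auto]. }
  rewrite Rpow_mult_distr in H0. lra.
Qed.

(** A bound vanishing to second order at PI. A mere sup bound on the perturbation would not keep the
    maximum of the elevation at PI. *)
Lemma cos_k_pi (k : Z) (al : R) :
  Rabs (cos (IZR k * PI) - cos (IZR k * al)) <= Rabs (IZR k) ^ 2 * (1 + cos al).
Proof.
  assert (Hs : sin (IZR k * PI) = 0) by (apply sin_eq_0_1; now exists k).
  assert (Hc := cos_mult_le k (PI - al)).
  replace (cos (PI - al)) with (- cos al) in Hc.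
  2:{ rewrite cos_minus, cos_PI, sin_PI. ring. }
  replace (IZR k * al) with (IZR k * PI - IZR k * (PI - al)) by ring.
  rewrite cos_minus, Hs, Rmult_0_l, Rplus_0_r.
  replace (cos (IZR k * PI) - cos (IZR k * PI) * cos (IZR k * (PI - al)))
    with (cos (IZR k * PI) * (1 - cos (IZR k * (PI - al)))) by ring.
  rewrite Rabs_mult. assert (H := cos_bd (IZR k * PI)).
  replace (1 - - cos al) with (1 + cos al) in Hc by ring.
  assert (H0 := Rabs_pos (1 - cos (IZR k * (PI - al)))).
  apply Rle_trans with (1 * Rabs (1 - cos (IZR k * (PI - al)))); [|lra].
  apply Rmult_le_compat_r; auto.
Qed.

Lemma cs_diff (f : W) (al be t : R) : 
  (forall k, Rabs (cos (IZR k * al) - cos (IZR k * be)) <= Rabs (IZR k) ^ 2 * t) -> 0 <= t ->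
  Rabs (cs f al - cs f be) <= 13 * nm f * t.
Proof.
  intros H Ht. unfold cs. rewrite <- SumZ_minus by apply cs_sum.
  destruct (mom_W f 2 ltac:(lia)) as [H1 H2].
  apply Rle_trans with (SumZ (fun k => t * mom 2 (absW f) k)).
  - apply SumZ_bound; [|now apply sumable_scal]. intros k.
    rewrite <- Rmult_minus_distr_l, Rabs_mult. unfold mom, absW.
    replace (t * (Rabs (IZR k) ^ 2 * Rabs (f k))) with (Rabs (f k) * (Rabs (IZR k) ^ 2 * t)) by ring.
    apply Rmult_le_compat_l; auto. apply Rabs_pos.
  - rewrite SumZ_scal, Rmult_comm. now apply Rmult_le_compat_r.
Qed.

Section Base2.
Variable b : R.
Hypothesis Hb : 0 < b < 1 / 2.

Lemma den_pos al : 0 < 1 + 2 * b * cos al + b * b.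
Proof. generalize (COS_bound al). intros. nra. Qed.

Lemma cs_y0 al : cs (y0 b) al = - (4 * b * (cos al + b) / (1 + 2 * b * cos al + b * b)).
Proof.
  assert (E : cs (y0 b) al = Re (Ev (u0 b) al)).
  { change (cs (y0 b) al) with (Re (Ev (y0 b) al)). unfold y0, u0.
    rewrite Ev_add, Ev_conj, Ev_scal. simpl. ring. }
  rewrite E, Ev_u0 by auto.
  assert (Hz : (1 + b * cos al - 0) ^ 2 + (b * - sin al) ^ 2 = 1 + 2 * b * cos al + b * b).
  { assert (H := sin2_cos2 al). unfold Rsqr in H. nra. }
  assert (Hd := den_pos al). assert (Hs := sin2_cos2 al). unfold Rsqr in Hs.
  set (Z := (1 + RtoC b * (cos al, - sin al)%R)%C).
  assert (HZ : Z = (1 + b * cos al, - (b * sin al))%R) by (apply C_ext; simpl; ring).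
  rewrite HZ. unfold Cdiv, Cinv. simpl.
  replace ((1 + b * cos al) * ((1 + b * cos al) * 1) + - (b * sin al) * (- (b * sin al) * 1))
    with (1 + 2 * b * cos al + b * b) by nra.
  set (D := 1 + 2 * b * cos al + b * b) in *.
  field_simplify; [|lra|lra]. f_equal.
  replace (sin al ^ 2) with (1 - cos al ^ 2) by (simpl; lra). ring.
Qed.

(** The margin is proportional to [1 + cos al], the quantity that controls the perturbation in
    [cos_k_pi]; [trough_base] plays the same part at 0. *)
Lemma crest_base al : 4 * b / (1 + b) * (1 + cos al) <= cs (y0 b) PI - cs (y0 b) al.
Proof.
  rewrite !cs_y0, cos_PI. assert (Hd := den_pos al). assert (Hc := COS_bound al).
  set (t := cos al) in *. set (D := 1 + 2 * b * t + b * b) in *.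
  replace (- (4 * b * (-1 + b) / (1 + 2 * b * -1 + b * b)) - - (4 * b * (t + b) / D))
    with (4 * b * (1 + b) * (1 + t) / ((1 - b) * D)).
  - assert (HD : (1 - b) * D <= (1 + b) ^ 2).
    { unfold D. assert (1 + 2 * b * t + b * b <= (1 + b) ^ 2) by nra. nra. }
    apply Rmult_le_reg_r with ((1 - b) * D); [apply Rmult_lt_0_compat; lra|].
    replace (4 * b * (1 + b) * (1 + t) / ((1 - b) * D) * ((1 - b) * D)) with (4 * b * (1 + b) * (1 + t)) by (field; lra).
    replace (4 * b / (1 + b) * (1 + t) * ((1 - b) * D)) with (4 * b * (1 + t) / (1 + b) * ((1 - b) * D)) by (field; lra).
    apply Rle_trans with (4 * b * (1 + t) / (1 + b) * (1 + b) ^ 2).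
    + apply Rmult_le_compat_l; auto. apply Rmult_le_pos; [nra|left; apply Rinv_0_lt_compat; lra].
    + right; field; lra.
  - unfold D. field. repeat split; unfold D in Hd; nra.
Qed.

Lemma trough_base al : b / 2 * (1 - cos al) <= cs (y0 b) al - cs (y0 b) 0.
Proof.
  rewrite !cs_y0, cos_0. assert (Hd := den_pos al). assert (Hc := COS_bound al).
  set (t := cos al) in *. set (D := 1 + 2 * b * t + b * b) in *.
  replace (- (4 * b * (t + b) / D) - - (4 * b * (1 + b) / (1 + 2 * b * 1 + b * b)))
    with (4 * b * (1 - b) * (1 - t) / ((1 + b) * D)).
  - assert (HD : (1 + b) * D <= 8 * (1 - b)).
    { assert (D <= (1 + b) ^ 2) by (unfold D; nra). nra. }
    apply Rmult_le_reg_r with ((1 + b) * D); [apply Rmult_lt_0_compat; lra|].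
    replace (4 * b * (1 - b) * (1 - t) / ((1 + b) * D) * ((1 + b) * D)) with (4 * b * (1 - b) * (1 - t)) by (field; lra).
    assert (0 <= b * (1 - t)) by nra. nra.
  - unfold D. field. repeat split; unfold D in Hd; nra.
Qed.
End Base2.

(** The cost of finite depth is of order 1/d throughout the strip: for negative k the growth of
    [exp (k t)] is offset by the factor [exp (- |k| d)] contained in [coth (k d) + 1]. *)
Lemma corr_maj (d : R) (f : W) : 1 <= d ->
  maj (fun t => - d <= t <= 0) (fun k => (mH d k - msg k) * f k) (fun k => 2 / d * absW f k).
Proof.
  intros Hd1 k t Ht. rewrite Rabs_mult. unfold absW.
  replace (Rabs (mH d k - msg k) * Rabs (f k) * exp (IZR k * t))
    with ((Rabs (mH d k - msg k) * exp (IZR k * t)) * Rabs (f k)) by ring.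
  apply Rmult_le_compat_r; [apply Rabs_pos|].
  destruct (Z_lt_dec k 0) as [Hk|Hk].
  - destruct (mH_neg d k Hd1 Hk) as [E Hx]. unfold msg. rewrite Z.sgn_neg by auto.
    replace (mH d k - -1) with (mH d k + 1) by ring. rewrite E, Rabs_Ropp.
    set (x := - IZR k * d) in *.
    assert (H1 : 1 <= - IZR k) by (rewrite <- opp_IZR; apply IZR_le; lia).
    assert (Hs := sinh_ge x ltac:(lra)).
    rewrite (Rabs_pos_eq (exp (- x) / sinh x)) by (apply Rlt_le, Rdiv_lt_0_compat; [apply exp_pos|lra]).
    apply exp_sinh_bound; auto. unfold x. split; nra.
  - assert (H0 : 0 <= IZR k) by (apply IZR_le; lia).
    assert (E : exp (IZR k * t) <= 1) by (apply exp_neg_le1; nra).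
    assert (H := mH_sgn d k). rewrite Rmax_right in H by auto.
    assert (Hp := exp_pos (IZR k * t)). assert (Hp2 := Rabs_pos (mH d k - msg k)). nra.
Qed.

Lemma maj_plus T u u' M M' : maj T u M -> maj T u' M' -> maj T (fun k => u k + u' k) (fun k => M k + M' k).
Proof.
  intros H H' k t Ht. specialize (H k t Ht). specialize (H' k t Ht).
  assert (T1 := Rabs_triang (u k) (u' k)). assert (T2 := exp_pos (IZR k * t)). nra.
Qed.

Lemma maj_mono (T T' : R -> Prop) u M : (forall t, T' t -> T t) -> maj T u M -> maj T' u M.
Proof. intros H HM k t Ht. apply HM. auto. Qed.

Lemma maj_ext T u u' M : (forall k, u k = u' k) -> maj T u M -> maj T u' M.
Proof. intros H HM k t Ht. rewrite <- H. now apply HM. Qed.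

Lemma mom_comb (A B : R) (f g : W) (n : nat) : (n <= 3)%nat -> 0 <= A -> 0 <= B ->
  sumable (mom n (fun k => A * absW f k + B * absW g k)) /\
  SumZ (mom n (fun k => A * absW f k + B * absW g k)) <= 13 * (A * nm f + B * nm g).
Proof.
  intros Hn HA HB.
  destruct (mom_W f n Hn) as [F1 F2]. destruct (mom_W g n Hn) as [G1 G2].
  assert (E : forall k, mom n (fun k => A * absW f k + B * absW g k) k = A * mom n (absW f) k + B * mom n (absW g) k).
  { intros k. unfold mom. ring. }
  assert (S1 := sumable_scal A _ F1). assert (S2 := sumable_scal B _ G1). split.
  - apply sumable_ext with (2 := sumable_plus _ _ S1 S2). intros k. now rewrite E.
  - rewrite (SumZ_ext _ _ E), SumZ_plus, !SumZ_scal by auto. nra.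
Qed.

Section Perturb.
Variables (b d eta : R) (x : W).
Hypothesis Hb : 0 < b < 1 / 2.
Hypothesis Hd1 : 1 <= d.
Hypothesis Hx : sym x.
Let y := yx x.
Hypothesis Hy : nm (y - y0 b) <= eta.

Let N := nm (y0 b).
Let T (t : R) := - d <= t <= 0.
Let M (k : Z) : R := 4 * absW (y - y0 b)%W k + 2 / d * absW (y0 b) k.
Let wdiff (k : Z) : R := upd d y k - u0 b k.

Lemma two_d : 0 <= 2 / d.
Proof. apply Rdiv_le_0_compat; lra. Qed.

Lemma u0_y0 k : u0 b k = (1 + msg k) * y0 b k.
Proof.
  assert (E : u0 b = (y0 b + Hs (y0 b))%W).
  { unfold u0, y0. rewrite Hs_add, Hs_conj, Hs_Hol, Wc_2.
    - ring.
    - apply Hol_Y0; auto.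
    - apply Y0_0; auto. }
  rewrite E, cf_add, cf_Hs. ring.
Qed.

(** Two errors are separated: the change of elevation [y - y0] at depth d, and the passage from coth
    to sgn for [y0]. *)
Lemma wdiff_maj : maj T wdiff M.
Proof.
  apply maj_ext with (2 := maj_plus _ _ _ _ _ (up_maj d (y - y0 b)%W Hd1) (corr_maj d (y0 b) Hd1)).
  intros k. unfold wdiff. rewrite !cf_up, u0_y0, cf_sub. ring.
Qed.

Lemma M_sum n : (n <= 3)%nat -> sumable (mom n M) /\ SumZ (mom n M) <= 13 * (4 * eta + 2 / d * N).
Proof.
  intros Hn. destruct (mom_comb 4 (2 / d) (y - y0 b)%W (y0 b) n Hn ltac:(lra) two_d) as [H1 H2].
  split; auto. apply Rle_trans with (1 := H2). fold N. nra.
Qed.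
Lemma M_sum0 : sumable M.
Proof. apply pack_sum0, M_sum. lia. Qed.

Lemma u0T_maj : maj T (u0 b) (absW (u0 b)).
Proof. apply maj_mono with (2 := u0_maj b Hb). unfold T, lower. intros; lra. Qed.

Lemma zf_zz P : T (Im P) -> (zf d x P = zz b P + Ci * FF wdiff P)%C.
Proof.
  intros HP. unfold zf, zz, wdiff. fold y.
  rewrite (FF_minus T (upd d y) (u0 b) _ _ P (up_maj d y Hd1) u0T_maj); auto.
  - ring.
  - apply pack_sum0, up_mom. lia.
  - apply u0_sum0.
Qed.

(** The factor 104 is 8 from [FF_lip] times 13 from the moment bound. *)
Lemma zf_bilip (c : R) :
  (forall P Q, low P -> low Q -> c * Cmod (P - Q)%C <= Cmod (zz b P - zz b Q)%C) ->
  104 * (4 * eta + 2 / d * N) <= c / 2 ->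
  forall P Q, strip_closed d P -> strip_closed d Q -> c / 2 * Cmod (P - Q)%C <= Cmod (zf d x P - zf d x Q)%C.
Proof.
  intros H Hs P Q HP HQ.
  assert (L := FF_lip T wdiff M P Q wdiff_maj M_sum0 (proj1 (M_sum 1 ltac:(lia))) HP HQ).
  assert (H1 := proj2 (M_sum 1 ltac:(lia))).
  specialize (H P Q ltac:(apply HP) ltac:(apply HQ)).
  rewrite !zf_zz by auto.
  assert (HN := Cmod_ge_0 (P - Q)%C).
  assert (Tr := Cmod_triangle (zz b P + Ci * FF wdiff P - (zz b Q + Ci * FF wdiff Q))%C
    (- (Ci * (FF wdiff P - FF wdiff Q)))%C).
  rewrite Cmod_opp, Cmod_mult, Cmod_Ci, Rmult_1_l in Tr.
  replace (zz b P + Ci * FF wdiff P - (zz b Q + Ci * FF wdiff Q) + - (Ci * (FF wdiff P - FF wdiff Q)))%C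
    with (zz b P - zz b Q)%C in Tr by ring.
  assert (8 * SumZ (mom 1 M) * Cmod (P - Q)%C <= c / 2 * Cmod (P - Q)%C) by (apply Rmult_le_compat_r; lra).
  lra.
Qed.

Lemma dzf_near (al : R) : Re (dzf d x (al, 0)%R) <= Re (dzz b (al, 0)%R) + 26 * (4 * eta + 2 / d * N).
Proof.
  assert (HT : T (Im (al, 0)%R)) by (unfold T; simpl; lra).
  assert (HM : sumable (mom 1 M)) by (apply M_sum; lia).
  assert (Bd := FF_bound T (kU wdiff) (mom 1 M) (al, 0)%R (maj_kU _ _ _ wdiff_maj) HM HT).
  assert (H1 := proj2 (M_sum 1 ltac:(lia))).
  assert (E : FF (kU wdiff) (al, 0)%R = (FF (upd d (Hs x)) (al, 0)%R - FF (kU (u0 b)) (al, 0)%R)%C).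
  { rewrite <- (FF_ext _ _ (al, 0)%R (kU_up d y (Hs x) (y_isL x))).
    rewrite <- (FF_minus T _ _ _ _ _ (maj_kU _ _ _ (up_maj d y Hd1)) (maj_kU _ _ _ u0T_maj)); auto.
    - apply FF_ext. intros k. unfold kU, wdiff. ring.
    - apply up_mom. lia.
    - apply u0_sum. lia. }
  assert (Hr := Rle_trans _ _ _ (Re_le_Cmod _) Bd). rewrite E in Hr.
  unfold dzf, dzz. apply Rabs_le_between in Hr. rewrite Re_minus in Hr. rewrite !Re_plus. lra.
Qed.

Lemma crest : 13 * eta <= 4 * b / (1 + b) -> forall al, cs y al <= cs y PI.
Proof.
  intros Hs al. assert (H := crest_base b Hb al). assert (Hc := COS_bound al).
  assert (Hdf := cs_diff (y - y0 b)%W PI al (1 + cos al) (fun k => cos_k_pi k al) ltac:(lra)).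
  assert (E : forall t, cs y t = cs (y0 b) t + cs (y - y0 b)%W t).
  { intros t. change (Re (Ev y t) = Re (Ev (y0 b) t) + Re (Ev (y - y0 b)%W t)).
    rewrite <- Re_plus, <- Ev_add. do 2 f_equal. ring. }
  rewrite !E. apply Rabs_le_between in Hdf.
  assert (13 * nm (y - y0 b) * (1 + cos al) <= 4 * b / (1 + b) * (1 + cos al)) by (apply Rmult_le_compat_r; lra).
  lra.
Qed.

Lemma trough : 13 * eta <= b / 2 -> forall al, cs y 0 <= cs y al.
Proof.
  intros Hs al. assert (H := trough_base b Hb al). assert (Hc := COS_bound al).
  assert (Hdf := cs_diff (y - y0 b)%W 0 al (1 - cos al)).
  assert (E : forall t, cs y t = cs (y0 b) t + cs (y - y0 b)%W t).
  { intros t. change (Re (Ev y t) = Re (Ev (y0 b) t) + Re (Ev (y - y0 b)%W t)).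
    rewrite <- Re_plus, <- Ev_add. do 2 f_equal. ring. }
  rewrite !E. specialize (Hdf ltac:(intros k; rewrite Rmult_0_r, cos_0; apply cos_mult_le) ltac:(lra)).
  apply Rabs_le_between in Hdf.
  assert (13 * nm (y - y0 b) * (1 - cos al) <= b / 2 * (1 - cos al)) by (apply Rmult_le_compat_r; lra).
  lra.
Qed.

Lemma exp_neg_inv (s : R) : 0 <= s -> exp (- s) <= 1 / (1 + s).
Proof.
  intros Hs. rewrite exp_Ropp. unfold Rdiv. rewrite Rmult_1_l. apply Rinv_le_contravar; [lra|].
  destruct Hs as [Hs|<-]; [left; now apply exp_ineq1; lra|rewrite exp_0; lra].
Qed.

(* Near the bottom the depth is controlled by comparison with the bottom itself, where the
   perturbation of the identity is small in C^1; elsewhere a sup bound suffices. *)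
Lemma above : eta <= 1 -> 1040 * (N + 1) + 1 <= d -> forall P, strip_top d P -> - d < Im (zf d x P).
Proof.
  (* K bounds the vertical displacement of [zf]: 2 from [FF_bound], 4 from [up_maj], 13 from the
     moments, and [nm y <= N + 1]. *)
  intros He Hd P HP. set (K := 104 * (N + 1)).
  assert (HN : 0 <= N) by apply nm_pos.
  assert (Hny : nm y <= N + 1).
  { replace y with ((y - y0 b) + y0 b)%W by ring. apply Rle_trans with (1 := nm_add _ _). fold N. lra. }
  assert (Hny0 := nm_pos y).
  assert (HPT : T (Im P)) by (unfold T; destruct HP; lra).
  assert (EI : forall P, Im (zf d x P) = Im P + Re (FF (upd d y) P)).
  { intros P'. unfold zf. fold y. rewrite Im_plus.
    destruct P' as [p1 p2], (FF (upd d y) (p1, p2)) as [f1 f2]. simpl. ring. }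
  destruct (Rlt_dec (- d + K) (Im P)) as [Hl|Hl].
  - assert (H := FF_bound T (upd d y) (fun k => 4 * absW y k) P (up_maj d y Hd1)
      (pack_sum0 _ (up_mom y 0 ltac:(lia))) HPT).
    assert (HS : SumZ (fun k => 4 * absW y k) <= 52 * nm y).
    { rewrite SumZ_scal. destruct (mom_W y 0 ltac:(lia)) as [_ H2].
      rewrite (SumZ_ext (mom 0 (absW y)) (absW y)) in H2 by (intros k; unfold mom; ring). lra. }
    assert (Hr := Rle_trans _ _ _ (Re_le_Cmod _) H). apply Rabs_le_between in Hr. rewrite EI. unfold K in Hl. lra.
  - assert (HK : K <= d) by (unfold K; lra).
    set (A := 4 * exp (- (d - K))).
    assert (HA : 0 <= A) by (unfold A; generalize (exp_pos (- (d - K))); lra).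
    assert (HA2 : A <= 4 * (1 / (1 + (d - K)))).
    { unfold A. generalize (exp_neg_inv (d - K) ltac:(lra)). lra. }
    set (T' := fun t => - d <= t <= - d + K).
    assert (Hy0 : y 0%Z = 0).
    { unfold y, yx. rewrite cf_J. unfold mJ. simpl. ring. }
    (* In the bottom layer of height K positive modes are damped by [exp (- (d - K))], negative ones
       are of order 1/d, and the mean of y is zero. *)
    assert (Hmaj : maj T' (upd d y) (fun k => A * absW y k + 2 / d * absW y k)).
    { intros k t Ht. unfold T' in Ht. rewrite cf_up, Rabs_mult. unfold absW. assert (Hp := Rabs_pos (y k)).
      assert (H2d := two_d).
      destruct (Z.lt_trichotomy k 0) as [Hk|[Hk|Hk]].
      - assert (Hc := corr_maj d y Hd1 k t ltac:(lra)). unfold msg in Hc. rewrite Z.sgn_neg in Hc by auto.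
        rewrite Rabs_mult in Hc. replace (mH d k - -1) with (1 + mH d k) in Hc by ring.
        unfold absW in Hc. nra.
      - subst k. rewrite Hy0, Rabs_R0. lra.
      - assert (H1 : 1 <= IZR k) by (apply IZR_le; lia).
        assert (Hexp : exp (IZR k * t) <= exp (- (d - K))).
        { assert (IZR k * t <= - (d - K)) by nra.
          destruct H as [H|H]; [left; now apply exp_increasing|rewrite H; lra]. }
        assert (Hm := mH_le d k). assert (Tr := Rabs_triang 1 (mH d k)). rewrite Rabs_R1 in Tr.
        assert (He1 := exp_pos (IZR k * t)). assert (He2 := Rabs_pos (1 + mH d k)).
        assert (Rabs (1 + mH d k) * exp (IZR k * t) <= A) by (unfold A; nra). nra. }
    destruct (mom_comb A (2 / d) y y 1 ltac:(lia) HA two_d) as [S1 S2].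
    destruct (mom_comb A (2 / d) y y 0 ltac:(lia) HA two_d) as [S0 _]. apply pack_sum0 in S0.
    destruct HP as [HP1 HP2]. destruct P as [al t]. cbn [Im snd] in *.
    assert (HT1 : T' (Im (al, t)%R)) by (unfold T'; simpl; lra).
    assert (HT2 : T' (Im (al, - d)%R)) by (unfold T', K; simpl; lra).
    assert (L := FF_lip T' (upd d y) _ (al, t)%R (al, - d)%R Hmaj S0 S1 HT1 HT2).
    replace (Cmod ((al, t)%R - (al, - d)%R)%C) with (t + d) in L.
    2:{ replace ((al, t)%R - (al, - d)%R)%C with (Ci * RtoC (t + d))%C by (apply C_ext; simpl; ring).
        rewrite Cmod_mult, Cmod_Ci, Cmod_R, Rabs_pos_eq; lra. }
    assert (Hbt := zf_bottom d x Hd1 Hx al). rewrite EI in *. cbn [Im snd] in *.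
    assert (Hr := Rle_trans _ _ _ (Re_le_Cmod _) L). rewrite Re_minus in Hr. apply Rabs_le_between in Hr.
    assert (Hq1 : 1 / (1 + (d - K)) <= 1 / (9 * K)).
    { unfold Rdiv. rewrite !Rmult_1_l. apply Rinv_le_contravar; unfold K; lra. }
    assert (Hq2 : 2 / d <= 2 / (10 * K)).
    { unfold Rdiv. apply Rmult_le_compat_l; [lra|]. apply Rinv_le_contravar; unfold K; lra. }
    assert (HA3 : A + 2 / d <= 4 * (1 / (9 * K)) + 2 / (10 * K)) by lra.
    replace (4 * (1 / (9 * K)) + 2 / (10 * K)) with (29 / (45 * K)) in HA3 by (field; unfold K; lra).
    assert (H104 : 104 * nm y <= K) by (unfold K; lra).
    (* With [d >= 10 K + 1] the displacement has a Lipschitz constant below 1, so a point above the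
       bottom cannot be pushed down to it. *)
    assert (HL : 8 * (13 * (A * nm y + 2 / d * nm y)) <= 29 / 45).
    { replace (8 * (13 * (A * nm y + 2 / d * nm y))) with ((A + 2 / d) * (104 * nm y)) by ring.
      apply Rle_trans with (29 / (45 * K) * K).
      - apply Rmult_le_compat; try lra. generalize two_d; lra.
      - right. field. unfold K; lra. }
    assert (8 * SumZ (mom 1 (fun k => A * absW y k + 2 / d * absW y k)) * (t + d) <= 29 / 45 * (t + d)).
    { apply Rmult_le_compat_r; lra. }
    lra.
Qed.
End Perturb.

(** * Overhang, parameter range and conclusion *)

(** At PI / 2 the real part of [z_alpha] is [((1 + b^2)^2 - 8 b^2) / (1 + b^2)^2], and
    [1 + b^2 < 2 sqrt 2 b] holds for b between [sqrt 2 - 1] and [sqrt 2 + 1]. *)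
Lemma overhang_base (b : R) : sqrt 2 - 1 < b < 1 / 2 -> Re (dzz b (PI / 2, 0)%R) < 0.
Proof.
  intros Hb. assert (Hs0 : 1 < sqrt 2) by (rewrite <- sqrt_1 at 1; apply sqrt_lt_1; lra).
  assert (Hs2 := sqrt_sqrt 2 ltac:(lra)).
  assert (Hb' : 0 < b < 1 / 2) by lra.
  rewrite (dzz_level b Hb') by lra. rewrite exp_0, Rmult_1_r, Zb_eq by auto.
  assert (E : P0 b = (- (Wc 2 * (Wc b * zeta * e1 b * e1 b)))%W) by reflexivity.
  rewrite E, Ev_add, Ev_1, Ev_scal, Ev_opp, Ev_scal, !Ev_mul, Ev_Wc, Ev_zeta, Ev_e1 by auto.
  rewrite cos_PI2, sin_PI2.
  assert (Hz : (/ (1 + RtoC b * (0, - (1))%R))%C = (1 / (1 + b * b), b / (1 + b * b))%R).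
  { unfold Cinv. apply C_ext; simpl; field; nra. }
  rewrite Hz. simpl.
  match goal with |- ?e < 0 => replace e with (((1 + b * b) ^ 2 - 8 * b * b) / (1 + b * b) ^ 2) by (field; nra) end.
  apply Rdiv_neg_pos; [|apply pow_lt; nra].
  assert (1 + b * b < 2 * sqrt 2 * b) by nra.
  assert ((1 + b * b) ^ 2 < (2 * sqrt 2 * b) ^ 2) by nra.
  replace ((2 * sqrt 2 * b) ^ 2) with (4 * (sqrt 2 * sqrt 2) * b * b) in H0 by ring. rewrite Hs2 in H0. lra.
Qed.

Lemma a_max_injective (a : R) : a_crit < a < a_max ->
  sqrt 2 - 1 < sqrt a < 1 / 2 /\ (forall b', 0 < b' <= sqrt a -> explicit_curve_injective (b' ^ 2)).
Proof.
  intros [H1 H2]. unfold a_crit in H1.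
  assert (Hs0 : 1 < sqrt 2) by (rewrite <- sqrt_1 at 1; apply sqrt_lt_1; lra).
  assert (Ha : 0 < a) by (assert (0 < (sqrt 2 - 1) ^ 2) by (apply pow_lt; lra); lra).
  set (E := fun a => 0 < a < 1 / 4 /\ ~ explicit_curve_injective a).
  assert (HE : a_max = real (Glb_Rbar E)) by reflexivity.
  destruct (Glb_Rbar_correct E) as [Hlb Hglb].
  assert (H3 : forall s, E s -> a < s).
  { intros s Hs. specialize (Hlb s Hs). rewrite HE in H2.
    destruct (Glb_Rbar E); simpl in *; [lra|lra|lra]. }
  assert (H4 : a < 1 / 4).
  { destruct (classic (exists s, E s)) as [(s & Hs)|Hn].
    - generalize (H3 s Hs). destruct Hs. lra.
    (* If the curve were injective for all parameters below 1/4, the infimum would be [p_infty],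
       whose real part is the default 0, and [a < a_max] would contradict [a > 0]. *)
    - exfalso. specialize (Hglb p_infty). rewrite HE in H2.
      assert (H5 : is_lb_Rbar E p_infty) by (intros s Hs; exfalso; eauto). specialize (Hglb H5).
      destruct (Glb_Rbar E); simpl in *; [tauto|lra|lra]. }
  assert (Hq := sqrt_sqrt a ltac:(lra)). assert (Hp := sqrt_lt_R0 a Ha).
  split; [split; nra|].
  intros b' Hb'. apply NNPP. intros Hn.
  assert (Hle : b' ^ 2 <= a) by nra.
  assert (H5 : E (b' ^ 2)) by (split; [split; nra|auto]).
  generalize (H3 _ H5). lra.
Qed.

Lemma nm_yx_sub (b q : R) (x : W) : 0 < b < 1 / 2 -> nm (yx x - y0 b) <= nm (x - x0 b q).
Proof.
  intros Hb. rewrite <- (yx_x0 b q) by auto. unfold yx. rewrite <- J_sub, <- Hs_sub.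
  assert (H1 := nm_m mJ 1 (Hs (x - x0 b q)%W) mJ_le). assert (H2 := nm_m msg 1 (x - x0 b q)%W msg_le).
  fold (J (Hs (x - x0 b q)%W)) in H1. fold (Hs (x - x0 b q)%W) in H2. lra.
Qed.

Theorem theorem4 :
  forall a : R, a_crit < a < a_max ->
  exists eps : R, 0 < eps /\
  forall G : R, - eps < G < eps ->
  exists H0 : R, 0 < H0 /\
  forall H : R, H0 < H ->
  exists (Q : R) (D : C -> Prop) (psi : R -> R -> R) (d : R) (z : C -> C),
    water_wave_solution G (Omega_of a) (B_of a) Q H D psi d z /\
    overhanging z.
Proof.
  intros a Ha. destruct (a_max_injective a Ha) as [Hr Hinj].
  assert (Ha0 : 0 < a).
  { destruct (Rle_or_lt a 0) as [E|E]; auto. rewrite (sqrt_neg_0 a E) in Hr.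
    assert (Hs0 : 1 < sqrt 2) by (rewrite <- sqrt_1 at 1; apply sqrt_lt_1; lra). lra. }
  assert (Hba := sqrt_sqrt a ltac:(lra)).
  assert (Hp := sqrt_lt_R0 a Ha0).
  set (b := sqrt a) in *. assert (Hb : 0 < b < 1 / 2) by lra.
  destruct (zz_bilip b Hb Hinj) as (c & Hc & Hbil).
  assert (Hov := overhang_base b Hr). set (tau := - Re (dzz b (PI / 2, 0)%R)) in *.
  assert (Htau : 0 < tau) by (unfold tau; lra).
  set (q := (1 + a) / (1 - 3 * a)). assert (Ha1 : a < 1 / 4) by nra.
  assert (Hq : 0 < q) by (apply Rdiv_lt_0_compat; lra).
  assert (Hb2 : 0 < 4 * b / (1 + b)) by (apply Rdiv_lt_0_compat; lra).
  (* m is the budget for each of the two errors [416 * eta] and [208 * N / d]: twice m is at most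
     half the bi-Lipschitz constant, and too small to undo the overhang. *)
  set (m := Rmin 1 (Rmin (c / 4) (tau / 4))).
  set (eta := Rmin (m / 416) (Rmin (4 * b / (1 + b) / 13) (b / 2 / 13))).
  assert (Hm : 0 < m) by (unfold m; repeat apply Rmin_glb_lt; lra).
  assert (Hm1 : m <= 1) by apply Rmin_l.
  assert (Hm2 : m <= c / 4) by (eapply Rle_trans; [apply Rmin_r|apply Rmin_l]).
  assert (Hm3 : m <= tau / 4) by (eapply Rle_trans; [apply Rmin_r|apply Rmin_r]).
  assert (He : 0 < eta) by (unfold eta; repeat apply Rmin_glb_lt; lra).
  assert (He1 : eta <= m / 416) by apply Rmin_l.
  assert (He2 : eta <= 4 * b / (1 + b) / 13) by (eapply Rle_trans; [apply Rmin_r|apply Rmin_l]).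
  assert (He3 : eta <= b / 2 / 13) by (eapply Rle_trans; [apply Rmin_r|apply Rmin_r]).
  destruct (wave_exists b q Hb ltac:(lra) eta He) as (eps & K & Heps & Hex).
  exists eps. split; auto. intros G HG.
  set (N := nm (y0 b)). assert (HN : 0 <= N) by apply nm_pos.
  (* K comes from the Newton method, [1040 * (N + 1)] from [above], and the last term keeps the
     depth error below m. *)
  exists (1 + Rabs K + 1040 * (N + 1) + 208 * N / m).
  assert (HNm : 0 <= 208 * N / m) by (apply Rdiv_le_0_compat; lra).
  assert (HK := Rle_abs K). assert (HK0 := Rabs_pos K).
  (* The prescribed depth itself serves as conformal depth, since the elevation has mean zero. *)
  split; [lra|]. intros d Hd1.
  destruct (Hex G d) as (x & Hx & Hxe & HE); [apply Rabs_def1; lra|lra|].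
  assert (Hy : nm (yx x - y0 b) <= eta) by (apply Rle_trans with (2 := Hxe); now apply nm_yx_sub).
  assert (Hd : 1 <= d) by lra.
  assert (HdN : 104 * (2 / d * N) <= m).
  { assert (H : 208 * N / m <= d) by lra. apply Rmult_le_reg_r with (d / m); [apply Rdiv_lt_0_compat; lra|].
    replace (104 * (2 / d * N) * (d / m)) with (208 * N / m) by (field; lra).
    replace (m * (d / m)) with d by (field; lra). auto. }
  assert (Hsm : 104 * (4 * eta + 2 / d * N) <= 2 * m) by lra.
  assert (HE2 : EE (kap b * q) (2 * (q * q / 2)) G d x = 0%W).
  { replace (2 * (q * q / 2)) with (q * q) by field. exact HE. }
  destruct (wave_solution d (kap b * q) (q * q / 2) G (c / 2) x Hd Hx HE2 ltac:(lra)) as (Q & D & psi & Hsol).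
  - apply (zf_bilip b d eta x Hb Hd Hy c Hbil). fold N. lra.
  - apply (above b d eta x Hb Hd Hx Hy); [lra|fold N; lra].
  - apply (crest b eta x Hb Hy). lra.
  - apply (trough b eta x Hb Hy). lra.
  - exists Q, D, psi, d, (zf d x). split.
    + replace (Omega_of a) with (kap b * q).
      2:{ unfold Omega_of, q, kap. rewrite Hba. field. lra. }
      replace (B_of a) with (q * q / 2) by (unfold B_of; fold q; field). exact Hsol.
    + exists (PI / 2). rewrite zf_derive by auto.
      assert (Hn := dzf_near b d eta x Hb Hd Hy (PI / 2)). fold N in Hn. unfold tau in *. lra.
Qed.
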